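(* Let $T>0$ and let $u_0\in H^2(\mathbb{T})$ satisfy $u_0\ge 0$ and $$\int_{\mathbb{T}} \ln(u_0)\,dx=:m_0 \quad\text{with } m_0 \text{ finite}.$$ Then there exists a global non-negative weak solution $u$ on $[0,T]$ (in the sense defined in the context) to the PDE $$\partial_t u=-u\,\partial_x^2\big[\partial_x^2 u+(1-u)\big]=-u(\partial_x^4u-\partial_x^2u)$$ with initial data $u(0,x)=u_0(x)$. Moreover, $$u(t,x)>0\quad\text{for a.e. }(t,x)\in[0,T]\times\mathbb{T}.$$
   Context: $\mathbb{T}=\mathbb{R}/\mathbb{Z}$. $H^k(\mathbb{T})=\{u\in H^k_{\rm loc}(\mathbb{R}): u(x+1)=u(x)\text{ for a.e. }x\in\mathbb{R}\}$ with the standard $H^k$ inner product over one period, and $L^2(\mathbb{T})=H^0(\mathbb{T})$. Define $$F(u)=\int_{\mathbb{T}}u\,dx,\qquad E(u)=\int_{\mathbb{T}}(\partial_{xx}u)^2+(\partial_xu)^2\,dx.$$ For a continuous non-negative $u$ on $[0,T]\times\mathbb{T}$, let $P_T:=\big((0,T)\times\mathbb{T}\big)\setminus\{(t,x):u(t,x)=0\}$, an open set; derivatives of $u$ on $P_T$ are taken in the sense of distributions on $P_T$. Definition (weak solution on $[0,T]$). A non-negative function $u(t,x)$ with $$u\in L^\infty([0,T];H^2(\mathbb{T})),\quad u(\partial_x^4u-\partial_x^2u)\in L^2(P_T),\quad \partial_tu\in L^2([0,T];L^2(\mathbb{T})),\quad u\in C([0,T];H^1(\mathbb{T}))$$ is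 a weak solution of $\partial_tu=-u(\partial_x^4u-\partial_x^2u)$ with initial data $u(0,x)=u_0(x)$ if: (1) for every $\phi\in C^\infty([0,T]\times\mathbb{T})$, $$\int_0^T\!\!\int_{\mathbb{T}}\phi\,\partial_tu\,dx\,dt+\iint_{P_T}\phi\,u(\partial_x^4u-\partial_x^2u)\,dx\,dt=0;$$ (2) $\displaystyle E(u(T,\cdot))+\iint_{P_T}2u(\partial_x^4u-\partial_x^2u)^2\,dx\,dt\le E(u(0,\cdot))$; (3) $\displaystyle F(u(T,\cdot))+\int_0^TE(u(t,\cdot))\,dt\le F(u(0,\cdot))$. *)

(* Defs.v *)
From HB Require Import structures.
From mathcomp Require Import all_boot all_order all_algebra.
From mathcomp Require Import all_classical all_reals all_analysis.

Set Implicit Arguments.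
Unset Strict Implicit.
Unset Printing Implicit Defensive.
Import Order.TTheory GRing.Theory Num.Theory.
Import numFieldNormedType.Exports.
Local Open Scope classical_set_scope.
Local Open Scope ring_scope.

(* The torus is R/Z: a function on it is a 1-periodic function on the line, and
   integrals over it are integrals over one period. *)

Notation mu1 := (@lebesgue_measure _).
Notation mu2 := (@lebesgue_measure _ \x @lebesgue_measure _)%E.

Definition test_line {R : realType} (phi : R -> R) : Prop :=
  (forall n x, derivable (derive1n n phi) x 1) /\
  compact (closure [set x | phi x != 0]).

Definition L2loc {R : realType} (u : R -> R) : Prop :=
  measurable_fun setT u /\
  forall K : set R, compact K -> (\int[mu1]_(x in K) (u x ^+ 2)%:E < +oo)%E.

Definition weak_deriv {R : realType} (j : nat) (u v : R -> R) : Prop :=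
  L2loc v /\
  forall phi, test_line phi ->
    \int[mu1]_(x in setT) (u x * derive1n j phi x) =
    (-1) ^+ j * \int[mu1]_(x in setT) (v x * phi x).

Definition Hper {R : realType} (k : nat) (u : R -> R) : Prop :=
  [/\ L2loc u,
      {ae mu1, forall x : R, u (x + 1) = u x} &
      forall j, (j <= k)%N -> exists v, weak_deriv j u v].

(* A choice of weak derivative, unique up to a null set when there is one. *)
Definition wderiv {R : realType} (j : nat) (u : R -> R) : R -> R :=
  xget (fun=> 0) [set v | weak_deriv j u v].

(* Meaningful only for u in Hper k. *)
Definition Hnorm {R : realType} (k : nat) (u : R -> R) : \bar R :=
  sqrte (\sum_(j < k.+1) \int[mu1]_(x in `[0%R, 1%R]) (wderiv j u x ^+ 2)%:E)%E.

Definition mass {R : realType} (u : R -> R) : \bar R :=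
  (\int[mu1]_(x in `[0%R, 1%R]) (u x)%:E)%E.

(* The value +oo outside H^2 prevents the default value of wderiv from
   producing a spurious finite energy. *)
Definition energy {R : realType} (u : R -> R) : \bar R :=
  if `[< Hper 2 u >] then
    (\int[mu1]_(x in `[0%R, 1%R]) (wderiv 2 u x ^+ 2 + wderiv 1 u x ^+ 2)%:E)%E
  else +oo%E.

Definition simple_Hper {R : realType} (k : nat) (s : R -> R -> R) : Prop :=
  exists (n : nat) (A : 'I_n -> set R) (g : 'I_n -> R -> R),
    [/\ forall i, measurable (A i),
        forall i, Hper k (g i) &
        s = fun t x => \sum_(i < n) \1_(A i) t * g i x].

(* Bochner measurability of t |-> u t from [0, T] to H^k. *)
Definition strongly_measurable {R : realType} (k : nat) (T : R)
    (u : R -> R -> R) : Prop :=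
  exists s : nat -> R -> R -> R,
    (forall n, simple_Hper k (s n)) /\
    {ae mu1, forall t : R, 0 <= t <= T ->
       Hper k (u t) /\ Hnorm k (u t \- s n t) @[n --> \oo] --> 0%E}.

Definition Linfty_Hper {R : realType} (k : nat) (T : R) (u : R -> R -> R) :
    Prop :=
  strongly_measurable k T u /\
  exists M : R, {ae mu1, forall t : R, 0 <= t <= T -> (Hnorm k (u t) <= M%:E)%E}.

Definition L2_Hper {R : realType} (k : nat) (T : R) (u : R -> R -> R) : Prop :=
  strongly_measurable k T u /\
  (\int[mu1]_(t in `[0%R, T]) (Hnorm k (u t) ^+ 2) < +oo)%E.

Definition C_Hper {R : realType} (k : nat) (T : R) (u : R -> R -> R) : Prop :=
  (forall t : R, 0 <= t <= T -> Hper k (u t)) /\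
  forall t : R, 0 <= t <= T ->
    Hnorm k (u s \- u t) @[s --> within `[0%R, T] (nbhs t)] --> 0%E.

Definition dt {R : realType} (f : R -> R -> R) : R -> R -> R :=
  fun t x => derive1 (f ^~ x) t.

Definition dx {R : realType} (f : R -> R -> R) : R -> R -> R :=
  fun t x => derive1 (f t) x.

Fixpoint Ck2 {R : realType} (n : nat) (f : R -> R -> R) : Prop :=
  continuous (fun p : R * R => f p.1 p.2) /\
  if n is m.+1 then
    [/\ forall t x : R, derivable (f ^~ x) t 1,
        forall t x : R, derivable (f t) x 1,
        Ck2 m (dt f) & Ck2 m (dx f)]
  else True.

Definition periodic_x {R : realType} (f : R -> R -> R) : Prop :=
  forall t x : R, f t (x + 1) = f t x.

(* C^oo functions on R x T; those on [0, T] x T are their restrictions. *)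
Definition smooth_torus {R : realType} (phi : R -> R -> R) : Prop :=
  (forall n, Ck2 n phi) /\ periodic_x phi.

Definition strip {R : realType} (T : R) : set (R * R) :=
  [set p | 0 < p.1 < T].

Definition one_period {R : realType} : set (R * R) :=
  [set p | 0 <= p.2 < 1].

(* The lift to R x R of the set P_T = ((0, T) x T) \ {u = 0}. *)
Definition PT {R : realType} (T : R) (u : R -> R -> R) : set (R * R) :=
  strip T `&` [set p | u p.1 p.2 != 0].

(* Below, Omega is an open subset of the strip, 1-periodic in x.  As the strip
   is bounded in t, a closed 1-periodic subset of R x R contained in Omega has
   compact image in R x T, so these are the smooth functions with compact
   support in the image of Omega in (0, T) x T. *)
Definition test_torus {R : realType} (Omega : set (R * R))
    (phi : R -> R -> R) : Prop :=
  smooth_torus phi /\ closure [set p : R * R | phi p.1 p.2 != 0] `<=` Omega.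

Definition loc_integrable {R : realType} (Omega : set (R * R))
    (f : R -> R -> R) : Prop :=
  [/\ periodic_x f,
      measurable_fun Omega (fun p : R * R => f p.1 p.2) &
      forall K : set (R * R), compact K -> K `<=` Omega ->
        (\int[mu2]_(p in K) `|f p.1 p.2|%:E < +oo)%E].

Definition pairing {R : realType} (Omega : set (R * R))
    (f phi : R -> R -> R) : R :=
  \int[mu2]_(p in Omega `&` one_period) (f p.1 p.2 * phi p.1 p.2).

Definition distr_dt {R : realType} (Omega : set (R * R)) (f : R -> R -> R) :
    (R -> R -> R) -> R :=
  fun phi => - pairing Omega f (dt phi).

Definition distr_dx {R : realType} (k : nat) (Omega : set (R * R))
    (f : R -> R -> R) : (R -> R -> R) -> R :=
  fun phi => (-1) ^+ k * pairing Omega f (iter k dx phi).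

(* The distribution D on Omega is the locally integrable function f. *)
Definition represented_by {R : realType} (Omega : set (R * R))
    (D : (R -> R -> R) -> R) (f : R -> R -> R) : Prop :=
  loc_integrable Omega f /\
  forall phi, test_torus Omega phi -> D phi = pairing Omega f phi.

(* v is the derivative of u in t, and w is the distribution
   (d/dx)^4 u - (d/dx)^2 u on P_T.  Since u is continuous and positive on P_T,
   the product of u with that distribution being a function amounts to the
   distribution itself being one. *)
Record weak_solution_with {R : realType} (T : R) (u0 : R -> R)
    (u v w : R -> R -> R) : Prop := {
  ws_periodic : forall t x : R, 0 <= t <= T -> u t (x + 1) = u t x;
  ws_nonneg : forall t x : R, 0 <= t <= T -> 0 <= u t x;
  ws_continuous :
    {within [set p : R * R | 0 <= p.1 <= T],
       continuous (fun p : R * R => u p.1 p.2)};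
  ws_Linfty_H2 : Linfty_Hper 2 T u;
  ws_C_H1 : C_Hper 1 T u;
  ws_dt : represented_by (strip T) (distr_dt (strip T) u) v;
  ws_dt_measurable :
    measurable_fun [set p : R * R | 0 <= p.1 <= T]
      (fun p : R * R => v p.1 p.2);
  ws_dt_L2 : L2_Hper 0 T v;
  ws_dxx : represented_by (PT T u)
    (fun phi => distr_dx 4 (PT T u) u phi - distr_dx 2 (PT T u) u phi) w;
  ws_dxx_L2 :
    (\int[mu2]_(p in PT T u `&` one_period)
       ((u p.1 p.2 * w p.1 p.2) ^+ 2)%:E < +oo)%E;
  ws_initial : {ae mu1, forall x : R, u 0 x = u0 x};
  ws_equation : forall phi, smooth_torus phi ->
    \int[mu1]_(t in `[0%R, T])
      (\int[mu1]_(x in `[0%R, 1%R]) (phi t x * v t x)) +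
    \int[mu2]_(p in PT T u `&` one_period)
      (phi p.1 p.2 * (u p.1 p.2 * w p.1 p.2)) = 0;
  ws_energy :
    (energy (u T) +
     \int[mu2]_(p in PT T u `&` one_period)
       (2 * u p.1 p.2 * w p.1 p.2 ^+ 2)%:E <= energy (u 0%R))%E;
  ws_mass :
    (mass (u T) + \int[mu1]_(t in `[0%R, T]) energy (u t) <= mass (u 0%R))%E
}.

Definition weak_solution {R : realType} (T : R) (u0 : R -> R)
    (u : R -> R -> R) : Prop :=
  exists v w, weak_solution_with T u0 u v w.

(* Main.v *)
Require Import Defs.
From HB Require Import structures.
From mathcomp Require Import all_boot all_order all_algebra.
From mathcomp Require Import all_classical all_reals all_analysis.
From mathcomp Require Import measurable_realfun ring lra.
Set Implicit Arguments.
Unset Strict Implicit.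
Unset Printing Implicit Defensive.
Import Order.TTheory GRing.Theory Num.Theory.
Import numFieldNormedType.Exports.
Local Open Scope classical_set_scope.
Local Open Scope ring_scope.

(* Where u > 0 the equation reads d_t ln u = - (d_x^4 u - d_x^2 u), and
   d_x^4 u - d_x^2 u is half the gradient of E.  It is therefore discretised by the
   implicit Euler scheme in which u_{n+1} minimises
     KL(u | u_n) + (tau / 2) E(u),   KL(u | w) = int (u ln (u / w) - u + w),
   over the nonnegative functions of H^2, a convex problem.  The minimiser satisfies
     int (ln u_{n+1} - ln u_n) d + tau B(u_{n+1}, d) >= 0   whenever u_{n+1} + d >= 0,
   where B is the bilinear form of E.  Taking d = 1 shows that int ln u_n does not
   decrease, hence, by Fatou's lemma, u > 0 almost everywhere in the limit;
   d = - u_{n+1} gives the decay of the mass, d = u_n - u_{n+1} that of the energy,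
   with the dissipation (ln a - ln b) (a - b) >= (a - b)^2 / max(a, b), and
   d = +- s phi, phi supported in {u > 0}, gives the equation.  The scheme converges
   uniformly by Arzela-Ascoli; convex combinations of its time derivatives and of its
   second space derivatives converge strongly in L^2 by Mazur's lemma, and the
   dissipation passes to the limit because v^2 / (u + eps) is convex in v. *)

(** * Integrals of real functions *)

Section integrability.
Context d (X : measurableType d) (R : realType).
Context (mu : {measure set X -> \bar R}) (D : set X) (mD : measurable D).
Implicit Types (f g : X -> R).

(** The equation degenerates where u = 0. Variations must keep u + d >= 0, so minimality gives only
    an inequality there, and an equality only against test functions supported where u is bounded
    below. The entropy rules out a zero set of positive measure because its slope at 0 is minus
    infinity. Since u is bounded, the dissipation controls the time derivative in L^2. Its weight
    1/u is reached only as a limit of 1/(u + eps): the approximations at times t and t - tau both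
    lie uniformly within 1/(j+1) of u, so u + eps dominates both as soon as 1/(j+1) <= eps. Weak
    compactness is avoided altogether. The hull used for Mazur's lemma is generated by midpoints, so
    every convex estimate passes to it by a two-case induction and no coefficients are carried.
    Squared L^2 distances of size 8^-n leave squared distances of size 4^-n on almost every time
    slice, hence the rate 2^-n without squares. Functions of H^2 are triples of everywhere defined
    functions tied together by integral formulas; the chosen weak derivatives of the statement are
    met only when the initial datum is read and when the final properties are stated. *)

Lemma ae_imp (P Q : X -> Prop) : (forall x, P x -> Q x) ->
  {ae mu, forall x, P x} -> {ae mu, forall x, Q x}.
Proof. by move=> PQ; apply: filterS. Qed.

Lemma ae_imp2 (P Q S : X -> Prop) : (forall x, P x -> Q x -> S x) ->
  {ae mu, forall x, P x} -> {ae mu, forall x, Q x} -> {ae mu, forall x, S x}.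
Proof. by move=> PQS; apply: filterS2. Qed.

Definition itg f : Prop := mu.-integrable D (EFin \o f).

Lemma itg_meas f : itg f -> measurable_fun D f.
Proof. by move=> /integrableP[/measurable_EFinP]. Qed.

Lemma itg_ext f g : (forall x, D x -> f x = g x) -> itg f -> itg g.
Proof.
by move=> fg; apply: eq_integrable => // x /set_mem Dx /=; rewrite fg.
Qed.

Lemma itgD f g : itg f -> itg g -> itg (fun x => f x + g x).
Proof. by move=> fi gi; exact: integrableD fi gi. Qed.

Lemma itgB f g : itg f -> itg g -> itg (fun x => f x - g x).
Proof. by move=> fi gi; exact: integrableB fi gi. Qed.

Lemma itgZ (c : R) f : itg f -> itg (fun x => c * f x).
Proof. by move=> fi; exact: integrableZl fi. Qed.

Lemma itgN f : itg f -> itg (fun x => - f x).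
Proof. by move=> fi; exact: integrableN fi. Qed.

Lemma itg_dom f g : measurable_fun D f -> itg g ->
  (forall x, D x -> `|f x| <= g x) -> itg f.
Proof.
move=> mf gi fg; apply: le_integrable gi => //; first exact/measurable_EFinP.
by move=> x Dx /=; rewrite lee_fin (le_trans (fg x Dx))// ler_norm.
Qed.

Lemma itg_norm f : itg f -> itg (fun x => `|f x|).
Proof. by move=> fi; exact: integrable_norm fi. Qed.

Lemma itgE f : itg f ->
  (\int[mu]_(x in D) (f x)%:E)%E = (\int[mu]_(x in D) f x)%:E.
Proof. by move=> fi; rewrite /Rintegral fineK//; exact: integrable_fin_num fi. Qed.

Lemma Int_le f g : itg f -> itg g -> (forall x, D x -> f x <= g x) ->
  \int[mu]_(x in D) f x <= \int[mu]_(x in D) g x.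
Proof. by move=> fi gi fg; exact: le_Rintegral. Qed.

Lemma Int_abs_le f g : itg f -> itg g -> (forall x, D x -> `|f x| <= g x) ->
  `|\int[mu]_(x in D) f x| <= \int[mu]_(x in D) g x.
Proof.
move=> fi gi fg; apply: le_trans (le_normr_Rintegral mD fi) _.
by apply: Int_le => //; exact: itg_norm.
Qed.

Lemma IntD f g : itg f -> itg g ->
  \int[mu]_(x in D) (f x + g x) = \int[mu]_(x in D) f x + \int[mu]_(x in D) g x.
Proof. by move=> *; exact: RintegralD. Qed.

Lemma IntB f g : itg f -> itg g ->
  \int[mu]_(x in D) (f x - g x) = \int[mu]_(x in D) f x - \int[mu]_(x in D) g x.
Proof. by move=> *; exact: RintegralB. Qed.

Lemma IntZ (c : R) f : itg f -> \int[mu]_(x in D) (c * f x) = c * \int[mu]_(x in D) f x.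
Proof. by move=> *; exact: RintegralZl. Qed.

Lemma IntN f : itg f -> \int[mu]_(x in D) (- f x) = - \int[mu]_(x in D) f x.
Proof.
move=> fi; rewrite -mulN1r -IntZ//.
by apply: eq_Rintegral => x _; rewrite mulN1r.
Qed.

Lemma eq_Int f g : (forall x, D x -> f x = g x) ->
  \int[mu]_(x in D) f x = \int[mu]_(x in D) g x.
Proof. by move=> fg; apply: eq_Rintegral => x /set_mem; exact: fg. Qed.

Lemma itg_bdd f (c : R) : (mu D < +oo)%E -> measurable_fun D f ->
  (forall x, D x -> `|f x| <= c) -> itg f.
Proof.
move=> Doo mf fc; apply: measurable_bounded_integrable => //.
exists c; split; first by rewrite num_real.
by move=> y cy x Dx; apply: le_trans (fc x Dx) _; exact: ltW.
Qed.

Lemma itg_cst (c : R) : (mu D < +oo)%E -> itg (fun=> c).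
Proof. by move=> Doo; apply: (@itg_bdd _ `|c|). Qed.

Lemma itg_mul_bdd f g (c : R) : measurable_fun D f ->
  (forall x, D x -> `|f x| <= c) -> itg g -> itg (fun x => f x * g x).
Proof.
move=> mf fc gi; apply: (@itg_dom _ (fun x => c * `|g x|)).
- by apply: measurable_funM => //; exact: itg_meas.
- exact/itgZ/itg_norm.
- by move=> x Dx; rewrite normrM ler_wpM2r// fc.
Qed.

Lemma itg_ub f (C : R) : measurable_fun D f -> (forall x, D x -> 0 <= f x) ->
  (\int[mu]_(x in D) (f x)%:E <= C%:E)%E ->
  itg f /\ \int[mu]_(x in D) f x <= C.
Proof.
move=> mf f0 fC.
have fi : itg f.
  apply/integrableP; split; first exact/measurable_EFinP.
  rewrite (eq_integral (EFin \o f)) ?(le_lt_trans fC) ?ltry//.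
  by move=> x /set_mem Dx /=; rewrite ger0_norm// f0.
by split => //; rewrite -lee_fin -itgE.
Qed.

Lemma Int_ae f g : itg f -> measurable_fun D g ->
  {ae mu, forall x, D x -> f x = g x} ->
  itg g /\ \int[mu]_(x in D) f x = \int[mu]_(x in D) g x.
Proof.
move=> fi mg fg; have mf := itg_meas fi.
have E (h k : X -> \bar R) : measurable_fun D h -> measurable_fun D k ->
    {ae mu, forall x, D x -> h x = k x} ->
    (\int[mu]_(x in D) h x = \int[mu]_(x in D) k x)%E.
  by move=> mh mk hk; apply: ae_eq_integral.
split; last first.
  congr fine; apply: E; [exact/measurable_EFinP..|].
  by apply: filterS fg => x /= h Dx; rewrite h.
apply/integrableP; split; first exact/measurable_EFinP.
have /integrableP[_] := fi; congr (_ < _)%E; apply: E.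
- by apply: measurableT_comp => //; exact/measurable_EFinP.
- by apply: measurableT_comp => //; exact/measurable_EFinP.
- by apply: filterS fg => x /= h Dx; rewrite h.
Qed.

(** Fatou's lemma for real integrals. The bound by [C] is required only up to an eventual error [e],
    which is what convergence arguments deliver, and integrability of the limit is part of the
    conclusion. *)
Lemma itg_fatou (f_ : nat -> X -> R) f (C : R) :
  (forall n, itg (f_ n)) -> (forall n x, D x -> 0 <= f_ n x) ->
  measurable_fun D f ->
  {ae mu, forall x, D x -> 0 <= f x} ->
  {ae mu, forall x, D x -> f_ ^~ x @ \oo --> f x} ->
  (forall e : R, 0 < e -> \forall n \near \oo, \int[mu]_(x in D) f_ n x <= C + e) ->
  itg f /\ \int[mu]_(x in D) f x <= C.
Proof.
move=> fi f0 mf fge0 cf fC.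
have mfabs : measurable_fun D (fun x => `|f x|) by exact: measurableT_comp.
suff [fi' fC'] : itg (fun x => `|f x|) /\ \int[mu]_(x in D) `|f x| <= C.
  have [] := Int_ae fi' mf; last by move=> ? <-.
  by apply: filterS fge0 => x h Dx; rewrite ger0_norm// h.
apply: itg_ub => //.
have mf_ n : measurable_fun D (EFin \o f_ n) by apply/measurable_EFinP/itg_meas.
have f0' n x : D x -> (0 <= (EFin \o f_ n) x)%E by move=> Dx; rewrite lee_fin f0.
have FH := fatou mu mD mf_ f0'.
have E x : limn_einf (fun n => (f_ n x)%:E) = (- limn_esup (fun n => - (f_ n x)%:E))%E.
  rewrite -limn_einfN; congr limn_einf; apply/funext => n /=; by rewrite opprK.
have mlim : measurable_fun D (fun x => limn_einf (fun n => (f_ n x)%:E)).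
  rewrite (_ : (fun x => _) = -%E \o (fun x => limn_esup (fun n => - (f_ n x)%:E)%E)).
    apply: measurableT_comp => //; apply: measurable_fun_limn_esup => k.
    by rewrite (_ : (fun x0 => _) = -%E \o (EFin \o f_ k))//; exact: measurableT_comp.
  by apply/funext => x; rewrite E.
have Eae : {ae mu, forall x, D x -> (`|f x|%:E)%E = limn_einf (fun n => (f_ n x)%:E)}.
  apply: filterS2 cf fge0 => x cfx f0x Dx /=.
  rewrite ger0_norm ?f0x//.
  have /(@cvg_limn_einf_sup _ (fun n => (f_ n x)%:E)) [-> _] // :
     (fun n => (f_ n x)%:E) @ \oo --> (f x)%:E.
  by apply: cvg_EFin; [exact: nearW|exact: cfx].
rewrite (@ae_eq_integral _ _ _ mu D (fun x => limn_einf (fun n => (f_ n x)%:E))) //.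
- apply: le_trans FH _; rewrite limn_einf_lim.
  apply/lee_addgt0Pr => e e0.
  have [N _ HN] := fC e e0.
  apply: lime_le; first exact: is_cvg_einfs.
  exists 0%N => // n _ /=.
  apply: le_trans (_ : (\int[mu]_(x in D) (f_ (maxn n N) x)%:E <= _)%E).
    by apply: ereal_inf_lbound; exists (maxn n N) => //=; rewrite leq_maxl.
  by rewrite itgE// -EFinD lee_fin; apply: HN; rewrite /= leq_maxr.
- exact/measurable_EFinP.
Qed.

Lemma itg_dct (f_ : nat -> X -> R) f g :
  (forall n, measurable_fun D (f_ n)) -> measurable_fun D f -> itg g ->
  {ae mu, forall x, D x -> f_ ^~ x @ \oo --> f x} ->
  (forall n x, D x -> `|f_ n x| <= g x) ->
  itg f /\ (\int[mu]_(x in D) f_ n x) @[n --> \oo] --> \int[mu]_(x in D) f x.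
Proof.
move=> mf_ mf gi cf fg.
have fi n : itg (f_ n) by apply: (@itg_dom _ g) => // x; exact: fg.
have [] := @dominated_convergence _ _ _ mu D mD (fun n => EFin \o f_ n) (EFin \o f) (EFin \o g).
- by move=> n; exact/measurable_EFinP.
- exact/measurable_EFinP.
- apply: filterS cf => x cfx Dx; apply: cvg_EFin; [exact: nearW|exact: cfx].
- exact: gi.
- by apply: aeW => x n Dx /=; rewrite lee_fin fg.
move=> i _; rewrite (@itgE f)//= => h; split => //.
by move: h; under eq_fun do rewrite /= itgE//; move/fine_cvg.
Qed.

(** Measurability of [f] is a separate clause because it does not follow from that of its square. *)
Definition sqi f : Prop := measurable_fun D f /\ itg (fun x => f x ^+ 2).

Lemma sqi_mul f g : sqi f -> sqi g -> itg (fun x => f x * g x).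
Proof.
move=> [mf fi] [mg gi]; apply: (@itg_dom _ (fun x => f x ^+ 2 + g x ^+ 2)).
- exact: measurable_funM.
- exact: itgD.
- by move=> x Dx; rewrite ler_norml; apply/andP; split; nra.
Qed.

Lemma sqiD f g : sqi f -> sqi g -> sqi (fun x => f x + g x).
Proof.
move=> sf sg; have [mf fi] := sf; have [mg gi] := sg.
split; first exact: measurable_funD.
apply: itg_ext (itgD (itgD fi gi) (itgZ 2 (sqi_mul sf sg))) => x _; ring.
Qed.

Lemma sqiZ (c : R) f : sqi f -> sqi (fun x => c * f x).
Proof.
move=> [mf fi]; split; first exact: measurable_funM.
by apply: itg_ext (itgZ (c ^+ 2) fi) => x _; ring.
Qed.

Lemma sqiB f g : sqi f -> sqi g -> sqi (fun x => f x - g x).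
Proof.
move=> sf sg; have [m i] := sqiD sf (sqiZ (-1) sg).
split; first by apply: measurable_funB; [case: sf|case: sg].
by apply: itg_ext i => x _; ring.
Qed.

Lemma sqi_itg f : (mu D < +oo)%E -> sqi f -> itg f.
Proof.
move=> Doo [mf fi]; apply: (@itg_dom _ (fun x => 1 + f x ^+ 2)) => //.
- by apply: itgD => //; exact: itg_cst.
- by move=> x Dx; rewrite ler_norml; apply/andP; split; nra.
Qed.

(** The integral of (a f + b g)^2 is nonnegative; a = B and b = - P turn this into B (A B - P^2) >=
    0. *)
Lemma cauchy_schwarz f g : sqi f -> sqi g ->
  (\int[mu]_(x in D) (f x * g x)) ^+ 2 <=
  (\int[mu]_(x in D) (f x ^+ 2)) * (\int[mu]_(x in D) (g x ^+ 2)).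
Proof.
move=> sf sg; have fg := sqi_mul sf sg; have [_ fi] := sf; have [_ gi] := sg.
set A := \int[mu]_(x in D) (f x ^+ 2); set B := \int[mu]_(x in D) (g x ^+ 2).
set P := \int[mu]_(x in D) (f x * g x).
have H a b : 0 <= a ^+ 2 * A + 2 * a * b * P + b ^+ 2 * B.
  rewrite -!IntZ// -!IntD//; try do ?[apply: itgD|apply: itgZ] => //.
  by apply: Rintegral_ge0 => x Dx; have := sqr_ge0 (a * f x + b * g x); nra.
have A0 : 0 <= A by apply: Rintegral_ge0 => x _; exact: sqr_ge0.
have B0 : 0 <= B by apply: Rintegral_ge0 => x _; exact: sqr_ge0.
(* If B = 0, the choice a = P, b = - (A + 1) gives - P^2 (A + 2) >= 0, hence P = 0. *)
have [B00|Bn0] := eqVneq B 0.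
  have := H P (- (A + 1)); rewrite B00 => h.
  have : P ^+ 2 * (A + 2) <= 0 by nra.
  nra.
have Bp : 0 < B by rewrite lt_def Bn0.
have := H B (- P) => h.
have : 0 <= B * (A * B - P ^+ 2) by nra.
by rewrite pmulr_rge0// subr_ge0.
Qed.

(** The sum of 4^n g_n has integral at most the sum of 2^-n, that is 2, so it is finite almost
    everywhere; its value at x serves as the constant [C]. *)
Lemma ae_summable (g : nat -> X -> R) :
  (forall n, itg (g n)) -> (forall n x, D x -> 0 <= g n x) ->
  (forall n, \int[mu]_(x in D) g n x <= (8^-1) ^+ n) ->
  {ae mu, forall x, D x -> exists2 C : R, 0 <= C & forall n, g n x <= C * (4^-1) ^+ n}.
Proof.
move=> gi g0 gC.
pose h n x := (4 ^+ n * g n x)%:E.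
have mh n : measurable_fun D (h n).
  by apply/measurable_EFinP/measurable_funM => //; exact: itg_meas.
have h0 n x : D x -> (0 <= h n x)%E.
  by move=> Dx; rewrite lee_fin mulr_ge0 ?exprn_ge0// g0.
have key : (\int[mu]_(x in D) (\sum_(n <oo) h n x) < +oo)%E.
  rewrite integral_nneseries//.
  apply: (@le_lt_trans _ _ 2%:E); last exact: ltry.
  have I0 n : (0 <= \int[mu]_(x in D) h n x)%E by apply: integral_ge0 => x; exact: h0.
  apply: lime_le; first by apply: is_cvg_nneseries => n _ _.
  apply: nearW => n.
  suff : (\sum_(0 <= k < n) \int[mu]_(x in D) h k x <= (2 - 2 * 2^-1 ^+ n)%:E)%E.
    move=> /le_trans; apply; rewrite lee_fin gerBl; apply: mulr_ge0 => //.
  elim: n => [|n IH]; first by rewrite big_geq// expr0 mulr1 subrr.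
  rewrite big_nat_recr//=.
  apply: le_trans (leeD IH (_ : _ <= (2^-1 ^+ n)%:E)%E) _; last first.
    by rewrite -EFinD lee_fin exprS; lra.
  rewrite itgE; last exact: itgZ.
  rewrite lee_fin IntZ// (_ : 2^-1 ^+ n = 4 ^+ n * 8^-1 ^+ n).
    by rewrite ler_wpM2l// exprn_ge0.
  by rewrite -exprMn; congr (_ ^+ _); field.
have : mu.-integrable D (fun x => \sum_(n <oo) h n x)%E.
  apply/integrableP; split; first exact: (@ge0_emeasurable_sum _ _ _ _ h xpredT (fun k x Dx _ => h0 k x Dx) (fun k _ => mh k)).
  apply: le_lt_trans key; rewrite (eq_integral (fun x => \sum_(n <oo) h n x)%E)//.
  by move=> x /set_mem Dx; rewrite gee0_abs// nneseries_ge0// => n _ _; exact: h0.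
move=> /(integrable_ae mD); apply: filterS => x hx Dx.
have {}hx := hx Dx.
exists (fine (\sum_(n <oo) h n x)); first by rewrite fine_ge0// nneseries_ge0// => n _ _; exact: h0.
move=> n; rewrite exprVn ler_pdivlMr ?exprn_gt0// mulrC -lee_fin fineK//.
apply: le_trans (_ : (\sum_(0 <= k < n.+1) h k x <= _)%E).
  by rewrite big_nat_recr//= leeDr// sume_ge0// => k _; exact: h0.
by apply: nneseries_lim_ge => k _ _; exact: h0.
Qed.


(** Increments are at most c 2^-n, so u_n - 2 c 2^-n is nondecreasing and u_n + 2 c 2^-n is
    nonincreasing; monotone convergence applies to the former. *)
Lemma fast_cauchy_cvg (u : nat -> R) (C : R) :
  (forall n, (u n.+1 - u n) ^+ 2 <= C * (4^-1) ^+ n) -> cvgn u.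
Proof.
move=> uC; have C0 : 0 <= C.
  by have := uC 0%N; rewrite expr0 mulr1; apply: le_trans; exact: sqr_ge0.
(* [C + 1] is a bound for the square root of [C] that avoids extracting it. *)
pose c := C + 1; have c0 : 0 < c by rewrite /c; lra.
have p0 n : 0 < (2^-1 : R) ^+ n by rewrite exprn_gt0// invr_gt0.
have step n : `|u n.+1 - u n| <= c * 2^-1 ^+ n.
  rewrite -(@ler_pXn2r _ 2)// ?nnegrE ?mulr_ge0 ?exprn_ge0 ?invr_ge0//; try exact: ltW.
  rewrite real_normK ?num_real//; apply: le_trans (uC n) _.
  rewrite exprMn -exprM mulnC exprM (_ : 2^-1 ^+ 2 = 4^-1 :> R); last by field.
  by rewrite ler_wpM2r ?exprn_ge0 ?invr_ge0// /c; nra.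
pose b n := u n - 2 * c * 2^-1 ^+ n.
have nb : {homo b : n m / (n <= m)%N >-> n <= m}.
  apply/nondecreasing_seqP => n; rewrite /b exprS.
  by have := step n; rewrite ler_norml => /andP[+ _]; lra.
have na n : u n + 2 * c * 2^-1 ^+ n <= u 0%N + 2 * c.
  elim: n => [|n IH]; first by rewrite expr0 mulr1.
  apply: le_trans IH; rewrite exprS.
  by have := step n; rewrite ler_norml => /andP[_ ]; lra.
have cb : cvgn b.
  apply: nondecreasing_is_cvgn => //; exists (u 0%N + 2 * c) => _ [n _ <-].
  apply: le_trans (na n); rewrite /b.
  by have := p0 n; have := c0; nra.
have -> : u = b \+ (fun n => 2 * c * 2^-1 ^+ n).
  by apply/funext => n; rewrite /b /= subrK.
apply: is_cvgD => //; apply: is_cvgMr.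
by apply/cvg_ex; exists 0; apply: cvg_expr; rewrite ger0_norm ?invr_ge0// invf_lt1// ltr1n.
Qed.

(** The limit is defined at every point as the limsup of the sequence. It is therefore measurable on
    the whole space and depends at x only on the values f_n(x), which transmits symmetries such as
    periodicity without exceptional sets. The rate 8^-n makes the sequence converge almost
    everywhere, and Fatou's lemma gives the L^2 estimate. *)
Lemma complete_sqi (f : nat -> X -> R) :
  (forall n, measurable_fun setT (f n)) -> (forall n, sqi (f n)) ->
  (forall n m, (n <= m)%N -> \int[mu]_(x in D) ((f m x - f n x) ^+ 2) <= (8^-1) ^+ n) ->
  exists g : X -> R,
    [/\ measurable_fun setT g, sqi g,
        forall x y, (forall n, f n x = f n y) -> g x = g y,
        {ae mu, forall x, D x -> f ^~ x @ \oo --> g x} &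
        forall n, \int[mu]_(x in D) ((g x - f n x) ^+ 2) <= (8^-1) ^+ n].
Proof.
move=> mf sf fC.
pose g x := fine (limn_esup (fun n => (f n x)%:E)).
have mg : measurable_fun setT g.
  apply: measurableT_comp => //; apply: measurable_fun_limn_esup => n.
  exact/measurable_EFinP.
have mgD : measurable_fun D g by exact: measurable_funS mg.
have cg : {ae mu, forall x, D x -> f ^~ x @ \oo --> g x}.
  have := @ae_summable (fun n x => (f n.+1 x - f n x) ^+ 2).
  move=> /(_ _ _ _)/filterS; apply.
  - move=> x h Dx; have [C _ hC] := h Dx.
    have /cvg_ex[/= l fl] := @fast_cauchy_cvg (f ^~ x) C hC.
    rewrite /g; have /(@cvg_limn_einf_sup _ (fun n => (f n x)%:E)) [_ ->] // :
       (fun n => (f n x)%:E) @ \oo --> l%:E by apply: cvg_EFin; [exact: nearW|].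
  - by move=> n; case: (sqiB (sf n.+1) (sf n)).
  - by move=> n x _; exact: sqr_ge0.
  - by move=> n; exact: fC.
have L n : itg (fun x => (g x - f n x) ^+ 2) /\
    \int[mu]_(x in D) ((g x - f n x) ^+ 2) <= (8^-1) ^+ n.
  apply: (@itg_fatou (fun m x => (f (m + n)%N x - f n x) ^+ 2)).
  - by move=> m; case: (sqiB (sf (m + n)%N) (sf n)).
  - by move=> m x _; exact: sqr_ge0.
  - by apply: measurable_funX; apply: measurable_funB => //; exact: measurable_funS (mf n).
  - by apply: aeW => x _; exact: sqr_ge0.
  - apply: filterS cg => x h Dx.
    have cH : (fun m => f (m + n)%N x - f n x) @ \oo --> g x - f n x.
      apply: cvgB; last exact: cvg_cst.
      by rewrite (cvg_shiftn n (f ^~ x) _); exact: h.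
    by rewrite expr2; under eq_fun do rewrite expr2; exact: (cvgM cH cH).
  - move=> e e0; apply: nearW => m; apply: le_trans (fC _ _ (leq_addl _ _)) _.
    by rewrite lerDl ltW.
exists g; split => //.
- have [m i] := sqiD (conj (measurable_funB mgD (measurable_funS measurableT (@subsetT _ D) (mf 0%N))) (L 0%N).1) (sf 0%N).
  by split=> //; apply: itg_ext i => x _; congr (_ ^+ 2); rewrite subrK.
- by move=> x y fxy; rewrite /g; congr (fine (limn_esup _)); apply/funext => n; rewrite fxy.
- by move=> n; case: (L n).
Qed.
End integrability.

(** * Mazur's lemma through midpoints *)

Section midpoint_closure.
Context (R : realType) (V : Type) (mid : V -> V -> V) (f : nat -> V).

(* The smallest set containing the tail [f j], [n <= j], and stable under [mid];
   for [mid] the midpoint map it plays the role of the convex hull of the tail. *)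
Inductive mhull (n : nat) : V -> Prop :=
| mhull_base j : (n <= j)%N -> mhull n (f j)
| mhull_mid x y : mhull n x -> mhull n y -> mhull n (mid x y).

Lemma mhull_le n m x : (n <= m)%N -> mhull m x -> mhull n x.
Proof.
move=> nm; elim=> [j mj|y z _ hy _ hz]; last exact: mhull_mid.
by apply: mhull_base; exact: leq_trans mj.
Qed.

(* Mazur's lemma for a quadratic form: near-minimisers of [Q] on the hulls of
   the tails are Cauchy by the parallelogram law. *)
Lemma mazur (Q : V -> R) (dist2 : V -> V -> R) (C : R) :
  (forall n x y, mhull n x -> mhull n y ->
    dist2 x y = 2 * Q x + 2 * Q y - 4 * Q (mid x y)) ->
  (forall x, 0 <= Q x) -> (forall j, Q (f j) <= C) ->
  exists g : nat -> V, (forall n, mhull n (g n)) /\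
    forall n m, (n <= m)%N -> dist2 (g m) (g n) <= (8^-1) ^+ n.
Proof.
move=> par Q0 QC.
pose m n := inf (Q @` mhull n).
have ne n : (Q @` mhull n) !=set0 by exists (Q (f n)); exists (f n) => //; exact: mhull_base.
have lb n : has_lbound (Q @` mhull n) by exists 0 => _ [x _ <-].
have mle n x : mhull n x -> m n <= Q x by move=> hx; apply: ge_inf => //; exists x.
have mC n : m n <= C by apply: le_trans (QC n); apply: mle; exact: mhull_base.
have mnd n k : (n <= k)%N -> m n <= m k.
  move=> nk; apply: lb_le_inf => // _ [x hx <-]; apply: mle.
  exact: mhull_le hx.
pose s := sup (range m).
have ub : has_ubound (range m) by exists C => _ [n _ <-].
have ms n : m n <= s by apply: ub_le_sup => //; exists n.
(* The parallelogram identity will yield 2 (s + eta) + 2 (s + eta) - 4 (s - eta) = 8 eta, hence the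
   division by 8. *)
pose eta n : R := 8^-1 ^+ n / 8.
have eta0 n : 0 < eta n by rewrite /eta divr_gt0// exprn_gt0// invr_gt0.
have /choice[N HN] n : exists k, (n <= k)%N /\ s - eta n <= m k.
  have [_ [k _ <-] hk] : exists2 y, range m y & s - eta n < y.
    by apply: sup_adherent => //; split => //; exists (m 0%N); exists 0%N.
  exists (maxn n k); rewrite leq_maxl; split => //.
  by rewrite (le_trans (ltW hk))// mnd// leq_maxr.
have /choice[g Hg] n : exists x, mhull (N n) x /\ Q x <= s + eta n.
  have [_ [x hx <-] hk] : exists2 y, (Q @` mhull (N n)) y & y < m (N n) + eta n.
    by apply: inf_adherent.
  by exists x; split => //; have := ms (N n); lra.
exists g; split => [n|n k nk].
  by apply: mhull_le (Hg n).1; exact: (HN n).1.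
(* [N] need not be monotone; both points and their midpoint lie in the hull of the smaller index,
   whose infimum is still at least s - eta n. *)
pose L := minn (N n) (N k).
have hn : mhull L (g n) by apply: mhull_le (Hg n).1; exact: geq_minl.
have hk : mhull L (g k) by apply: mhull_le (Hg k).1; exact: geq_minr.
rewrite (par L)//.
have etak : eta k <= eta n.
  rewrite /eta ler_pM2r ?invr_gt0//; apply: ler_wiXn2l => //.
  by rewrite invf_le1// ler1n.
have mL : s - eta n <= m L.
  rewrite /L; case: leqP => _; first exact: (HN n).2.
  by apply: le_trans (HN k).2; lra.
have := mle _ _ (mhull_mid hk hn).
have := (Hg n).2; have := (Hg k).2; have : 8^-1 ^+ n = 8 * eta n by rewrite /eta; field.
move=> ->; lra.
Qed.

End midpoint_closure.

(** * The Arzela-Ascoli theorem *)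

Section ascoli.
Context (R : realType) (X : Type).

(* The limit is taken along a free ultrafilter, so no diagonal extraction is
   needed; a finite net makes the pointwise convergence uniform. *)
Lemma ascoli_net (f : nat -> X -> R) (K : R) :
  (forall k x, `|f k x| <= K) ->
  (forall e : R, 0 < e -> exists (m : nat) (s : nat -> X) (N : nat), forall x,
     exists2 i : nat, (i < m)%N & forall k, (N <= k)%N -> `|f k x - f k (s i)| <= e) ->
  exists (g : X -> R) (h : nat -> nat),
    forall j, (j <= h j)%N /\ forall x, `|f (h j) x - g x| <= j.+1%:R^-1.
Proof.
move=> fK net.
have [U [UU ooU]] := @ultraFilterLemma nat \oo _.
have lim_ex x : exists l : R, (f ^~ x) @ U --> l.
  have : UltraFilter ((f ^~ x) @ U).
    split; first exact: fmap_proper_filter.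
    move=> G GF sG; rewrite predeqE => A; split; last exact: sG.
    move=> GA; have [//|nA] := in_ultra_setVsetC (f ^~ x @^-1` A) UU.
    have GnA : G (~` A) by apply: sG.
    by have /filter_ex[y []] : G (A `&` ~` A) by exact: filterI.
  move=> UfU; have := @segment_compact R (- K) K; rewrite compact_ultra => /(_ _ UfU).
  case; last by move=> l [_ ?]; exists l.
  have : U [set k | (f k x) \in `[- K, K]] by apply: filterE => k /=; rewrite in_itv/= -ler_norml.
  by [].
have [g gl] := choice lim_ex.
have close x (e : R) : 0 < e -> U [set k | `|f k x - g x| <= e].
  move=> e0; have := gl x; move=> /cvgrPdist_le /(_ e e0); apply: filterS => k /=.
  by rewrite distrC.
have unif (e : R) : 0 < e -> U [set k | forall x, `|f k x - g x| <= e].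
  move=> e0; have e4 : 0 < e / 4 by rewrite divr_gt0.
  have [m [s [N HN]]] := net _ e4.
  have UN : U [set k | (N <= k)%N] by apply: ooU; exists N.
  have Us : U [set k | forall i : 'I_m, `|f k (s i) - g (s i)| <= e / 4].
    by apply: filter_forall => i; exact: close.
  apply: filterS (filterI UN Us) => k [/= Nk ks] x.
  have [i im Hi] := HN x.
  have h1 := Hi _ Nk.
  have h2 := ks (Ordinal im).
  have h3 : `|g x - g (s i)| <= e / 4 + e / 4.
    apply/ler_addgt0Pr => d d0.
    have d2 : 0 < d / 2 by rewrite divr_gt0.
    have /filter_ex[l [/= l1 [l3 l4]]] : U ([set k | (N <= k)%N] `&`
        ([set k | `|f k x - g x| <= d / 2] `&` [set k | `|f k (s i) - g (s i)| <= d / 2])).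
      by apply: filterI => //; apply: filterI; exact: close.
    have := Hi _ l1; move: l3 l4 => /=.
    rewrite !ler_norml => /andP[? ?] /andP[? ?] /andP[? ?]; apply/andP; split; lra.
  move: h1 h2 h3 => /=; rewrite !ler_norml => /andP[? ?] /andP[? ?] /andP[? ?].
  apply/andP; split; lra.
have /choice[h Hh] j : exists k, (j <= k)%N /\ forall x, `|f k x - g x| <= j.+1%:R^-1.
  have Uj : U [set k | (j <= k)%N] by apply: ooU; exists j.
  have Uu : U [set k | forall x, `|f k x - g x| <= j.+1%:R^-1] by apply: unif; rewrite invr_gt0.
  have /filter_ex[k [/= k1 k2]] : U ([set k | (j <= k)%N] `&`
    [set k | forall x, `|f k x - g x| <= j.+1%:R^-1]) by exact: filterI.
  by exists k.
by exists g, h.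
Qed.
End ascoli.

(** * Translation invariance of the Lebesgue measure *)

Section shift.
Context (R : realType).
Local Notation mu := (@lebesgue_measure R).

(** Typed on [measurableTypeR R] so that it can be declared a measurable map and used to push
    measures forward. *)
Definition shiftr (c : R) : measurableTypeR R -> measurableTypeR R := fun x => x + c.

Lemma measurable_shiftr c : measurable_fun setT (shiftr c).
Proof. exact: measurable_funD. Qed.

HB.instance Definition _ c := isMeasurableFun.Build _ _ _ _ (shiftr c) (measurable_shiftr c).

(** The pushed-forward measure gives half-open intervals their length, and the Lebesgue measure is
    determined by these values. *)
Lemma lebesgue_measure_shift (c : R) (A : set R) : measurable A ->
  pushforward mu (shiftr c) A = mu A.
Proof.
move=> mA.
apply/esym/lebesgue_measure_unique => //= _ [[a b]] _ <-.
rewrite /pushforward (_ : _ @^-1` _ = `]a - c, b - c]%classic); last first.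
  by apply/seteqP; split => x /=; rewrite /shiftr !in_itv/= lerBrDr ltrBlDr.
rewrite !lebesgue_measure_itv/= !lte_fin ltrD2r; case: ifP => // _.
by rewrite -!EFinB; congr (_%:E); ring.
Qed.

Lemma integral_shift_ge0 (f : R -> \bar R) (D : set R) (c : R) : measurable D ->
  measurable_fun D f -> (forall x, D x -> (0 <= f x)%E) ->
  (\int[mu]_(x in D) f x = \int[mu]_(x in shiftr c @^-1` D) f (x + c)%R)%E.
Proof.
move=> mD mf f0.
transitivity (\int[pushforward mu (shiftr c)]_(x in D) f x)%E.
  by apply: eq_measure_integral => A mA _; exact/esym/lebesgue_measure_shift.
by rewrite ge0_integral_pushforward// => x /set_mem; exact: f0.
Qed.

Lemma itg_shift (f : R -> R) (D : set R) (c : R) : measurable D ->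
  itg mu D f -> itg mu (shiftr c @^-1` D) (fun x => f (x + c)).
Proof.
move=> mD fi; have mf := itg_meas fi; apply/integrableP; split.
  apply/measurable_EFinP.
  apply: (@measurable_comp _ _ _ _ _ _ D _ _ (shiftr c)) => //.
  - by move=> _ [x Dx <-].
  - exact: measurable_funS (measurable_shiftr c).
have /integrableP[_] := fi.
rewrite (integral_shift_ge0 c mD) //.
by apply: measurableT_comp => //; exact/measurable_EFinP.
Qed.

Lemma Int_shift (f : R -> R) (D : set R) (c : R) : measurable D ->
  itg mu D f ->
  \int[mu]_(x in D) f x = \int[mu]_(x in shiftr c @^-1` D) f (x + c).
Proof.
move=> mD fi; have mf := itg_meas fi.
have mfD : measurable_fun setT (f \_ D) by apply/(measurable_restrictT _ _).1.
have E : (f \_ D) \o shiftr c = (fun x => f (x + c)) \_ (shiftr c @^-1` D).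
  by apply/funext => x; rewrite /= !patchE.
rewrite Rintegral_mkcond [RHS]Rintegral_mkcond -E; congr fine.
transitivity (\int[pushforward mu (shiftr c)]_(x in setT) ((f \_ D) x)%:E)%E.
  by apply: eq_measure_integral => A mA _; exact/esym/lebesgue_measure_shift.
rewrite integral_pushforward//.
- exact/measurable_EFinP.
- rewrite preimage_setT.
  suff : itg mu setT ((f \_ D) \o shiftr c) by [].
  have mE : measurable (shiftr c @^-1` D).
    by rewrite -[X in measurable X]setTI; exact: measurable_shiftr.
  have h := itg_shift c mD fi; rewrite E /itg -restrict_EFin.
  apply/(integrable_mkcond _ mE).
  exact: h.
Qed.

End shift.

(** * Iterated integrals of real functions on rectangles *)

Section fubini_real.
Context (R : realType).
Local Notation mu := (@lebesgue_measure R).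

(** Fubini's theorem on the plane, applied to the extension by zero. The real inner integral agrees
    with the extended one only for those t whose section is integrable, hence the first conclusion
    and the passage through equality almost everywhere. *)
Lemma Int_fubini (A B : set R) (f : R -> R -> R) : measurable A -> measurable B ->
  itg mu2 (A `*` B) (fun p => f p.1 p.2) ->
  [/\ {ae mu, forall t, A t -> itg mu B (f t)},
    \int[mu2]_(p in A `*` B) f p.1 p.2 = \int[mu]_(t in A) \int[mu]_(x in B) f t x,
    measurable_fun A (fun t => \int[mu]_(x in B) f t x) &
    itg mu A (fun t => \int[mu]_(x in B) f t x)].
Proof.
move=> mA mB fi.
have mAB : measurable (A `*` B) by exact: measurableX.
pose F := (fun p : R * R => f p.1 p.2) \_ (A `*` B).
have Fi : (mu \x mu)%E.-integrable setT (EFin \o F).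
  by move: fi => /integrable_mkcond; rewrite restrict_EFin; apply.
have Fsec t x : F (t, x) = if t \in A then (f t \_ B) x else 0.
  rewrite /F !patchE in_setX/=; by case: (t \in A).
have aei : {ae mu, forall t, A t -> itg mu B (f t)}.
  apply: ae_imp (ae_integrable1 Fi) => t /= h At.
  apply/integrable_mkcond => //; rewrite restrict_EFin.
  by apply: eq_integrable h => // x _ /=; rewrite Fsec mem_set.
have FE t : A t -> fine (fubini_F mu (EFin \o F) t) = \int[mu]_(x in B) f t x.
  move=> At; rewrite Rintegral_mkcond; congr fine; apply: eq_integral => x _ /=.
  by rewrite Fsec mem_set.
have FN t : ~ A t -> fubini_F mu (EFin \o F) t = 0%E.
  move=> At; rewrite /fubini_F integral0_eq// => x _ /=.
  by rewrite Fsec memNset.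
have mF := measurable_fubini_F Fi.
have mG : measurable_fun A (fun t => \int[mu]_(x in B) f t x).
  apply: (@eq_measurable_fun _ _ _ _ _ (fine \o fubini_F mu (EFin \o F))).
    by move=> t /set_mem At /=; rewrite FE.
  by apply: measurable_funS (measurableT_comp _ mF).
have Hi := integrable_fubini_F Fi.
have HiA : mu.-integrable A (fubini_F mu (EFin \o F)) by exact: integrableS Hi.
have Hae : {ae mu, forall t, A t -> fubini_F mu (EFin \o F) t = (\int[mu]_(x in B) f t x)%:E}.
  apply: ae_imp aei => t h At.
  rewrite -FE// fineK//; apply: integrable_fin_num => //.
  have := h At; rewrite /itg => /integrable_mkcond; rewrite restrict_EFin => /(_ mB) h'.
  by apply: eq_integrable h' => // x _ /=; rewrite Fsec mem_set.
have gi : itg mu A (fun t => \int[mu]_(x in B) f t x).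
  have Ki : itg mu A (fine \o fubini_F mu (EFin \o F)).
    apply/integrableP; split.
      by apply/measurable_EFinP; apply: measurable_funS (measurableT_comp _ mF).
    have /integrableP[_ ] := HiA; apply: le_lt_trans; apply: ge0_le_integral => //.
    + apply: measurableT_comp => //; apply/measurable_EFinP.
      by apply: measurable_funS (measurableT_comp _ mF).
    + by apply: measurableT_comp => //; exact: measurable_funS mF.
    + by move=> x _ /=; case: (fubini_F _ _ _) => //= *; rewrite ?normr0// ?lexx// leey.
  have e t : A t -> (fine \o fubini_F mu (EFin \o F)) t = \int[mu]_(x in B) f t x by move=> At /=; rewrite FE.
  exact: (itg_ext (mu:=mu) mA e Ki).
split => //.
rewrite Rintegral_mkcond; congr fine.
transitivity (\int[mu \x mu]_z (EFin \o F) z)%E; first by [].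
rewrite -integral12_prod_meas1//.
rewrite (_ : (\int[mu]_x _ = \int[mu]_(t in A) fubini_F mu (EFin \o F) t)%E); last first.
  rewrite [RHS]integral_mkcond; apply: eq_integral => t _.
  by rewrite patchE; case: ifPn => // /negP At; apply: FN => ?; apply: At; exact: mem_set.
apply: ae_eq_integral => //.
- exact: measurable_funS mF.
- exact/measurable_EFinP.
Qed.

(** Tonelli: for a nonnegative function a finite iterated integral is enough. *)
Lemma itg_prod (A B : set R) (f : R -> R -> R) : measurable A -> measurable B ->
  measurable_fun (A `*` B) (fun p => f p.1 p.2) ->
  (forall t x, A t -> B x -> 0 <= f t x) ->
  (forall t, A t -> itg mu B (f t)) -> itg mu A (fun t => \int[mu]_(x in B) f t x) ->
  itg mu2 (A `*` B) (fun p => f p.1 p.2).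
Proof.
move=> mA mB mf f0 fi gi.
have mAB : measurable (A `*` B) by exact: measurableX.
pose F := (fun p : R * R => f p.1 p.2) \_ (A `*` B).
have Fsec t x : F (t, x) = if t \in A then (f t \_ B) x else 0.
  rewrite /F !patchE in_setX/=; by case: (t \in A).
apply/integrable_mkcond => //; rewrite restrict_EFin.
apply/integrable12ltyP; first by apply/measurable_EFinP/(measurable_restrictT _ _).1.
have F0 t x : 0 <= F (t, x).
  rewrite Fsec patchE; case: ifPn => // /set_mem tA; case: ifPn => // /set_mem xB.
  exact: f0.
rewrite (_ : (\int[mu]_x _ = \int[mu]_(t in A) (\int[mu]_(x in B) f t x)%:E)%E).
  by rewrite itgE// ltry.
rewrite [RHS]integral_mkcond; apply: eq_integral => t _.
rewrite patchE; case: ifPn => tA; last first.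
  by rewrite integral0_eq// => x _; rewrite /= -/(F (t, x)) Fsec (negbTE tA) normr0.
have At := set_mem tA.
rewrite -itgE//; last exact: fi.
rewrite [RHS]integral_mkcond; apply: eq_integral => x _ /=.
by rewrite -/(F (t, x)) ger0_norm// Fsec tA !patchE; case: ifP.
Qed.
End fubini_real.

(** * Test functions on the line *)

Section calculus_line.
Context (R : realType).
Local Notation mu := (@lebesgue_measure R).

Lemma is_derive_continuous (F : R -> R) (x l : R) : is_derive x 1 F l -> {for x, continuous F}.
Proof. by move=> [dF _]; apply/differentiable_continuous/derivable1_diffP. Qed.

Lemma is_derive_ext (f g : R -> R) (x l l' : R) :
  is_derive x 1 f l -> f =1 g -> l = l' -> is_derive x 1 g l'.
Proof. by move=> d /funext <- <-. Qed.

(* Integrals against [mu] see the line as [measurableTypeR R], whose canonical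
   structure differs syntactically from the default one on [R]. *)
Lemma cont_meas (f : R -> R) (D : set R) : continuous f ->
  measurable_fun (D : set (measurableTypeR R)) (f : measurableTypeR R -> R).
Proof. by move=> cf; apply: measurable_funS (continuous_measurable_fun cf). Qed.

Lemma mI (a b : R) : measurable (`[a, b]%classic : set (measurableTypeR R)).
Proof. exact: measurable_itv. Qed.

Lemma itv_fin (a b : R) : (mu `[a, b]%classic < +oo)%E.
Proof. by rewrite lebesgue_measure_itv/=; case: ifP => _; rewrite -?EFinD ltry. Qed.

Lemma itg_cont (f : R -> R) (a b : R) : continuous f -> itg mu `[a, b] f.
Proof.
move=> cf; apply: continuous_compact_integrable; first exact: segment_compact.
exact: continuous_subspaceT.
Qed.

Lemma itg_contS (f : R -> R) (a b : R) (D : set (measurableTypeR R)) :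
  measurable D -> D `<=` `[a, b] -> continuous f -> itg mu D f.
Proof. by move=> mD Dab cf; apply: (integrableS (mI a b) mD Dab); exact: itg_cont. Qed.

Lemma eq_IntI (a b : R) (f g : R -> R) : (forall x, a <= x <= b -> f x = g x) ->
  \int[mu]_(x in `[a, b]) f x = \int[mu]_(x in `[a, b]) g x.
Proof. by move=> fg; apply: eq_Int => x /=; rewrite in_itv/=; exact: fg. Qed.

Lemma FTC2_line (F f : R -> R) (a b : R) : a <= b ->
  (forall x : R, is_derive x 1 F (f x)) -> continuous f ->
  \int[mu]_(x in `[a, b]) f x = F b - F a.
Proof.
move=> ab dF cf; have cF x : {for x, continuous F} by exact: is_derive_continuous (dF x).
move: ab; rewrite le_eqVlt => /predU1P[<-|ab].
  by rewrite set_itv1 Rintegral_set1 subrr.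
rewrite /Rintegral (@continuous_FTC2 _ f F)//.
- exact: continuous_subspaceT.
- split => [x _||]; first by case: (dF x).
  + exact: cvg_at_right_filter (cF a).
  + exact: cvg_at_left_filter (cF b).
- by move=> x _; rewrite derive1E; case: (dF x).
Qed.

End calculus_line.

(** * Smooth bump functions *)

Section bump.
Context (R : realType).
Implicit Types (x y : R) (k : nat).
Local Notation mu := (@lebesgue_measure R).

(** The functions y^-k exp (- 1/y) extended by 0. All exponents k are taken together because
    differentiation maps one member of the family to a combination of two others. *)
Definition ebump k y : R := if 0 < y then y ^- k * expR (- y^-1) else 0.

Lemma ebump_ge0 k y : 0 <= ebump k y.
Proof.
by rewrite /ebump; case: ifP => // y0; rewrite mulr_ge0 ?expR_ge0// invr_ge0 exprn_ge0// ltW.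
Qed.

(** One term of the exponential series, exp (1/y) >= y^-(k+2) / (k+2)!, suffices. The quadratic
    bound makes the derivative at 0 exist and vanish. *)
Lemma ebump_le k y : ebump k y <= (k.+2)`!%:R * y ^+ 2.
Proof.
rewrite /ebump; case: ifP => y0; last by rewrite mulr_ge0// sqr_ge0.
have := @expR_ge1Dxn R (y^-1) k.+1; rewrite invr_ge0 ltW// => /(_ isT) h.
have f0 : 0 < (k.+2)`!%:R :> R by rewrite ltr0n fact_gt0.
have {}h : y ^- k.+2 / (k.+2)`!%:R <= expR y^-1.
  by rewrite -exprVn; apply: le_trans h; rewrite lerDr.
rewrite expRN ler_pdivrMr ?expR_gt0//.
apply: le_trans (_ : y ^- k <= (k.+2)`!%:R * y ^+ 2 * (y ^- k.+2 / (k.+2)`!%:R)) _.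
  rewrite le_eqVlt; apply/orP; left; apply/eqP.
  have yn0 : y != 0 by rewrite gt_eqF.
  have fn0 : (k.+2)`!%:R != 0 :> R by rewrite gt_eqF.
  rewrite -[in y ^- k.+2]addn2 exprD invfM; field; by rewrite yn0 fn0 expf_neq0.
by rewrite ler_wpM2l// mulr_ge0// ?sqr_ge0// ltW.
Qed.

Lemma is_derive_ebump k y :
  is_derive y 1 (ebump k) (ebump k.+2 y - k%:R * ebump k.+1 y).
Proof.
have [y0|y0|->] := ltgtP y 0.
- rewrite /ebump !ltNge (ltW y0)/= mulr0 subrr.
  apply: (near_eq_is_derive _ (is_derive_cst (0 : R) y 1)).
  near=> z; rewrite ltNge (_ : z <= 0)//.
  by apply: ltW; near: z; exact: lt_nbhsl.
- rewrite /ebump y0.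
  have yn0 : y != 0 by rewrite gt_eqF.
  have d1 : is_derive y 1 (fun z : R => z^-1) (- y ^- 2).
    have := @is_deriveV _ id y 1 1 yn0 (is_derive_id _ _).
    by rewrite /GRing.scale/= mulr1.
  have d2 : is_derive y 1 (fun z : R => expR (- z^-1)) (expR (- y^-1) * y ^- 2).
    have := @is_derive1_comp _ expR (fun z => - z^-1) y (expR (- y^-1)) (y ^- 2) (is_derive_expR _).
    apply; have := is_deriveN d1; by rewrite opprK.
  have d3 : is_derive y 1 (fun z : R => z ^- k) (- k%:R * y ^- k.+1).
    have := @is_deriveV _ (fun z => z ^+ k) y (k%:R * y ^+ k.-1) 1 (expf_neq0 _ yn0).
    have -> : (fun z : R => z ^- k) = (fun z => (z ^+ k)^-1) by [].
    have E : - (y ^+ k) ^- 2 *: (k%:R * y ^+ k.-1) = - k%:R * y ^- k.+1.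
      rewrite /GRing.scale/=; case: k => [|k] /=; first by rewrite !mul0r mulr0 oppr0 mul0r.
      rewrite !exprS; field. by rewrite yn0 expf_neq0.
    rewrite E; apply.
    apply: (is_derive_ext (is_derive_poly 'X^k y)) => [x|]; first by rewrite hornerXn.
    by rewrite derivXn hornerMn hornerXn mulr_natl.
  have d : is_derive y 1 (fun z => z ^- k * expR (- z^-1))
      (y ^- k.+2 * expR (- y^-1) - k%:R * (y ^- k.+1 * expR (- y^-1))).
    apply: (is_derive_ext (is_deriveM d3 d2)) => //.
    rewrite /GRing.scale/= !exprS; field; by rewrite yn0 expf_neq0.
  apply: (near_eq_is_derive _ d).
  near=> z; rewrite (_ : 0 < z)//.
  by near: z; exact: lt_nbhsr.
- have -> : ebump k.+2 0 - k%:R * ebump k.+1 0 = 0.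
    by rewrite /ebump ltxx mulr0 subrr.
  suff H : (fun h => h^-1 *: (ebump k (h *: 1 + 0) - ebump k 0)) @ 0^' --> (0 : R).
    split; first by apply/cvg_ex; exists 0; under eq_fun do rewrite /= ; exact: H.
    by apply/cvg_lim => //; exact: H.
  have e0 : ebump k 0 = 0 by rewrite /ebump ltxx.
  apply/cvgr0Pnorm_le => e e_gt0.
  near=> h.
  have h0 : h != 0 by near: h; exact: nbhs_dnbhs_neq.
  rewrite e0 subr0 addr0 /GRing.scale/= mulr1 normrM normfV.
  rewrite ler_pdivrMl ?normr_gt0// ger0_norm ?ebump_ge0//.
  apply: le_trans (ebump_le _ _) _.
  rewrite -real_normK ?num_real// expr2 mulrA mulrC ler_wpM2l//.
  rewrite -ler_pdivlMl ?ltr0n ?fact_gt0//.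
  near: h; apply: (@dnbhs0_le _ R^o).
  by rewrite mulr_gt0// invr_gt0 ltr0n fact_gt0.
Unshelve. all: by end_near. Qed.

Definition smooth (f : R -> R) : Prop := forall n x, derivable (derive1n n f) x 1.

(** Sums of a polynomial times some [ebump k] composed with [G]: a class stable under
    differentiation, so that smoothness follows by induction on the order. *)
Inductive ebump_class (G : {poly R}) : (R -> R) -> Prop :=
| ebump_base (P : {poly R}) k : ebump_class G (fun x => P.[x] * ebump k G.[x])
| ebump_add f g : ebump_class G f -> ebump_class G g -> ebump_class G (f \+ g).

Lemma ebump_class_derive G f : ebump_class G f ->
  exists2 f', ebump_class G f' & forall x, is_derive x 1 f (f' x).
Proof.
elim=> [P k|{}f g _ [f' cf' df] _ [g' cg' dg]]; last first.
  by exists (f' \+ g'); [exact: ebump_add|move=> x; exact: is_deriveD].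
exists ((fun x => (P^`()).[x] * ebump k G.[x]) \+
  ((fun x => (P * G^`()).[x] * ebump k.+2 G.[x]) \+
   (fun x => (- k%:R *: P * G^`()).[x] * ebump k.+1 G.[x]))).
  by apply: ebump_add; [|apply: ebump_add]; exact: ebump_base.
move=> x.
have dP := is_derive_poly P x; have dG := is_derive_poly G x.
have dE := is_derive1_comp (is_derive_ebump k G.[x]) dG.
apply: (is_derive_ext (is_deriveM dP dE)) => //.
rewrite /GRing.scale/= !hornerM hornerZ; ring.
Qed.

Lemma ebump_class_smooth G f : ebump_class G f -> smooth f.
Proof.
move=> cf n; elim: n f cf => [|n IH] f cf x.
  by have [f' _ /(_ x)[]] := ebump_class_derive cf.
have [f' cf' df] := ebump_class_derive cf.
rewrite derive1Sn (_ : derive1 f = f'); first exact: IH.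
by apply/funext => y; rewrite derive1E; case: (df y).
Qed.

Definition test_on (a b : R) (phi : R -> R) : Prop :=
  smooth phi /\ forall x, ~ (a <= x <= b) -> phi x = 0.

Lemma test_on_line a b phi : test_on a b phi -> test_line phi.
Proof.
move=> [sp p0]; split => //; apply: (@subclosed_compact _ _ `[a, b]).
- exact: closed_closure.
- exact: segment_compact.
- rewrite closureE; apply: smallest_sub; first exact: interval_closed.
  move=> x /= /eqP px; rewrite in_itv/=; apply: contrapT => /negP nx.
  by apply: px; apply: p0; exact/negP.
Qed.

(** The functions exp (- 1 / ((n+1) (x - a) (b - x))), extended by 0 outside ]a, b[, tend to 1
    inside as n grows. *)
Lemma bump_exists (a b : R) : a < b -> exists phi : nat -> R -> R,
  [/\ forall n, test_on a b (phi n), forall n x, 0 <= phi n x <= 1 &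
      forall x, (phi n x) @[n --> \oo] --> (\1_(`]a, b[%classic) x : R)].
Proof.
move=> ab.
pose G n : {poly R} := n.+1%:R *: (('X - a%:P) * (b%:P - 'X)).
have GE n x : (G n).[x] = n.+1%:R * ((x - a) * (b - x)).
  by rewrite hornerZ hornerM !hornerE.
exists (fun n x => ebump 0 (G n).[x]); split.
- move=> n; split.
    apply: (@ebump_class_smooth (G n)).
    have := @ebump_base (G n) 1 0; congr ebump_class; apply/funext => x.
    by rewrite hornerC mul1r.
  move=> x nx; rewrite /ebump GE ifF//; apply/negbTE; rewrite -leNgt.
  rewrite pmulr_rle0 ?ltr0n//.
  by case: (leP a x) => h1; case: (leP x b) => h2; [exfalso; apply: nx; rewrite h1 h2|nra|nra|lra].
- move=> n x; rewrite ebump_ge0 /ebump; case: ifP => h; last by rewrite ler01.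
  by rewrite expr0 invr1 mul1r -expR0 ler_expR oppr_le0 invr_ge0 ltW.
- move=> x; rewrite indicE mem_setE in_itv/=; case: (boolP (a < x < b)) => [/andP[ax xb]|xab].
    have g0 : 0 < (x - a) * (b - x) by rewrite mulr_gt0// subr_gt0.
    rewrite (_ : (fun n => _) = (fun n => expR (- (n.+1%:R^-1 * ((x - a) * (b - x))^-1)))); last first.
      apply/funext => n; rewrite /ebump GE mulr_gt0// expr0 invr1 mul1r.
      by rewrite invfM.
    rewrite -[in X in _ --> X](expR0 R) -oppr0 -(mul0r ((x - a) * (b - x))^-1).
    apply: continuous_cvg; first exact: continuous_expR.
    apply: cvgN; apply: cvgM; [exact: cvg_harmonic|exact: cvg_cst].
  rewrite (_ : (fun n => _) = cst 0); first exact: cvg_cst.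
  apply/funext => n; rewrite /ebump GE pmulr_rgt0 ?ltr0n// ifF//.
  apply/negbTE; move: xab; rewrite negb_and -!leNgt => /orP[h|h]; nra.
Qed.

End bump.

(** * The fundamental lemmas of the calculus of variations *)

Section fundamental_lemma.
Context (R : realType).
Local Notation mu := (@lebesgue_measure R).

Lemma smooth_is_derive (f : R -> R) : smooth f -> forall x : R, is_derive x 1 f (derive1 f x).
Proof. by move=> sf x; rewrite derive1E; exact: DeriveDef (sf 0%N x) _. Qed.

Lemma smooth_cont (f : R -> R) : smooth f -> continuous f.
Proof. by move=> sf x; exact: is_derive_continuous (smooth_is_derive sf x). Qed.

Lemma smooth_derive1 (f : R -> R) : smooth f -> smooth (derive1 f).
Proof. by move=> sf n x; rewrite -derive1Sn; exact: sf. Qed.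

Lemma smooth_lin (f g : R -> R) (c : R) : smooth f -> smooth g ->
  smooth (fun x => f x + c * g x).
Proof.
move=> + + n; elim: n f g => [|n IH] f g sf sg x.
  apply: derivableD; first exact: (sf 0%N).
  by apply: derivableM => //; exact: (sg 0%N).
rewrite derive1Sn (_ : derive1 _ = fun x => derive1 f x + c * derive1 g x).
  by apply: IH; exact: smooth_derive1.
apply/funext => y; rewrite derive1E.
have := is_deriveD (smooth_is_derive sf y) (is_deriveZ c (smooth_is_derive sg y)).
by case.
Qed.

Lemma test_on_lin a b (f g : R -> R) (c : R) : test_on a b f -> test_on a b g ->
  test_on a b (fun x => f x + c * g x).
Proof.
move=> [sf f0] [sg g0]; split; first exact: smooth_lin.
by move=> x nx; rewrite f0// g0// mulr0 addr0.
Qed.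

Lemma itg_subitv (f : R -> R) (a b c d : R) : a <= c -> d <= b ->
  itg mu `[a, b] f -> itg mu `[c, d] f.
Proof.
move=> ac db; apply: integrableS => //.
by apply: subset_itv; rewrite bnd_simp.
Qed.

(** Bumps tending to the indicator of ]a, x[, with [|g|] as dominating function, show that the
    integral of g over [a, x] vanishes for every x; almost everywhere differentiation of this
    primitive gives g = 0. *)
Lemma fundamental_lemma (a b : R) (g : R -> R) : itg mu `[a, b] g ->
  (forall phi, test_on a b phi -> \int[mu]_(x in `[a, b]) (g x * phi x) = 0) ->
  {ae mu, forall x, a <= x <= b -> g x = 0}.
Proof.
move=> gi g0.
have I0 x : a <= x <= b -> \int[mu]_(t in `[a, x]) g t = 0.
  move=> /andP[]; rewrite le_eqVlt => /predU1P[<- _|ax xb].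
    by rewrite set_itv1 Rintegral_set1.
  have [phi [tphi phi01 cphi]] := bump_exists ax.
  have tphi' n : test_on a b (phi n).
    have [s h] := tphi n; split => // y ny; apply: h => /andP[ay yx].
    by apply: ny; rewrite ay (le_trans yx xb).
  have mg := itg_meas gi.
  have mphi n : measurable_fun (`[a, b]%classic : set (measurableTypeR R)) (phi n : measurableTypeR R -> R) by apply: cont_meas; exact: smooth_cont (tphi n).1.
  have [] := @itg_dct _ _ _ mu `[a, b] (mI a b) (fun n t => g t * phi n t)
    (fun t => g t * \1_(`]a, x[%classic) t) (fun t => `|g t|).
  - by move=> n; exact: measurable_funM.
  - by apply: measurable_funM => //; exact: measurable_indic.
  - exact: itg_norm gi.
  - apply: aeW => t _; apply: cvgM; [exact: cvg_cst|exact: cphi].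
  - move=> n t _; rewrite normrM ler_piMr//; have /andP[h1 h2] := phi01 n t.
    by rewrite ger0_norm.
  have H0 n : \int[mu]_(t in `[a, b]) (g t * phi n t) = 0 by exact: g0.
  rewrite (_ : (fun n : nat => _) = (fun=> 0)); last by apply/funext => n; exact: H0.
  move=> gi' /(cvg_lim (@Rhausdorff _)); rewrite lim_cst// => /esym h.
  rewrite -Rintegral_itv_bndo_bndc; last first.
    apply: (integrableS _ _ _ gi) => //; apply: subset_itv; rewrite ?bnd_simp//.
  rewrite -(@Rintegral_itv_obnd_cbnd _ a (BLeft x)); last first.
    apply: (integrableS _ _ _ gi) => //; apply: subset_itv; rewrite ?bnd_simp//.
  rewrite -{}[RHS]h Rintegral_mkcond [RHS]Rintegral_mkcond.
  apply: eq_Int => t _; rewrite !patchE indicE !mem_setE !in_itv/=.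
  case: (boolP (a < t < x)) => [/andP[h1 h2]|_]; last by rewrite mulr0; case: ifP.
  by rewrite mulr1 (ltW h1) (ltW (lt_le_trans h2 xb)).
have [ba|ab] := leP b a.
  have : mu.-negligible [set a].
    by exists [set a]; split => //; exact: lebesgue_measure_set1.
  apply: negligibleS => x /= nx; apply: contrapT => xa; apply: nx => /andP[h1 h2].
  by exfalso; apply: xa; lra.
pose f := g \_ `[a, b].
have fi : itg mu setT f.
  by move: (gi); rewrite /itg => /integrable_mkcond; rewrite restrict_EFin; apply.
have Hi y : mu.-integrable [set` Interval (BLeft a) (BRight y)] (EFin \o f).
  by apply: (integrableS _ _ _ fi).
have Hl : locally_integrable [set: R] f by apply: integrable_locally.
have H := FTC1 Hi Hl.
have Nb : {ae mu, forall x, x != b}.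
  exists [set b]; split => //; first exact: lebesgue_measure_set1.
  by move=> x /= /negP; rewrite negbK => /eqP.
have Na : {ae mu, forall x, x != a}.
  exists [set a]; split => //; first exact: lebesgue_measure_set1.
  by move=> x /= /negP; rewrite negbK => /eqP.
apply: ae_imp2 (_ : {ae mu, forall x, x != a /\ x != b}) H; last first.
  by apply: ae_imp2 Na Nb => x.
move=> x [xa xb] Hx /andP[ax xb'].
have ax' : a < x by rewrite lt_def xa.
have xb'' : x < b by rewrite lt_def eq_sym xb.
have [_ <-] : derivable (fun x => \int[mu]_(t in `[a, x]) f t) x 1 /\
   derive1 (fun x => \int[mu]_(t in `[a, x]) f t) x = g x.
  have axb : (BLeft a < BRight x)%E by rewrite lte_fin.
  have := Hx axb; rewrite /f [X in _ = X]patchE mem_set//=.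
  by rewrite in_itv/= ax.
rewrite derive1E (@near_eq_derive _ _ _ _ (cst 0)) ?derive_cst//.
near=> y.
have yab : a < y < b.
  apply/andP; split; near: y; [exact: lt_nbhsr|exact: lt_nbhsl].
have {}yab : a <= y <= b by move: yab => /andP[h1 h2]; rewrite !ltW.
rewrite -(I0 y yab); apply: eq_Int => t; rewrite /= in_itv/= => /andP[h1 h2].
rewrite /f patchE mem_set//= in_itv/= h1/=.
by move: yab => /andP[_]; exact: le_trans.
Unshelve. all: by end_near. Qed.

(** The primitive vanishes to the left of a trivially and to the right of b because chi has mean
    zero. *)
Lemma antiderivative_test (a b : R) (chi : R -> R) : a < b -> test_on a b chi ->
  \int[mu]_(x in `[a, b]) chi x = 0 ->
  exists2 Phi, test_on a b Phi & derive1 Phi = chi.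
Proof.
move=> ab [sc c0] I0.
(* Starting at a - 1 makes a an interior point of the interval on which the primitive is
   differentiated. *)
pose Phi x := \int[mu]_(t in `[a - 1, x]) chi t.
have cc := smooth_cont sc.
have Pl x : x < a -> Phi x = 0.
  move=> xa; rewrite /Phi (@eq_Int _ _ _ _ _ _ (fun=> 0)).
    by rewrite Rintegral_cst// mul0r.
  move=> t; rewrite /= in_itv/= => /andP[_ tx]; apply: c0 => /andP[h _]; lra.
have E (x y : R) : a - 1 <= x -> x <= y -> Phi y - Phi x = \int[mu]_(t in `]x, y]) chi t.
  move=> ax xy; rewrite /Phi Rintegral_itvB ?bnd_simp//; exact: itg_cont.
have Pr x : b < x -> Phi x = 0.
  move=> bx.
  have -> : Phi x = (Phi x - Phi b) + (Phi b - Phi a) + Phi a by ring.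
  have a1 : a - 1 <= a by lra.
  rewrite (E b x (le_trans a1 (ltW ab)) (ltW bx)) (E a b a1 (ltW ab)).
  rewrite (@eq_Int _ _ _ mu `]b, x] _ (fun=> 0)); last first.
    by move=> t; rewrite /= in_itv/= => /andP[h1 h2]; apply: c0 => /andP[_ h]; lra.
  rewrite Rintegral_cst// mul0r add0r Rintegral_itv_obnd_cbnd ?I0 ?add0r; last first.
    by apply: (integrableS _ _ _ (itg_cont a b cc)) => //; apply: subset_itv; rewrite ?bnd_simp.
  rewrite /Phi -Rintegral_itv_bndo_bndc; last first.
    by apply: (@itg_contS _ _ (a - 1) a) => //; apply: subset_itv; rewrite bnd_simp.
  rewrite (@eq_Int _ _ _ _ _ _ (fun=> 0)); first by rewrite Rintegral_cst// mul0r.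
  move=> t; rewrite /= in_itv/= => /andP[_ tx]; apply: c0 => /andP[h _]; lra.
have dP (x : R) : is_derive x 1 Phi (chi x).
  have [xa|ax] := ltP x a.
    rewrite c0; last by move=> /andP[h _]; lra.
    apply: (near_eq_is_derive _ (is_derive_cst (0 : R) x 1)).
    near=> z; rewrite Pl//; near: z; exact: lt_nbhsl.
  have [//| |d1 d2] := @continuous_FTC1_closed _ chi (a - 1) x (x + 1) _ (itg_cont (a - 1) (x + 1) cc) _ (cc x).
  - by rewrite ltrDl.
  - lra.
  - by apply: DeriveDef; [exact: d1|rewrite -derive1E; exact: d2].
have dE : derive1 Phi = chi by apply/funext => x; rewrite derive1E; case: (dP x).
exists Phi => //; split; last first.
  move=> x nx; have [xa|ax] := ltP x a; first exact: Pl.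
  by apply: Pr; rewrite ltNge; apply/negP => xb; apply: nx; rewrite ax.
move=> [|n] x; first by case: (dP x).
by rewrite derive1Sn dE; exact: sc.
Unshelve. all: by end_near. Qed.

(** Every test function f differs by a multiple of one fixed bump [psi] from a function of mean
    zero, which is the derivative of a test function. The constant is the [psi]-average of g, and
    the fundamental lemma applies to g - c. *)
Lemma du_bois_reymond (a b : R) (g : R -> R) : a < b -> itg mu `[a, b] g ->
  (forall phi, test_on a b phi -> \int[mu]_(x in `[a, b]) (g x * derive1 phi x) = 0) ->
  exists c, {ae mu, forall x, a <= x <= b -> g x = c}.
Proof.
move=> ab gi g0.
have gm f : continuous f -> itg mu `[a, b] (fun x => g x * f x).
  move=> cf.
  have [M [_ HM]] : bounded_set (f @` `[a, b]).
    by apply: compact_bounded; apply: continuous_compact; [exact: continuous_subspaceT|exact: segment_compact].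
  apply: (itg_ext (mI a b) _ (@itg_mul_bdd _ _ _ mu _ (mI a b) f g (M + 1) (cont_meas cf) _ gi)).
  - by move=> x _; rewrite mulrC.
  - move=> x xab; apply: (HM (M + 1)); first by rewrite ltrDl.
    by exists x.
have [phi [tphi phi01 cphi]] := bump_exists ab.
have p0 n : 0 <= phi n (0 : R) by case/andP: (phi01 n 0).
have [n In] : exists n, 0 < \int[mu]_(x in `[a, b]) phi n x.
  have [] := @itg_dct _ _ _ mu `[a, b] (mI a b) phi
    (fun t => \1_(`]a, b[%classic) t) (fun=> 1).
  - by move=> n; apply: cont_meas; exact: smooth_cont (tphi n).1.
  - exact: measurable_indic.
  - by apply: itg_cst => //; exact: itv_fin.
  - by apply: aeW => t _; exact: cphi.
  - by move=> n t _; have /andP[h1 h2] := phi01 n t; rewrite ger0_norm.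
  move=> _; rewrite {2}/Rintegral integral_indic//.
  rewrite (_ : `]a, b[ `&` `[a, b] = `]a, b[%classic); last first.
    by apply/seteqP; split=> x /=; rewrite !in_itv/=; [case|move=> /andP[h1 h2]; split; rewrite ?h1 ?h2 ?ltW].
  have -> : fine (mu `]a, b[%classic) = b - a.
    by have := lebesgue_measure_itv `]a, b[; rewrite /= lte_fin ab => ->.
  move=> /cvgrPdist_lt/(_ (b - a)).
  rewrite subr_gt0 => /(_ ab)[N _ HN]; exists N.
  have := HN N (leqnn N); rewrite /= ltr_norml => /andP[_]; lra.
pose psi := phi n; pose J := \int[mu]_(x in `[a, b]) psi x.
pose c := (\int[mu]_(x in `[a, b]) (g x * psi x)) / J.
exists c.
suff : {ae mu, forall x, a <= x <= b -> g x - c = 0}.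
  by apply: ae_imp => x h /h /eqP; rewrite subr_eq0 => /eqP.
have cpsi : continuous psi by exact: smooth_cont (tphi n).1.
apply: fundamental_lemma.
  apply: (itgB (mI a b)) => //; apply: itg_cst => //; exact: itv_fin.
move=> f tf; have cf : continuous f by exact: smooth_cont tf.1.
pose m := (\int[mu]_(x in `[a, b]) f x) / J.
have tchi := test_on_lin (- m) tf (tphi n).
have [] := antiderivative_test ab tchi.
  rewrite (IntD (mI a b)) ?(IntZ (mI a b))//; try exact: itg_cont.
    by rewrite /m -/psi -/J; field; rewrite gt_eqF.
  by apply: (itgZ (mI a b)) => //; exact: itg_cont.
move=> Phi tPhi dPhi; have := g0 _ tPhi; rewrite dPhi.
rewrite (@eq_IntI _ a b _ (fun x => g x * f x - m * (g x * psi x))); last by move=> x _; rewrite /psi; ring.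
rewrite (IntB (mI a b)) ?(IntZ (mI a b))//; last 1 first.
  by apply: (itgZ (mI a b)) => //; exact: gm.
1-3: try exact: gm.
move=> h.
rewrite (@eq_IntI _ a b _ (fun x => g x * f x - c * f x)); last by move=> x _; ring.
rewrite (IntB (mI a b)) ?(IntZ (mI a b))//; try exact: gm; try exact: itg_cont.
  by move: h; rewrite /c /m; set A := Rintegral _ _ _; set B := Rintegral _ _ _; set C := Rintegral _ _ _; lra.
by apply: (itgZ (mI a b)) => //; exact: itg_cont.
Qed.

End fundamental_lemma.

Notation mfun1 D f := (@measurable_fun _ _ (measurableTypeR _) _ D f).

(** * Integrals over intervals and periods *)

Section line_integrals.
Context (R : realType).
Local Notation mu := (@lebesgue_measure R).

Lemma itg_patch (f : R -> R) (D : set R) : measurable D ->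
  itg mu D f <-> itg mu setT (f \_ D).
Proof.
move=> mD; rewrite /itg -restrict_EFin; split => h.
  by apply/(integrable_mkcond (mu:=mu) (EFin \o f) mD).
by apply/(integrable_mkcond (mu:=mu) (EFin \o f) mD).
Qed.

Lemma itg_cat (f : R -> R) (a b c : R) : a <= b -> b <= c ->
  itg mu `[a, b] f -> itg mu `[b, c] f -> itg mu `[a, c] f.
Proof.
move=> ab bc fab fbc.
have fbc' : itg mu `]b, c] f.
  by apply: (integrableS _ _ _ fbc) => //; apply: subset_itv; rewrite bnd_simp.
apply/itg_patch => //.
have := itgD measurableT ((itg_patch _ _).1 fab) ((itg_patch _ _).1 fbc').
move=> /(_ (measurable_itv _) (measurable_itv _)).
rewrite (_ : (fun x => _) = f \_ `[a, c])//; apply/funext => x.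
rewrite !patchE !mem_setE !in_itv/=.
have [xb|bx] := leP x b; first by rewrite addr0 (le_trans xb bc).
by rewrite andbF add0r (le_trans ab (ltW bx)).
Qed.

Lemma Int_cat (f : R -> R) (a b c : R) : a <= b -> b <= c -> itg mu `[a, c] f ->
  \int[mu]_(x in `[a, c]) f x =
  \int[mu]_(x in `[a, b]) f x + \int[mu]_(x in `[b, c]) f x.
Proof.
move=> ab bc fac.
rewrite -(@Rintegral_itv_obnd_cbnd _ b (BRight c)).
  by rewrite -(@Rintegral_itvB _ f (BLeft a) (BRight c) b)// ?bnd_simp// addrC subrK.
by apply: (integrableS _ _ _ fac) => //; apply: subset_itv; rewrite bnd_simp.
Qed.

Lemma itg_shift_itv (f : R -> R) (a b c : R) : itg mu `[a, b] f ->
  itg mu `[a - c, b - c] (fun x => f (x + c)) /\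
  \int[mu]_(x in `[a, b]) f x = \int[mu]_(x in `[a - c, b - c]) f (x + c).
Proof.
move=> fi.
have E : shiftr c @^-1` `[a, b] = `[a - c, b - c]%classic.
  by apply/seteqP; split => x /=; rewrite /shiftr !in_itv/= lerBlDr lerBrDr.
rewrite -E; split; last exact: Int_shift.
exact: itg_shift.
Qed.

Lemma per_nat (f : R -> R) (n : nat) x : (forall y, f (y + 1) = f y) -> f (x + n%:R) = f x.
Proof.
by move=> pf; elim: n => [|n IH]; rewrite ?addr0// -natr1 addrA pf.
Qed.

(** Integers are written throughout as differences of two naturals, so that periodicity only needs
    inductions over [nat]. *)
Lemma per_int (f : R -> R) (n m : nat) x : (forall y, f (y + 1) = f y) ->
  f (x + (n%:R - m%:R)) = f x.
Proof.
by move=> pf; rewrite -(per_nat m _ pf) addrA subrK per_nat.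
Qed.

Lemma itg_per (f : R -> R) (n m : nat) : (forall y, f (y + 1) = f y) ->
  itg mu `[0, 1] f -> itg mu `[- m%:R, n%:R - m%:R] f.
Proof.
move=> pf fi; elim: n => [|n IH].
  rewrite sub0r set_itv1; apply/integrableP; split; first exact: measurable_fun_set1.
  by rewrite integral_set1// ltry.
apply: (itg_cat _ _ IH).
- by rewrite lerDr.
- by rewrite lerD2r ler_nat.
have [] := itg_shift_itv (- (n%:R - m%:R)) fi.
rewrite opprK add0r (_ : 1 + (n%:R - m%:R) = n.+1%:R - m%:R); last by rewrite -natr1; ring.
move=> h _; apply: (itg_ext _ _ h) => //.
by move=> x _; rewrite opprB per_int.
Qed.

Lemma Int_split (f : R -> R) (n m : nat) : itg mu `[- m%:R, n%:R - m%:R] f ->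
  \int[mu]_(x in `[- m%:R, n%:R - m%:R]) f x =
  \sum_(i < n) \int[mu]_(x in `[0, 1]) f (x + (i%:R - m%:R)).
Proof.
elim: n => [|n IH] fi.
  by rewrite sub0r set_itv1 Rintegral_set1 big_ord0.
have l1 : - m%:R <= n%:R - m%:R :> R by rewrite lerDr.
have l2 : n%:R - m%:R <= n.+1%:R - m%:R :> R by rewrite lerD2r ler_nat.
rewrite big_ord_recr/= (Int_cat l1 l2 fi) IH; last exact: itg_subitv fi.
congr (_ + _).
have fi2 : itg mu `[n%:R - m%:R, n.+1%:R - m%:R] f by exact: itg_subitv fi.
have [_ ->] := itg_shift_itv (n%:R - m%:R) fi2.
by rewrite subrr (_ : n.+1%:R - m%:R - (n%:R - m%:R) = 1)// -natr1; ring.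
Qed.

(** Integrability is assumed for every section, so both real iterated integrals agree pointwise with
    the extended ones and no exceptional set arises. *)
Lemma Int_swap (A B : set R) (f : R -> R -> R) : measurable A -> measurable B ->
  itg mu2 (A `*` B) (fun p => f p.1 p.2) ->
  (forall t, A t -> itg mu B (f t)) -> (forall x, B x -> itg mu A (f ^~ x)) ->
  \int[mu]_(t in A) \int[mu]_(x in B) f t x = \int[mu]_(x in B) \int[mu]_(t in A) f t x.
Proof.
move=> mA mB fi ft fx.
have mAB : measurable (A `*` B) by exact: measurableX.
pose F := (fun p : R * R => f p.1 p.2) \_ (A `*` B).
have Fi : (mu \x mu)%E.-integrable setT (EFin \o F).
  by move: fi => /integrable_mkcond; rewrite restrict_EFin; apply.
have Fsec t x : F (t, x) = if (t \in A) && (x \in B) then f t x else 0.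
  by rewrite /F !patchE in_setX.
congr fine; rewrite integral_mkcond [RHS]integral_mkcond.
transitivity (\int[mu]_t \int[mu]_x (EFin \o F) (t, x))%E.
  apply: eq_integral => t _; rewrite patchE; case: ifPn => tA.
    rewrite -itgE//; last by apply: ft; exact: set_mem.
    rewrite integral_mkcond; apply: eq_integral => x _ /=.
    by rewrite -/(F (t, x)) Fsec tA/= patchE; case: ifP.
  by rewrite integral0_eq// => x _ /=; rewrite -/(F (t, x)) Fsec (negbTE tA).
rewrite (Fubini Fi); apply: eq_integral => x _; rewrite patchE; case: ifPn => xB.
  rewrite -itgE//; last by apply: fx; exact: set_mem.
  rewrite [RHS]integral_mkcond; apply: eq_integral => t _ /=.
  by rewrite -/(F (t, x)) Fsec xB andbT patchE; case: ifP.
by rewrite integral0_eq// => t _ /=; rewrite -/(F (t, x)) Fsec (negbTE xB) andbF.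
Qed.

Lemma itg_snd (f : R -> R) (a b c d : R) : itg mu `[c, d] f ->
  itg mu2 (`[a, b] `*` `[c, d]) (fun p => f p.2).
Proof.
move=> fi.
pose f' : R -> R := f \_ `[c, d].
have mf : mfun1 setT f'.
  by have := itg_meas ((itg_patch _ _).1 fi) => /(_ (measurable_itv _)).
have mab := mI a b; have mcd := mI c d.
have mX : measurable (`[a, b] `*` `[c, d] : set (measurableTypeR R * measurableTypeR R)).
  exact: measurableX.
have m2 : measurable_fun setT (fun p : measurableTypeR R * measurableTypeR R => f' p.2).
  exact: measurableT_comp mf measurable_snd.
have ff' x : `[c, d]%classic x -> f x = f' x by move=> xc; rewrite /f' patchE mem_set.
have fi' : itg mu `[c, d] (fun x => `|f' x|).
  exact: itg_norm (itg_ext mcd ff' fi).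
apply: (itg_ext mX (f := fun p => f' p.2)).
  by move=> [t x] [/= _ xc]; rewrite ff'.
apply: (itg_dom mX (g := fun p => `|f' p.2|)).
- exact: measurable_funS m2.
- apply: (itg_prod (f := fun _ x => `|f' x|)) => //.
  + by apply: measurableT_comp => //; exact: measurable_funS m2.
  + by apply: itg_cst => //; exact: itv_fin.
- by move=> p _.
Qed.

End line_integrals.

(** * Absolutely continuous functions and integration by parts *)

Section absolute_continuity.
Context (R : realType).
Local Notation mu := (@lebesgue_measure R).
Implicit Types (F f G g u p q : R -> R).

(** The integral formula is imposed at every point of [0, b], so it selects the continuous
    representative there. *)
Definition ac (b : R) F f : Prop := itg mu `[0, b] f /\
  forall x, 0 <= x <= b -> F x = F 0 + \int[mu]_(t in `[0, x]) f t.

Context (b : R) (b0 : 0 <= b).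

Lemma ac_sub F f x y : ac b F f -> 0 <= x -> x <= y -> y <= b ->
  F y - F x = \int[mu]_(t in `[x, y]) f t.
Proof.
move=> [fi Ff] x0 xy y1.
have y0 := le_trans x0 xy; have x1 := le_trans xy y1.
rewrite (Ff x) ?x0// (Ff y) ?y0// (@Int_cat _ f 0 x y)//; first ring.
exact: itg_subitv fi.
Qed.

Lemma Int_le_sub f x y : (forall t, 0 <= f t) -> 0 <= x -> y <= b -> itg mu `[0, b] f ->
  \int[mu]_(t in `[x, y]) f t <= \int[mu]_(t in `[0, b]) f t.
Proof.
move=> f0 x0 y1 fi.
rewrite -lee_fin -!(itgE (mu:=mu))//; last exact: itg_subitv fi.
apply: ge0_subset_integral => //.
- by apply/measurable_EFinP; exact: itg_meas fi.
- by move=> t _; rewrite lee_fin.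
- by apply: subset_itv; rewrite bnd_simp.
Qed.

(** Cauchy-Schwarz against the constant 1 on the interval between x and y. *)
Lemma ac_holder F f x y : ac b F f -> sqi mu `[0, b] f -> 0 <= x <= b -> 0 <= y <= b ->
  (F y - F x) ^+ 2 <= `|y - x| * \int[mu]_(t in `[0, b]) (f t ^+ 2).
Proof.
move=> aF sf; wlog xy : x y / x <= y.
  move=> H x01 y01; have [xy|/ltW yx] := leP x y; first exact: H.
  by rewrite -sqrrN opprB distrC; exact: H.
move=> /andP[x0 x1] /andP[y0 y1].
rewrite (ac_sub aF)// ger0_norm ?subr_ge0//.
have mxy := mI x y.
have sfxy : sqi mu `[x, y] f.
  split; first by apply: measurable_funS sf.1 => //; apply: subset_itv; rewrite bnd_simp.
  exact: itg_subitv sf.2.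
have s1 : sqi mu `[x, y] (fun=> 1) by split => //; apply: itg_cst => //; exact: itv_fin.
have := cauchy_schwarz mxy s1 sfxy.
under eq_Int do rewrite mul1r.
move=> /le_trans; apply.
rewrite expr1n Rintegral_cst// mul1r.
have -> : fine (mu `[x, y]%classic) = y - x.
  have := lebesgue_measure_itv `[x, y]; rewrite /= lte_fin.
  move: xy; rewrite le_eqVlt => /predU1P[->|xy]; first by rewrite ltxx subrr => ->.
  by rewrite xy => ->.
rewrite ler_wpM2l ?subr_ge0//; apply: Int_le_sub => //; last exact: sf.2.
by move=> t; exact: sqr_ge0.
Qed.

Lemma Int_le_ind f x : itg mu `[0, b] f -> 0 <= x <= b ->
  \int[mu]_(t in `[0, b]) (if t <= x then f t else 0) = \int[mu]_(t in `[0, x]) f t.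
Proof.
move=> fi /andP[x0 x1]; rewrite Rintegral_mkcond [RHS]Rintegral_mkcond.
congr Rintegral; apply/funext => t; rewrite !patchE !mem_setE !in_itv/=.
by case: (leP 0 t) => //= t0; case: (leP t x) => tx; [rewrite (le_trans tx x1)|case: ifP].
Qed.

Lemma Int_ge_ind f x : itg mu `[0, b] f -> 0 <= x <= b ->
  \int[mu]_(t in `[0, b]) (if x <= t then f t else 0) = \int[mu]_(t in `[x, b]) f t.
Proof.
move=> fi /andP[x0 x1]; rewrite Rintegral_mkcond [RHS]Rintegral_mkcond.
congr Rintegral; apply/funext => t; rewrite !patchE !mem_setE !in_itv/=.
case: (leP x t) => //= xt; first by rewrite (le_trans x0 xt).
by case: ifP.
Qed.

Lemma cont_bdd g : continuous g -> exists2 M, 0 <= M & forall x, 0 <= x <= b -> `|g x| <= M.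
Proof.
move=> cg.
have [M [_ HM]] : bounded_set (g @` `[0, b]).
  by apply: compact_bounded; apply: continuous_compact; [exact: continuous_subspaceT|exact: segment_compact].
exists (`|M| + 1); first by rewrite addr_ge0.
move=> x x01; apply: (HM (`|M| + 1)); first by have := ler_norm M; lra.
by exists x.
Qed.

Lemma itg_mul_cont f g : itg mu `[0, b] f -> continuous g -> itg mu `[0, b] (fun x => f x * g x).
Proof.
move=> fi cg; have [M M0 HM] := cont_bdd cg.
apply: (itg_ext (mI 0 b) _ (itg_mul_bdd (mI 0 b) (cont_meas cg) _ fi)).
- by move=> x _; rewrite mulrC.
- by move=> x; rewrite /= in_itv/=; exact: HM.
Qed.

(** Fubini on the triangle y <= x for the function g(x) f(y): one order of integration produces F -
    F 0, the other G b - G. No derivative of F is ever taken. *)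
Lemma ibp F f G g : ac b F f -> (forall x : R, is_derive x 1 G (g x)) -> continuous g ->
  itg mu `[0, b] F ->
  \int[mu]_(x in `[0, b]) (F x * g x + f x * G x) = F b * G b - F 0 * G 0.
Proof.
move=> [fi Ff] dG cg Fi.
have cG : continuous G by move=> x; exact: is_derive_continuous (dG x).
have [M M0 HM] := cont_bdd cg.
have I01 := mI 0 b.
(* Extension by zero makes the density measurable on the whole line, as joint measurability of the
   integrand requires. *)
pose f' : R -> R := f \_ `[0, b].
have ff' x : `[0, b]%classic x -> f' x = f x by move=> h; rewrite /f' patchE mem_set.
have ffI x : 0 <= x <= b -> f' x = f x by move=> h; apply: ff'; rewrite /= in_itv.
have fi' : itg mu `[0, b] f' by apply: (itg_ext I01 _ fi) => x /ff' ->.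
have mf' : mfun1 setT f' by have := itg_meas ((itg_patch _ _).1 fi) => /(_ I01).
pose h x y := if y <= x then g x * f' y else 0.
have mh : measurable_fun setT (fun p : measurableTypeR R * measurableTypeR R => h p.1 p.2).
  apply: measurable_fun_ifT.
  - apply: measurable_fun_ler; [exact: measurable_snd|exact: measurable_fst].
  - apply: measurable_funM.
    + exact: measurableT_comp (cont_meas cg) measurable_fst.
    + exact: measurableT_comp mf' measurable_snd.
  - by [].
have mX : measurable (`[0, b] `*` `[0, b] : set (measurableTypeR R * measurableTypeR R)).
  exact: measurableX.
have hi : itg mu2 (`[0, b] `*` `[0, b]) (fun p : R * R => h p.1 p.2).
  apply: (itg_dom mX (g := fun p : R * R => M * `|f' p.2|)).
  - exact: measurable_funS mh.
  - by apply: (itgZ mX); exact: itg_norm (itg_snd _ _ _).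
  - move=> [x y] [/= + _]; rewrite in_itv/= => xI; rewrite /h.
    case: ifP => _; rewrite ?normrM ?normr0; last by rewrite mulr_ge0.
    by rewrite ler_wpM2r// HM.
have fic x : itg mu `[0, b] (fun y => if y <= x then f' y else 0).
  apply: (itg_dom I01 (g := fun y => `|f' y|)).
  - apply: measurable_funS (measurable_fun_ifT _ mf' _) => //.
    by apply: measurable_fun_ler.
  - exact: itg_norm.
  - by move=> y _; case: ifP; rewrite ?normr0.
have gic y : itg mu `[0, b] (fun x => if y <= x then g x else 0).
  apply: (itg_dom I01 (g := fun y => `|g y|)).
  - apply: measurable_funS (measurable_fun_ifT _ (cont_meas cg) _) => //.
    by apply: measurable_fun_ler.
  - by apply: itg_norm; exact: itg_cont.
  - by move=> x _; case: ifP; rewrite ?normr0.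
have h1 x : itg mu `[0, b] (h x).
  by apply: (itg_ext I01 _ (itgZ I01 (g x) (fic x))) => y _; rewrite /h; case: ifP; rewrite ?mulr0.
have h2 y : itg mu `[0, b] (h ^~ y).
  by apply: (itg_ext I01 _ (itgZ I01 (f' y) (gic y))) => x _; rewrite /h; case: ifP; rewrite ?mulr0// mulrC.
have sw := Int_swap I01 I01 hi (fun x _ => h1 x) (fun y _ => h2 y).
have L x : 0 <= x <= b -> \int[mu]_(y in `[0, b]) h x y = g x * (F x - F 0).
  move=> xI; rewrite (Ff x xI) [F 0 + _]addrC addrK -(Int_le_ind fi xI).
  rewrite -(IntZ I01).
    by apply: eq_IntI => y yI; rewrite /h; case: ifP => _; [rewrite (ffI y yI)|rewrite mulr0].
  by apply: (itg_ext I01 _ (fic x)) => y yI; case: ifP => _ //; exact: ff'.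
have Rr y : 0 <= y <= b -> \int[mu]_(x in `[0, b]) h x y = f y * (G b - G y).
  move=> yI; have /andP[y0 y1] := yI; rewrite -(FTC2_line y1 dG cg) -(Int_ge_ind (itg_cont 0 b cg) yI).
  rewrite -(IntZ I01 (f y) (gic y)).
  by apply: eq_IntI => x xI; rewrite /h; case: ifP => _; [rewrite (ffI y yI) mulrC|rewrite mulr0].
have fG := itg_mul_cont fi cG.
have Fg := itg_mul_cont Fi cg.
move: sw; rewrite (eq_IntI L) (eq_IntI Rr).
rewrite (@eq_IntI _ _ _ _ (fun x => F x * g x - F 0 * g x)); last by move=> x _; ring.
rewrite (@eq_IntI _ _ _ (fun y => f y * (G b - G y)) (fun x => G b * f x - f x * G x)); last by move=> x _; ring.
rewrite !(IntB I01) ?(IntZ I01)//; try exact: itg_cont; try by apply: (itgZ I01) => //; exact: itg_cont.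
rewrite (IntD I01)// (FTC2_line b0 dG cg).
have := Ff b; rewrite b0 lexx => /(_ isT).
by set A := Rintegral _ _ _; set B := Rintegral _ _ _; set C := Rintegral _ _ _ => -> ; lra.
Qed.

End absolute_continuity.

(** * Sobolev functions on the circle *)

Section torus.
Context (R : realType).
Local Notation mu := (@lebesgue_measure R).
Implicit Types (F f G g u p q phi : R -> R).
Let m01 := mI (0 : R) 1.

Definition per f : Prop := forall x, f (x + 1) = f x.

Definition l2p f : Prop := [/\ mfun1 setT f, per f & sqi mu `[0, 1] f].

Lemma fin01 : (mu `[0%R, 1%R]%classic < +oo)%E. Proof. exact: itv_fin. Qed.

Lemma per_frac (x : R) : exists y (n m : nat), 0 <= y < 1 /\ x = y + (n%:R - m%:R).
Proof.
have /andP[h1 h2] := floor_itv x; set z := Num.floor x in h1 h2.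
exists (x - z%:~R); move: h2; rewrite intrD => h2.
case: (intP z) h1 h2 => [|n|n] h1 h2.
- by exists 0%N, 0%N; split; rewrite ?subrr ?addr0 ?subr0//; apply/andP; split; lra.
- exists n.+1, 0%N; split; last by rewrite subr0 subrK.
  by apply/andP; split; lra.
- exists 0%N, n.+1; rewrite sub0r mulrNz; split; last by rewrite opprK addrK.
  by move: h1 h2; rewrite mulrNz => h1 h2; apply/andP; split; lra.
Qed.

Lemma per_shift f x (n m : nat) : per f -> f (x + (n%:R - m%:R)) = f x.
Proof. exact: per_int. Qed.

Lemma sq_cont f (C : R) : (forall x y, `|x - y| <= 1 -> (f x - f y) ^+ 2 <= C * `|x - y|) ->
  continuous f.
Proof.
move=> H x; apply/cvgrPdist_le => e e0.
have C0 : 0 <= C.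
  have := H (x + 1) x; rewrite addrAC subrr add0r normr1 lexx mulr1 => /(_ isT).
  by apply: le_trans; exact: sqr_ge0.
have c0 : 0 < Num.min 1 (e ^+ 2 / (C + 1)).
  by rewrite lt_min ltr01/= divr_gt0 ?exprn_gt0//; lra.
have nb : \forall y \near x, `|x - y| <= Num.min 1 (e ^+ 2 / (C + 1)).
  by exists (Num.min 1 (e ^+ 2 / (C + 1))) => // y /= h; exact: ltW.
near=> y.
have : `|x - y| <= Num.min 1 (e ^+ 2 / (C + 1)).
  by near: y; exact: nb.
rewrite le_min => /andP[y1 y2].
rewrite -(@ler_pXn2r _ 2)// ?nnegrE//; last exact: ltW.
rewrite real_normK ?num_real//; apply: le_trans (H _ _ y1) _.
apply: le_trans (_ : C * (e ^+ 2 / (C + 1)) <= _); first by rewrite ler_wpM2l.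
rewrite mulrA ler_pdivrMr; last lra.
by have := sqr_ge0 e; nra.
Unshelve. all: by end_near. Qed.

(** After reduction to one period the segment crosses at most one integer. If it does, the two
    pieces are added and (a + c)^2 <= 2 a^2 + 2 c^2 costs the factor 2. *)
Lemma per_holder F f x y : per F -> ac 1 F f -> sqi mu `[0, 1] f -> `|x - y| <= 1 ->
  (F x - F y) ^+ 2 <= 2 * (\int[mu]_(t in `[0, 1]) (f t ^+ 2)) * `|x - y|.
Proof.
move=> pF aF sf.
set A := \int[mu]_(t in _) _.
have A0 : 0 <= A by apply: Rintegral_ge0 => t _; exact: sqr_ge0.
wlog xy : x y / x <= y.
  move=> H; have [xy|/ltW yx] := leP x y; first exact: H.
  by rewrite distrC -sqrrN opprB; exact: H.
rewrite distrC ger0_norm ?subr_ge0// => xy1.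
have [x' [n [m [/andP[x0 x1] xE]]]] := per_frac x.
have yE : y = (y - x + x') + (n%:R - m%:R) by rewrite xE; ring.
have -> : F x = F x' by rewrite xE per_shift.
have -> : F y = F (y - x + x') by rewrite [in LHS]yE per_shift.
pose y' := y - x + x'; rewrite -/y'.
have -> : y - x = y' - x' by rewrite /y'; ring.
have y'1 : y' <= x' + 1 by rewrite /y'; lra.
have xy' : x' <= y' by rewrite /y'; lra.
have [yl|yg] := leP y' 1.
  have := @ac_holder _ 1 F f x' y' aF sf; rewrite x0 (ltW x1) yl (le_trans x0 xy').
  move=> /(_ isT isT); rewrite -/A ger0_norm ?subr_ge0//; nra.
have F01 : F 1 = F 0 by have := aF; rewrite -[1]add0r.
have Fy : F y' = F (y' - 1) by rewrite -[in LHS](subrK 1 y').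
have h1 := @ac_holder _ 1 F f 0 (y' - 1) aF sf.
have h2 := @ac_holder _ 1 F f x' 1 aF sf.
move: h1; rewrite lexx ler01 subr0 ger0_norm; last lra.
have -> : 0 <= y' - 1 <= 1 by apply/andP; split; lra.
move=> /(_ isT isT) h1; move: h2; rewrite x0 (ltW x1) ler01 lexx/=.
rewrite ger0_norm; last lra.
move=> /(_ isT isT) h2; rewrite -/A in h1 h2; rewrite Fy.
set a := F (y' - 1) - F 0 in h1; set c := F 1 - F x' in h2.
have -> : (F x' - F (y' - 1)) ^+ 2 = (a + c) ^+ 2 by rewrite /a /c F01; ring.
have := sqr_ge0 (a - c); nra.
Qed.

Lemma per_cont F f : per F -> ac 1 F f -> sqi mu `[0, 1] f -> continuous F.
Proof.
move=> pF aF sf; apply: (@sq_cont _ (2 * \int[mu]_(t in `[0, 1]) (f t ^+ 2))).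
by move=> x y; exact: per_holder.
Qed.

Lemma cont_l2p f : continuous f -> per f -> l2p f.
Proof.
move=> cf pf; split => //; first exact: cont_meas.
split; first exact: cont_meas.
by apply: itg_cont => x; apply: cvgM; exact: cf.
Qed.

Lemma l2p_lin f g (c : R) : l2p f -> l2p g -> l2p (fun x => f x + c * g x).
Proof.
move=> [mf pf sf] [mg pg sg]; split.
- by apply: measurable_funD => //; exact: measurable_funM.
- by move=> x; rewrite pf pg.
- by apply: (sqiD m01) => //; exact: (sqiZ m01).
Qed.

Lemma ac_lin (b : R) F f G g (c : R) : 0 <= b -> ac b F f -> ac b G g ->
  ac b (fun x => F x + c * G x) (fun x => f x + c * g x).
Proof.
move=> b0 [fi Ff] [gi Gg]; split.
  by apply: (itgD (mI 0 b)) => //; exact: (itgZ (mI 0 b)).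
move=> x x01; have m0x := mI 0 x.
have /andP[x0 xb] := x01.
have fx := itg_subitv (lexx 0) xb fi; have gx := itg_subitv (lexx 0) xb gi.
rewrite (IntD m0x)// ?(IntZ m0x)//; last exact: (itgZ m0x).
by rewrite (Ff x)// (Gg x)//; ring.
Qed.

(** An element of H^2 of the circle with its first and second derivatives as explicit functions: [u]
    and [p] are continuous representatives, [q] is any square-integrable one. Carrying the
    derivatives along avoids the arbitrary choice made by [wderiv]. *)
Record h2 u p q : Prop := H2 {
  h2u : l2p u; h2p : l2p p; h2q : l2p q; h2up : ac 1 u p; h2pq : ac 1 p q }.

Lemma h2_intro u p q : per u -> per p -> l2p q -> ac 1 u p -> ac 1 p q -> h2 u p q.
Proof.
move=> pu pp lq up pq; have [_ _ sq] := lq.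
have cp := per_cont pp pq sq; have lp := cont_l2p cp pp.
split => //; apply: cont_l2p => //; have [_ _ sp] := lp; exact: per_cont up sp.
Qed.

Lemma h2_cont u p q : h2 u p q -> continuous u /\ continuous p.
Proof.
move=> [[_ pu _] [_ pp sp] [_ _ sq] up pq].
by split; [exact: per_cont up sp|exact: per_cont pq sq].
Qed.

Lemma h2_lin u p q u' p' q' (c : R) : h2 u p q -> h2 u' p' q' ->
  h2 (fun x => u x + c * u' x) (fun x => p x + c * p' x) (fun x => q x + c * q' x).
Proof.
by move=> [? ? ? ? ?] [? ? ? ? ?]; split; try exact: l2p_lin; exact: ac_lin.
Qed.

Lemma ac_C1 F f : (forall x : R, is_derive x 1 F (f x)) -> continuous f -> ac 1 F f.
Proof.
move=> dF cf; split; first exact: itg_cont.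
by move=> x /andP[x0 _]; rewrite (FTC2_line x0 dF cf) addrC subrK.
Qed.

Lemma h2_cst (c : R) : h2 (fun=> c) (fun=> 0) (fun=> 0).
Proof.
have c0 (a : R) : continuous (fun _ : R => a) by exact: cst_continuous.
apply: h2_intro => //; first exact: cont_l2p.
all: by apply: ac_C1 => // x; exact: is_derive_cst.
Qed.

Lemma h2_C2 phi phi1 phi2 : (forall x : R, is_derive x 1 phi (phi1 x)) ->
  (forall x : R, is_derive x 1 phi1 (phi2 x)) -> continuous phi2 ->
  per phi -> per phi1 -> per phi2 -> h2 phi phi1 phi2.
Proof.
move=> d1 d2 c2 p0 p1 p2.
have c1 : continuous phi1 by move=> x; exact: is_derive_continuous (d2 x).
by apply: h2_intro => //; [exact: cont_l2p|exact: ac_C1|exact: ac_C1].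
Qed.

Lemma l2p_itg f : l2p f -> itg mu `[0, 1] f.
Proof. by case=> _ _; apply: (sqi_itg m01); exact: fin01. Qed.

Lemma l2p_L2loc f : l2p f -> L2loc f.
Proof.
move=> [mf pf [_ sf]]; split => // K cK.
have [M [_ HM]] := compact_bounded cK.
have [N NM] : exists N : nat, M + 1 <= N%:R.
  exists (Num.bound (`|M| + 1)); have : `|M| + 1 < (Num.bound (`|M| + 1))%:R by rewrite archi_boundP// addr_ge0.
  by have := ler_norm M; lra.
have H := @itg_per _ (fun x => f x ^+ 2) (N + N) N _ sf.
have {}H : itg mu `[- N%:R, N%:R] (fun x => f x ^+ 2).
  by move: H; rewrite natrD addrK; apply => y; rewrite pf.
apply: (@le_lt_trans _ _ (\int[mu]_(x in `[(- N%:R)%R, N%:R%R]) ((f x ^+ 2)%R)%:E)%E).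
  apply: ge0_subset_integral => //.
  - exact: compact_measurable.
  - by apply/measurable_EFinP; exact: measurable_funS (measurable_funX 2 mf).
  - by move=> x _; rewrite lee_fin sqr_ge0.
  - move=> x Kx; rewrite /= in_itv/= -ler_norml; apply: le_trans NM.
    by apply: (HM (M + 1)) => //; rewrite ltrDl.
by rewrite (itgE (mI _ _) H) ltry.
Qed.

Lemma test_line_supp phi : test_line phi -> exists N : nat,
  forall x, N%:R <= `|x| -> phi x = 0 /\ derive1 phi x = 0.
Proof.
move=> [_ cphi]; have [M [_ HM]] := compact_bounded cphi.
pose N := Num.bound `|M + 1|.
have NM : `|M + 1| < N%:R by rewrite archi_boundP.
have z x : M + 1 < `|x| -> phi x = 0.
  move=> Mx; apply/eqP; apply: contraPT Mx => px; apply/negP; rewrite -leNgt.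
  by apply: (HM (M + 1)); [rewrite ltrDl|exact: subset_closure].
exists N => x Nx; have Mx : M + 1 < `|x| by apply: le_lt_trans (ler_norm _) (lt_le_trans NM Nx).
split; first exact: z.
rewrite derive1E (@near_eq_derive _ _ _ _ (cst 0)) ?derive_cst//.
have c : {for x, continuous (fun y : R => `|y|)} by exact: norm_continuous.
near=> y; apply: z; near: y.
by apply: (cvgr_gt _ c).
Unshelve. all: by end_near. Qed.

Lemma Int_unfold f g (N : nat) : l2p f -> continuous g -> (forall x, N%:R <= `|x| -> g x = 0) ->
  \int[mu]_(x in setT) (f x * g x) =
  \sum_(i < N + N) \int[mu]_(x in `[0, 1]) (f x * g (x + (i%:R - N%:R))).
Proof.
move=> lf cg g0; have [mf pf sf] := lf.
have fi := @itg_per _ f (N + N) N pf (l2p_itg lf).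
have [M M0 HM] : exists2 M, 0 <= M & forall x, `|g x| <= M.
  have [M [_ HM]] : bounded_set (g @` `[- N%:R, N%:R]).
    by apply: compact_bounded; apply: continuous_compact; [exact: continuous_subspaceT|exact: segment_compact].
  exists (`|M| + 1); first by rewrite addr_ge0.
  move=> x; have [Nx|xN] := leP N%:R `|x|; first by rewrite g0// normr0 addr_ge0.
  apply: (HM (`|M| + 1)); first by have := ler_norm M; lra.
  by exists x => //; rewrite /= in_itv/= -ler_norml ltW.
have fgi : itg mu `[- N%:R, (N + N)%:R - N%:R] (fun x => f x * g x).
  apply: (itg_ext (mI _ _) _ (itg_mul_bdd (mI _ _) (cont_meas cg) (fun x _ => HM x) fi)).
  by move=> x _; rewrite mulrC.
rewrite (_ : \int[mu]_(x in setT) _ = \int[mu]_(x in `[- N%:R, (N + N)%:R - N%:R]) (f x * g x)).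
  rewrite (Int_split fgi); apply: eq_bigr => i _; apply: eq_IntI => x _.
  by rewrite per_shift.
rewrite [RHS]Rintegral_mkcond; congr Rintegral; apply/funext => x; rewrite patchE.
case: ifPn => //; rewrite mem_setE in_itv/= natrD addrK -ler_norml -ltNge => Nx.
by rewrite g0 ?mulr0// ltW.
Qed.

Lemma smooth_test phi : test_line phi -> smooth phi. Proof. by case. Qed.

(** Integration by parts on each period leaves F(0) (phi(i+1) - phi(i)); these terms telescope and
    vanish beyond the support of phi. *)
Lemma weak_deriv_ac F f phi : l2p F -> l2p f -> ac 1 F f -> test_line phi ->
  \int[mu]_(x in setT) (F x * derive1 phi x) = - \int[mu]_(x in setT) (f x * phi x).
Proof.
move=> lF lf aF tphi; have sp := smooth_test tphi.
have [N HN] := test_line_supp tphi.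
have cp := smooth_cont sp; have cp' := smooth_cont (smooth_derive1 sp).
rewrite (Int_unfold lF cp' (fun x h => (HN x h).2)) (Int_unfold lf cp (fun x h => (HN x h).1)).
apply/eqP; rewrite -addr_eq0 -big_split/=; apply/eqP.
have [_ pF _] := lF; have F01 : F 1 = F 0 by have := pF 0; rewrite add0r.
have E (i : nat) : \int[mu]_(x in `[0, 1]) (F x * derive1 phi (x + (i%:R - N%:R))) +
    \int[mu]_(x in `[0, 1]) (f x * phi (x + (i%:R - N%:R))) =
    F 0 * phi (i.+1%:R - N%:R) - F 0 * phi (i%:R - N%:R).
  set c := i%:R - N%:R.
  have cc : continuous (fun x : R => x + c) by move=> x; apply: cvgD; [exact: cvg_id|exact: cvg_cst].
  have d (x : R) : is_derive x 1 (fun x : R => phi (x + c)) (derive1 phi (x + c)).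
    have dc : is_derive x 1 (fun x : R => x + c) 1.
      by apply: (is_derive_ext (is_deriveD (is_derive_id x 1) (is_derive_cst c x 1))) => //; rewrite addr0.
    by have := @is_derive1_comp _ phi (fun y => y + c) x _ _ (smooth_is_derive sp (x + c)) dc; rewrite mulr1.
  have c1 : continuous (fun x : R => phi (x + c)) by move=> x; apply: (continuous_comp (cc x)); exact: cp.
  have c2 : continuous (fun x : R => derive1 phi (x + c)) by move=> x; apply: (continuous_comp (cc x)); exact: cp'.
  rewrite -(IntD m01); try by apply: itg_mul_cont => //; exact: l2p_itg.
  rewrite (ibp ler01 aF d c2); last exact: l2p_itg.
  rewrite F01 add0r.
  by rewrite (_ : 1 + c = i.+1%:R - N%:R)// /c -natr1; ring.
under eq_bigr => i _ do rewrite E.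
rewrite -(big_mkord xpredT (fun i => F 0 * phi (i.+1%:R - N%:R) - F 0 * phi (i%:R - N%:R))).
rewrite (@telescope_sumr _ 0 (N + N) (fun i => F 0 * phi (i%:R - N%:R)))//.
rewrite natrD addrK sub0r.
have [|-> _] := HN N%:R; first by rewrite ger0_norm.
have [|-> _] := HN (- N%:R); first by rewrite normrN ger0_norm.
by rewrite !mulr0 subrr.
Qed.

Lemma weak_deriv0 f : l2p f -> weak_deriv 0 f f.
Proof. by move=> lf; split => [|phi _]; [exact: l2p_L2loc|rewrite expr0 mul1r]. Qed.

Lemma weak_deriv1 F f : l2p F -> l2p f -> ac 1 F f -> weak_deriv 1 F f.
Proof.
move=> lF lf aF; split => [|phi tphi]; first exact: l2p_L2loc.
by rewrite derive1n1 expr1 mulN1r; exact: weak_deriv_ac.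
Qed.

Lemma test_line_derive1 phi : test_line phi -> test_line (derive1 phi).
Proof.
move=> tphi; have [sp cp] := tphi; split; first exact: (smooth_derive1 sp).
apply: subclosed_compact cp _; first exact: closed_closure.
rewrite closureE; apply: smallest_sub; first exact: closed_closure.
move=> x /= dx; apply: contrapT => nx.
have : nbhs x (~` closure [set x | phi x != 0]).
  by apply: open_nbhs_nbhs; split => //; apply: closed_openC; exact: closed_closure.
move=> nbh; move/eqP : dx; apply.
rewrite derive1E (@near_eq_derive _ _ _ _ (cst 0)) ?derive_cst//.
apply: filterS nbh => y ny; apply/eqP; apply: contrapT => /negP py; apply: ny.
exact: subset_closure.
Qed.

Lemma weak_deriv2 u p q : h2 u p q -> weak_deriv 2 u q.
Proof.
move=> [lu lp lq up pq]; split => [|phi tphi]; first exact: l2p_L2loc.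
have tphi' := test_line_derive1 tphi.
rewrite derive1Sn derive1n1 (weak_deriv_ac lu lp up tphi') (weak_deriv_ac lp lq pq tphi).
by rewrite sqrrN expr1n mul1r opprK.
Qed.

Lemma Hper_l2p f : l2p f -> Hper 0 f.
Proof.
move=> lf; have [_ pf _] := lf; split; first exact: l2p_L2loc.
- exact: aeW.
- by move=> j; rewrite leqn0 => /eqP ->; exists f; exact: weak_deriv0.
Qed.

Lemma Hper_h2 k u p q : (k <= 2)%N -> h2 u p q -> Hper k u.
Proof.
move=> k2 hu; have [lu lp lq up pq] := hu; have [_ pu _] := lu.
split; [exact: l2p_L2loc|exact: aeW|move=> j jk].
have : (j <= 2)%N := leq_trans jk k2.
case: j {jk} => [|[|[|//]]] _.
- by exists u; exact: weak_deriv0.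
- by exists p; exact: weak_deriv1.
- by exists q; exact: weak_deriv2 hu.
Qed.

Lemma L2loc_itg f (a b : R) : L2loc f -> sqi mu `[a, b] f.
Proof.
move=> [mf fK]; have mfab : mfun1 `[a, b] f by exact: measurable_funS mf.
split => //; apply/integrableP; split; first by apply/measurable_EFinP; exact: measurable_funX.
under eq_integral do rewrite /= ger0_norm ?sqr_ge0//.
by apply: fK; exact: segment_compact.
Qed.

Lemma test_on_IntT (a b : R) phi f : test_on a b phi ->
  \int[mu]_(x in setT) (f x * phi x) = \int[mu]_(x in `[a, b]) (f x * phi x).
Proof.
move=> [_ p0]; rewrite [RHS]Rintegral_mkcond; congr Rintegral; apply/funext => x.
rewrite patchE; case: ifPn => //; rewrite mem_setE in_itv/= => /negP nx.
by rewrite p0 ?mulr0.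
Qed.

Lemma weak_deriv_unique j u v v' (a b : R) : weak_deriv j u v -> weak_deriv j u v' ->
  {ae mu, forall x, a <= x <= b -> v x = v' x}.
Proof.
move=> [lv Hv] [lv' Hv'].
have mab := mI a b.
have sv := L2loc_itg a b lv; have sv' := L2loc_itg a b lv'.
have vi := sqi_itg mab (itv_fin a b) sv; have vi' := sqi_itg mab (itv_fin a b) sv'.
suff : {ae mu, forall x, a <= x <= b -> v x - v' x = 0}.
  by apply: ae_imp => x h /h /eqP; rewrite subr_eq0 => /eqP.
apply: fundamental_lemma; first exact: (itgB mab).
move=> phi tphi; have tl := test_on_line tphi.
have sphi : sqi mu `[a, b] phi.
  have cphi := smooth_cont tphi.1.
  split; first exact: cont_meas.
  by apply: itg_cont => x; apply: cvgM; exact: cphi.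
have := Hv _ tl; rewrite (Hv' _ tl) => h.
have {}h : \int[mu]_(x in setT) (v' x * phi x) = \int[mu]_(x in setT) (v x * phi x).
  by apply: (mulfI _ h); rewrite expf_neq0// oppr_eq0 oner_eq0.
move: h; rewrite !(test_on_IntT _ tphi) => h.
rewrite (@eq_IntI _ _ _ _ (fun x => v x * phi x - v' x * phi x)); last by move=> x _; rewrite mulrBl.
by rewrite (IntB mab) ?h ?subrr//; exact: (sqi_mul mab).
Qed.

(** The bridge from the chosen weak derivative to an explicit one: the two agree almost everywhere,
    which is all the norms and the energy see. *)
Lemma wderiv_int j u v : weak_deriv j u v -> l2p v ->
  (\int[mu]_(x in `[0%R, 1%R]) (wderiv j u x ^+ 2)%:E)%E =
  (\int[mu]_(x in `[0, 1]) (v x ^+ 2))%:E.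
Proof.
move=> wv lv; have [_ _ [mv sv]] := lv; rewrite -(itgE m01)//.
have ww : weak_deriv j u (wderiv j u) by exact: (xgetPex (fun=> 0)) (ex_intro _ v wv).
apply: ae_eq_integral => //.
- apply/measurable_EFinP; apply: measurable_funX; have [[mw _] _] := ww.
  exact: measurable_funS mw.
- by apply/measurable_EFinP; exact: measurable_funX.
- apply: ae_imp (weak_deriv_unique 0 1 ww wv) => x h; rewrite /= in_itv/= => x01.
  by rewrite h.
Qed.

Definition nrm2 f : R := \int[mu]_(x in `[0, 1]) (f x ^+ 2).

Lemma nrm2_ge0 f : 0 <= nrm2 f.
Proof. by apply: Rintegral_ge0 => x _; exact: sqr_ge0. Qed.

Lemma Hnorm0E f : l2p f -> Hnorm 0 f = (Num.sqrt (nrm2 f))%:E.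
Proof. by move=> lf; rewrite /Hnorm big_ord1 (wderiv_int (weak_deriv0 lf)). Qed.

Lemma Hnorm1E u p q : h2 u p q -> Hnorm 1 u = (Num.sqrt (nrm2 u + nrm2 p))%:E.
Proof.
move=> [lu lp lq up pq]; rewrite /Hnorm !big_ord_recr big_ord0/= add0e.
by rewrite (wderiv_int (weak_deriv0 lu))// (wderiv_int (weak_deriv1 lu lp up)).
Qed.

Lemma Hnorm2E u p q : h2 u p q -> Hnorm 2 u = (Num.sqrt (nrm2 u + nrm2 p + nrm2 q))%:E.
Proof.
move=> hu; have [lu lp lq up pq] := hu; rewrite /Hnorm !big_ord_recr big_ord0/= add0e.
rewrite (wderiv_int (weak_deriv0 lu))// (wderiv_int (weak_deriv1 lu lp up))//.
by rewrite (wderiv_int (weak_deriv2 hu)).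
Qed.

Lemma energyE u p q : h2 u p q -> energy u = (nrm2 q + nrm2 p)%:E.
Proof.
move=> hu; have [lu lp lq up pq] := hu; rewrite /energy ifT; last first.
  by apply/asboolP; exact: Hper_h2 hu.
have w1 : weak_deriv 1 u (wderiv 1 u).
  exact: (xgetPex (fun=> 0)) (ex_intro _ p (weak_deriv1 lu lp up)).
have w2 : weak_deriv 2 u (wderiv 2 u).
  exact: (xgetPex (fun=> 0)) (ex_intro _ q (weak_deriv2 hu)).
have [mw1 _] := w1.1; have [mw2 _] := w2.1.
under eq_integral do rewrite EFinD.
rewrite ge0_integralD//=.
- by rewrite (wderiv_int (weak_deriv2 hu))// (wderiv_int (weak_deriv1 lu lp up)).
- by move=> x _; rewrite lee_fin sqr_ge0.
- by apply/measurable_EFinP; apply: measurable_funX; exact: measurable_funS mw2.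
- by move=> x _; rewrite lee_fin sqr_ge0.
- by apply/measurable_EFinP; apply: measurable_funX; exact: measurable_funS mw1.
Qed.

End torus.

(** * Inequalities, lower semicontinuity and compactness in H^2 *)

Section h2_estimates.
Context (R : realType).
Local Notation mu := (@lebesgue_measure R).
Implicit Types (F f G g u p q phi : R -> R).
Let m01 := mI (0 : R) 1.

Lemma Int1 : \int[mu]_(x in `[0%R, 1%R]) (1 : R) = 1.
Proof.
rewrite Rintegral_cst// mul1r; have := lebesgue_measure_itv (`[0 : R, 1]).
by rewrite /= lte_fin ltr01 => ->; rewrite /= subr0.
Qed.

Lemma IntC (c : R) : \int[mu]_(x in `[0, 1]) c = c.
Proof.
by have := Int1; rewrite !Rintegral_cst// mul1r => ->; rewrite mulr1.
Qed.

Lemma itgC (c : R) : itg mu `[0, 1] (fun=> c).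
Proof. by apply: itg_cst => //; exact: fin01. Qed.

Lemma Int01_le f g : itg mu `[0, 1] f -> itg mu `[0, 1] g ->
  (forall x, 0 <= x <= 1 -> f x <= g x) ->
  \int[mu]_(x in `[0, 1]) f x <= \int[mu]_(x in `[0, 1]) g x.
Proof. by move=> fi gi fg; apply: (Int_le m01) => // x /=; rewrite in_itv/=; exact: fg. Qed.

Lemma sq_Int_le f : sqi mu `[0, 1] f -> (\int[mu]_(x in `[0, 1]) f x) ^+ 2 <= nrm2 f.
Proof.
move=> sf; have s1 : sqi mu `[0, 1] (fun=> 1 : R) by split => //; exact: itgC.
have := cauchy_schwarz m01 s1 sf; rewrite (@eq_IntI _ _ _ _ f); last by move=> x _; rewrite mul1r.
rewrite (@eq_IntI _ _ _ (fun=> 1 ^+ 2) (fun=> 1)); last by move=> x _; rewrite expr1n.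
by rewrite Int1 mul1r.
Qed.

(** Periodicity of u gives p mean zero, so p(y) is the average over t of p(y) - p(t), and each of
    these is controlled by the Hoelder estimate at distance at most 1. *)
Lemma h2_p_bound u p q x : h2 u p q -> p x ^+ 2 <= nrm2 q.
Proof.
move=> hu; have [[_ pu _] lp [_ _ sq] up pq] := hu; have [_ pp sp] := lp.
have [y [n [m [/andP[y0 y1] ->]]]] := per_frac x; rewrite per_shift//.
have pi := l2p_itg lp.
have p0 : \int[mu]_(t in `[0, 1]) p t = 0.
  have [_ /(_ 1)] := up; rewrite ler01 lexx => /(_ isT).
  have := pu 0; rewrite add0r => -> /eqP.
  by rewrite -[X in X == _]addr0 (inj_eq (addrI _)) eq_sym => /eqP.
have sy : sqi mu `[0, 1] (fun=> p y) by split => //; exact: itgC.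
have : (\int[mu]_(t in `[0, 1]) (p y - p t)) ^+ 2 <= nrm2 q.
  apply: le_trans (sq_Int_le (sqiB m01 sy sp)) _.
  rewrite -[leRHS]IntC; apply: Int01_le; [exact: (sqiB m01 sy sp).2|exact: itgC|].
  move=> t t01; have := @ac_holder _ 1 p q t y pq sq t01; rewrite y0 (ltW y1) => /(_ isT).
  move=> /le_trans; apply; rewrite -[leRHS]mul1r ler_wpM2r ?nrm2_ge0//.
  move: t01 => /andP[? ?]; rewrite ler_norml; apply/andP; split; lra.
by rewrite (IntB m01) ?p0 ?IntC ?subr0//; exact: itgC.
Qed.

Lemma nrm2_p_le u p q : h2 u p q -> nrm2 p <= nrm2 q.
Proof.
move=> hu; have [_ [_ _ [_ sp]] _ _ _] := hu.
rewrite -[leRHS]IntC; apply: Int01_le => // [|x _]; first exact: itgC.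
exact: h2_p_bound hu.
Qed.

Lemma h2_holder u p q x y : h2 u p q -> `|x - y| <= 1 ->
  (u x - u y) ^+ 2 <= 2 * nrm2 q * `|x - y|.
Proof.
move=> hu xy; have [[_ pu _] [_ _ sp] _ up _] := hu.
apply: le_trans (per_holder pu up sp xy) _.
rewrite ler_wpM2r// ler_wpM2l//; exact: nrm2_p_le hu.
Qed.

(** Average u(y)^2 <= 2 u(t)^2 + 2 (u(y) - u(t))^2 over an interval of length eta containing y. It
    turns smallness in L^2 plus a bound on the second derivative into smallness in the supremum
    norm. *)
Lemma h2_interp u p q (eta : R) x : h2 u p q -> 0 < eta -> eta <= 1 / 2 ->
  u x ^+ 2 <= 2 * nrm2 u / eta + 4 * nrm2 q * eta.
Proof.
move=> hu e0 e1; have [lu _ _ _ _] := hu; have [_ pu su] := lu.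
have [y [n [m [/andP[y0 y1] ->]]]] := per_frac x; rewrite per_shift//.
(* Since eta <= 1/2, the interval of length eta on one of the two sides of y stays inside [0, 1]. *)
pose a := if y <= 1 / 2 then y else y - eta.
have [a0 a1 aya] : [/\ 0 <= a, a + eta <= 1 & a <= y <= a + eta].
  by rewrite /a; case: ifPn => h; [|rewrite -ltNge in h]; split; try (apply/andP; split); lra.
have ma := mI a (a + eta).
have ui : itg mu `[a, a + eta] (fun t => u t ^+ 2) by exact: itg_subitv su.2.
have fa : (mu `[a, (a + eta)%R]%classic < +oo)%E by exact: itv_fin.
have IA (c : R) : \int[mu]_(t in `[a, a + eta]) c = c * eta.
  rewrite Rintegral_cst//; congr (_ * _); have := lebesgue_measure_itv (`[a, a + eta]).
  rewrite /= lte_fin ltrDl e0 => ->; rewrite /=; ring.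
have key : u y ^+ 2 * eta <= 2 * nrm2 u + 4 * nrm2 q * eta * eta.
  rewrite -IA; apply: le_trans (_ : \int[mu]_(t in `[a, a + eta]) (2 * u t ^+ 2 + 4 * nrm2 q * eta) <= _).
    apply: (Int_le ma); first exact: itg_cst.
      by apply: (itgD ma); [exact: (itgZ ma)|exact: itg_cst].
    move=> t; rewrite /= in_itv/= => /andP[t0 t1]; move: aya => /andP[ya1 ya2].
    have yt : `|y - t| <= eta by rewrite ler_norml; apply/andP; split; lra.
    have := @h2_holder u p q y t hu; rewrite (le_trans yt); last lra.
    move=> /(_ isT) h; have {}h : (u y - u t) ^+ 2 <= 2 * nrm2 q * eta.
      by apply: le_trans h _; rewrite ler_wpM2l// mulr_ge0// nrm2_ge0.
    have := sqr_ge0 (u y - u t - u t); nra.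
  rewrite (IntD ma) ?(IntZ ma 2)//; try exact: (itgZ ma); try exact: itg_cst.
  rewrite IA lerD2r ler_wpM2l//; apply: Int_le_sub => //; last exact: su.2.
  by move=> t; exact: sqr_ge0.
rewrite -(ler_pM2r e0); apply: le_trans key _.
rewrite le_eqVlt; apply/orP; left; apply/eqP; field; by rewrite gt_eqF.
Qed.

(** A value exceeds the mean by at most the oscillation, which the Hoelder estimate bounds at
    distance one. *)
Lemma h2_sup_bound u p q x : h2 u p q -> (forall x, 0 <= u x) ->
  u x <= \int[mu]_(t in `[0, 1]) u t + Num.sqrt (2 * nrm2 q).
Proof.
move=> hu u0; have [lu _ _ _ _] := hu; have [_ pu su] := lu.
have [y [n [m [/andP[y0 y1] ->]]]] := per_frac x; rewrite per_shift//.
rewrite -[leLHS]IntC -[X in _ <= _ + X]IntC -(IntD m01); try exact: itgC; last exact: l2p_itg.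
apply: Int01_le; [exact: itgC|apply: (itgD m01); [exact: l2p_itg|exact: itgC]|].
move=> t /andP[t0 t1].
have yt : `|y - t| <= 1 by rewrite ler_norml; apply/andP; split; lra.
rewrite -lerBlDl; apply: le_trans (ler_norm _) _.
rewrite -sqrtr_sqr ler_wsqrtr//; apply: le_trans (h2_holder hu yt) _.
by rewrite ler_piMr// mulr_ge0// nrm2_ge0.
Qed.

Definition energy2 p q : R := nrm2 q + nrm2 p.

Lemma nrm2_mid f g : sqi mu `[0, 1] f -> sqi mu `[0, 1] g ->
  nrm2 (fun x => 2^-1 * (f x + g x)) =
  2^-1 * nrm2 f + 2^-1 * nrm2 g - 4^-1 * nrm2 (fun x => f x - g x).
Proof.
move=> sf sg; have sB := sqiB m01 sf sg; have [_ fi] := sf; have [_ gi] := sg; have [_ bi] := sB.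
rewrite /nrm2 -!(IntZ m01)// -(IntD m01); try exact: (itgZ m01).
rewrite -(IntB m01); [|by apply: (itgD m01); exact: (itgZ m01)|exact: (itgZ m01)].
by apply: eq_IntI => x _; field.
Qed.

Lemma sq8_cvg (a : nat -> R) (l : R) : (forall n, (a n - l) ^+ 2 <= 8^-1 ^+ n) ->
  a n @[n --> \oo] --> l.
Proof.
move=> H; apply/cvgrPdist_le => e e0.
have : (fun n => (8^-1 : R) ^+ n) @ \oo --> 0.
  by apply: cvg_expr; rewrite ger0_norm ?invr_ge0// invf_lt1// ltr1n.
move=> /cvgrPdist_le /(_ (e ^+ 2) (exprn_gt0 _ e0)); apply: filterS => n.
rewrite sub0r normrN => h; rewrite -(@ler_pXn2r _ 2)// ?nnegrE//; last exact: ltW.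
rewrite real_normK ?num_real// -sqrrN opprB; apply: le_trans (H n) _.
exact: le_trans (ler_norm _) h.
Qed.

Lemma cvgn_le (a : nat -> R) (l c : R) : a n @[n --> \oo] --> l ->
  (forall n, a n <= c) -> l <= c.
Proof.
move=> al ac; rewrite -(cvg_lim (@Rhausdorff _) al); apply: limr_le.
  by apply/cvg_ex; exists l.
by apply: nearW => n; exact: ac.
Qed.

Lemma ac_Int f : itg mu `[0, 1] f -> ac 1 (fun x => \int[mu]_(t in `[0, x]) f t) f.
Proof. by move=> fi; split => // x _; rewrite set_itv1 Rintegral_set1 add0r. Qed.

(** Closedness of the derivative: the primitive of f - f_n is small at every x by [ac_holder], so
    the integral formula survives the limit. *)
Lemma ac_lim (F_ f_ : nat -> R -> R) F f : (forall n, ac 1 (F_ n) (f_ n)) ->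
  (forall n, sqi mu `[0, 1] (f_ n)) -> sqi mu `[0, 1] f ->
  (forall x, F_ n x @[n --> \oo] --> F x) ->
  (forall n, nrm2 (fun x => f x - f_ n x) <= 8^-1 ^+ n) -> ac 1 F f.
Proof.
move=> aF sf_ sf cF cf; have fi := sqi_itg m01 (fin01 R) sf.
split => // x x01; have /andP[x0 x1] := x01; have m0x := mI 0 x.
have c1 : F_ n x - F_ n 0 @[n --> \oo] --> F x - F 0 by apply: cvgB; exact: cF.
have c2 : F_ n x - F_ n 0 @[n --> \oo] --> \int[mu]_(t in `[0, x]) f t.
  apply: sq8_cvg => n; have [fni Fn] := aF n.
  rewrite (Fn x)// [F_ n 0 + _]addrC addrK.
  rewrite -(IntB m0x); [|exact: itg_subitv fni|exact: itg_subitv fi].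
  have sB := sqiB m01 (sf_ n) sf.
  have := @ac_holder _ 1 _ _ 0 x (ac_Int (sqi_itg m01 (fin01 R) sB)) sB.
  rewrite lexx ler01 => /(_ isT x01); rewrite set_itv1 Rintegral_set1 !subr0 => /le_trans; apply.
  rewrite ger0_norm//; apply: le_trans (cf n); rewrite /nrm2.
  rewrite (@eq_IntI _ _ _ (fun t => (f_ n t - f t) ^+ 2) (fun t => (f t - f_ n t) ^+ 2)); last by move=> t _; ring.
  by rewrite ler_piMl// nrm2_ge0.
have E := cvg_lim (@Rhausdorff _) c1; rewrite (cvg_lim (@Rhausdorff _) c2) in E.
by rewrite E addrC subrK.
Qed.

Lemma h2B u p q u' p' q' : h2 u p q -> h2 u' p' q' ->
  h2 (fun x => u x - u' x) (fun x => p x - p' x) (fun x => q x - q' x).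
Proof.
move=> h h'; have := h2_lin (-1) h h'.
by congr h2; apply/funext => x; rewrite mulN1r.
Qed.

(* Mazur's lemma replaces the second derivatives by strongly converging convex combinations. *)
Lemma energy_lsc (u_ p_ q_ : nat -> R -> R) (u : R -> R) (C : R) :
  (forall k, h2 (u_ k) (p_ k) (q_ k)) ->
  (forall x, u_ k x @[k --> \oo] --> u x) ->
  (forall e : R, 0 < e -> \forall k \near \oo, energy2 (p_ k) (q_ k) <= C + e) ->
  exists p q, h2 u p q /\ energy2 p q <= C.
Proof.
move=> hu cu EC.
have [N0 _ HN0] := EC 1 ltr01.
pose V := ((R -> R) * (R -> R) * (R -> R))%type.
pose mid (a b : V) : V := (fun x => 2^-1 * (a.1.1 x + b.1.1 x),
  fun x => 2^-1 * (a.1.2 x + b.1.2 x), fun x => 2^-1 * (a.2 x + b.2 x)).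
(* Dropping the first [N0] terms bounds all energies by C + 1, as Mazur's lemma demands from index 0
   on. *)
pose f j : V := (u_ (j + N0)%N, p_ (j + N0)%N, q_ (j + N0)%N).
pose Q (a : V) := nrm2 a.2.
have hh n a : mhull mid f n a -> h2 a.1.1 a.1.2 a.2.
  elim=> [j nj|x y _ hx _ hy]; first exact: hu.
  have H := h2_lin 2^-1 (h2_lin 2^-1 (h2_cst 0) hx) hy.
  by rewrite /mid/=; have := H; congr h2; apply/funext => z; rewrite mulrDr add0r.
(* Bounds on a convex function, and closeness to the limit, hold on the hull as soon as they hold on
   the tail of the sequence. *)
have Eh n a : mhull mid f n a -> forall e, (forall k, (n <= k)%N -> energy2 (p_ (k + N0)%N) (q_ (k + N0)%N) <= e) ->
    energy2 a.1.2 a.2 <= e.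
  elim=> [j nj e He|x y hx IHx hy IHy e He]; first exact: He.
  have := IHx e He; have := IHy e He; rewrite /energy2 /mid/=.
  have [_ [_ _ sp] [_ _ sq] _ _] := hh _ _ hx; have [_ [_ _ sp'] [_ _ sq'] _ _] := hh _ _ hy.
  rewrite !nrm2_mid//; have := nrm2_ge0 (fun x0 => x.1.2 x0 - y.1.2 x0).
  have := nrm2_ge0 (fun x0 => x.2 x0 - y.2 x0); lra.
have uh n a : mhull mid f n a -> forall x e, (forall k, (n <= k)%N -> `|u_ (k + N0)%N x - u x| <= e) ->
    `|a.1.1 x - u x| <= e.
  elim=> [j nj x e He|a1 a2 _ IH1 _ IH2 x e He]; first exact: He.
  have := IH1 x e He; have := IH2 x e He; rewrite /mid/= !ler_norml => /andP[? ?] /andP[? ?].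
  by apply/andP; split; lra.
have [g [gh gC]] : exists g : nat -> V, (forall n, mhull mid f n (g n)) /\
    forall n m, (n <= m)%N -> nrm2 (fun x => (g m).2 x - (g n).2 x) <= 8^-1 ^+ n.
  apply: (@mazur R V mid f Q (fun a b => nrm2 (fun x => a.2 x - b.2 x)) (C + 1)).
  - move=> n a b ha hb; have [_ _ [_ _ sa] _ _] := hh _ _ ha.
    have [_ _ [_ _ sb] _ _] := hh _ _ hb; rewrite /Q /mid/= nrm2_mid//; lra.
  - by move=> a; exact: nrm2_ge0.
  - move=> j; have := HN0 (j + N0)%N (leq_addl _ _); rewrite /energy2 /Q/=.
    have := nrm2_ge0 (p_ (j + N0)%N); lra.
have hg n := hh _ _ (gh n).
have [q [mq sq perq cq Lq]] := @complete_sqi _ _ _ mu `[0, 1] m01 (fun n => (g n).2)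
  (fun n => let: And3 m _ _ := h2q (hg n) in m) (fun n => let: And3 _ _ s := h2q (hg n) in s) gC.
(* The first derivatives are Cauchy in the supremum norm, so their limit exists at every point and
   not merely in L^2. *)
have pC n m x : (n <= m)%N -> ((g m).1.2 x - (g n).1.2 x) ^+ 2 <= 8^-1 ^+ n.
  move=> nm; apply: le_trans (gC _ _ nm); exact: h2_p_bound (h2B (hg m) (hg n)).
have /choice[p cp] : forall x, exists l : R, (g n).1.2 x @[n --> \oo] --> l.
  move=> x; apply/cvg_ex; apply: (@fast_cauchy_cvg _ _ 1) => n; rewrite mul1r.
  apply: le_trans (pC _ _ x (leqnSn n)) _.
  by rewrite !exprVn lef_pV2 ?posrE ?exprn_gt0// lerXn2r ?nnegrE// ler_nat.
have up : forall x, (g n).1.1 x @[n --> \oo] --> u x.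
  move=> x; apply/cvgrPdist_le => e e0.
  have [N1 _ HN1] : \forall k \near \oo, `|u_ k x - u x| <= e.
    have := cu x; move=> /cvgrPdist_le /(_ e e0); apply: filterS => k.
    by rewrite distrC.
  exists N1 => // n /= N1n; rewrite distrC; apply: uh (gh n) _ _ _ => k nk.
  by apply: HN1; rewrite /= (leq_trans N1n)// (leq_trans nk)// leq_addr.
have perp : per p.
  move=> x; apply: (cvg_unique (@Rhausdorff _) (cp (x + 1))).
  rewrite (_ : (fun n => _) = (fun n => (g n).1.2 x)); first exact: cp.
  by apply/funext => n; have [_ pp _] := h2p (hg n); exact: pp.
have peru : per u.
  move=> x; apply: (cvg_unique (@Rhausdorff _) (up (x + 1))).
  rewrite (_ : (fun n => _) = (fun n => (g n).1.1 x)); first exact: up.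
  by apply/funext => n; have [_ pp _] := h2u (hg n); exact: pp.
have perq' : per q by move=> x; apply: perq => n; have [_ pp _] := h2q (hg n); exact: pp.
have apq : ac 1 p q.
  by apply: ac_lim cp Lq => // n; [exact: h2pq (hg n)|have [] := h2q (hg n)].
have cpp := per_cont perp apq sq.
have [_ _ sp] := cont_l2p cpp perp.
have aup : ac 1 u p.
  apply: ac_lim up _ => //.
  - by move=> n; exact: h2up (hg n).
  - by move=> n; have [] := h2p (hg n).
  move=> n; rewrite -[leRHS]IntC; apply: Int01_le; last 1 first.
  - move=> x _.
    have : (fun m => ((g (m + n)%N).1.2 x - (g n).1.2 x) ^+ 2) @ \oo --> (p x - (g n).1.2 x) ^+ 2.
      have c1 : (fun m => (g (m + n)%N).1.2 x - (g n).1.2 x) @ \oo --> p x - (g n).1.2 x.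
        by apply: cvgB; [rewrite (cvg_shiftn n (fun m => (g m).1.2 x) _); exact: cp|exact: cvg_cst].
      by rewrite expr2; under eq_fun do rewrite expr2; exact: (cvgM c1 c1).
    move=> h.
    by apply: cvgn_le h _ => m; apply: pC; exact: leq_addl.
  - by have [_ _ sg] := h2p (hg n); exact: (sqiB m01 sp sg).2.
  - exact: itgC.
exists p, q; split; first exact: h2_intro.
have [] := @itg_fatou _ _ _ mu `[0, 1] m01 (fun n x => (g n).2 x ^+ 2 + (g n).1.2 x ^+ 2)
  (fun x => q x ^+ 2 + p x ^+ 2) C.
- move=> n; have [_ _ [_ s1]] := h2p (hg n); have [_ _ [_ s2]] := h2q (hg n).
  exact: (itgD m01).
- by move=> n x _; rewrite addr_ge0// sqr_ge0.
- by apply: measurable_funD; apply: measurable_funX; [case: sq|case: sp].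
- by apply: aeW => x _; rewrite addr_ge0// sqr_ge0.
- apply: ae_imp cq => x h Dx; rewrite !expr2; under eq_fun do rewrite !expr2.
  by apply: cvgD; apply: cvgM; try exact: h; exact: cp.
- move=> e e0; have [N1 _ HN1] := EC e e0; exists N1 => // n /= N1n.
  have [_ _ [_ s1]] := h2p (hg n); have [_ _ [_ s2]] := h2q (hg n).
  rewrite (IntD m01)//; apply: Eh (gh n) _ _ => k nk; apply: HN1.
  by rewrite /= (leq_trans N1n)// (leq_trans nk)// leq_addr.
move=> _; rewrite (IntD m01)//; [exact: sq.2|exact: sp.2].
Qed.

(** The common Hoelder modulus makes m equidistant points of the circle a net for the oscillation e
    once 2 C / m <= e^2. *)
Lemma h2_compact (u_ p_ q_ : nat -> R -> R) (K C : R) :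
  (forall k, h2 (u_ k) (p_ k) (q_ k)) -> (forall k x, `|u_ k x| <= K) ->
  (forall k, nrm2 (q_ k) <= C) ->
  exists (u : R -> R) (h : nat -> nat),
    forall j, (j <= h j)%N /\ forall x, `|u_ (h j) x - u x| <= j.+1%:R^-1.
Proof.
move=> hu uK qC; have C0 : 0 <= C := le_trans (nrm2_ge0 _) (qC 0%N).
apply: (ascoli_net uK) => e e0.
have d0 : 0 < e ^+ 2 / (2 * C + 1) by rewrite divr_gt0 ?exprn_gt0//; lra.
pose m := (Num.bound (e ^+ 2 / (2 * C + 1))^-1).+1.
have m0 : 0 < m%:R :> R by rewrite ltr0n.
have md : m%:R^-1 <= e ^+ 2 / (2 * C + 1).
  rewrite -[leRHS]invrK lef_pV2 ?posrE ?invr_gt0//.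
  apply: le_trans (ltW (archi_boundP _)) _; first by rewrite invr_ge0 ltW.
  by rewrite ler_nat.
exists m, (fun i => i%:R / m%:R), 0%N => x.
have [y [n [n' [/andP[y0 y1] ->]]]] := per_frac x.
pose i := Num.trunc (y * m%:R).
have ym0 : 0 <= y * m%:R by rewrite mulr_ge0// ltW.
have /andP[i1 i2] : i%:R <= y * m%:R < i.+1%:R by exact: truncn_itv.
exists i.
  rewrite -(ltr_nat R); apply: le_lt_trans i1 _; rewrite -[ltRHS]mul1r ltr_pM2r//.
move=> k _; have [_ pu _] := h2u (hu k); rewrite per_shift//.
have yi : `|y - i%:R / m%:R| <= m%:R^-1.
  rewrite ger0_norm ?subr_ge0 ?ler_pdivrMr//.
  rewrite lerBlDr -(ler_pM2r m0) mulrDl mulVf ?gt_eqF// divfK ?gt_eqF//.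
  by apply: ltW; rewrite addrC natr1.
have m1 : m%:R^-1 <= 1 :> R by rewrite invf_le1// ler1n.
rewrite -(@ler_pXn2r _ 2)// ?nnegrE//; last exact: ltW.
rewrite real_normK ?num_real//; apply: le_trans (h2_holder (hu k) (le_trans yi m1)) _.
have l1 : 2 * nrm2 (q_ k) <= 2 * C by rewrite ler_wpM2l.
have q0 := nrm2_ge0 (q_ k).
apply: le_trans (_ : 2 * C * (e ^+ 2 / (2 * C + 1)) <= _).
  by apply: ler_pM => //; [rewrite mulr_ge0|exact: le_trans yi md].
rewrite mulrA ler_pdivrMr; last lra.
by have := sqr_ge0 e; nra.
Qed.

End h2_estimates.

(** * Representatives of Sobolev functions and the initial datum *)

Section initial_datum.
Context (R : realType).
Local Notation mu := (@lebesgue_measure R).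
Implicit Types (F f G g u p q phi : R -> R).
Let m01 := mI (0 : R) 1.

(** [test_on] only forces vanishing outside the closed interval; continuity adds the endpoints. *)
Lemma test_endpoints (b : R) phi : 0 < b -> test_on 0 b phi -> phi 0 = 0 /\ phi b = 0.
Proof.
move=> b0 [sp p0]; have cp := smooth_cont sp.
have E (z : R) : (forall e : R, 0 < e -> exists2 y : R, `|z - y| < e & phi y = 0) -> phi z = 0.
  move=> H; apply/eqP; rewrite -normr_le0; apply/ler_addgt0Pl => e e0; rewrite addr0.
  have /cvgrPdist_le/(_ e e0)[d /= d0 Hd] := cp z.
  by have [y zy py] := H d d0; have := Hd y zy; rewrite py subr0.
split; apply: E => e e0.
  exists (- (e / 2)); first by rewrite opprK add0r gtr0_norm; lra.
  by apply: p0 => /andP[? _]; lra.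
exists (b + e / 2); first by rewrite opprD addNKr normrN gtr0_norm; lra.
by apply: p0 => /andP[_ ?]; lra.
Qed.

Lemma test_derive1_out (b : R) phi : test_on 0 b phi ->
  forall x, ~ (0 <= x <= b) -> derive1 phi x = 0.
Proof.
move=> [sp p0] x nx; rewrite derive1E (@near_eq_derive _ _ _ _ (cst 0)) ?derive_cst//.
have [x0|x0] := ltP x 0.
  near=> y; rewrite p0//; suff y0 : y < 0 by move=> /andP[]; rewrite leNgt y0.
  by near: y; exact: lt_nbhsl.
have bx : b < x by rewrite ltNge; apply/negP => xb; apply: nx; rewrite x0.
near=> y; rewrite p0//; suff yb : b < y by move=> /andP[_]; rewrite leNgt yb.
by near: y; exact: lt_nbhsr.
Unshelve. all: by end_near. Qed.

Lemma clampP (b x : R) : 0 <= b ->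
  [\/ x <= 0 /\ Num.max 0 (Num.min b x) = 0,
      0 <= x <= b /\ Num.max 0 (Num.min b x) = x |
      b <= x /\ Num.max 0 (Num.min b x) = b].
Proof.
move=> b0; have [xb|bx] := leP x b.
  have [x0|x0] := leP x 0; last by constructor 2; rewrite (ltW x0).
  by constructor 1.
by constructor 3; split; [exact: ltW|exact/max_idPr].
Qed.

Lemma ae_hit (c d : R) (P : R -> Prop) : c < d -> {ae mu, forall x, P x} ->
  exists2 x, c <= x <= d & P x.
Proof.
move=> cd [N [mN N0 PN]]; apply: contrapT => nex.
have sub : `[c, d]%classic `<=` N.
  move=> x; rewrite /= in_itv/= => xcd; apply: PN => /= Px; apply: nex; exists x => //.
have := @le_measure _ _ _ mu `[c, d]%classic N.
rewrite !inE => /(_ (mI c d) mN sub); rewrite /= N0.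
have := lebesgue_measure_itv (`[c, d]); rewrite /= lte_fin cd => ->.
by rewrite /= lee_fin subr_le0 leNgt cd.
Qed.

(** The difference between f and a primitive of f' has zero weak derivative, so it is constant by du
    Bois-Reymond. *)
Lemma weak_ac (b : R) f f' : 0 < b -> sqi mu `[0, b] f -> sqi mu `[0, b] f' ->
  (forall phi, test_on 0 b phi -> \int[mu]_(x in `[0, b]) (f x * derive1 phi x) =
    - \int[mu]_(x in `[0, b]) (f' x * phi x)) ->
  exists F, [/\ ac b F f', continuous F & {ae mu, forall x, 0 <= x <= b -> f x = F x}].
Proof.
move=> b0 sf sf' H; have m0b := mI 0 b.
have fi := sqi_itg m0b (itv_fin 0 b) sf; have fi' := sqi_itg m0b (itv_fin 0 b) sf'.
pose V x := \int[mu]_(t in `[0, x]) f' t.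
have aV : ac b V f' by split => // x _; rewrite /V set_itv1 Rintegral_set1 add0r.
have Vh x y : 0 <= x <= b -> 0 <= y <= b -> `|V y - V x| ^+ 2 <=
    `|y - x| * \int[mu]_(t in `[0, b]) (f' t ^+ 2).
  by move=> xb yb; rewrite real_normK ?num_real//; exact: (@ac_holder _ b).
(* Clamping the argument extends the primitive continuously to the whole line. *)
pose W x := V (Num.max 0 (Num.min b x)).
have Wc : continuous W.
  apply: (@sq_cont R W (\int[mu]_(t in `[0, b]) (f' t ^+ 2))) => x y xy.
  rewrite mulrC -(real_normK (num_real _)); apply: le_trans (Vh _ _ _ _) _.
  - by rewrite le_max lexx ge_max ge_min lexx !(ltW b0).
  - by rewrite le_max lexx ge_max ge_min lexx !(ltW b0).
  rewrite ler_wpM2r//.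
    by apply: (Rintegral_ge0) => t _; exact: sqr_ge0.
  by case: (clampP x (ltW b0)) => [[? ->]|[/andP[? ?] ->]|[? ->]];
    case: (clampP y (ltW b0)) => [[? ->]|[/andP[? ?] ->]|[? ->]];
    rewrite ler_norml; apply/andP; split; case: (ger0P (x - y)) => ?; lra.
have WV x : 0 <= x <= b -> W x = V x.
  by move=> /andP[x0 xb]; rewrite /W (min_idPr xb) (max_idPr x0).
have Vi : itg mu `[0, b] V.
  apply: (@itg_ext _ _ _ mu _ m0b W V); last exact: itg_cont.
  by move=> x; rewrite /= in_itv/=; exact: WV.
have [] := @du_bois_reymond R 0 b (fun x => f x - V x) b0.
- exact: (itgB m0b).
- move=> phi tphi; have cphi := smooth_cont tphi.1.
  have cphi' := smooth_cont (smooth_derive1 tphi.1).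
  rewrite (@eq_IntI _ _ _ _ (fun x => f x * derive1 phi x - V x * derive1 phi x)); last first.
    by move=> x _; rewrite mulrBl.
  have b0' := ltW b0.
  rewrite (IntB m0b) ?H//; try exact: itg_mul_cont.
  have := @ibp R b b0' V f' phi (derive1 phi) aV (smooth_is_derive tphi.1) cphi' Vi.
  rewrite (IntD m0b); try exact: itg_mul_cont.
  have [ph0 ->] := test_endpoints b0 tphi.
  rewrite ph0 !mulr0 subr0 => hh; apply/eqP; rewrite -opprD oppr_eq0 addrC; exact/eqP.
move=> c Hc; exists (fun x => W x + c); split.
- have b00 : 0 <= (0 : R) <= b by rewrite lexx ltW.
  have [_ H'] := aV; split => // x xb; rewrite !WV// H'//; ring.
- by move=> x; apply: cvgD; [exact: Wc|exact: cvg_cst].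
by apply: ae_imp Hc => x h xb; rewrite WV//; have := h xb; lra.
Qed.

(** Every neighbourhood of x meets [a, b] in an interval of positive length, on which almost every
    point satisfies the inequality. *)
Lemma ae_cont_le (a b : R) f g : a < b -> continuous f -> continuous g ->
  {ae mu, forall x, a <= x <= b -> f x <= g x} -> forall x, a <= x <= b -> f x <= g x.
Proof.
move=> ab cf cg H x /andP[ax xb].
rewrite -subr_le0; apply/ler_addgt0Pl => e e0; rewrite addr0.
have ch : {for x, continuous (fun y => f y - g y)} by apply: cvgB; [exact: cf|exact: cg].
have /cvgrPdist_le/(_ e e0)[d /= d0 Hd] := ch.
have [y xy] : exists2 y, `|x - y| < d & f y - g y <= 0.
  have [c [c' [cc' ac cb Hc]]] : exists c c', [/\ c < c', a <= c, c' <= b &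
      forall y, c <= y <= c' -> `|x - y| < d].
    have [h|h] := ltP x b.
      exists x, (Num.min b (x + d / 2)); split => //.
      - by rewrite lt_min h ltrDl; lra.
      - by rewrite ge_min lexx.
      by move=> y; rewrite le_min => /and3P[? ? ?]; rewrite ltr_norml; apply/andP; split; lra.
    exists (Num.max a (x - d / 2)), b; split => //.
    - by rewrite gt_max ab/=; lra.
    - by rewrite le_max lexx.
    move=> y; rewrite ge_max => /andP[/andP[? ?] ?]; rewrite ltr_norml; apply/andP; split; lra.
  have [y /andP[cy yc] Hy] := ae_hit cc' H; exists y; first by apply: Hc; rewrite cy.
  by rewrite subr_le0; apply: Hy; rewrite (le_trans ac cy) (le_trans yc cb).
move=> h; have := Hd y xy; rewrite ler_norml => /andP[_]; lra.
Qed.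


Lemma ae_shift (c : R) (P : R -> Prop) : {ae mu, forall x, P x} -> {ae mu, forall x, P (x + c)}.
Proof.
move=> [N [mN N0 PN]]; exists (shiftr c @^-1` N); split.
- by rewrite -[X in measurable X]setTI; exact: measurable_shiftr.
- by have := lebesgue_measure_shift c mN; rewrite /pushforward => ->.
by move=> x nP; apply: PN.
Qed.

Lemma cont_Int0 h : continuous h ->
  (forall x, 0 <= x <= 1 -> \int[mu]_(t in `[0, x]) h t = 0) -> h 0 = 0.
Proof.
move=> ch H; apply/eqP; rewrite -normr_le0; apply/ler_addgt0Pl => e e0; rewrite addr0.
have /cvgrPdist_le/(_ e e0)[d /= d0 Hd] := ch 0.
pose x := Num.min 1 (d / 2).
have x0 : 0 < x by rewrite lt_min ltr01 divr_gt0.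
have x01 : 0 <= x <= 1 by rewrite (ltW x0) ge_min lexx.
have xd : x < d by rewrite gt_min; apply/orP; right; lra.
have m0x := mI 0 x.
have IA (c : R) : \int[mu]_(t in `[0, x]) c = c * x.
  rewrite Rintegral_cst//; congr (_ * _); have := lebesgue_measure_itv (`[0, x]).
  by rewrite /= lte_fin x0 => ->; rewrite /= subr0.
have ic (c : R) : itg mu `[0, x] (fun=> c) by apply: itg_cst => //; exact: itv_fin.
have hi : itg mu `[0, x] h by exact: itg_cont.
have h0x : h 0 * x = \int[mu]_(t in `[0, x]) (h 0 - h t) by rewrite (IntB m0x)// H// IA subr0.
rewrite -(ler_pM2r x0) -[X in _ * X <= _](gtr0_norm x0) -normrM h0x -IA.
apply: (Int_abs_le m0x); [exact: (itgB m0x)|exact: ic|].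
move=> t; rewrite /= in_itv/= => /andP[t0 tx]; apply: Hd.
by rewrite /= sub0r normrN ger0_norm// (le_lt_trans tx).
Qed.

Definition frac (x : R) : R := x - (Num.floor x)%:~R.

Lemma frac_itv x : 0 <= frac x < 1.
Proof.
have /andP[h1 h2] := floor_itv x; rewrite /frac subr_ge0 h1/= ltrBlDr.
by rewrite addrC -intrD1.
Qed.

Lemma frac_eq x (m : int) : m%:~R <= x < m%:~R + 1 -> frac x = x - m%:~R.
Proof. by move=> h; rewrite /frac (@floor_def _ x m)// intrD1. Qed.

Lemma frac_per x : frac (x + 1) = frac x.
Proof.
have /andP[h1 h2] := frac_itv x.
rewrite (@frac_eq _ (Num.floor x + 1)) intrD1; first by rewrite /frac; ring.
by move: h1 h2; rewrite /frac => *; apply/andP; split; lra.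
Qed.

Lemma frac_id x : 0 <= x < 1 -> frac x = x.
Proof. by move=> h; rewrite (@frac_eq x 0) ?subr0// add0r. Qed.

Lemma frac1 : frac 1 = 0.
Proof. by rewrite -[1]add0r frac_per frac_id// lexx ltr01. Qed.

Lemma measurable_frac : mfun1 setT frac.
Proof.
apply: measurable_funB => //; apply: nondecreasing_measurable => // x y xy.
by rewrite ler_int; exact: le_floor.
Qed.

Lemma frac_shift x : exists n m : nat, x = frac x + (n%:R - m%:R).
Proof.
rewrite /frac; case: (Num.floor x) => n.
  by exists n, 0%N; rewrite subr0 subrK.
by exists 0%N, n.+1; rewrite NegzE mulrNz opprK sub0r addrK.
Qed.

Lemma per_extend f : f 1 = f 0 ->
  per (f \o frac) /\ forall x, 0 <= x <= 1 -> (f \o frac) x = f x.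
Proof.
move=> f10; split => [x|x /andP[x0]]; first by rewrite /= frac_per.
rewrite le_eqVlt => /predU1P[->|x1]; first by rewrite /= frac1.
by rewrite /= frac_id// x0.
Qed.

(** The representatives are built on [0, 2], two periods, so that the unit translate of [0, 1] is
    still covered and periodicity can be read off there; composing with [frac] then makes them
    periodic everywhere. *)
Lemma Hper_rep u0 : Hper 2 u0 -> exists U P Q, h2 U P Q /\ {ae mu, forall x, u0 x = U x}.
Proof.
move=> [lu per0 wd]; have [v1 [l1 w1]] := wd 1%N isT; have [v2 [l2 w2]] := wd 2%N isT.
have m02 := mI 0 (2 : R).
have su := L2loc_itg 0 2 lu; have s1 := L2loc_itg 0 2 l1; have s2 := L2loc_itg 0 2 l2.
have [||P [aP cP eP]] := @weak_ac 2 v1 v2 _ s1 s2; first by rewrite ltr0n.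
  move=> phi tphi; have tl := test_on_line tphi.
  have tphi' : test_on 0 2 (derive1 phi).
    split; first exact: smooth_derive1 tphi.1.
    exact: test_derive1_out tphi.
  have := w2 _ tl; rewrite sqrrN expr1n mul1r.
  have := w1 _ (test_line_derive1 tl); rewrite expr1 mulN1r.
  rewrite /= => -> h.
  rewrite -(test_on_IntT _ tphi) -(test_on_IntT _ tphi') -h opprK.
  done.
have [||U [aU cU eU]] := @weak_ac 2 u0 v1 _ su s1; first by rewrite ltr0n.
  move=> phi tphi; have tl := test_on_line tphi.
  have tphi' : test_on 0 2 (derive1 phi).
    split; first exact: smooth_derive1 tphi.1.
    exact: test_derive1_out tphi.
  have := w1 _ tl; rewrite expr1 mulN1r.
  by rewrite (test_on_IntT _ tphi) -(test_on_IntT _ tphi').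
have UP x y : 0 <= x -> x <= y -> y <= 2 -> U y - U x = \int[mu]_(t in `[x, y]) P t.
  move=> x0 xy y2; rewrite (@ac_sub R 2 U v1 x y aU)//.
  have [//|||_ ->//] := @Int_ae _ _ _ mu `[x, y] (mI x y) v1 P.
  - exact: itg_subitv aU.1.
  - exact: cont_meas.
  apply: ae_imp eP => t h; rewrite /= in_itv/= => /andP[xt ty]; apply: h.
  by rewrite (le_trans x0 xt) (le_trans ty y2).
have perU x : 0 <= x <= 1 -> U (x + 1) = U x.
  have H : {ae mu, forall x, 0 <= x <= 1 -> U (x + 1) = U x}.
    have H1 := ae_shift 1 eU.
    apply: ae_imp2 (ae_imp2 _ per0 eU) H1; last by move=> t a b; exact: (conj a b).
    move=> t [h1 h2] h3 /andP[t0 t1]; rewrite -h3 ?h1 ?h2//; apply/andP; split; lra.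
  have cU1 : continuous (fun x : R => U (x + 1)).
    by move=> z; apply: continuous_comp; [apply: cvgD; [exact: cvg_id|exact: cvg_cst]|exact: cU].
  move=> x01; apply/eqP; rewrite eq_le; apply/andP; split.
    apply: (ae_cont_le ltr01 cU1 cU _ x01); apply: ae_imp H => t h /h ->; exact: lexx.
  apply: (ae_cont_le ltr01 cU cU1 _ x01); apply: ae_imp H => t h /h ->; exact: lexx.
have U10 : U 1 = U 0 by rewrite -{1}[1]add0r perU// lexx ler01.
(* The integral of P(t+1) - P(t) over [0, x] is U(x+1) - U(x) - (U(1) - U(0)) = 0, so this
   continuous function vanishes at 0. *)
have P10 : P 1 = P 0.
  have cP1 : continuous (fun x : R => P (x + 1)).
    by move=> z; apply: continuous_comp; [apply: cvgD; [exact: cvg_id|exact: cvg_cst]|exact: cP].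
  apply/eqP; rewrite -subr_eq0; apply/eqP; rewrite -{1}[1]add0r.
  apply: (@cont_Int0 (fun x : R => P (x + 1) - P x)) => [z|x /andP[x0 x1]].
    by apply: cvgB; [exact: cP1|exact: cP].
  rewrite (IntB (mI 0 x)); try exact: itg_cont.
  have [_] := @itg_shift_itv R P 1 (x + 1) 1 (itg_cont _ _ cP).
  rewrite subrr addrK => <-; rewrite -!UP//; try lra.
  rewrite perU ?x0// U10 subrr//.
have [pU eU1] := per_extend U10; have [pP eP1] := per_extend P10.
have sQ : {ae mu, forall x, 0 <= x <= 1 -> v2 x = (v2 \o frac) x}.
  have : {ae mu, forall x, x != 1}.
    exists [set 1]; split => //; first exact: lebesgue_measure_set1.
    by move=> x /= /negP; rewrite negbK => /eqP.
  apply: ae_imp => x x1 /andP[x0 x1']; rewrite /= frac_id// x0/= lt_def eq_sym x1.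
  by [].
have mQ : mfun1 setT (v2 \o frac) by apply: measurableT_comp; [exact: l2.1|exact: measurable_frac].
have mQ' (D : set (measurableTypeR R)) : mfun1 D (v2 \o frac) by exact: measurable_funS mQ.
have lQ : l2p (v2 \o frac).
  split => //; first by move=> x; rewrite /= frac_per.
  split => //; have [] := @Int_ae _ _ _ mu `[0, 1] m01 (fun x => v2 x ^+ 2) (fun x => (v2 \o frac) x ^+ 2).
  - by apply: (@itg_subitv _ _ 0 2) => //; [rewrite ler1n|exact: s2.2].
  - exact: measurable_funX.
  - by apply: ae_imp sQ => x h; rewrite /= in_itv/= => /h /= ->.
  done.
exists (U \o frac), (P \o frac), (v2 \o frac); split.
  apply: h2_intro => //.
    split; first by apply: (itg_ext m01 _ (itg_cont 0 1 cP)) => x; rewrite /= in_itv/= => /eP1.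
    move=> x x01; rewrite !eU1 ?lexx ?ler01//; have /andP[x0 x1] := x01.
    rewrite (@eq_IntI _ _ _ (P \o frac) P); first by rewrite -UP//; lra.
    by move=> t /andP[t0 tx]; apply: eP1; rewrite t0 (le_trans tx).
  split; first by have [_ _ sl] := lQ; exact: (sqi_itg m01 (fin01 R) sl).
  move=> x x01; rewrite !eP1 ?lexx ?ler01//; have /andP[x0 x1] := x01.
  rewrite (aP.2 x); last by rewrite x0/=; lra.
  congr (_ + _); have [|||_ ->//] := @Int_ae _ _ _ mu `[0, x] (mI 0 x) v2 (v2 \o frac).
  - by apply: itg_subitv aP.1 => //; lra.
  - exact: mQ'.
  - apply: ae_imp sQ => t h; rewrite /= in_itv/= => /andP[t0 tx]; apply: h.
    by rewrite t0 (le_trans tx).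
(* The identity known almost everywhere on [0, 2] is carried to the whole line by the countably many
   integer translations. *)
have H1 : {ae mu, forall x, forall n m : nat, 0 <= x + (n%:R - m%:R) <= 2 -> u0 (x + (n%:R - m%:R)) = U (x + (n%:R - m%:R))}.
  apply/ae_foralln => n; apply/ae_foralln => m; exact: ae_shift eU.
have H2 : {ae mu, forall x, forall n m : nat, u0 (x + (n%:R - m%:R) + 1) = u0 (x + (n%:R - m%:R))}.
  apply/ae_foralln => n; apply/ae_foralln => m; exact: ae_shift per0.
have e1 (y : R) (n m : nat) : y + (n.+1%:R - m%:R) = y + (n%:R - m%:R) + 1 by rewrite -natr1; ring.
have e2 (y : R) (n m : nat) : frac y + (n%:R - m%:R) + (m%:R - n%:R) = frac y by ring.
apply: ae_imp2 H1 H2 => x h1 h2.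
have p1 n m : u0 (x + (n%:R - m%:R)) = u0 (x - m%:R).
  elim: n => [|n IH]; first by rewrite sub0r.
  by rewrite e1 h2 IH.
have p2 n m : u0 (x + (n%:R - m%:R)) = u0 x.
  by rewrite p1 -(p1 m m) subrr addr0.
have [n [m E]] := frac_shift x.
have E' : frac x = x + (m%:R - n%:R) by rewrite {2}E e2.
rewrite /= E' -h1 ?p2// -E'; have /andP[f0 f1] := frac_itv x.
by rewrite f0/=; lra.
Qed.


(** [lne] is minus infinity at 0, so once the logarithm is shown integrable it is finite almost
    everywhere, and this is the positivity of the representative. *)
Lemma initial_rep u0 (m0 : R) : Hper 2 u0 -> {ae mu, forall x, 0 <= u0 x} ->
  (\int[mu]_(x in `[0%R, 1%R]) lne (u0 x)%:E = m0%:E)%E ->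
  exists U P Q, [/\ h2 U P Q, forall x, 0 <= U x, {ae mu, forall x, u0 x = U x},
    {ae mu, forall x, 0 <= x <= 1 -> 0 < U x} & itg mu `[0, 1] (fun x => ln (U x))].
Proof.
move=> Hu u0_ge0 u0_ln; have [U [P [Q [hU eU]]]] := Hper_rep Hu.
have [cU _] := h2_cont hU.
have U0 x : 0 <= U x.
  have xx : x - 1 < x + 1 by lra.
  have c0 : continuous (fun _ : R => 0 : R) by exact: cst_continuous.
  apply: (ae_cont_le xx c0 cU); last by apply/andP; split; lra.
  by apply: ae_imp2 u0_ge0 eU => y h <-.
have mU : mfun1 `[0, 1] U by exact: cont_meas.
pose f x : \bar R := lne (U x)%:E.
have mln g : mfun1 `[0, 1] g -> mfun1 `[0, 1] (fun x => ln (g x)).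
  by move=> mg; apply: measurableT_comp; [exact: measurable_ln|].
have mlne g : mfun1 `[0, 1] g ->
    measurable_fun (`[0, 1]%classic : set (measurableTypeR R)) (fun x : measurableTypeR R => lne (g x)%:E).
  move=> mg; apply: (measurable_fun_if m01).
  - by apply: measurable_fun_ler => //; exact: mg.
  - exact: measurable_cst.
  - by apply/measurable_EFinP; apply: measurable_funS (mln _ mg) => // x [].
have mf : measurable_fun (`[0, 1]%classic : set (measurableTypeR R)) f by exact: mlne.
have fm0 : (\int[mu]_(x in `[0%R, 1%R]) f x = m0%:E)%E.
  rewrite -u0_ln; apply: ae_eq_integral => //.
    by apply: mlne; have [[mu0 _] _ _] := Hu; exact: measurable_funS mu0.
  by apply: ae_imp eU => x E _; rewrite /f E.
have [M M0 HM] := cont_bdd 1 cU.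
have pos : (\int[mu]_(x in `[0%R, 1%R]) f^\+%E x < +oo)%E.
  apply: (@le_lt_trans _ _ (\int[mu]_(x in `[0%R, 1%R]) M%:E)%E).
    apply: ge0_le_integral => //.
    - exact: measurable_funepos.
    move=> x; rewrite /= in_itv/= => x01; rewrite funeposE ge_max lee_fin M0 andbT.
    apply: (le_trans (ltW (lne_sublinear _))) => //.
    by rewrite lee_fin (le_trans (ler_norm _))// HM.
  by rewrite integral_cst// lte_mul_pinfty// ?fin01.
(* The positive part has finite integral because U is bounded; an infinite negative part would make
   the total minus infinity instead of [m0]. *)
have neg : (\int[mu]_(x in `[0%R, 1%R]) f^\-%E x < +oo)%E.
  move: fm0 pos; rewrite integralE.
  set A := (\int[mu]_(x in _) f^\+%E x)%E; set B := (\int[mu]_(x in _) f^\-%E x)%E.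
  case: B => [b| |] // ; rewrite ?ltry//.
  by case: A.
have fi : mu.-integrable `[0, 1] f.
  apply/integrableP; split => //.
  rewrite -[X in (X < _)%E]/(\int[mu]_(x in `[0%R, 1%R]) (abse \o f) x)%E fune_abse.
  rewrite ge0_integralD//; first exact: lte_add_pinfty.
  - exact: measurable_funepos.
  - exact: measurable_funeneg.
exists U, P, Q; split => //.
  apply: ae_imp (integrable_ae m01 fi) => x h x01.
  have := h; rewrite /= in_itv/= => /(_ x01); rewrite /f.
  by rewrite lt_def U0 andbT; apply: contraTN => /eqP ->; rewrite /= lexx.
apply: (le_integrable m01 _ _ fi); first by apply/measurable_EFinP; exact: mln.
move=> x _; rewrite /f /=; case: ifPn => [h|_]; last by [].
by rewrite leey.
Qed.

End initial_datum.

(** * The implicit Euler step *)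

Section entropy.
Context (R : realType).
Implicit Types a b c K : R.

(** The relative entropy density without the terms involving the reference function; the convention
    [ln 0 = 0] yields the correct value 0 at a = 0. *)
Definition hent a : R := a * ln a - a.

(** The right side dominates the tangent at c of a convex function. Nearly every inequality on
    logarithms below is an instance of it. *)
Lemma hent_tangent a c : 0 <= a -> 0 < c -> a * ln c - c <= hent a.
Proof.
rewrite le_eqVlt => /predU1P[<-|a0] c0; first by rewrite /hent !mul0r; lra.
have ca : 0 < c / a by rewrite divr_gt0.
have := le_ln1Dx (_ : -1 < c / a - 1); rewrite ltrBrDl addrN => /(_ ca).
rewrite addrCA subrr addr0 ln_div ?posrE// => h.
have : a * (ln c - ln a) <= a * (c / a - 1) by rewrite ler_wpM2l// ltW.
by rewrite /hent mulrBr [X in _ <= X]mulrBr mulr1 mulrCA divff ?gt_eqF// mulr1; lra.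
Qed.

Lemma ln_le a : 0 <= a -> ln a <= a.
Proof.
rewrite le_eqVlt => /predU1P[<-|a0]; first by rewrite ln0.
by have := @hent_tangent 1 a ler01 a0; rewrite /hent ln1; lra.
Qed.

Lemma hent_bound a K : 0 <= a -> a <= K -> -1 <= hent a <= K ^+ 2.
Proof.
move=> a0 aK; apply/andP; split.
  by have := hent_tangent a0 ltr01; rewrite ln1; lra.
have : a * ln a <= a * a by rewrite ler_wpM2l// ln_le.
rewrite /hent => h; have : a * a <= K ^+ 2 by rewrite expr2 ler_pM.
lra.
Qed.

Lemma hent_cvg (s : nat -> R) a : s n @[n --> \oo] --> a -> (forall n, 0 <= s n) ->
  hent (s n) @[n --> \oo] --> hent a.
Proof.
move=> sa s0.
have : 0 <= a.
  rewrite -(cvg_lim (@Rhausdorff _) sa); apply: limr_ge; first by apply/cvg_ex; exists a.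
  by apply: nearW.
rewrite le_eqVlt => /predU1P[a0|a0]; last first.
  apply: cvgB => //; apply: cvgM => //.
  by apply: continuous_cvg => //; exact: continuous_ln.
rewrite -a0 in sa *; rewrite {2}/hent mul0r subr0; apply/cvgrPdist_le => e e0.
(* Near 0 the lower bound is the tangent at c, namely s ln c - c, whose two terms cost e/2 each; the
   upper bound is 0, since s ln s <= s^2 <= s for s <= 1. *)
pose c := e / 2; have c0 : 0 < c by rewrite /c; lra.
pose del := Num.min 1 (c / (`|ln c| + 1)).
have l1 : 0 < `|ln c| + 1 by rewrite ltr_wpDl.
have del0 : 0 < del by rewrite lt_min ltr01 divr_gt0.
move: sa => /cvgrPdist_lt /(_ _ del0); apply: filterS => n.
rewrite sub0r normrN ger0_norm// lt_min => /andP[n1]; rewrite ltr_pdivlMr// => n2.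
rewrite sub0r normrN ler_norml; apply/andP; split.
  have := hent_tangent (s0 n) c0; have := ler_norm (- ln c); rewrite normrN => h.
  have : s n * - ln c <= s n * `|ln c| by rewrite ler_wpM2l.
  have := s0 n; rewrite /c in c0 n2 *; lra.
have /andP[_] := hent_bound (s0 n) (lexx _); have : s n * s n <= 1 * 1 by rewrite ler_pM// ltW.
have : s n * ln (s n) <= s n * s n by rewrite ler_wpM2l// ln_le.
have : s n * s n <= s n * 1 by rewrite ler_wpM2l// ltW.
rewrite /hent; lra.
Qed.

Lemma inv_near (e : R) : 0 < e -> \forall j \near \oo, j.+1%:R^-1 <= e.
Proof.
move=> e0; have := @cvg_harmonic R => /cvgrPdist_le /(_ e e0); apply: filterS => n.
by rewrite sub0r normrN ger0_norm// invr_ge0.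
Qed.

Lemma inv_cvg (a : nat -> R) (l : R) : (forall j, `|a j - l| <= j.+1%:R^-1) ->
  a j @[j --> \oo] --> l.
Proof.
move=> H; apply/cvgrPdist_le => e e0; apply: filterS (inv_near e0) => n.
by rewrite distrC; exact: le_trans (H n).
Qed.

End entropy.

(** * Positivity from a lower bound on the integral of the logarithm *)

Section positivity.
Context d (X : measurableType d) (R : realType).
Context (mu : {measure set X -> \bar R}) (D : set X) (mD : measurable D) (fD : (mu D < +oo)%E).

(** The minimum of f and g lies below g everywhere and equals f almost everywhere. *)
Lemma Int_le_ae (f g : X -> R) : itg mu D f -> itg mu D g ->
  {ae mu, forall x, D x -> f x <= g x} ->
  \int[mu]_(x in D) f x <= \int[mu]_(x in D) g x.
Proof.
move=> fi gi fg.
have [||mi ->] := @Int_ae _ _ _ mu D mD f (fun x => Num.min (f x) (g x)) fi.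
- by apply: measurable_minr; [exact: itg_meas fi|exact: itg_meas gi].
- by apply: ae_imp fg => x h /h /min_idPl ->.
by apply: (Int_le mD) => // x _; rewrite ge_min lexx orbT.
Qed.

Lemma Int_ae0 (f : X -> R) : itg mu D f -> (forall x, D x -> 0 <= f x) ->
  \int[mu]_(x in D) f x = 0 -> {ae mu, forall x, D x -> f x = 0}.
Proof.
move=> fi f0 I0; have mf := itg_meas fi.
have [H _] := @ae_eq_integral_abs _ _ _ mu _ mD (EFin \o f) (proj2 (measurable_EFinP _ _) mf).
have : ae_eq mu D (EFin \o f) (cst 0%E).
  apply: H; rewrite (eq_integral (fun x => (f x)%:E)); last first.
    by move=> x; rewrite inE => Dx /=; rewrite ger0_norm ?f0.
  by rewrite (itgE mD fi) I0.
by apply: ae_imp => x h Dx; have := h Dx => -[].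
Qed.

(* Fatou's lemma for [- ln]; the junk value [ln 0 = 0] is only met on a null set. *)
Lemma ln_fatou (f_ : nat -> X -> R) (f : X -> R) (K C : R) :
  measurable_fun D f -> (forall x, D x -> 0 <= f x) ->
  (forall n x, D x -> 0 <= f_ n x <= K) -> 1 <= K ->
  (forall n, {ae mu, forall x, D x -> 0 < f_ n x}) ->
  (forall n, itg mu D (fun x => ln (f_ n x))) ->
  (forall n, C <= \int[mu]_(x in D) ln (f_ n x)) ->
  (forall x, D x -> f_ n x @[n --> \oo] --> f x) ->
  [/\ {ae mu, forall x, D x -> 0 < f x}, itg mu D (fun x => ln (f x)) &
      C <= \int[mu]_(x in D) ln (f x)].
Proof.
move=> mf f0 fK K1 fpos fi fC cf.
have K0 : 0 < K by lra.
pose c := ln K; pose g n x := c - ln (f_ n x).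
have ic (a : R) : itg mu D (fun=> a) by exact: itg_cst.
have gi n : itg mu D (g n) by exact: (itgB mD).
have lnKc x : 0 <= x <= K -> ln x <= c.
  move=> /andP[]; rewrite le_eqVlt => /predU1P[<- _|x0 xK]; first by rewrite ln0 ?ln_ge0.
  by rewrite ler_ln ?posrE.
have g0 n x : D x -> 0 <= g n x by move=> Dx; rewrite subr_ge0 lnKc ?fK.
pose C' := \int[mu]_(x in D) c - C.
have gC n : \int[mu]_(x in D) g n x <= C' by rewrite (IntB mD)// lerB.
pose A x : R := if f x <= 0 then 1 else 0.
have mA : measurable_fun D A.
  by apply: (measurable_fun_if mD) => //; apply: measurable_fun_ler.
have A01 x : 0 <= A x <= 1 by rewrite /A; case: ifP; rewrite ?lexx ?ler01.
have Ai : itg mu D A.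
  by apply: (@itg_bdd _ _ _ mu D mD A 1 fD mA) => x _; have /andP[? ?] := A01 x; rewrite ger0_norm.
have cvg_pos : {ae mu, forall x, D x -> forall n, 0 < f_ n x}.
  have : {ae mu, forall x, forall n, D x -> 0 < f_ n x} by apply/ae_foralln.
  by apply: ae_imp => x h Dx n; exact: h.
(* Where f = 0 the functions c - ln f_n tend to infinity, so their truncation at M is eventually M:
   this happens once f_n < exp (c - M). A bound uniform in M leaves measure zero for that set. *)
have AM (M : nat) : M%:R * \int[mu]_(x in D) A x <= C'.
  rewrite -(IntZ mD)//.
  have [] := @itg_fatou _ _ _ mu D mD (fun n x => A x * Num.min M%:R (g n x)) (fun x => M%:R * A x) C'.
  - move=> n; have mm : measurable_fun D (fun x => Num.min M%:R (g n x)).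
      by apply: measurable_minr => //; exact: itg_meas (gi n).
    apply: (itg_dom mD _ (gi n)); first exact: measurable_funM.
    move=> x Dx; have /andP[a0 a1] := A01 x.
    have m0 : 0 <= Num.min M%:R (g n x) by rewrite le_min ler0n g0.
    rewrite ger0_norm ?mulr_ge0//; apply: le_trans (ler_piMl m0 a1) _.
    by rewrite ge_min lexx orbT.
  - move=> n x Dx; rewrite mulr_ge0 ?le_min ?ler0n ?g0//; by case/andP: (A01 x).
  - exact: measurable_funM.
  - by apply: aeW => x _; rewrite mulr_ge0//; case/andP: (A01 x).
  - apply: ae_imp cvg_pos => x hx Dx; rewrite /A; case: ifPn => [fx|_]; last first.
      by rewrite mulr0; under eq_fun do rewrite mul0r; exact: cvg_cst.
    have fx0 : f x = 0 by apply/eqP; rewrite eq_le fx f0.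
    rewrite mulr1; apply: cvg_near_cst.
    have := cf x Dx; rewrite fx0 => /cvgrPdist_lt /(_ (expR (c - M%:R)) (expR_gt0 _)).
    apply: filterS => n; rewrite sub0r normrN gtr0_norm ?hx// => h.
    rewrite mul1r; apply/min_idPl; rewrite /g lerBrDr addrC -lerBrDr.
    by rewrite -ler_expR lnK ?posrE ?hx// ltW.
  - move=> e e0; apply: nearW => n; apply: le_trans (_ : \int[mu]_(x in D) g n x <= _); last first.
      by apply: le_trans (gC n) _; rewrite lerDl ltW.
    apply: (Int_le mD) => //.
      have mm : measurable_fun D (fun x => Num.min M%:R (g n x)).
        by apply: measurable_minr => //; exact: itg_meas (gi n).
      apply: (itg_dom mD _ (gi n)); first exact: measurable_funM.
      move=> x Dx; have /andP[a0 a1] := A01 x.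
      have m0 : 0 <= Num.min M%:R (g n x) by rewrite le_min ler0n g0.
      rewrite ger0_norm ?mulr_ge0//; apply: le_trans (ler_piMl m0 a1) _.
      by rewrite ge_min lexx orbT.
    move=> x Dx; have /andP[a0 a1] := A01 x.
    have m0 : 0 <= Num.min M%:R (g n x) by rewrite le_min ler0n g0.
    by apply: le_trans (ler_piMl m0 a1) _; rewrite ge_min lexx orbT.
  done.
have A0 : {ae mu, forall x, D x -> A x = 0}.
  apply: Int_ae0 => // [x _|]; first by case/andP: (A01 x).
  apply/eqP; rewrite eq_le; apply/andP; split; last first.
    by apply: Rintegral_ge0 => x _; case/andP: (A01 x).
  rewrite leNgt; apply/negP => I0.
  have := AM (Num.bound (C' / \int[mu]_(x in D) A x)).
  rewrite -ler_pdivlMr// leNgt; move/negP; apply.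
  by apply: archi_boundP; apply: divr_ge0 (ltW I0); have := AM 0%N; rewrite mul0r.
have fpos' : {ae mu, forall x, D x -> 0 < f x}.
  by apply: ae_imp A0 => x h /h; rewrite /A; case: leP => // _ /eqP; rewrite oner_eq0.
have [] := @itg_fatou _ _ _ mu D mD g (fun x => c - ln (f x)) C' gi.
- exact: g0.
- by apply: measurable_funB => //; apply: measurableT_comp => //; exact: measurable_ln.
- apply: aeW => x Dx; rewrite subr_ge0 lnKc// f0//=.
  rewrite -(cvg_lim (@Rhausdorff _) (cf x Dx)); apply: limr_le; first by apply/cvg_ex; exists (f x); exact: cf.
  by apply: nearW => n; case/andP: (fK n x Dx).
- apply: ae_imp fpos' => x h Dx; apply: cvgB; first exact: cvg_cst.
  by apply: continuous_cvg; [apply: continuous_ln; exact: h|exact: cf].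
- by move=> e e0; apply: nearW => n; apply: le_trans (gC n) _; rewrite lerDl ltW.
move=> h1 h2; have h3 : itg mu D (fun x => ln (f x)).
  apply: (itg_ext mD _ (itgB mD (ic c) h1)) => x _; ring.
split => //; move: h2; rewrite (IntB mD)// /C'; lra.
Qed.

End positivity.

(** * The minimiser and its variational inequality *)

Section euler_step.
Context (R : realType).
Local Notation mu := (@lebesgue_measure R).
Implicit Types (d f g u p q b : R -> R).
Let m01 := mI (0 : R) 1.

Definition bilin p q d1 d2 : R := \int[mu]_(x in `[0, 1]) (q x * d2 x + p x * d1 x).

Lemma energy2_ge0 p q : 0 <= energy2 p q.
Proof. by rewrite addr_ge0 ?nrm2_ge0. Qed.

Lemma energy2_lin u p q d d1 d2 (s : R) : h2 u p q -> h2 d d1 d2 ->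
  energy2 (fun x => p x + s * d1 x) (fun x => q x + s * d2 x) =
  energy2 p q + 2 * s * bilin p q d1 d2 + s ^+ 2 * energy2 d1 d2.
Proof.
move=> [_ [_ _ sp] [_ _ sq] _ _] [_ [_ _ s1] [_ _ s2] _ _].
have E f g : sqi mu `[0, 1] f -> sqi mu `[0, 1] g -> nrm2 (fun x => f x + s * g x) =
    nrm2 f + 2 * s * \int[mu]_(x in `[0, 1]) (f x * g x) + s ^+ 2 * nrm2 g.
  move=> sf sg; have fg := sqi_mul m01 sf sg; have [_ ff] := sf; have [_ gg] := sg.
  rewrite /nrm2 (@eq_IntI _ _ _ _ (fun x => f x ^+ 2 + 2 * s * (f x * g x) + s ^+ 2 * g x ^+ 2)); last first.
    by move=> x _; ring.
  have fg' : itg mu `[0, 1] (fun x => 2 * s * (f x * g x)) by exact: (itgZ m01).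
  have gg' : itg mu `[0, 1] (fun x => s ^+ 2 * g x ^+ 2) by exact: (itgZ m01).
  by rewrite (IntD m01) ?(IntD m01) ?(IntZ m01)//; exact: (itgD m01).
rewrite /energy2 /bilin !E// (IntD m01); try exact: (sqi_mul m01).
ring.
Qed.

Section one_step.
Context (tau : R) (tau0 : 0 < tau).
Context (b p0 q0 : R -> R) (hb : h2 b p0 q0) (b_ge0 : forall x, 0 <= b x).
Context (b_pos : {ae mu, forall x, `[0, 1]%classic x -> 0 < b x}).
Context (b_ln : itg mu `[0, 1] (fun x => ln (b x))).

(** KL(u | b) up to the additive constant, the integral of b. *)
Let S u := \int[mu]_(x in `[0, 1]) (hent (u x) - u x * ln (b x)).
Let J (z : (R -> R) * (R -> R) * (R -> R)) := S z.1.1 + tau / 2 * energy2 z.1.2 z.2.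
Let adm (z : (R -> R) * (R -> R) * (R -> R)) := h2 z.1.1 z.1.2 z.2 /\ forall x, 0 <= z.1.1 x.

Lemma meas_hent u (D : set (measurableTypeR R)) : continuous u -> mfun1 D (fun x => hent (u x)).
Proof.
move=> cu; have mu' := @cont_meas R u D cu.
apply: measurable_funB => //; apply: measurable_funM => //.
by apply: measurableT_comp => //; exact: measurable_ln.
Qed.

Lemma cont_itg_bdd u f : continuous u -> itg mu `[0, 1] f -> itg mu `[0, 1] (fun x => u x * f x).
Proof.
move=> cu fi; apply: (itg_ext m01 _ (itg_mul_cont fi cu)) => x _; exact: mulrC.
Qed.

Lemma S_itg u : continuous u -> (forall x, 0 <= u x) ->
  itg mu `[0, 1] (fun x => hent (u x) - u x * ln (b x)).
Proof.
move=> cu u0; have [M M0 HM] := cont_bdd 1 cu.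
apply: (itgB m01); last exact: cont_itg_bdd.
apply: (@itg_bdd _ _ _ mu _ m01 _ (M ^+ 2 + 1)); [exact: fin01|exact: meas_hent|].
move=> x; rewrite /= in_itv/= => x01; have uM := le_trans (ler_norm _) (HM x x01).
have /andP[h1 h2] := hent_bound (u0 x) uM; have := sqr_ge0 M.
by rewrite ler_norml => ?; apply/andP; split; lra.
Qed.

(** The tangent of the entropy at exp (s) b. With s = 0 it bounds S from below; with s = 1 it bounds
    the mass of u by S. *)
Lemma S_lb u (s : R) : continuous u -> (forall x, 0 <= u x) ->
  s * (\int[mu]_(x in `[0, 1]) u x) - expR s * (\int[mu]_(x in `[0, 1]) b x) <= S u.
Proof.
move=> cu u0; have [cb _] := h2_cont hb.
have ui : itg mu `[0, 1] u by exact: itg_cont.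
have bi : itg mu `[0, 1] b by exact: itg_cont.
have sui : itg mu `[0, 1] (fun x => s * u x) by exact: (itgZ m01).
have ebi : itg mu `[0, 1] (fun x => expR s * b x) by exact: (itgZ m01).
rewrite -!(IntZ m01)// -(IntB m01)//; apply: (Int_le_ae m01); first exact: (itgB m01).
  exact: S_itg.
apply: ae_imp b_pos => x h Dx; have bx := h Dx.
have := hent_tangent (u0 x) (mulr_gt0 (expR_gt0 s) bx).
by rewrite lnM ?posrE ?expR_gt0// expRK; lra.
Qed.

Lemma S_cvg (u_ : nat -> R -> R) u (K : R) : (forall n, continuous (u_ n)) -> continuous u ->
  (forall n x, 0 <= u_ n x <= K) -> (forall x, u_ n x @[n --> \oo] --> u x) ->
  S (u_ n) @[n --> \oo] --> S u.
Proof.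
move=> cu_ cu uK uu.
have [] := @itg_dct _ _ _ mu `[0, 1] m01 (fun n x => hent (u_ n x) - u_ n x * ln (b x))
  (fun x => hent (u x) - u x * ln (b x)) (fun x => (K ^+ 2 + 1) + K * `|ln (b x)|).
- move=> n; apply: measurable_funB; first exact: meas_hent.
  by apply: measurable_funM; [exact: cont_meas|exact: itg_meas b_ln].
- apply: measurable_funB; first exact: meas_hent.
  by apply: measurable_funM; [exact: cont_meas|exact: itg_meas b_ln].
- by apply: (itgD m01); [exact: itgC|apply: (itgZ m01); exact: itg_norm b_ln].
- apply: aeW => x _; apply: cvgB; first by apply: hent_cvg => // n; case/andP: (uK n x).
  by apply: cvgM => //; exact: cvg_cst.
- move=> n x _; have /andP[u0 u1] := uK n x; apply: le_trans (ler_normB _ _) _.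
  apply: lerD; last by rewrite normrM ler_wpM2r// ger0_norm.
  have /andP[h1 h2] := hent_bound u0 u1; have := sqr_ge0 K.
  by rewrite ler_norml => ?; apply/andP; split; lra.
by [].
Qed.

(** Direct method: a minimising sequence is bounded in H^2, a subsequence converges uniformly, S is
    continuous for that convergence and the energy is lower semicontinuous. *)
Lemma minimizer : exists z, adm z /\ forall z', adm z' -> J z <= J z'.
Proof.
have [cb _] := h2_cont hb.
pose A : set R := [set J z | z in adm].
have admb : adm (b, p0, q0) by [].
have Jlb z : adm z -> - (\int[mu]_(x in `[0, 1]) b x) <= J z.
  move=> [hz z0]; have [cz _] := h2_cont hz; have := S_lb 0 cz z0.
  rewrite mul0r expR0 mul1r sub0r => h; apply: le_trans h _.
  by rewrite lerDl mulr_ge0// ?energy2_ge0// divr_ge0// ltW.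
have infA : has_inf A.
  split; first by exists (J (b, p0, q0)), (b, p0, q0).
  by exists (- (\int[mu]_(x in `[0, 1]) b x)) => _ [z az <-]; exact: Jlb.
have /choice[z Hz] : forall k : nat, exists z, adm z /\ J z <= inf A + k.+1%:R^-1.
  move=> k; have k0 : (0 : R) < k.+1%:R^-1 by rewrite invr_gt0.
  have [_ [z az <-] h] := inf_adherent k0 infA; exists z; split => //; exact: ltW.
pose C := inf A + 1; pose B := \int[mu]_(x in `[0, 1]) b x.
have JC k : J (z k) <= C.
  by apply: le_trans (Hz k).2 _; rewrite lerD2l invf_le1// ler1n.
have hz k : h2 (z k).1.1 (z k).1.2 (z k).2 by have [[]] := Hz k.
have z0 k x : 0 <= (z k).1.1 x by have [[]] := Hz k.
have cz k : continuous (z k).1.1 by have [] := h2_cont (hz k).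
(* The bound with s = 0 leaves C + B for the energy term. *)
have EC k : energy2 (z k).1.2 (z k).2 <= (C + B) * (2 / tau).
  have := S_lb 0 (cz k) (z0 k); rewrite mul0r expR0 mul1r sub0r -/B => h.
  have := JC k; rewrite /J => h'; rewrite -ler_pdivrMr ?divr_gt0//.
  rewrite invf_div; lra.
(* The bound with s = 1 controls the mass, which together with the energy gives the uniform bound
   [K]. *)
have MC k : \int[mu]_(x in `[0, 1]) (z k).1.1 x <= C + expR 1 * B.
  have := S_lb 1 (cz k) (z0 k); rewrite mul1r -/B => h.
  have := JC k; rewrite /J => h'.
  have : 0 <= tau / 2 * energy2 (z k).1.2 (z k).2 by rewrite mulr_ge0// ?energy2_ge0// divr_ge0// ltW.
  lra.
have qC k : nrm2 (z k).2 <= (C + B) * (2 / tau).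
  by apply: le_trans (EC k); rewrite lerDl nrm2_ge0.
pose K := C + expR 1 * B + Num.sqrt (2 * ((C + B) * (2 / tau))).
have zK k x : (z k).1.1 x <= K.
  apply: le_trans (h2_sup_bound x (hz k) (z0 k)) _; apply: lerD => //.
  by rewrite ler_wsqrtr// ler_wpM2l.
have [|u [h Hu]] := @h2_compact R _ _ _ K _ hz _ qC.
  by move=> k x; rewrite ger0_norm//; exact: (zK k x).
have cu x : (z (h j)).1.1 x @[j --> \oo] --> u x.
  by apply: inv_cvg => j; exact: (Hu j).2.
have u0 x : 0 <= u x.
  rewrite -oppr_le0; apply: (@cvgn_le _ (fun j => - (z (h j)).1.1 x)).
    by apply: cvgN; exact: cu.
  by move=> j; rewrite oppr_le0.
have cont_u : continuous u.
  apply: (@sq_cont _ _ (2 * ((C + B) * (2 / tau)))) => x y xy.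
  apply: (@cvgn_le _ (fun j => ((z (h j)).1.1 x - (z (h j)).1.1 y) ^+ 2)).
    have c : (fun j => (z (h j)).1.1 x - (z (h j)).1.1 y) @ \oo --> u x - u y.
      by apply: cvgB; exact: cu.
    by rewrite expr2; under eq_fun do rewrite expr2; exact: (cvgM c c).
  move=> j; apply: le_trans (h2_holder (hz _) xy) _.
  by rewrite ler_wpM2r// ler_wpM2l.
have cS : S (z (h j)).1.1 @[j --> \oo] --> S u.
  by apply: (@S_cvg _ _ K) => // n x; rewrite z0 zK.
(* As S converges, the energies are asymptotically at most 2/tau times inf A - S u. The errors in S
   and in the infimum are e tau / 4 each, which the factor 2/tau turns into e. *)
have Ec (e : R) : 0 < e -> \forall j \near \oo, energy2 (z (h j)).1.2 (z (h j)).2 <=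
    (inf A - S u) * (2 / tau) + e.
  move=> e0; have e1 : 0 < e * tau / 4 by rewrite divr_gt0// mulr_gt0.
  near=> j.
  have H1 : `|S u - S (z (h j)).1.1| <= e * tau / 4.
    by near: j; move: cS => /cvgrPdist_le; apply.
  have H2 : j.+1%:R^-1 <= e * tau / 4 by near: j; exact: inv_near.
  have H3 : (h j).+1%:R^-1 <= j.+1%:R^-1 :> R.
    by rewrite lef_pV2 ?posrE// ler_nat; exact: (Hu j).1.
  have := (Hz (h j)).2; rewrite /J => H4.
  move: H1; rewrite ler_norml => /andP[_ H1].
  have -> : (inf A - S u) * (2 / tau) + e = (inf A - S u + e * tau / 2) * (2 / tau).
    by field; rewrite gt_eqF.
  rewrite -[2 / tau]invf_div ler_pdivlMr ?divr_gt0// mulrC.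
  move: (le_trans H3 H2) H4 => {H2 H3}; set h' := (h j).+1%:R^-1 => H2 H4.
  lra.
have [p [q [hu Eu]]] := energy_lsc (fun j => hz (h j)) cu Ec.
exists (u, p, q); split => // z' az'; apply: (@le_trans _ _ (inf A)); last first.
  by apply: ge_inf; [case: infA|exists z'].
rewrite /J/=; move: Eu; rewrite -[2 / tau]invf_div ler_pdivlMr ?divr_gt0// mulrC; lra.
Unshelve. all: by end_near. Qed.

(** By convexity the increment is at most the slope at the new point u + s d. The slope is passed as
    a function [L] prescribed only almost everywhere, so that it can be given a harmless value where
    the logarithm is not controlled. *)
Lemma S_diff u d L (s : R) : continuous u -> continuous d -> (forall x, 0 <= u x) ->
  (forall x, 0 <= u x + s * d x) -> itg mu `[0, 1] (fun x => L x * d x) ->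
  {ae mu, forall x, `[0, 1]%classic x -> 0 < u x + s * d x /\ L x = ln (u x + s * d x)} ->
  S (fun x => u x + s * d x) - S u <= s * \int[mu]_(x in `[0, 1]) ((L x - ln (b x)) * d x).
Proof.
move=> cu cd u0 us0 Ldi HL.
have cus : continuous (fun x => u x + s * d x).
  by move=> x; apply: cvgD; [exact: cu|apply: cvgM; [exact: cvg_cst|exact: cd]].
have Li : itg mu `[0, 1] (fun x => (L x - ln (b x)) * d x).
  apply: (itg_ext m01 _ (itgB m01 Ldi (cont_itg_bdd cd b_ln))) => x _; ring.
have Si := S_itg cus us0; have Su := S_itg cu u0.
rewrite -(IntZ m01)// -(IntB m01)//; apply: (Int_le_ae m01); [exact: (itgB m01)|exact: (itgZ m01)|].
apply: ae_imp HL => x h Dx; have [p ->] := h Dx.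
have := hent_tangent (u0 x) p; rewrite {2}/hent; lra.
Qed.

Lemma step_exists : exists u p q,
  [/\ h2 u p q, forall x, 0 <= u x, {ae mu, forall x, `[0, 1]%classic x -> 0 < u x},
    itg mu `[0, 1] (fun x => ln (u x)) /\
      \int[mu]_(x in `[0, 1]) ln (b x) <= \int[mu]_(x in `[0, 1]) ln (u x) &
    forall d d1 d2, h2 d d1 d2 -> (forall x, 0 <= u x + d x) ->
      0 <= \int[mu]_(x in `[0, 1]) ((ln (u x) - ln (b x)) * d x) + tau * bilin p q d1 d2].
Proof.
have [[[u p] q] [[/= hu u0] zmin]] := minimizer.
have [cu _] := h2_cont hu; have [M M0 HM] := cont_bdd 1 cu.
have var d d1 d2 (s : R) : h2 d d1 d2 -> (forall x, 0 <= u x + d x) -> 0 <= s -> s <= 1 ->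
    (forall x, 0 <= u x + s * d x) /\
    0 <= S (fun x => u x + s * d x) - S u + tau / 2 * (2 * s * bilin p q d1 d2 + s ^+ 2 * energy2 d1 d2).
  move=> hd d0 s0 s1.
  have us0 x : 0 <= u x + s * d x.
    have -> : u x + s * d x = (1 - s) * u x + s * (u x + d x) by ring.
    by rewrite addr_ge0// mulr_ge0// subr_ge0.
  split => //; have := zmin (_, _, _) (conj (h2_lin s hu hd) us0).
  by rewrite /J/= (energy2_lin s hu hd); lra.
(* The direction d = 1 carries no energy, so minimality gives that the integral of ln (u + 1/(n+1))
   is at least that of ln b. The limit in n yields positivity, integrability of ln u and the
   monotonicity at once. *)
have [u_pos u_ln lnb] : [/\ {ae mu, forall x, `[0, 1]%classic x -> 0 < u x},
    itg mu `[0, 1] (fun x => ln (u x)) &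
    \int[mu]_(x in `[0, 1]) ln (b x) <= \int[mu]_(x in `[0, 1]) ln (u x)].
  have s0 n : 0 < n.+1%:R^-1 :> R by rewrite invr_gt0.
  have s1 n : n.+1%:R^-1 <= 1 :> R by rewrite invf_le1// ler1n.
  have up n x : 0 < u x + n.+1%:R^-1 * 1 by rewrite mulr1 ltr_wpDl.
  have cln n : continuous (fun x : R => ln (u x + n.+1%:R^-1 * 1)).
    move=> x; apply: continuous_comp; last exact: continuous_ln.
    by apply: cvgD; [exact: cu|exact: cvg_cst].
  apply: (@ln_fatou _ _ _ mu `[0, 1] m01 (fin01 R) (fun n x => u x + n.+1%:R^-1 * 1) u (M + 1)).
  - exact: cont_meas.
  - by move=> x _; exact: u0.
  - move=> n x; rewrite /= in_itv/= => x01; rewrite ltW//=; apply: lerD.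
      by apply: le_trans (HM x x01); exact: ler_norm.
    by rewrite mulr1.
  - lra.
  - by move=> n; apply: aeW => x _; exact: up.
  - by move=> n; exact: itg_cont.
  - move=> n; have [|_] := @var _ _ _ (n.+1%:R^-1) (h2_cst 1) _ (ltW (s0 n)) (s1 n).
      by move=> x; rewrite addr_ge0.
    have c1 : continuous (fun _ : R => 1 : R) by exact: cst_continuous.
    have := @S_diff u (fun=> 1) (fun x => ln (u x + n.+1%:R^-1 * 1)) (n.+1%:R^-1) cu c1 u0.
    have -> : bilin p q (fun=> 0) (fun=> 0) = 0.
      rewrite /bilin (@eq_IntI _ _ _ _ (fun=> 0)) ?IntC//.
      by move=> x _; rewrite !mulr0 addr0.
    have -> : energy2 (fun=> 0) (fun=> 0 : R) = 0.
      by rewrite /energy2 /nrm2 (@eq_IntI _ _ _ _ (fun=> 0)) ?IntC ?addr0// => x _; rewrite expr0n.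
    rewrite !mulr0 addr0 mulr0 addr0 => h h'.
    have : 0 <= n.+1%:R^-1 * \int[mu]_(x in `[0, 1]) ((ln (u x + n.+1%:R^-1 * 1) - ln (b x)) * 1).
      apply: le_trans h' _; apply: h.
      + by move=> x; rewrite ltW// up.
      + by apply: itg_cont => x; apply: cvgM; [exact: cln|exact: cvg_cst].
      + by apply: aeW => x _; split => //; exact: up.
    rewrite pmulr_rge0// (@eq_IntI _ _ _ _ (fun x => ln (u x + n.+1%:R^-1 * 1) - ln (b x))); last first.
      by move=> x _; rewrite mulr1.
    by rewrite (IntB m01) ?subr_ge0//; exact: itg_cont.
  - move=> x _; rewrite -[X in _ --> X]addr0; apply: cvgD; first exact: cvg_cst.
    by under eq_fun do rewrite mulr1; exact: cvg_harmonic.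
exists u, p, q; split => // d d1 d2 hd d0.
have [cd _] := h2_cont hd; have [Md Md0 HMd] := cont_bdd 1 cd.
(* Steps at most 1/2 keep u + s d >= u/2 for every d >= - u, which bounds ln (u + s d) below by ln u
   - ln 2. *)
pose s n : R := n.+2%:R^-1.
have s0 n : 0 < s n by rewrite invr_gt0.
have s2 n : s n <= 1 / 2 by rewrite div1r lef_pV2 ?posrE// ler_nat.
have s1 n : s n <= 1 by apply: le_trans (s2 n) _; lra.
have cs : s n @[n --> \oo] --> 0.
  by have := @cvg_harmonic R; rewrite -(cvg_shiftS (@harmonic R)).
(* The value 0 on the null set {u = 0} makes the domination by [G] hold at every point. *)
pose L n x := if 0 < u x then ln (u x + s n * d x) else 0.
have us n x : 0 < u x -> u x / 2 <= u x + s n * d x.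
  move=> ux; have := d0 x; have := s2 n; have := s0 n; nra.
have up n x : 0 < u x -> 0 < u x + s n * d x.
  by move=> ux; apply: lt_le_trans (us n x ux); rewrite divr_gt0.
have mL n : mfun1 `[0, 1] (L n).
  apply: (measurable_fun_if m01).
  - by apply: measurable_fun_ltr => //; exact: cont_meas.
  - apply: measurableT_comp; first exact: measurable_ln.
    apply: cont_meas => x; apply: cvgD; first exact: cu.
    by apply: cvgM; [exact: cvg_cst|exact: cd].
  - exact: measurable_cst.
pose G x := (`|ln (u x)| + (ln 2 + (M + Md)) + `|ln (b x)|) * Md.
have Gi : itg mu `[0, 1] G.
  apply: (itg_ext m01 (f := fun x => Md * (`|ln (u x)| + (ln 2 + (M + Md)) + `|ln (b x)|))) => [x _|].
    by rewrite mulrC.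
  apply: (itgZ m01); apply: (itgD m01); last exact: itg_norm b_ln.
  by apply: (itgD m01); [exact: itg_norm u_ln|exact: itgC].
have ln20 : 0 <= ln 2 :> R by rewrite ln_ge0// ler1n.
have LG n x : `[0, 1]%classic x -> `|L n x| <= `|ln (u x)| + (ln 2 + (M + Md)).
  rewrite /= in_itv/= => x01; rewrite /L; case: ifPn => [ux|_]; last first.
    by rewrite normr0; apply: addr_ge0 => //; apply: addr_ge0 => //; exact: addr_ge0.
  have up' := up n x ux.
  have H1 : ln (u x) - ln 2 <= ln (u x + s n * d x).
    by rewrite -ln_div ?posrE// ler_ln ?posrE ?divr_gt0//; exact: us.
  have H2 : ln (u x + s n * d x) <= M + Md.
    apply: le_trans (ln_le (ltW up')) _; apply: lerD.
      exact: le_trans (ler_norm _) (HM x x01).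
    apply: le_trans (ler_norm _) _; rewrite normrM -[leRHS]mul1r ler_pM//.
      by rewrite ger0_norm// ltW.
    exact: HMd.
  have := ler_norm (- ln (u x)); have := normr_ge0 (ln (u x)).
  rewrite normrN ler_norml => *; apply/andP; split; lra.
have dM x : `[0, 1]%classic x -> `|d x| <= Md by rewrite /= in_itv; exact: HMd.
have Ldi n : itg mu `[0, 1] (fun x => L n x * d x).
  apply: (itg_dom m01 _ Gi) => [|x Dx]; first by apply: measurable_funM; [exact: mL|exact: cont_meas].
  rewrite normrM; apply: ler_pM => //; last exact: dM.
  by apply: le_trans (LG n x Dx) _; rewrite lerDl.
have ineq n : 0 <= \int[mu]_(x in `[0, 1]) ((L n x - ln (b x)) * d x) +
    tau * bilin p q d1 d2 + tau / 2 * s n * energy2 d1 d2.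
  have [us0] := var _ _ _ (s n) hd d0 (ltW (s0 n)) (s1 n).
  have := @S_diff u d (L n) (s n) cu cd u0 us0 (Ldi n) => h h'.
  rewrite -(pmulr_rge0 _ (s0 n)); apply: le_trans h' _.
  have -> : s n * (\int[mu]_(x in `[0, 1]) ((L n x - ln (b x)) * d x) +
    tau * bilin p q d1 d2 + tau / 2 * s n * energy2 d1 d2) =
    s n * \int[mu]_(x in `[0, 1]) ((L n x - ln (b x)) * d x) +
      tau / 2 * (2 * s n * bilin p q d1 d2 + s n ^+ 2 * energy2 d1 d2) by field.
  rewrite lerD2r; apply: h; apply: ae_imp u_pos => x ux /ux {}ux.
  by rewrite /L ux; split => //; exact: up.
have [||//|||_ cI] := @itg_dct _ _ _ mu `[0, 1] m01 (fun n x => (L n x - ln (b x)) * d x)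
  (fun x => (ln (u x) - ln (b x)) * d x) G.
- by move=> n; apply: measurable_funM; [apply: measurable_funB; [exact: mL|exact: itg_meas b_ln]|exact: cont_meas].
- by apply: measurable_funM; [apply: measurable_funB; [exact: itg_meas u_ln|exact: itg_meas b_ln]|exact: cont_meas].
- apply: aeW => x _; apply: cvgM; last exact: cvg_cst.
  apply: cvgB; last exact: cvg_cst.
  rewrite /L; have [ux|ux] := ltP 0 (u x); last first.
    have -> : u x = 0 by apply/eqP; rewrite eq_le ux u0.
    by rewrite ln0//; exact: cvg_cst.
  apply: continuous_cvg; first exact: continuous_ln.
  rewrite -[X in _ --> X]addr0; apply: cvgD; first exact: cvg_cst.
  by rewrite -[X in _ --> X](mul0r (d x)); apply: cvgM => //; exact: cvg_cst.
- move=> n x Dx; rewrite normrM; apply: ler_pM => //; last exact: dM.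
  by apply: le_trans (ler_normB _ _) _; rewrite lerD2r; exact: LG.
rewrite -oppr_le0; apply: (@cvgn_le _ (fun n => - (\int[mu]_(x in `[0, 1]) ((L n x - ln (b x)) * d x) +
    tau * bilin p q d1 d2 + tau / 2 * s n * energy2 d1 d2))); last by move=> n; rewrite oppr_le0.
apply: cvgN; rewrite -[X in _ --> X]addr0; apply: cvgD.
  apply: cvgD; last exact: cvg_cst.
  exact: cI.
have -> : 0 = tau / 2 * 0 * energy2 d1 d2 by rewrite mulr0 mul0r.
by apply: cvgM; [apply: cvgM => //; exact: cvg_cst|exact: cvg_cst].
Qed.

End one_step.
End euler_step.

(** * Consequences of one Euler step *)

Section euler_estimates.
Context (R : realType).
Local Notation mu := (@lebesgue_measure R).
Implicit Types (d f g u p q b v w phi : R -> R).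
Let m01 := mI (0 : R) 1.

(** Between a and c the logarithm has slope at least 1/w. *)
Lemma ln_sub_ge (a c w : R) : 0 < a -> 0 < c -> a <= w -> c <= w ->
  (a - c) ^+ 2 / w <= (ln a - ln c) * (a - c).
Proof.
move=> a0 c0 aw cw; have w0 : 0 < w by lra.
have H (x y : R) : 0 < x -> 0 < y -> (x - y) / x <= ln x - ln y.
  move=> x0 y0; rewrite mulrBl divff ?gt_eqF//.
  have := hent_tangent (ltW x0) y0; rewrite /hent => h.
  rewrite -(ler_pM2l x0) mulrBr mulr1 mulrCA divff ?gt_eqF// mulr1; lra.
have iw x : 0 < x -> x <= w -> w^-1 <= x^-1 by move=> x0 xw; rewrite lef_pV2 ?posrE.
have [ca|ac] := leP c a.
  rewrite expr2 -mulrA mulrC ler_wpM2r ?subr_ge0//; apply: le_trans (H a c a0 c0).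
  by rewrite ler_wpM2l ?subr_ge0// iw.
have -> : (a - c) ^+ 2 / w = (c - a) / w * (c - a) by ring.
have -> : (ln a - ln c) * (a - c) = (ln c - ln a) * (c - a) by ring.
apply: ler_wpM2r; first by rewrite subr_ge0 ltW.
apply: (le_trans _ (H c a c0 a0)); apply: ler_wpM2l; first by rewrite subr_ge0 ltW.
exact: iw.
Qed.

(** The difference of logarithms lies between (a - c)/a and (a - c)/c, which are (a - c)^2 / (a c)
    apart. *)
Lemma ln_sub_taylor (a c del : R) : 0 < del -> del <= a -> del <= c ->
  `|ln a - ln c - (a - c) / a| <= (a - c) ^+ 2 / del ^+ 2.
Proof.
move=> d0 da dc; have a0 : 0 < a by lra. have c0 : 0 < c by lra.
have H (x y : R) : 0 < x -> 0 < y -> (x - y) / x <= ln x - ln y.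
  move=> x0 y0; rewrite mulrBl divff ?gt_eqF//.
  have := hent_tangent (ltW x0) y0; rewrite /hent => h.
  rewrite -(ler_pM2l x0) mulrBr mulr1 mulrCA divff ?gt_eqF// mulr1; lra.
rewrite ger0_norm ?subr_ge0 ?H//.
apply: (@le_trans _ _ ((a - c) / c - (a - c) / a)).
  by rewrite lerD2r -[ln a - ln c]opprB -[(a - c) / c]opprK lerN2 -mulNr opprB H.
have -> : (a - c) / c - (a - c) / a = (a - c) ^+ 2 / (a * c) by field; rewrite !gt_eqF.
by rewrite ler_wpM2l ?sqr_ge0// lef_pV2 ?posrE ?mulr_gt0 ?exprn_gt0// expr2 ler_pM// ltW.
Qed.

Lemma measurable_invr : mfun1 setT (fun x : R => x^-1).
Proof.
have m0 : measurable ([set 0] : set (measurableTypeR R)) by exact: measurable_set1.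
rewrite -(setUv [set 0]); apply/measurable_funU => //; first exact: measurableC.
split; first exact: measurable_fun_set1.
apply: open_continuous_measurable_fun.
  by apply: closed_openC; exact: closed_eq.
move=> x; rewrite inE /= => /eqP x0; exact: inv_continuous.
Qed.

Lemma bilin_ibp u p q phi phi1 phi2 phi3 phi4 : h2 u p q ->
  (forall x : R, is_derive x 1 phi (phi1 x)) -> (forall x : R, is_derive x 1 phi1 (phi2 x)) ->
  (forall x : R, is_derive x 1 phi2 (phi3 x)) -> (forall x : R, is_derive x 1 phi3 (phi4 x)) ->
  continuous phi4 -> per phi1 -> per phi2 -> per phi3 ->
  bilin p q phi1 phi2 = \int[mu]_(x in `[0, 1]) (u x * (phi4 x - phi2 x)).
Proof.
move=> hu d0 d1 d2 d3 c4 per1 per2 per3; have [lu lp lq up pq] := hu.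
have [cu cp] := h2_cont hu; have [_ pu _] := lu; have [_ pp _] := lp.
have c (f g : R -> R) : (forall x : R, is_derive x 1 f (g x)) -> continuous f.
  by move=> fg x; exact: is_derive_continuous (fg x).
have c1 := c _ _ d1; have c2 := c _ _ d2; have c3 := c _ _ d3.
have e1 f : per f -> f 1 = f 0 by move=> pf; rewrite -[1]add0r pf.
have qi := l2p_itg lq.
have ui : itg mu `[0, 1] u by exact: itg_cont.
have pi : itg mu `[0, 1] p by exact: itg_cont.
have I (f g G : R -> R) F : ac 1 F f -> itg mu `[0, 1] F -> per F -> per G ->
    (forall x : R, is_derive x 1 G (g x)) -> continuous g ->
    \int[mu]_(x in `[0, 1]) (f x * G x) = - \int[mu]_(x in `[0, 1]) (F x * g x).
  move=> aF Fi pF pG dG cg; have [fi _] := aF.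
  have := @ibp R 1 ler01 F f G g aF dG cg Fi; rewrite (e1 _ pF) (e1 _ pG) subrr.
  have i1 : itg mu `[0, 1] (fun x => F x * g x) by exact: itg_mul_cont.
  have i2 : itg mu `[0, 1] (fun x => f x * G x) by apply: itg_mul_cont => //; exact: c dG.
  by rewrite (IntD m01)// => /eqP; rewrite addrC addr_eq0 => /eqP.
have qp : itg mu `[0, 1] (fun x => q x * phi2 x) by exact: itg_mul_cont.
have pp1 : itg mu `[0, 1] (fun x => p x * phi1 x) by exact: itg_mul_cont.
rewrite /bilin (IntD m01)// (I q phi3 phi2 p)// (I p phi2 phi1 u)// (I p phi4 phi3 u)//.
rewrite opprK -(IntB m01); try exact: itg_mul_cont.
by apply: eq_IntI => x _; ring.
Qed.

Lemma bilinZ p q d1 d2 (s : R) :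
  sqi mu `[0, 1] p -> sqi mu `[0, 1] q -> sqi mu `[0, 1] d1 -> sqi mu `[0, 1] d2 ->
  bilin p q (fun x => s * d1 x) (fun x => s * d2 x) = s * bilin p q d1 d2.
Proof.
move=> sp sq s1 s2; rewrite /bilin -(IntZ m01); last by apply: (itgD m01); exact: (sqi_mul m01).
by apply: eq_IntI => x _; ring.
Qed.

Lemma bilin_self p q : sqi mu `[0, 1] p -> sqi mu `[0, 1] q -> bilin p q p q = energy2 p q.
Proof. by move=> [_ pi] [_ qi]; rewrite /bilin (IntD m01). Qed.

Lemma h2Z u p q (s : R) : h2 u p q -> h2 (fun x => s * u x) (fun x => s * p x) (fun x => s * q x).
Proof.
move=> h; have := h2_lin s (h2_cst 0) h.
by congr h2; apply/funext => x; rewrite add0r.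
Qed.

Definition triple : Type := (R -> R) * (R -> R) * (R -> R).

(** Exactly what a step requires of its starting point and guarantees for its result, so that steps
    can be iterated. *)
Record state (z : triple) : Prop := State {
  st_h2 : h2 z.1.1 z.1.2 z.2;
  st_ge0 : forall x, 0 <= z.1.1 x;
  st_pos : {ae mu, forall x, `[0, 1]%classic x -> 0 < z.1.1 x};
  st_ln : itg mu `[0, 1] (fun x => ln (z.1.1 x)) }.

Definition enz (z : triple) : R := energy2 z.1.2 z.2.

(** The consequences of the variational inequality used later. The weight [w] of the dissipation is
    free so that it can be the limit plus eps, and [eu_eq] is the equation with the logarithmic
    difference quotient linearised, at the price of an error of order tau. *)
Record euler (tau : R) (z z' : triple) : Prop := Euler {
  eu_ln : \int[mu]_(x in `[0, 1]) ln (z.1.1 x) <= \int[mu]_(x in `[0, 1]) ln (z'.1.1 x);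
  eu_mass : \int[mu]_(x in `[0, 1]) z'.1.1 x + tau * enz z' <= \int[mu]_(x in `[0, 1]) z.1.1 x;
  eu_energy : forall w, continuous w -> (forall x, 0 < w x) ->
    (forall x, z.1.1 x <= w x) -> (forall x, z'.1.1 x <= w x) ->
    enz z' + tau * \int[mu]_(x in `[0, 1]) (2 * ((z'.1.1 x - z.1.1 x) / tau) ^+ 2 / w x) <= enz z;
  eu_eq : forall phi phi1 phi2 phi3 phi4 (del M : R),
    (forall x : R, is_derive x 1 phi (phi1 x)) -> (forall x : R, is_derive x 1 phi1 (phi2 x)) ->
    (forall x : R, is_derive x 1 phi2 (phi3 x)) -> (forall x : R, is_derive x 1 phi3 (phi4 x)) ->
    continuous phi4 -> per phi -> per phi1 -> per phi2 -> per phi3 ->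
    0 < del -> (forall x, phi x != 0 -> del <= z.1.1 x /\ del <= z'.1.1 x) ->
    (forall x, `|phi x| <= M) ->
    `|\int[mu]_(x in `[0, 1]) ((z'.1.1 x - z.1.1 x) / tau * phi x / z'.1.1 x +
        z'.1.1 x * (phi4 x - phi2 x))| <=
      M / del ^+ 2 * tau * nrm2 (fun x => (z'.1.1 x - z.1.1 x) / tau) }.

Lemma euler_exists (tau : R) (z : triple) : 0 < tau -> state z ->
  exists z', state z' /\ euler tau z z'.
Proof.
move: z => [[b p0] q0] tau0 [/= hb b0 bpos bln].
have [u [p [q [hu u0 upos [uln lnb] EL]]]] := step_exists tau0 hb b0 bpos bln.
have [cb _] := h2_cont hb; have [cu _] := h2_cont hu.
have [_ [_ _ sp] [_ _ sq] _ _] := hu.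
exists (u, p, q); split; first by split.
have bi : itg mu `[0, 1] b by exact: itg_cont.
have ui : itg mu `[0, 1] u by exact: itg_cont.
have lni : itg mu `[0, 1] (fun x => ln (u x) - ln (b x)) by exact: (itgB m01).
have lnd d : continuous d -> itg mu `[0, 1] (fun x => (ln (u x) - ln (b x)) * d x).
  by move=> cd; exact: itg_mul_cont.
split => //=.
(* The direction - u is just admissible, since u + d = 0; the tangent inequality at b bounds the
   entropy term by the loss of mass. *)
- have := EL _ _ _ (h2Z (-1) hu); rewrite bilinZ// bilin_self// /enz/= => H.
  have {}H := H (fun x => eq_ind_r (fun y => 0 <= y) (lexx 0) (etrans (congr1 (+%R (u x)) (mulN1r (u x))) (subrr (u x)))).
  suff : \int[mu]_(x in `[0, 1]) ((ln (u x) - ln (b x)) * (-1 * u x)) <=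
      \int[mu]_(x in `[0, 1]) (b x - u x).
    by rewrite (IntB m01)//; lra.
  have cNu : continuous (fun x : R => -1 * u x) by move=> x; apply: cvgM; [exact: cvg_cst|exact: cu].
  apply: (Int_le_ae m01); [exact: lnd|exact: (itgB m01)|].
  apply: ae_imp bpos => x h Dx; have := hent_tangent (u0 x) (h Dx); rewrite /hent; lra.
- move=> w cw w0 bw uw.
  (* Direction b - u: expanding E(b) around u gives E(b) >= E(u) + 2 B, and the inequality bounds
     tau B below by the dissipation. *)
  have hd := h2B hb hu; have [cd _] := h2_cont hd.
  have := EL _ _ _ hd; have := energy2_lin 1 hu hd.
  rewrite (_ : (fun x => p x + 1 * (p0 x - p x)) = p0); last by apply/funext => x; ring.
  rewrite (_ : (fun x => q x + 1 * (q0 x - q x)) = q0); last by apply/funext => x; ring.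
  rewrite /enz/= => -> H.
  have bu x : 0 <= u x + (b x - u x) by rewrite addrC subrK.
  have {H} := H bu; set B := bilin _ _ _ _ => H.
  have cwi : continuous (fun x => (w x)^-1).
    by move=> x; apply: continuous_comp; [exact: cw|apply: inv_continuous; rewrite gt_eqF].
  have cub : continuous (fun x => u x - b x) by move=> x; apply: cvgB; [exact: cu|exact: cb].
  have c2 : continuous (fun x => (u x - b x) ^+ 2 / w x).
    by move=> x; apply: cvgM; [apply: cvgM; exact: cub|exact: cwi].
  have -> : \int[mu]_(x in `[0, 1]) (2 * ((u x - b x) / tau) ^+ 2 / w x) =
      2 / tau ^+ 2 * \int[mu]_(x in `[0, 1]) ((u x - b x) ^+ 2 / w x).
    rewrite -(IntZ m01); last exact: itg_cont.
    by apply: eq_IntI => x _; field; rewrite !gt_eqF.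
  have I : \int[mu]_(x in `[0, 1]) ((u x - b x) ^+ 2 / w x) <=
      - \int[mu]_(x in `[0, 1]) ((ln (u x) - ln (b x)) * (b x - u x)).
    rewrite -(IntN m01); last exact: lnd.
    apply: (Int_le_ae m01); [exact: itg_cont|apply: itgN; exact: lnd|].
    apply: ae_imp2 upos bpos => x ux bx Dx.
    by rewrite -mulrN opprB; apply: ln_sub_ge; [exact: ux|exact: bx|exact: uw|exact: bw].
  have E0 := energy2_ge0 (fun x => p0 x - p x) (fun x => q0 x - q x).
  set I0 := Rintegral _ _ _ in I *; set I1 := Rintegral _ _ _ in H I.
  have : tau * (2 / tau ^+ 2 * I0) <= 2 * B.
    have -> : tau * (2 / tau ^+ 2 * I0) = 2 * I0 / tau by field; rewrite gt_eqF.
    rewrite ler_pdivrMr//; lra.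
  lra.
move=> phi phi1 phi2 phi3 phi4 del M D0 D1 D2 D3 c4 per0 per1 per2 per3 del0 Hdel HM.
have M0 : 0 <= M := le_trans (normr_ge0 _) (HM 0).
have cc (f g : R -> R) : (forall x : R, is_derive x 1 f (g x)) -> continuous f.
  by move=> fg x; exact: is_derive_continuous (fg x).
have c0 := cc _ _ D0; have c1 := cc _ _ D1; have c2 := cc _ _ D2.
have hphi : h2 phi phi1 phi2 by exact: h2_C2.
have [_ [_ _ sp1] [_ _ sp2] _ _] := hphi.
(* Small enough that |eta phi| <= del <= u on the support of phi: both signs are admissible and the
   inequality becomes the equality [X0]. *)
pose eta := del / (M + 1); have M1 : 0 < M + 1 by lra.
have eta0 : 0 < eta by rewrite divr_gt0.
pose X := \int[mu]_(x in `[0, 1]) ((ln (u x) - ln (b x)) * phi x) + tau * bilin p q phi1 phi2.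
have Xs (s : R) : `|s| = 1 -> 0 <= s * X.
  move=> s1; have Hs x : 0 <= u x + s * eta * phi x.
    have [->|px] := eqVneq (phi x) 0; first by rewrite mulr0 addr0.
    have [_ du] := Hdel x px.
    have : `|s * eta * phi x| <= del.
      rewrite normrM normrM s1 mul1r gtr0_norm// /eta.
      apply: (@le_trans _ _ (del / (M + 1) * M)); first by rewrite ler_wpM2l// ltW.
      by rewrite mulrAC ler_pdivrMr// ler_wpM2l ?ltW//; lra.
    rewrite ler_norml => /andP[? _]; lra.
  have := EL _ _ _ (h2Z (s * eta) hphi) Hs; rewrite bilinZ//.
  rewrite (@eq_IntI _ _ _ _ (fun x => s * eta * ((ln (u x) - ln (b x)) * phi x))); last by move=> x _; ring.
  rewrite (IntZ m01); last exact: lnd.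
  have -> : s * eta * \int[mu]_(x in `[0, 1]) ((ln (u x) - ln (b x)) * phi x) +
    tau * (s * eta * bilin p q phi1 phi2) = eta * (s * X) by rewrite /X; ring.
  by rewrite pmulr_rge0.
have X0 : X = 0.
  apply/eqP; rewrite eq_le; apply/andP; split.
    by have := Xs (-1); rewrite normrN1 => /(_ erefl); rewrite mulN1r oppr_ge0.
  by have := Xs 1; rewrite normr1 => /(_ erefl); rewrite mul1r.
have X0' : \int[mu]_(x in `[0, 1]) ((ln (u x) - ln (b x)) * phi x) = - (tau * bilin p q phi1 phi2).
  by move: X0 => /eqP; rewrite addr_eq0 => /eqP.
have vi : itg mu `[0, 1] (fun x => (u x - b x) / tau * phi x / u x).
  have cv : continuous (fun x : R => (u x - b x) / tau).
    by move=> x; apply: cvgM; [apply: cvgB; [exact: cu|exact: cb]|exact: cvg_cst].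
  apply: (itg_ext m01 (f := fun x => phi x / u x * ((u x - b x) / tau))) => [x _|]; first by ring.
  apply: (@itg_mul_bdd _ _ _ mu _ m01 _ _ (M / del)); last exact: itg_cont.
    apply: measurable_funM; first exact: cont_meas.
    by apply: measurableT_comp; [exact: measurable_invr|exact: cont_meas].
  move=> x _; have [->|px] := eqVneq (phi x) 0.
    by rewrite mul0r normr0 divr_ge0// ltW.
  have [_ du] := Hdel x px; have ux : 0 < u x by exact: lt_le_trans du.
  rewrite normrM ler_pM// normfV gtr0_norm// lef_pV2 ?posrE//.
have ui4 : itg mu `[0, 1] (fun x => u x * (phi4 x - phi2 x)).
  by apply: itg_cont => x; apply: cvgM; [exact: cu|apply: cvgB; [exact: c4|exact: c2]].
rewrite (IntD m01)// -(bilin_ibp hu D0 D1 D2 D3)//.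
have -> : \int[mu]_(x in `[0, 1]) ((u x - b x) / tau * phi x / u x) + bilin p q phi1 phi2 =
    \int[mu]_(x in `[0, 1]) ((u x - b x) / tau * phi x / u x - tau^-1 * ((ln (u x) - ln (b x)) * phi x)).
  have li : itg mu `[0, 1] (fun x => tau^-1 * ((ln (u x) - ln (b x)) * phi x)).
    by apply: (itgZ m01); exact: lnd.
  rewrite (IntB m01)// (IntZ m01) ?X0'; last exact: lnd.
  by rewrite mulrN opprK mulKf// gt_eqF.
have ni : itg mu `[0, 1] (fun x => ((u x - b x) / tau) ^+ 2).
  apply: itg_cont => x; have c : continuous (fun x : R => (u x - b x) / tau).
    by move=> y; apply: cvgM; [apply: cvgB; [exact: cu|exact: cb]|exact: cvg_cst].
  by apply: cvgM; exact: c.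
rewrite -(IntZ m01)//; apply: (Int_abs_le m01).
- by apply: (itgB m01) => //; apply: (itgZ m01); exact: lnd.
- exact: (itgZ m01).
move=> x _; have [->|px] := eqVneq (phi x) 0.
  rewrite !mulr0 mul0r subr0 normr0; apply: mulr_ge0; last exact: sqr_ge0.
  by apply: mulr_ge0; [apply: divr_ge0 => //; rewrite exprn_ge0// ltW|exact: ltW].
have [db du] := Hdel x px; have ux : 0 < u x by exact: lt_le_trans du.
(* What remains is the Taylor remainder of the logarithm divided by tau; being quadratic in u - b,
   it is of order tau in terms of the difference quotient. *)
have -> : (u x - b x) / tau * phi x / u x - tau^-1 * ((ln (u x) - ln (b x)) * phi x) =
    - (tau^-1 * phi x * (ln (u x) - ln (b x) - (u x - b x) / u x)) by field; rewrite !gt_eqF.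
rewrite normrN normrM normrM (gtr0_norm (_ : 0 < tau^-1)) ?invr_gt0//.
have -> : M / del ^+ 2 * tau * ((u x - b x) / tau) ^+ 2 = tau^-1 * M * ((u x - b x) ^+ 2 / del ^+ 2).
  by field; rewrite !gt_eqF.
apply: ler_pM => //; first by rewrite mulr_ge0// invr_ge0 ltW.
  by rewrite ler_wpM2l// invr_ge0 ltW.
exact: ln_sub_taylor.
Qed.

End euler_estimates.

(** * The piecewise constant interpolation *)

Section discrete_solution.
Context (R : realType).
Local Notation mu := (@lebesgue_measure R).
Implicit Types (f g u p q w phi : R -> R) (z : triple R).
Let m01 := mI (0 : R) 1.

Lemma sqi_cont u : continuous u -> sqi mu `[0, 1] u.
Proof.
move=> cu; split; first exact: cont_meas.
by apply: itg_cont => x; apply: cvgM; exact: cu.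
Qed.

Lemma sqr_sum_le (n : nat) (a : nat -> R) :
  (\sum_(i < n) a i) ^+ 2 <= n%:R * \sum_(i < n) a i ^+ 2.
Proof.
elim: n => [|n IH]; first by rewrite !big_ord0 expr0n mul0r.
rewrite !big_ord_recr/= -natr1; set S := \sum_(i < n) a i in IH *.
set Q := \sum_(i < n) a i ^+ 2 in IH *.
have Q0 : 0 <= Q by apply: sumr_ge0 => i _; exact: sqr_ge0.
have [n0|n0] := posnP n.
  by rewrite /S /Q n0 !big_ord0 !add0r mul1r.
have n0' : 0 < n%:R :> R by rewrite ltr0n.
have : 0 <= (S / n%:R - a n) ^+ 2 * n%:R by rewrite mulr_ge0 ?sqr_ge0// ltW.
have -> : (S / n%:R - a n) ^+ 2 * n%:R = S ^+ 2 / n%:R - 2 * S * a n + a n ^+ 2 * n%:R.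
  by field; rewrite gt_eqF.
have : S ^+ 2 / n%:R <= Q by rewrite ler_pdivrMr// mulrC.
lra.
Qed.

Lemma itg_set1 f a : itg mu [set a] f.
Proof.
have m1 : measurable ([set a] : set (measurableTypeR R)) by exact: measurable_set1.
apply: (@itg_ext _ _ _ mu _ m1 (fun=> f a)); first by move=> x ->.
by apply: itg_cst => //; rewrite -set_itv1; exact: itv_fin.
Qed.

Section steps.
Context (T tau : R) (M : nat) (tau0 : 0 < tau) (TM : T = M%:R * tau).

(** Counts the grid points strictly before t: the value is n + 1 on ]n tau, (n+1) tau], 0 for t <= 0
    and M from T on. It is thus defined for all times and visibly monotone. *)
Definition tidx (t : R) : nat := (\sum_(n < M) (n%:R * tau < t)%R)%N.

Lemma tidx_le t : (tidx t <= M)%N.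
Proof.
rewrite /tidx -[leqRHS]card_ord -sum1_card; apply: leq_sum => i _; exact: leq_b1.
Qed.

Lemma tidx_homo s t : s <= t -> (tidx s <= tidx t)%N.
Proof.
move=> st; apply: leq_sum => i _; case: ltP => // h.
by rewrite (lt_le_trans h st).
Qed.

Lemma tidx_eq t n : (n < M)%N -> n%:R * tau < t <= n.+1%:R * tau -> tidx t = n.+1.
Proof.
move=> nM /andP[h1 h2]; rewrite /tidx.
rewrite (eq_bigr (fun i : 'I_M => nat_of_bool (i < n.+1)%N)) => [|i _]; last first.
  congr nat_of_bool; rewrite ltnS; apply/idP/idP => [h|h].
    rewrite leqNgt; apply/negP => ni; have := lt_le_trans h h2.
    by rewrite ltr_pM2r// ltr_nat ltnNge ni.
  by apply: le_lt_trans h1; rewrite ler_pM2r// ler_nat.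
rewrite -[RHS](card_ord n.+1) -sum1_card (big_ord_widen M (fun _ => 1%N))//.
by rewrite [RHS]big_mkcond/=; apply: eq_bigr => i _; case: ifP.
Qed.

Lemma tidx0 t : t <= 0 -> tidx t = 0%N.
Proof.
move=> t0; apply: big1 => i _; rewrite ltNge (le_trans t0)// mulr_ge0// ltW//.
Qed.

Lemma tidxT t : T <= t -> tidx t = M.
Proof.
move=> Tt; rewrite /tidx -[RHS]card_ord -sum1_card; apply: eq_bigr => i _.
by rewrite (lt_le_trans _ Tt)// TM ltr_pM2r// ltr_nat ltn_ord.
Qed.

Lemma tidxP t : 0 < t -> t <= T -> exists2 n, (n < M)%N & n%:R * tau < t <= n.+1%:R * tau.
Proof.
move=> t0 tT; have [|n] := @ex_minnP (fun n => t <= n.+1%:R * tau).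
  exists M; apply: (le_trans tT); rewrite TM ler_pM2r// ler_nat//.
move=> tn nmin; exists n; last first.
  rewrite tn andbT; case: n tn nmin => [|n] tn nmin; first by rewrite mul0r.
  by rewrite ltNge; apply/negP => h; have := nmin n h; rewrite ltnn.
rewrite ltnNge; apply/negP => Mn.
case: M TM Mn => [E|M' E Mn]; first by move: tT; rewrite E mul0r leNgt t0.
by have := nmin M'; rewrite -E => /(_ tT); rewrite leqNgt Mn.
Qed.

Lemma tidx_pred t : t <= T -> tidx (t - tau) = (tidx t).-1.
Proof.
move=> tT; have [t0|t0] := leP t 0; first by rewrite !tidx0//; apply: le_trans t0; rewrite gerBl ltW.
have [n nM /andP[h1 h2]] := tidxP t0 tT.
rewrite (@tidx_eq t n nM) ?h1//=; case: n nM h1 h2 => [|n] nM h1 h2.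
  by apply: tidx0; rewrite subr_le0 -[leRHS]mul1r.
apply: tidx_eq; first exact: ltnW.
move: h1 h2; rewrite -[n.+2%:R]natr1 -[n.+1%:R]natr1 !mulrDl !mul1r => h1 h2.
by apply/andP; split; lra.
Qed.

(** The extra tau is the rounding error of the grid; it reappears in every modulus of continuity in
    time. *)
Lemma tidx_diff s t : s <= t -> (tidx t - tidx s)%:R * tau <= t - s + tau.
Proof.
move=> st; have [t0|t0] := leP t 0; first by rewrite !tidx0 ?(le_trans st)// subnn mul0r addr_ge0 ?subr_ge0// ltW.
have [Ts|sT] := leP T s; first by rewrite !tidxT ?(le_trans Ts)// subnn mul0r addr_ge0 ?subr_ge0// ltW.
have H1 : (tidx t)%:R * tau <= t + tau.
  have [Tt|tT] := leP T t; first by rewrite tidxT// -TM (le_trans Tt)// lerDl ltW.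
  have [n nM h] := tidxP t0 (ltW tT); rewrite (tidx_eq nM h).
  by move: h => /andP[h _]; rewrite -natr1 mulrDl mul1r; lra.
have H2 : s <= (tidx s)%:R * tau.
  have [s0|s0] := leP s 0; first by rewrite tidx0// mul0r.
  have [n nM h] := tidxP s0 (ltW sT); rewrite (tidx_eq nM h).
  by case/andP: h.
by rewrite natrB ?tidx_homo// mulrBl; lra.
Qed.

Lemma tidx_meas (i : nat) : measurable ((tidx @^-1` [set i]) : set (measurableTypeR R)).
Proof.
have m : mfun1 setT (fun t : R => (tidx t)%:R : R).
  by apply: nondecreasing_measurable => // x y xy; rewrite ler_nat tidx_homo.
have := m measurableT [set i%:R] (measurable_set1 _); rewrite setTI.
rewrite (_ : _ @^-1` _ = tidx @^-1` [set i])//; apply/seteqP; split => t /=.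
  by move=> /eqP; rewrite eqr_nat => /eqP.
by move=> ->.
Qed.

(** The left endpoints n tau belong to the previous step, so on each closed interval f is constant
    only up to one point. *)
Lemma Int_steps f (c : nat -> R) :
  (forall n t, (n < M)%N -> n%:R * tau < t <= n.+1%:R * tau -> f t = c n) ->
  itg mu `[0, T] f /\ \int[mu]_(t in `[0, T]) f t = tau * \sum_(n < M) c n.
Proof.
move=> fc; suff H m : (m <= M)%N -> itg mu `[0, m%:R * tau] f /\
    \int[mu]_(t in `[0, m%:R * tau]) f t = tau * \sum_(n < m) c n by rewrite TM; exact: H.
elim: m => [_|m IH mM].
  rewrite mul0r big_ord0 mulr0 set_itv1 Rintegral_set1; split => //.
  exact: itg_set1.
have [fi If] := IH (ltnW mM).
have l0 : 0 <= m%:R * tau by rewrite mulr_ge0// ltW.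
have l1 : m%:R * tau <= m.+1%:R * tau by rewrite ler_pM2r// ler_nat.
have ae1 : {ae mu, forall x, x != m%:R * tau}.
  exists [set m%:R * tau]; split => //; first exact: lebesgue_measure_set1.
  by move=> x /= /negP; rewrite negbK => /eqP.
pose a := m%:R * tau.
have fm : mfun1 `[a, m.+1%:R * tau] f.
  apply: (@eq_measurable_fun _ _ _ _ _ (fun t => c m + (f a - c m) * \1_([set a]) t)).
    move=> t; rewrite inE /= in_itv/= => /andP[h1 h2]; rewrite indicE.
    have [->|ta] := eqVneq t a; first by rewrite mem_set// mulr1 addrC subrK.
    rewrite memNset; last by move=> /eqP; rewrite (negbTE ta).
    by rewrite mulr0 addr0 (fc m)// h2 andbT lt_def ta.
  apply: measurable_funD; first exact: measurable_cst.
  by apply: measurable_funM; [exact: measurable_cst|exact: measurable_indic].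
have [|//||fi' If'] := @Int_ae _ _ _ mu `[a, m.+1%:R * tau] (mI _ _) (fun=> c m) f.
- by apply: itg_cst; [exact: mI|exact: itv_fin].
- apply: ae_imp ae1 => t tm; rewrite /= in_itv/= => /andP[h1 h2].
  by rewrite (fc m)// h2 andbT lt_def tm.
have fi2 := itg_cat l0 l1 fi fi'; split => //.
rewrite (Int_cat l0 l1 fi2) If -If' big_ord_recr/= mulrDr; congr (_ + _).
rewrite Rintegral_cst// mulrC; congr (_ * _).
have := lebesgue_measure_itv (`[m%:R * tau, m.+1%:R * tau]).
rewrite /= lte_fin ltr_pM2r// ltr_nat ltnSn => ->; rewrite /= -natr1; ring.
Qed.

(** Telescoping in integral form: it converts the inequalities of the single steps into inequalities
    integrated over [0, T]. *)
Lemma Int_steps_shift (h : nat -> R) :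
  [/\ itg mu `[0, T] (fun t => h (tidx t)), itg mu `[0, T] (fun t => h (tidx (t - tau))) &
   \int[mu]_(t in `[0, T]) h (tidx (t - tau)) - \int[mu]_(t in `[0, T]) h (tidx t) =
    tau * (h 0%N - h M)].
Proof.
have H1 n t : (n < M)%N -> n%:R * tau < t <= n.+1%:R * tau -> h (tidx t) = h n.+1.
  by move=> nM ht; rewrite (tidx_eq nM ht).
have H2 n t : (n < M)%N -> n%:R * tau < t <= n.+1%:R * tau -> h (tidx (t - tau)) = h n.
  move=> nM ht; rewrite tidx_pred ?(tidx_eq nM ht)//.
  by case/andP: ht => _ /le_trans; apply; rewrite TM ler_pM2r// ler_nat.
have [i1 I1] := Int_steps H1.
have [i2 I2] := Int_steps H2.
split => //; rewrite I1 I2 -mulrBr; congr (_ * _); rewrite -sumrB.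
elim: M => [|m IH]; first by rewrite big_ord0 subrr.
by rewrite big_ord_recr/= IH addrA subrK.
Qed.

End steps.

(** All that is used of the interpolation, with a constant [K] independent of tau. It is extended by
    constants outside [0, T] so that the shift by tau is always meaningful. The telescoping identity
    [ap_shift] is stated for an arbitrary functional, to serve both the energy and the mass. *)
Record approx (T tau K : R) (z0 : triple R) (Z : R -> triple R) : Prop := Approx {
  ap_state : forall t, state (Z t);
  ap_init : forall t, t <= 0 -> Z t = z0;
  ap_const : forall t, T <= t -> Z t = Z T;
  ap_steps : exists (N : nat) (idx : R -> nat) (g : nat -> triple R),
    [/\ forall t, (idx t < N)%N, forall i, measurable (idx @^-1` [set i] : set (measurableTypeR R)),
        forall i, state (g i) & forall t, Z t = g (idx t)];
  ap_le : forall t x, (Z t).1.1 x <= K;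
  ap_en : forall t, enz (Z t) <= enz z0;
  ap_ln : forall t, \int[mu]_(x in `[0, 1]) ln (z0.1.1 x) <= \int[mu]_(x in `[0, 1]) ln ((Z t).1.1 x);
  ap_mod : forall s t, s <= t ->
    nrm2 (fun x => (Z t).1.1 x - (Z s).1.1 x) <= K * enz z0 / 2 * (t - s + tau);
  ap_euler : forall t, 0 < t -> t <= T -> euler tau (Z (t - tau)) (Z t);
  ap_shift : forall h : triple R -> R,
    [/\ itg mu `[0, T] (fun t => h (Z t)), itg mu `[0, T] (fun t => h (Z (t - tau))) &
      \int[mu]_(t in `[0, T]) h (Z (t - tau)) - \int[mu]_(t in `[0, T]) h (Z t) =
      tau * (h z0 - h (Z T))] }.

(** The sum of the two functions plus 1 is an admissible weight, and the dissipation is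
    nonnegative. *)
Lemma euler_energy_le tau z z' : 0 < tau -> state z -> state z' -> euler tau z z' ->
  enz z' <= enz z.
Proof.
move=> tau0 sz sz' eu; have [c _] := h2_cont (st_h2 sz); have [c' _] := h2_cont (st_h2 sz').
have z0 := st_ge0 sz; have z0' := st_ge0 sz'.
have w0 x : 0 < z.1.1 x + z'.1.1 x + 1 by rewrite ltr_wpDl// addr_ge0.
apply: le_trans (eu_energy eu _ w0 _ _).
- rewrite lerDl; apply: mulr_ge0; first exact: ltW.
  apply: Rintegral_ge0 => x _; apply: divr_ge0; last exact: ltW.
  by rewrite mulr_ge0// sqr_ge0.
- by move=> x; apply: cvgD; [apply: cvgD; [exact: c|exact: c']|exact: cvg_cst].
- by move=> x; have := z0' x; lra.
- by move=> x; have := z0 x; lra.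
Qed.

Lemma approx_exists (T : R) (z0 : triple R) : 0 < T -> state z0 ->
  exists2 K, 0 < K & forall M, (0 < M)%N -> exists Z, approx T (T / M%:R) K z0 Z.
Proof.
move=> T0 sz0; pose F0 := \int[mu]_(x in `[0, 1]) z0.1.1 x.
have F00 : 0 <= F0 by apply: Rintegral_ge0 => x _; exact: st_ge0 sz0 x.
pose K := F0 + Num.sqrt (2 * enz z0) + 1.
have K0 : 0 < K by rewrite ltr_wpDl ?addr_ge0 ?sqrtr_ge0.
exists K => // M M0; have M0' : 0 < M%:R :> R by rewrite ltr0n.
pose tau := T / M%:R; have tau0 : 0 < tau by rewrite divr_gt0.
have TM : T = M%:R * tau by rewrite /tau mulrC divfK// gt_eqF.
have /choice[nxt Hnxt] : forall z, exists z', state z -> state z' /\ euler tau z z'.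
  move=> z; have [sz|nsz] := pselect (state z); last by exists z.
  by have [z' H] := euler_exists tau0 sz; exists z'.
pose g n := iter n nxt z0.
have sg n : state (g n) by elim: n => [//|n IH]; have [] := Hnxt (g n) IH.
have eg n : euler tau (g n) (g n.+1) by have [] := Hnxt (g n) (sg n).
have cg n : continuous (g n).1.1 by have [] := h2_cont (st_h2 (sg n)).
have Eg n : enz (g n) <= enz z0.
  by elim: n => [//|n]; exact: le_trans (euler_energy_le tau0 (sg n) (sg n.+1) (eg n)).
have E0 n : 0 <= enz (g n) by exact: energy2_ge0.
have Fg n : \int[mu]_(x in `[0, 1]) (g n).1.1 x <= F0.
  elim: n => [//|n]; apply: le_trans; apply: le_trans (eu_mass (eg n)).
  by rewrite lerDl mulr_ge0// ltW.
have Kg n x : (g n).1.1 x <= K.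
  apply: le_trans (h2_sup_bound x (st_h2 (sg n)) (st_ge0 (sg n))) _.
  rewrite /K -addrA; apply: lerD => //; apply: (@le_trans _ _ (Num.sqrt (2 * enz z0))).
    by rewrite ler_wsqrtr// ler_wpM2l//; apply: le_trans (Eg n); rewrite lerDl nrm2_ge0.
  by rewrite lerDl.
have Lg n : \int[mu]_(x in `[0, 1]) ln (z0.1.1 x) <= \int[mu]_(x in `[0, 1]) ln ((g n).1.1 x).
  by elim: n => [//|n IH]; apply: le_trans IH _; exact: eu_ln (eg n).
(* The constant weight K, an upper bound for all iterates, makes the dissipation an L^2 bound on the
   difference quotient. *)
have D n : tau * nrm2 (fun x => ((g n.+1).1.1 x - (g n).1.1 x) / tau) <=
    K / 2 * (enz (g n) - enz (g n.+1)).
  have cK : continuous (fun _ : R => K) by exact: cst_continuous.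
  have := eu_energy (eg n) cK (fun=> K0) (Kg n) (Kg n.+1).
  have -> : \int[mu]_(x in `[0, 1]) (2 * (((g n.+1).1.1 x - (g n).1.1 x) / tau) ^+ 2 / K) =
     2 / K * nrm2 (fun x => ((g n.+1).1.1 x - (g n).1.1 x) / tau).
    rewrite -(IntZ m01); first by apply: eq_IntI => x _; ring.
    apply: (sqi_cont _).2 => x; apply: cvgM; last exact: cvg_cst.
    by apply: cvgB; exact: cg.
  set N := nrm2 _ => h.
  have -> : tau * N = K / 2 * (tau * (2 / K * N)) by field; rewrite gt_eqF.
  by rewrite ler_pM2l ?divr_gt0//; lra.
have Dsum n m : \sum_(i < m) tau * nrm2 (fun x => ((g (n + i).+1).1.1 x - (g (n + i)%N).1.1 x) / tau) <=
    K / 2 * enz z0.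
  apply: (@le_trans _ _ (\sum_(i < m) (K / 2 * (enz (g (n + i)%N) - enz (g (n + i).+1))))).
    by apply: ler_sum => i _; exact: D.
  rewrite -mulr_sumr; apply: ler_wpM2l; first by rewrite divr_ge0// ltW.
  have -> : \sum_(i < m) (enz (g (n + i)%N) - enz (g (n + i).+1)) = enz (g n) - enz (g (n + m)%N).
    elim: m => [|m IH]; first by rewrite big_ord0 addn0 subrr.
    by rewrite big_ord_recr/= IH addnS addrA subrK.
  by have := E0 (n + m)%N; have := Eg n; lra.
(* Cauchy-Schwarz over the m steps: the squared distance is at most m tau times the sum of the
   squared speeds weighted by tau, which [Dsum] bounds. *)
have diff n m : nrm2 (fun x => (g (n + m)%N).1.1 x - (g n).1.1 x) <= K * enz z0 / 2 * (m%:R * tau).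
  pose v i x := ((g (n + i).+1).1.1 x - (g (n + i)%N).1.1 x) / tau.
  have cv i : continuous (v i).
    by move=> x; apply: cvgM; [apply: cvgB; exact: cg|exact: cvg_cst].
  have vi i : itg mu `[0, 1] (fun x => v i x ^+ 2) by exact: (sqi_cont (cv i)).2.
  have tel x : (g (n + m)%N).1.1 x - (g n).1.1 x = tau * \sum_(i < m) v i x.
    rewrite /v -mulr_suml mulrC divfK ?gt_eqF//.
    elim: m => [|m IH]; first by rewrite big_ord0 addn0 subrr.
    by rewrite big_ord_recr/= -IH addnS [RHS]addrC addrA subrK.
  have si : itg mu `[0, 1] (fun x => \sum_(i < m) v i x ^+ 2) /\
      \int[mu]_(x in `[0, 1]) (\sum_(i < m) v i x ^+ 2) = \sum_(i < m) nrm2 (v i).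
    elim: (m) => [|k [IH1 IH2]].
      split; first by apply: (@itg_ext _ _ _ mu _ m01 (fun=> 0)) => [x _|]; [rewrite big_ord0|exact: itgC].
      by rewrite big_ord0 -[RHS]IntC; apply: eq_IntI => x _; rewrite big_ord0.
    have E x : \sum_(i < k.+1) v i x ^+ 2 = \sum_(i < k) v i x ^+ 2 + v k x ^+ 2 by rewrite big_ord_recr.
    split; first by apply: (@itg_ext _ _ _ mu _ m01 _ _ (fun x _ => esym (E x))); exact: (itgD m01).
    by rewrite (@eq_IntI _ _ _ _ _ (fun x _ => E x)) (IntD m01)// IH2 big_ord_recr.
  have [si1 si2] := si.
  apply: (@le_trans _ _ (\int[mu]_(x in `[0, 1]) (tau ^+ 2 * m%:R * \sum_(i < m) v i x ^+ 2))).
    apply: Int01_le; [|exact: (itgZ m01)|].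
      by apply: (sqi_cont _).2 => x; apply: cvgB; exact: cg.
    move=> x _; rewrite tel exprMn -mulrA; apply: ler_wpM2l; first exact: sqr_ge0.
    exact: (@sqr_sum_le m (fun i => v i x)).
  rewrite (IntZ m01)// si2.
  have -> : tau ^+ 2 * m%:R * \sum_(i < m) nrm2 (v i) = m%:R * tau * \sum_(i < m) tau * nrm2 (v i).
    by rewrite -mulr_sumr; ring.
  rewrite [X in _ <= X]mulrC; apply: ler_wpM2l; first by rewrite mulr_ge0// ltW.
  by apply: le_trans (Dsum n m) _; rewrite mulrAC.
exists (fun t => g (tidx tau M t)); split.
- by move=> t; exact: sg.
- by move=> t t0; rewrite tidx0.
- by move=> t Tt; rewrite !(tidxT tau0 TM).
- exists M.+1, (tidx tau M), g; split => // t; first by rewrite ltnS tidx_le.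
  exact: tidx_meas.
- by move=> t x; exact: Kg.
- by move=> t; exact: Eg.
- by move=> t; exact: Lg.
- move=> s t st; have := diff (tidx tau M s) (tidx tau M t - tidx tau M s)%N.
  rewrite subnKC ?tidx_homo// => /le_trans; apply; apply: ler_wpM2l.
    by apply: divr_ge0 => //; apply: mulr_ge0; [exact: ltW|exact: energy2_ge0].
  exact: (tidx_diff tau0 TM).
- move=> t t0 tT; rewrite (tidx_pred tau0 TM)//.
  have [n nM h] := tidxP tau0 TM t0 tT; rewrite (tidx_eq tau0 nM h).
  exact: eg.
- move=> h; have := Int_steps_shift tau0 TM (fun n => h (g n)).
  by rewrite (tidxT tau0 TM).
Qed.
End discrete_solution.

(** * Compactness of the approximations *)

Section compactness.
Context (R : realType).
Local Notation mu := (@lebesgue_measure R).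
Implicit Types (z : triple R).
Let m01 := mI (0 : R) 1.

Lemma net_itv (L del : R) : 0 < del -> exists (m : nat) (s : nat -> R),
  forall y, 0 <= y <= L -> exists2 i, (i < m)%N & `|y - s i| <= del.
Proof.
move=> d0; exists (Num.trunc (L / del)).+1, (fun i => i%:R * del) => y /andP[y0 yL].
have yd : 0 <= y / del by rewrite divr_ge0// ltW.
exists (Num.trunc (y / del)).
  rewrite ltnS; apply: le_truncn; by rewrite ler_pM2r// invr_gt0.
have /andP[h1 h2] : (Num.trunc (y / del))%:R <= y / del < (Num.trunc (y / del)).+1%:R.
  by exact: truncn_itv.
rewrite ler_pdivlMr// in h1; rewrite ltr_pdivrMr// -natr1 mulrDl mul1r in h2.
by rewrite ler_norml; apply/andP; split; lra.
Qed.

Lemma net_itv2 (T del : R) : 0 < del -> exists (m : nat) (s : nat -> R * R),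
  forall t y, 0 <= t <= T -> 0 <= y <= 1 ->
    exists2 i, (i < m)%N & `|t - (s i).1| <= del /\ `|y - (s i).2| <= del.
Proof.
move=> d0; have [m1 [s1 H1]] := net_itv T d0; have [m2 [s2 H2]] := net_itv 1 d0.
exists (m1 * m2)%N, (fun i => (s1 (i %/ m2)%N, s2 (i %% m2)%N)) => t y ht hy.
have [i1 l1 h1] := H1 t ht; have [i2 l2 h2] := H2 y hy.
have m2p : (0 < m2)%N by exact: leq_ltn_trans l2.
exists (i1 * m2 + i2)%N.
  by apply: (@leq_trans (i1.+1 * m2)); [rewrite mulSn addnC ltn_add2r|rewrite leq_mul2r l1 orbT].
by rewrite divnMDl// divn_small// addn0 modnMDl modn_small.
Qed.

Context (T K : R) (T0 : 0 < T) (K0 : 0 < K) (z0 : triple R).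

Lemma nrm2_sub_le (f g : R -> R) : sqi mu `[0, 1] f -> sqi mu `[0, 1] g ->
  nrm2 (fun x => f x - g x) <= 2 * nrm2 f + 2 * nrm2 g.
Proof.
move=> sf sg; have := nrm2_mid sf sg; have := nrm2_ge0 (fun x => 2^-1 * (f x + g x)).
lra.
Qed.

(** Interpolation: the L^2 modulus in time and the energy bound together control the supremum norm.
    The step tau enters the smallness condition because the approximations jump. *)
Lemma time_modulus (e : R) : 0 < e -> exists2 del, 0 < del &
  forall tau Z, approx T tau K z0 Z -> forall s t x, `|t - s| + tau <= del ->
    `|(Z t).1.1 x - (Z s).1.1 x| <= e.
Proof.
move=> e0; set E0 := enz z0; have E00 : 0 <= E0 by exact: energy2_ge0.
(* The second derivatives differ by at most 4 E0 in squared norm, so their term is at most 16 E0 eta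
   <= e^2/2; [del] below gives the other e^2/2 to the L^2 term. *)
pose eta := Num.min (1 / 2) (e ^+ 2 / (32 * (E0 + 1))).
have eta0 : 0 < eta by rewrite lt_min !divr_gt0// ?exprn_gt0// mulr_gt0//; lra.
have eta1 : eta <= 1 / 2 by rewrite ge_min lexx.
have eta2 : eta * (32 * (E0 + 1)) <= e ^+ 2.
  rewrite -ler_pdivlMr; first by rewrite ge_min lexx orbT.
  by rewrite mulr_gt0//; lra.
pose C := K * E0 / 2; have C0 : 0 <= C by apply: divr_ge0 => //; apply: mulr_ge0 => //; exact: ltW.
exists (e ^+ 2 * eta / (4 * (C + 1))).
  by rewrite divr_gt0// mulr_gt0// ?exprn_gt0//; lra.
move=> tau Z ap.
have key s t x : s <= t -> `|t - s| + tau <= e ^+ 2 * eta / (4 * (C + 1)) ->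
    `|(Z t).1.1 x - (Z s).1.1 x| <= e.
  move=> st; rewrite ger0_norm ?subr_ge0// => h.
  have hZ t' := st_h2 (ap_state ap t'); have hB := h2B (hZ t) (hZ s).
  rewrite -(@ler_pXn2r _ 2)// ?nnegrE//; last exact: ltW.
  rewrite real_normK ?num_real//; apply: le_trans (h2_interp x hB eta0 eta1) _.
  have q4 : nrm2 (fun x => (Z t).2 x - (Z s).2 x) <= 4 * E0.
    have [_ _ [_ _ sq] _ _] := hZ t; have [_ _ [_ _ sq'] _ _] := hZ s.
    have nE t' : nrm2 (Z t').2 <= E0 by apply: le_trans (ap_en ap t'); rewrite lerDl nrm2_ge0.
    by have := nrm2_sub_le sq sq'; have := nE t; have := nE s; lra.
  have n2 := ap_mod ap st; rewrite -/E0 -/C in n2.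
  have h1 : nrm2 (fun x => (Z t).1.1 x - (Z s).1.1 x) <= C * (e ^+ 2 * eta / (4 * (C + 1))).
    by apply: le_trans n2 _; rewrite ler_wpM2l.
  have h2 : 2 * nrm2 (fun x => (Z t).1.1 x - (Z s).1.1 x) / eta <= e ^+ 2 / 2.
    rewrite ler_pdivrMr//; apply: (@le_trans _ _ (2 * (C * (e ^+ 2 * eta / (4 * (C + 1)))))).
      by rewrite ler_wpM2l.
    have e2 : 0 <= e ^+ 2 * eta by rewrite mulr_ge0// ?sqr_ge0// ltW.
    have -> : 2 * (C * (e ^+ 2 * eta / (4 * (C + 1)))) = C / (C + 1) * (e ^+ 2 / 2 * eta).
      by field; rewrite gt_eqF//; lra.
    rewrite -[leRHS]mul1r; apply: ler_wpM2r; first by rewrite mulrAC divr_ge0.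
    by rewrite ler_pdivrMr; lra.
  have h3 : 4 * nrm2 (fun x => (Z t).2 x - (Z s).2 x) * eta <= 16 * E0 * eta.
    by rewrite ler_pM2r//; lra.
  move: h2 h3 eta2; set a := 2 * _ / eta; set b := 4 * _ * eta; set e2 := e ^+ 2.
  have := mulr_ge0 E00 (ltW eta0); nra.
move=> s t x; have [st|/ltW ts] := leP s t; first exact: key.
by move=> h; rewrite distrC; apply: key => //; rewrite distrC.
Qed.

Lemma space_modulus (e : R) : 0 < e -> exists2 del, 0 < del &
  forall tau Z, approx T tau K z0 Z -> forall t x y, `|x - y| <= del ->
    `|(Z t).1.1 x - (Z t).1.1 y| <= e.
Proof.
move=> e0; set E0 := enz z0; have E00 : 0 <= E0 by exact: energy2_ge0.
exists (Num.min 1 (e ^+ 2 / (2 * (E0 + 1)))).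
  by rewrite lt_min ltr01 divr_gt0// ?exprn_gt0// mulr_gt0//; lra.
move=> tau Z ap t x y; rewrite le_min => /andP[h1 h2].
have hZ := st_h2 (ap_state ap t).
rewrite -(@ler_pXn2r _ 2)// ?nnegrE//; last exact: ltW.
rewrite real_normK ?num_real//; apply: le_trans (h2_holder hZ h1) _.
have nE : nrm2 (Z t).2 <= E0 by apply: le_trans (ap_en ap t); rewrite lerDl nrm2_ge0.
apply: (@le_trans _ _ (2 * (E0 + 1) * `|x - y|)); first by rewrite ler_wpM2r// ler_wpM2l//; lra.
by rewrite mulrC -ler_pdivlMr// mulr_gt0//; lra.
Qed.

Lemma approx_clamp tau Z t : approx T tau K z0 Z -> Z t = Z (Num.max 0 (Num.min T t)).
Proof.
move=> ap; case: (clampP t (ltW T0)) => [[h ->]|[h ->]//|[h ->]].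
  by rewrite !(ap_init ap).
by rewrite (ap_const ap).
Qed.

(** The approximations and their shifts by one step must share the limit with an explicit rate: the
    dissipation weight has to dominate both. *)
Lemma extract (tau_ : nat -> R) (Z_ : nat -> R -> triple R) :
  (forall k, approx T (tau_ k) K z0 (Z_ k)) -> (forall k, 0 < tau_ k) ->
  tau_ k @[k --> \oo] --> 0 ->
  exists (u : R -> R -> R) (h : nat -> nat), forall j t x,
    [/\ (j <= h j)%N, `|(Z_ (h j) t).1.1 x - u t x| <= j.+1%:R^-1 &
      `|(Z_ (h j) (t - tau_ (h j))).1.1 x - u t x| <= j.+1%:R^-1].
Proof.
move=> ap tau0 ctau.
pose f k (p : R * R) := (Z_ k p.1).1.1 p.2.
have fK k p : `|f k p| <= K.
  by rewrite ger0_norm ?(ap_le (ap k))//; exact: st_ge0 (ap_state (ap k) _) _.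
have tau_small (del : R) : 0 < del -> exists N, forall k, (N <= k)%N -> tau_ k <= del.
  move=> d0; have /cvgrPdist_le/(_ del d0)[N _ HN] := ctau; exists N => k Nk.
  by have := HN k Nk; rewrite sub0r normrN ger0_norm// ltW.
(* The functions jump in time, so they are equicontinuous only up to an error vanishing with tau;
   this is why the net condition is asked only for k >= N. *)
have [|u [h Hu]] := ascoli_net fK.
  move=> e e0; have e2 : 0 < e / 2 by lra.
  have [d1 d10 H1] := time_modulus e2; have [d2 d20 H2] := space_modulus e2.
  pose d := Num.min (d1 / 2) d2.
  have d0 : 0 < d by rewrite lt_min d20 andbT; lra.
  have dd1 : d <= d1 / 2 by rewrite ge_min lexx.
  have dd2 : d <= d2 by rewrite ge_min lexx orbT.
  have [m [s Hs]] := net_itv2 T d0.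
  have [N HN] := tau_small (d1 / 2) (ltac:(lra)).
  exists m, s, N => -[t x].
  have [y [n [n' [/andP[y0 y1] xy]]]] := per_frac x.
  pose t' := Num.max 0 (Num.min T t).
  have t'T : 0 <= t' <= T by rewrite /t' le_max lexx ge_max ge_min lexx (ltW T0).
  have [i im [hi1 hi2]] := Hs t' y t'T (ltac:(by rewrite y0 ltW)).
  exists i => // k Nk; rewrite /f/= (approx_clamp t (ap k)) -/t' xy.
  have [_ pu _] := h2u (st_h2 (ap_state (ap k) t')); rewrite per_shift//.
  have -> : (Z_ k t').1.1 y - (Z_ k (s i).1).1.1 (s i).2 =
    ((Z_ k t').1.1 y - (Z_ k (s i).1).1.1 y) + ((Z_ k (s i).1).1.1 y - (Z_ k (s i).1).1.1 (s i).2) by ring.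
  apply: le_trans (ler_normD _ _) _; have -> : e = e / 2 + e / 2 by field.
  apply: lerD; last by apply: H2 (ap k) _ _ _ _; exact: le_trans dd2.
  by apply: H1 (ap k) _ _ _ _; have := HN k Nk; lra.
(* Index [r j] makes the distance to the limit and the effect of the shift at most 1/(2j+2) each, so
   that their sum is 1/(j+1). *)
have /choice[r Hr] : forall j : nat, exists r : nat, (j.*2.+1 <= r)%N /\
    forall k, (r <= k)%N -> forall t x, `|(Z_ k t).1.1 x - (Z_ k (t - tau_ k)).1.1 x| <= (j.*2.+2)%:R^-1.
  move=> j; have e0 : (0 : R) < j.*2.+2%:R^-1 by rewrite invr_gt0.
  have [d d0 Hd] := time_modulus e0; have [N HN] := tau_small (d / 2) (ltac:(lra)).
  exists (maxn j.*2.+1 N); rewrite leq_maxl; split => // k.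
  rewrite geq_max => /andP[_ Nk] t x; apply: (Hd _ _ (ap k)).
  have := HN k Nk; have := tau0 k.
  have -> : t - (t - tau_ k) = tau_ k by ring.
  by move=> p0 pd; rewrite gtr0_norm//; lra.
exists (fun t x => u (t, x)), (fun j => h (r j)) => j t x.
have [r1 r2] := Hr j; have [h1 h2] := Hu (r j).
have inv2 : (r j).+1%:R^-1 <= (j.*2.+2)%:R^-1 :> R by rewrite lef_pV2 ?posrE// ler_nat ltnS.
have invj : (j.*2.+2)%:R^-1 + (j.*2.+2)%:R^-1 = j.+1%:R^-1 :> R.
  rewrite -doubleS -muln2 natrM; have : j.+1%:R != 0 :> R by rewrite pnatr_eq0.
  by set a := j.+1%:R => a0; field.
have inv0 : (0 : R) < j.*2.+2%:R^-1 by rewrite invr_gt0.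
have hu := le_trans (h2 (t, x)) inv2; rewrite /f/= in hu.
split.
- by apply: leq_trans h1; apply: leq_trans r1; rewrite -addnn -addnS leq_addr.
- by apply: le_trans hu _; rewrite -invj lerDl ltW.
have -> : (Z_ (h (r j)) (t - tau_ (h (r j)))).1.1 x - u (t, x) =
  ((Z_ (h (r j)) t).1.1 x - u (t, x)) - ((Z_ (h (r j)) t).1.1 x - (Z_ (h (r j)) (t - tau_ (h (r j)))).1.1 x) by ring.
apply: le_trans (ler_normB _ _) _; rewrite -invj; apply: lerD => //.
exact: r2.
Qed.


Lemma extract_approx : (forall M, (0 < M)%N -> exists Z, approx T (T / M%:R) K z0 Z) ->
  exists (u : R -> R -> R) (tau_ : nat -> R) (Z_ : nat -> R -> triple R),
    [/\ forall j, approx T (tau_ j) K z0 (Z_ j), forall j, 0 < tau_ j <= T / j.+1%:R,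
        forall j t x, `|(Z_ j t).1.1 x - u t x| <= j.+1%:R^-1 &
        forall j t x, `|(Z_ j (t - tau_ j)).1.1 x - u t x| <= j.+1%:R^-1].
Proof.
move=> H; have /choice[Z HZ] : forall k : nat, exists Z, approx T (T / k.+1%:R) K z0 Z.
  by move=> k; exact: H.
have tau0 k : 0 < T / k.+1%:R by rewrite divr_gt0.
have [|u [h Hu]] := extract HZ tau0.
  rewrite -[X in _ --> X](mulr0 T); apply: cvgM; first exact: cvg_cst.
  exact: cvg_harmonic.
exists u, (fun j => T / (h j).+1%:R), (fun j => Z (h j)); split.
- by move=> j; exact: HZ.
- move=> j; rewrite tau0/= ler_pM2l// lef_pV2 ?posrE// ler_nat ltnS.
  by have [] := Hu j 0 0.
- by move=> j t x; have [] := Hu j t x.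
- by move=> j t x; have [] := Hu j t x.
Qed.

Section limit.
Context (u : R -> R -> R) (tau_ : nat -> R) (Z_ : nat -> R -> triple R).
Context (ap : forall j, approx T (tau_ j) K z0 (Z_ j)).
Context (tau01 : forall j, 0 < tau_ j <= T / j.+1%:R).
Context (cu : forall j t x, `|(Z_ j t).1.1 x - u t x| <= j.+1%:R^-1).

Lemma lim_cvg t x : (Z_ j t).1.1 x @[j --> \oo] --> u t x.
Proof. by apply: inv_cvg => j; exact: cu. Qed.

Lemma tau0 j : 0 < tau_ j. Proof. by case/andP: (tau01 j). Qed.

Lemma tau_cvg : tau_ j @[j --> \oo] --> 0.
Proof.
have cT : T * j.+1%:R^-1 @[j --> \oo] --> 0.
  by rewrite -[X in _ --> X](mulr0 T); apply: cvgM; [exact: cvg_cst|exact: cvg_harmonic].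
apply: (squeeze_cvgr _ (cvg_cst 0) cT); apply: nearW => j.
by rewrite ltW ?tau0//=; case/andP: (tau01 j).
Qed.

Lemma lim_ge0 t x : 0 <= u t x.
Proof.
rewrite -oppr_le0; apply: (@cvgn_le _ (fun j => - (Z_ j t).1.1 x)).
  by apply: cvgN; exact: lim_cvg.
by move=> j; rewrite oppr_le0; exact: st_ge0 (ap_state (ap j) t) x.
Qed.

Lemma lim_le t x : u t x <= K.
Proof. by apply: (cvgn_le (lim_cvg (t := t) (x := x))) => j; exact: ap_le. Qed.

Lemma lim_per t : per (u t).
Proof.
move=> x; apply: (cvg_unique (@Rhausdorff _) (lim_cvg (t := t) (x := x + 1))).
rewrite (_ : (fun j => _) = (fun j => (Z_ j t).1.1 x)); first exact: lim_cvg.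
by apply/funext => j; have [_ pz _] := h2u (st_h2 (ap_state (ap j) t)); exact: pz.
Qed.

Lemma lim_init x : u 0 x = z0.1.1 x.
Proof.
apply: (cvg_unique (@Rhausdorff _) (lim_cvg (t := 0) (x := x))).
rewrite (_ : (fun j => _) = (fun j => z0.1.1 x)); first exact: cvg_cst.
by apply/funext => j; rewrite (ap_init (ap j)).
Qed.

Lemma lim_h2 t : exists p q, h2 (u t) p q /\ energy2 p q <= enz z0.
Proof.
apply: (@energy_lsc _ (fun j => (Z_ j t).1.1) (fun j => (Z_ j t).1.2) (fun j => (Z_ j t).2)).
- by move=> j; exact: st_h2 (ap_state (ap j) t).
- by move=> x; exact: lim_cvg.
- move=> e e0; apply: nearW => j; apply: le_trans (ap_en (ap j) t) _.
  by rewrite lerDl ltW.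
Qed.

Lemma lim_modulus (e : R) : 0 < e -> exists2 del, 0 < del &
  forall s t x y, `|t - s| <= del -> `|x - y| <= del -> `|u t x - u s y| <= e.
Proof.
move=> e0; have e2 : 0 < e / 2 by lra.
have [d1 d10 H1] := time_modulus e2; have [d2 d20 H2] := space_modulus e2.
exists (Num.min (d1 / 2) d2); first by rewrite lt_min d20 andbT; lra.
move=> s t x y; rewrite !le_min => /andP[ts _] /andP[_ xy].
have [N _ HN] : \forall j \near \oo, tau_ j <= d1 / 2.
  have d12 : 0 < d1 / 2 by lra.
  have := tau_cvg => /cvgrPdist_le/(_ _ d12); apply: filterS => j.
  by rewrite sub0r normrN gtr0_norm ?tau0.
have c : (fun j => `|(Z_ (j + N)%N t).1.1 x - (Z_ (j + N)%N s).1.1 y|) @ \oo --> `|u t x - u s y|.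
  apply: cvg_norm; apply: cvgB.
    by rewrite (cvg_shiftn N (fun j => (Z_ j t).1.1 x) _); exact: lim_cvg.
  by rewrite (cvg_shiftn N (fun j => (Z_ j s).1.1 y) _); exact: lim_cvg.
apply: (cvgn_le c) => j.
have -> : (Z_ (j + N)%N t).1.1 x - (Z_ (j + N)%N s).1.1 y =
  ((Z_ (j + N)%N t).1.1 x - (Z_ (j + N)%N s).1.1 x) +
  ((Z_ (j + N)%N s).1.1 x - (Z_ (j + N)%N s).1.1 y) by ring.
apply: le_trans (ler_normD _ _) _; have -> : e = e / 2 + e / 2 by field.
apply: lerD; last exact: (H2 _ _ (ap _)).
by apply: (H1 _ _ (ap (j + N)%N)); have := HN (j + N)%N (leq_addl _ _); rewrite /=; lra.
Qed.

Lemma lim_cont : continuous (fun p : R * R => u p.1 p.2).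
Proof.
move=> [t x]; apply/cvgrPdist_le => e e0; have [d d0 Hd] := lim_modulus e0.
exists (ball t d, ball x d) => /=; first by split; exact: nbhsx_ballx.
by move=> [s y] [/= /ltW h1 /ltW h2]; exact: Hd.
Qed.

Lemma lim_pos t : {ae mu, forall x, 0 < u t x}.
Proof.
have [p [q [hu _]]] := lim_h2 t; have [cut _] := h2_cont hu.
have [H _ _] := @ln_fatou _ _ _ mu `[0, 1] m01 (fin01 R) (fun j x => (Z_ j t).1.1 x) (u t)
  (K + 1) (\int[mu]_(x in `[0, 1]) ln (z0.1.1 x)) (cont_meas cut) (fun x _ => lim_ge0 t x)
  (fun j x _ => ltac:(by rewrite (st_ge0 (ap_state (ap j) t) x)/=; apply: le_trans (ap_le (ap j) t x) _; rewrite lerDl))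
  (ltac:(by rewrite lerDr ltW))
  (fun j => st_pos (ap_state (ap j) t)) (fun j => st_ln (ap_state (ap j) t))
  (fun j => ap_ln (ap j) t) (fun x _ => lim_cvg (t := t) (x := x)).
(* Positivity is obtained on one period and carried to the line by integer translations. *)
have H1 : {ae mu, forall x, forall n m : nat, 0 <= x + (n%:R - m%:R) <= 1 -> 0 < u t (x + (n%:R - m%:R))}.
  apply/ae_foralln => n; apply/ae_foralln => m.
  have : {ae mu, forall x, 0 <= x <= 1 -> 0 < u t x}.
    by apply: ae_imp H => x; rewrite /= in_itv.
  exact: ae_shift.
apply: ae_imp H1 => x h.
have [n [m E]] := frac_shift x; have /andP[f0 f1] := frac_itv x.
have E' : frac x = x + (m%:R - n%:R) by rewrite {2}E; ring.
have := h m n; rewrite per_shift; last exact: lim_per.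
by apply; rewrite -E' f0 ltW.
Qed.

End limit.
End compactness.

(** * Step functions of time *)

Section simple_functions.
Context (R : realType).
Local Notation mu := (@lebesgue_measure R).

(** Values in an arbitrary type: a tuple of functions is handled as one step function, and any
    operation on the values is an instance of [simple_comp] and [simple_pair]. *)
Definition simple {X : Type} (f : R -> X) : Prop :=
  exists (N : nat) (idx : R -> nat) (g : nat -> X),
    [/\ forall t, (idx t < N)%N,
        forall i, measurable (idx @^-1` [set i] : set (measurableTypeR R)) &
        forall t, f t = g (idx t)].

Lemma simple_comp {X Y : Type} (F : X -> Y) (f : R -> X) : simple f -> simple (F \o f).
Proof.
move=> [N [idx [g [h1 h2 h3]]]]; exists N, idx, (F \o g); split => // t.
by rewrite /= h3.
Qed.

Lemma simple_pair {X Y : Type} (f : R -> X) (g : R -> Y) : simple f -> simple g ->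
  simple (fun t => (f t, g t)).
Proof.
move=> [N [i1 [f' [l1 m1 E1]]]] [M [i2 [g' [l2 m2 E2]]]].
have M0 : (0 < M)%N := leq_ltn_trans (leq0n _) (l2 0).
exists (N * M)%N, (fun t => i1 t * M + i2 t)%N, (fun k => (f' (k %/ M)%N, g' (k %% M)%N)); split.
- move=> t; apply: (@leq_trans ((i1 t).+1 * M)); first by rewrite mulSn addnC ltn_add2r.
  by rewrite leq_mul2r l1 orbT.
- move=> k; rewrite (_ : _ @^-1` _ = i1 @^-1` [set (k %/ M)%N] `&` i2 @^-1` [set (k %% M)%N]).
    exact: measurableI.
  apply/seteqP; split => t /=.
    by move=> <-; rewrite divnMDl// divn_small// addn0 modnMDl modn_small.
  by move=> [-> ->]; rewrite -divn_eq.
- by move=> t; rewrite divnMDl// divn_small// addn0 modnMDl modn_small// E1 E2.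
Qed.

Lemma simple_shift {X : Type} (f : R -> X) (c : R) : simple f -> simple (fun t => f (t + c)).
Proof.
move=> [N [idx [g [h1 h2 h3]]]]; exists N, (fun t => idx (t + c)), g; split => // i.
rewrite -[X in measurable X]setTI.
exact: (@measurable_shiftr R c measurableT _ (h2 i)).
Qed.

(** The finitely many values are realised at actual times, so a property known of all [f t] holds
    for them. The default 0 is reached only for indices that are never attained. *)
Lemma simple_range {X : Type} (f : R -> X) : simple f ->
  exists (N : nat) (idx : R -> nat) (s : nat -> R),
    [/\ forall t, (idx t < N)%N,
        forall i, measurable (idx @^-1` [set i] : set (measurableTypeR R)) &
        forall t, f t = f (s (idx t))].
Proof.
move=> [N [idx [g [h1 h2 h3]]]]; exists N, idx, (fun i => xget 0 [set t | idx t = i]).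
split => // t; rewrite h3 [in RHS]h3; congr g.
by have : [set t' | idx t' = idx t] (xget 0 [set t' | idx t' = idx t]) by apply: xgetPex; exists t.
Qed.

Lemma simple_sum (f : R -> R -> R) : simple f ->
  exists (N : nat) (idx : R -> nat) (s : nat -> R),
    [/\ forall t, (idx t < N)%N,
        forall i, measurable (idx @^-1` [set i] : set (measurableTypeR R)) &
        f = fun t x => \sum_(i < N) \1_(idx @^-1` [set (i : nat)]) t * f (s i) x].
Proof.
move=> /simple_range[N [idx [s [h1 h2 h3]]]]; exists N, idx, s; split => //.
apply/funext => t; apply/funext => x; rewrite (bigD1 (Ordinal (h1 t)))//= big1 => [|i ni].
  by rewrite addr0 indicE mem_set// mul1r -h3.
rewrite indicE memNset ?mul0r// => /= it; move/eqP: ni; apply.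
by apply/val_inj; rewrite /= it.
Qed.

Lemma simple_Hper_intro (k : nat) (f : R -> R -> R) : simple f -> (forall t, Hper k (f t)) ->
  simple_Hper k f.
Proof.
move=> /simple_sum[N [idx [s [h1 h2 h3]]]] Hf.
exists N, (fun i => idx @^-1` [set (i : nat)]), (fun i => f (s i)); split => //.
by move=> i; exact: h2.
Qed.

Lemma simple_meas2 (f : R -> R -> R) : simple f -> (forall t, mfun1 setT (f t)) ->
  measurable_fun setT (fun p : measurableTypeR R * measurableTypeR R => f p.1 p.2).
Proof.
move=> /simple_sum[N [idx [s [h1 h2 h3]]]] mf.
rewrite (_ : (fun p => f p.1 p.2) =
  fun p => \sum_(i < N) \1_(idx @^-1` [set (i : nat)]) p.1 * f (s i) p.2); last first.
  by apply/funext => p; rewrite {1}h3.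
apply: (@measurable_sum _ _ _ _ _ _ (fun i (p : measurableTypeR R * measurableTypeR R) => \1_(idx @^-1` [set (nat_of_ord i)]) p.1 * f (s i) p.2)) => i.
apply: measurable_funM.
  by apply: measurableT_comp; [exact: measurable_indic|exact: measurable_fst].
by apply: measurableT_comp; [exact: mf|exact: measurable_snd].
Qed.

Lemma simple_bdd (f : R -> R) : simple f -> exists2 C, 0 <= C & forall t, `|f t| <= C.
Proof.
move=> /simple_range[N [idx [s [h1 _ h3]]]].
exists (\sum_(i < N) `|f (s i)|); first by apply: sumr_ge0.
move=> t; rewrite h3 (bigD1 (Ordinal (h1 t)))//= lerDl; exact: sumr_ge0.
Qed.

Lemma simple_itg (f : R -> R) (a b : R) : simple f -> itg mu `[a, b] f.
Proof.
move=> sf; have [C _ HC] := simple_bdd sf.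
apply: (@itg_bdd _ _ _ mu _ (mI a b) f C); [exact: itv_fin| |by move=> x _; exact: HC].
(* A scalar step function is read as a family of functions constant in x. *)
have [N [idx [s [h1 h2 h3]]]] := simple_sum (simple_comp (fun c : R => fun _ : R => c) sf).
have E t : f t = \sum_(i < N) \1_(idx @^-1` [set (i : nat)]) t * f (s i).
  by have := congr1 (fun F => F t 0) h3.
rewrite (funext E); apply: measurable_sum => i; apply: measurable_funM => //.
Qed.

(** The closed rectangle, convenient for iterated integrals; it differs from the half-open
    fundamental domains of the statement by null sets. *)
Definition QT (T : R) : set (measurableTypeR R * measurableTypeR R) := `[0, T] `*` `[0, 1].

Lemma mQT T : measurable (QT T).
Proof. by apply: measurableX; exact: mI. Qed.

Lemma finQT T : (mu2 (QT T) < +oo)%E.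
Proof.
rewrite product_measure1E; try exact: mI.
apply: lte_mul_pinfty; [exact: measure_ge0| |exact: itv_fin].
by rewrite ge0_fin_numE ?measure_ge0//; exact: itv_fin.
Qed.

Lemma simple_sqi (T : R) (f : R -> R -> R) : simple f -> (forall t, l2p (f t)) ->
  sqi mu2 (QT T) (fun p => f p.1 p.2) /\
  \int[mu2]_(p in QT T) (f p.1 p.2 ^+ 2) = \int[mu]_(t in `[0, T]) nrm2 (f t).
Proof.
move=> sf lf; have mf := simple_meas2 sf (fun t => let: And3 m _ _ := lf t in m).
have mfQ : measurable_fun (QT T) (fun p => f p.1 p.2) by exact: measurable_funS mf.
have sq : itg mu2 (QT T) (fun p : R * R => f p.1 p.2 ^+ 2).
  apply: (@itg_prod R `[0, T] `[0, 1] (fun t x => f t x ^+ 2)).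
  - exact: mI.
  - exact: mI.
  - exact: measurable_funX.
  - by move=> t x _ _; exact: sqr_ge0.
  - by move=> t _; have [_ _ []] := lf t.
  - exact: (@simple_itg (fun t => nrm2 (f t)) 0 T (simple_comp (@nrm2 R) sf)).
split; first by split.
by have [_ -> _ _] := @Int_fubini R `[0, T] `[0, 1] (fun t x => f t x ^+ 2) (mI _ _) (mI _ _) sq.
Qed.

End simple_functions.

Section quadratic.
Context d (X : measurableType d) (R : realType).
Context (mu : {measure set X -> \bar R}) (D : set X) (mD : measurable D).

Lemma sq_mid (f g : X -> R) : sqi mu D f -> sqi mu D g ->
  \int[mu]_(x in D) (2^-1 * (f x + g x)) ^+ 2 =
  2^-1 * \int[mu]_(x in D) f x ^+ 2 + 2^-1 * \int[mu]_(x in D) g x ^+ 2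
  - 4^-1 * \int[mu]_(x in D) (f x - g x) ^+ 2.
Proof.
move=> sf sg; have sB := sqiB mD sf sg; have [_ fi] := sf; have [_ gi] := sg; have [_ bi] := sB.
rewrite -!(IntZ mD)// -(IntD mD); try exact: (itgZ mD).
rewrite -(IntB mD); [|by apply: (itgD mD); exact: (itgZ mD)|exact: (itgZ mD)].
by apply: eq_Int => x _; field.
Qed.

End quadratic.

(** * Strong limits of convex combinations *)

Section hull.
Context (R : realType).
Local Notation mu := (@lebesgue_measure R).
Let m01 := mI (0 : R) 1.

(** The solution, its first two space derivatives and its time derivative, kept together so that one
    and the same convex combination acts on all four. *)
Record quad : Type := Quad {
  qU : R -> R -> R; qP : R -> R -> R; qQ : R -> R -> R; qV : R -> R -> R }.

Definition qmid (a b : quad) : quad :=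
  Quad (fun t x => 2^-1 * (qU a t x + qU b t x)) (fun t x => 2^-1 * (qP a t x + qP b t x))
    (fun t x => 2^-1 * (qQ a t x + qQ b t x)) (fun t x => 2^-1 * (qV a t x + qV b t x)).

Record good (a : quad) : Prop := Good {
  g_simple : simple (fun t => (qU a t, qP a t, qQ a t, qV a t));
  g_h2 : forall t, h2 (qU a t) (qP a t) (qQ a t);
  g_l2 : forall t, l2p (qV a t) }.

Lemma l2p_mid (f g : R -> R) : l2p f -> l2p g -> l2p (fun x => 2^-1 * (f x + g x)).
Proof.
move=> lf lg; have l0 : l2p (fun=> 0 : R) by apply: cont_l2p => // x; exact: cvg_cst.
have := l2p_lin 2^-1 (l2p_lin 2^-1 l0 lf) lg.
by congr l2p; apply/funext => x; rewrite add0r mulrDr.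
Qed.

Lemma h2_mid (u p q u' p' q' : R -> R) : h2 u p q -> h2 u' p' q' ->
  h2 (fun x => 2^-1 * (u x + u' x)) (fun x => 2^-1 * (p x + p' x)) (fun x => 2^-1 * (q x + q' x)).
Proof.
move=> h h'; have := h2_lin 2^-1 (h2_lin 2^-1 (h2_cst 0) h) h'.
by congr h2; apply/funext => x; rewrite add0r mulrDr.
Qed.

Lemma good_mid a b : good a -> good b -> good (qmid a b).
Proof.
move=> [sa ha la] [sb hb lb]; split.
- pose F (p : ((R -> R) * (R -> R) * (R -> R) * (R -> R)) * ((R -> R) * (R -> R) * (R -> R) * (R -> R))) :=
    (fun x => 2^-1 * (p.1.1.1.1 x + p.2.1.1.1 x), fun x => 2^-1 * (p.1.1.1.2 x + p.2.1.1.2 x),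
     fun x => 2^-1 * (p.1.1.2 x + p.2.1.2 x), fun x => 2^-1 * (p.1.2 x + p.2.2 x)).
  exact: (simple_comp F (simple_pair sa sb)).
- by move=> t; exact: h2_mid.
- by move=> t; exact: l2p_mid.
Qed.

Context (T K : R) (T0 : 0 < T) (K0 : 0 < K) (z0 : triple R).
Context (u : R -> R -> R) (tau_ : nat -> R) (Z_ : nat -> R -> triple R).
Context (ap : forall j, approx T (tau_ j) K z0 (Z_ j)).
Context (tau01 : forall j, 0 < tau_ j <= T / j.+1%:R).
Context (cu : forall j t x, `|(Z_ j t).1.1 x - u t x| <= j.+1%:R^-1).
Context (cus : forall j t x, `|(Z_ j (t - tau_ j)).1.1 x - u t x| <= j.+1%:R^-1).
Let mQ := @mQT R T.
Let tau0 := tau0 tau01.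

Definition vdiff (j : nat) (t x : R) : R :=
  ((Z_ j t).1.1 x - (Z_ j (t - tau_ j)).1.1 x) / tau_ j.

Definition qseq (j : nat) : quad :=
  Quad (fun t => (Z_ j t).1.1) (fun t => (Z_ j t).1.2) (fun t => (Z_ j t).2) (vdiff j).

Lemma vdiff_l2 j t : l2p (vdiff j t).
Proof.
have [lu _ _ _ _] := st_h2 (ap_state (ap j) t).
have [lu' _ _ _ _] := st_h2 (ap_state (ap j) (t - tau_ j)).
have l0 : l2p (fun=> 0 : R) by apply: cont_l2p => // x; exact: cvg_cst.
have := l2p_lin (tau_ j)^-1 l0 (l2p_lin (-1) lu lu').
by congr l2p; apply/funext => x; rewrite add0r mulN1r mulrC.
Qed.

Lemma qseq_good j : good (qseq j).
Proof.
have sZ : simple (Z_ j).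
  by have [N [idx [g [h1 h2 _ h3]]]] := ap_steps (ap j); exists N, idx, g; split.
split.
- pose F (p : triple R * triple R) :=
    (p.1.1.1, p.1.1.2, p.1.2, fun x => (p.1.1.1 x - p.2.1.1 x) / tau_ j).
  exact: (simple_comp F (simple_pair sZ (simple_shift (- tau_ j) sZ))).
- by move=> t; exact: st_h2 (ap_state (ap j) t).
- exact: vdiff_l2.
Qed.

Lemma good_sqi a : good a ->
  [/\ sqi mu2 (QT T) (fun p => qV a p.1 p.2), sqi mu2 (QT T) (fun p => qQ a p.1 p.2),
    \int[mu2]_(p in QT T) (qV a p.1 p.2 ^+ 2) = \int[mu]_(t in `[0, T]) nrm2 (qV a t),
    \int[mu2]_(p in QT T) (qQ a p.1 p.2 ^+ 2) = \int[mu]_(t in `[0, T]) nrm2 (qQ a t) &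
    itg mu `[0, T] (fun t => energy2 (qP a t) (qQ a t))].
Proof.
move=> [sa ha la].
have sV : simple (qV a) := simple_comp (fun p => p.2) sa.
have sQ : simple (qQ a) := simple_comp (fun p => p.1.2) sa.
have [i1 I1] := simple_sqi T sV la.
have [i2 I2] := simple_sqi T sQ (fun t => h2q (ha t)).
split => //; apply: simple_itg.
exact: (simple_comp (fun p => energy2 p.1.1.2 p.1.2) sa).
Qed.

Definition wt (eps : R) (p : R * R) : R := u p.1 p.2 + eps.
Let ucont := lim_cont K0 ap tau01 cu.
Let uge0 := lim_ge0 ap cu.

Lemma wt_meas eps (D : set (measurableTypeR R * measurableTypeR R)) :
  measurable_fun D (fun p : measurableTypeR R * measurableTypeR R => wt eps p).
Proof.
apply: measurable_funTS; apply: measurable_funD; last exact: measurable_cst.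
apply: (@measurable_fun_cvg _ _ _ _ (fun j p => (Z_ j p.1).1.1 p.2)) => [j|p _]; last exact: lim_cvg.
have g := qseq_good j.
apply: (simple_meas2 (simple_comp (fun p => p.1.1.1) (g_simple g))) => t.
by have [m _ _] := h2u (g_h2 g t).
Qed.

Lemma wt_gt0 eps p : 0 < eps -> 0 < wt eps p.
Proof. by move=> e0; rewrite ltr_wpDl. Qed.

Definition dissip (eps : R) (V : R -> R -> R) : R :=
  \int[mu2]_(p in QT T) (2 * V p.1 p.2 ^+ 2 / wt eps p).

Lemma itg_wt eps f : 0 < eps -> itg mu2 (QT T) f -> itg mu2 (QT T) (fun p => f p / wt eps p).
Proof.
move=> e0 fi; apply: (@itg_ext _ _ _ mu2 _ mQ (fun p => (wt eps p)^-1 * f p)).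
  by move=> p _; rewrite mulrC.
apply: (@itg_mul_bdd _ _ _ mu2 _ mQ _ f eps^-1) => //.
  apply: measurable_funTS; apply: measurableT_comp; [exact: measurable_invr|exact: wt_meas].
move=> p _; have w0 := wt_gt0 p e0; rewrite ger0_norm; last by rewrite invr_ge0 ltW.
by rewrite lef_pV2 ?posrE// lerDr.
Qed.

Lemma dissip_itg eps V : 0 < eps -> sqi mu2 (QT T) (fun p => V p.1 p.2) ->
  itg mu2 (QT T) (fun p => 2 * V p.1 p.2 ^+ 2 / wt eps p).
Proof. by move=> e0 [_ Vi]; apply: itg_wt => //; exact: (itgZ mQ). Qed.

(** When 1/(j+1) <= eps the weight u + eps dominates the approximation and its shift, by [cu] and
    [cus], so it is admissible in every step at once; the energies telescope in time. *)
Lemma qseq_dissip j eps : j.+1%:R^-1 <= eps -> enz (Z_ j T) + dissip eps (qV (qseq j)) <= enz z0.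
Proof.
move=> je; have e0 : 0 < eps by apply: lt_le_trans je; rewrite invr_gt0.
have [sV _ _ _ _] := good_sqi (qseq_good j).
have di := dissip_itg e0 sV.
have [_ I _ gi] := @Int_fubini R `[0, T] `[0, 1] (fun t x => 2 * qV (qseq j) t x ^+ 2 / wt eps (t, x)) (mI _ _) (mI _ _) di.
rewrite /dissip I; have [i1 i2 E] := ap_shift (ap j) (@enz R).
have mT := mI 0 T.
have i3 : itg mu `[0, T] (fun t => (tau_ j)^-1 * (enz (Z_ j (t - tau_ j)) - enz (Z_ j t))).
  by apply: (itgZ mT); exact: (itgB mT).
have -> : enz z0 = enz (Z_ j T) + \int[mu]_(t in `[0, T]) ((tau_ j)^-1 * (enz (Z_ j (t - tau_ j)) - enz (Z_ j t))).
  rewrite (IntZ mT) ?(IntB mT)//; last exact: (itgB mT).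
  by rewrite E mulKf ?gt_eqF// addrC subrK.
rewrite lerD2l; apply: (Int_le_ae mT) => //.
have : {ae mu, forall t, t != 0}.
  exists [set 0]; split => //; first exact: lebesgue_measure_set1.
  by move=> x /= /negP; rewrite negbK => /eqP.
apply: ae_imp => t tn0; rewrite /= in_itv/= => /andP[t0 tT].
have {}t0 : 0 < t by rewrite lt_def tn0.
have cut : continuous (fun x => u t x + eps).
  have [p [q [hu _]]] := lim_h2 ap cu t; have [c _] := h2_cont hu.
  by move=> x; apply: cvgD; [exact: c|exact: cvg_cst].
have le (t' : R) x : `|(Z_ j t').1.1 x - u t x| <= j.+1%:R^-1 -> (Z_ j t').1.1 x <= u t x + eps.
  by rewrite ler_norml => /andP[_]; rewrite lerBlDl => /le_trans; apply; rewrite lerD2l.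
have := eu_energy (ap_euler (ap j) t0 tT) cut (fun x => wt_gt0 (t, x) e0)
  (fun x => le _ _ (cus j t x)) (fun x => le _ _ (cu j t x)).
rewrite ler_pdivlMl; last exact: tau0.
by rewrite /qV/= /vdiff /wt/=; lra.
Qed.

Lemma qseq_mass j : \int[mu]_(x in `[0, 1]) (Z_ j T).1.1 x +
  \int[mu]_(t in `[0, T]) enz (Z_ j t) <= \int[mu]_(x in `[0, 1]) z0.1.1 x.
Proof.
have [i1 i2 E] := ap_shift (ap j) (fun z => \int[mu]_(x in `[0, 1]) z.1.1 x).
have [i3 _ _] := ap_shift (ap j) (@enz R).
have mT := mI 0 T.
have : \int[mu]_(t in `[0, T]) (tau_ j * enz (Z_ j t)) <=
  \int[mu]_(t in `[0, T]) (\int[mu]_(x in `[0, 1]) (Z_ j (t - tau_ j)).1.1 x - \int[mu]_(x in `[0, 1]) (Z_ j t).1.1 x).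
  apply: (Int_le_ae mT); [exact: (itgZ mT)|exact: (itgB mT)|].
  have : {ae mu, forall t, t != 0}.
    exists [set 0]; split => //; first exact: lebesgue_measure_set1.
    by move=> x /= /negP; rewrite negbK => /eqP.
  apply: ae_imp => t tn0; rewrite /= in_itv/= => /andP[t0 tT].
  have {}t0 : 0 < t by rewrite lt_def tn0.
  by have := eu_mass (ap_euler (ap j) t0 tT); rewrite lerBrDl.
rewrite (IntZ mT)// (IntB mT)// E ler_pM2l ?tau0//; lra.
Qed.

(** Discretising the time variable exhibits f on the strip as a pointwise limit of functions that
    are simple in time and continuous in x. *)
Lemma cont_meas2 (f : R -> R -> R) : continuous (fun p : R * R => f p.1 p.2) ->
  measurable_fun (`[0, T] `*` setT : set (measurableTypeR R * measurableTypeR R))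
    (fun p => f p.1 p.2).
Proof.
move=> cf; pose s (M : nat) t := (tidx (T / M.+1%:R) M.+1 t)%:R * (T / M.+1%:R).
have tp (M : nat) : 0 < T / M.+1%:R by rewrite divr_gt0.
have TE (M : nat) : T = M.+1%:R * (T / M.+1%:R) by rewrite mulrC divfK.
have ss M : simple (s M).
  exists M.+2, (tidx (T / M.+1%:R) M.+1), (fun i => i%:R * (T / M.+1%:R)); split => //.
    by move=> t; rewrite ltnS tidx_le.
  exact: tidx_meas.
have sT t : 0 <= t <= T -> s M t @[M --> \oo] --> t.
  move=> /andP[t0 tT].
  have cT : T * M.+1%:R^-1 @[M --> \oo] --> 0.
    by rewrite -[X in _ --> X](mulr0 T); apply: cvgM; [exact: cvg_cst|exact: cvg_harmonic].
  apply/cvgrPdist_le => e e0; move: cT => /cvgrPdist_le/(_ e e0); apply: filterS => M.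
  rewrite sub0r normrN (ger0_norm (ltW (tp M))); apply: le_trans.
  move: t0; rewrite le_eqVlt => /predU1P[<-|t0].
    by rewrite /s tidx0// mul0r subr0 normr0 ltW.
  have [n nM h] := tidxP (tp M) (TE M) t0 tT; rewrite /s (tidx_eq (tp M) nM h).
  move: h => /andP[h1 h2]; rewrite distrC ger0_norm ?subr_ge0//.
  by rewrite -[n.+1%:R]natr1 mulrDl mul1r lerBlDl lerD2r ltW.
have cf' t x : {for (t, x), continuous (fun p : R * R => f p.1 p.2)} by exact: cf.
apply: (@measurable_fun_cvg _ _ _ _ (fun M p => f (s M p.1) p.2)) => [M|[t x] /=].
  apply: measurable_funTS.
  apply: (@simple_meas2 _ (fun t x => f (s M t) x)); first exact: (simple_comp f (ss M)).
  move=> t; apply: cont_meas => x.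
  apply: (@continuous_comp _ _ _ (fun x : R => (s M t, x)) (fun p : R * R => f p.1 p.2)); last exact: cf.
  move=> A [[B C] /= [hB hC] BC]; apply: filterS hC => y Cy.
  by apply: BC; split => //=; exact: nbhs_singleton hB.
rewrite in_itv/= => -[tT _].
have c : (s M t, x) @[M --> \oo] --> (t, x).
  move=> A [[B C] /= [hB hC] BC].
  have [N _ HN] : \forall M \near \oo, B (s M t) := sT t tT B hB.
  exists N => // M NM; apply: BC; split => /=; first exact: HN.
  exact: nbhs_singleton hC.
exact: (@cvg_comp _ _ _ (fun M => (s M t, x)) (fun p : R * R => f p.1 p.2) _ _ _ c (cf' t x)).
Qed.

Let hull n a := mhull qmid qseq n a.

Lemma hull_good n a : hull n a -> good a.
Proof. by elim=> [j _|x y _ gx _ gy]; [exact: qseq_good|exact: good_mid]. Qed.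

Lemma hull_close n a : hull n a -> forall t x, `|qU a t x - u t x| <= n.+1%:R^-1.
Proof.
elim=> [j nj t x|a1 a2 _ IH1 _ IH2 t x].
  by apply: le_trans (cu j t x) _; rewrite lef_pV2 ?posrE// ler_nat ltnS.
have := IH1 t x; have := IH2 t x; rewrite /qmid/= !ler_norml; set e := n.+1%:R^-1.
by move=> /andP[? ?] /andP[? ?]; apply/andP; split; lra.
Qed.

Lemma energy2_mid_le (v p q v' p' q' : R -> R) : h2 v p q -> h2 v' p' q' ->
  energy2 (fun x => 2^-1 * (p x + p' x)) (fun x => 2^-1 * (q x + q' x)) <=
  2^-1 * energy2 p q + 2^-1 * energy2 p' q'.
Proof.
move=> [_ [_ _ sp] [_ _ sq] _ _] [_ [_ _ sp'] [_ _ sq'] _ _].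
rewrite /energy2 !nrm2_mid//; have := nrm2_ge0 (fun x => p x - p' x).
by have := nrm2_ge0 (fun x => q x - q' x); lra.
Qed.

(** With the weight u + eps fixed, energy plus dissipation is convex in the combination, so the
    bound of the sequence extends to the hull. *)
Lemma hull_energy n a : hull n a -> forall eps, n.+1%:R^-1 <= eps ->
  energy2 (qP a T) (qQ a T) + dissip eps (qV a) <= enz z0.
Proof.
move=> ha eps ne; have e0 : 0 < eps by apply: lt_le_trans ne; rewrite invr_gt0.
elim: ha => [j nj|a1 a2 h1 IH1 h2 IH2].
  by apply: qseq_dissip; apply: le_trans ne; rewrite lef_pV2 ?posrE// ler_nat ltnS.
have g1 := hull_good h1; have g2 := hull_good h2.
have [s1 _ _ _ _] := good_sqi g1; have [s2 _ _ _ _] := good_sqi g2.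
have [s3 _ _ _ _] := good_sqi (good_mid g1 g2).
have d1 := dissip_itg e0 s1; have d2 := dissip_itg e0 s2; have d3 := dissip_itg e0 s3.
have E := energy2_mid_le (g_h2 g1 T) (g_h2 g2 T).
have : dissip eps (qV (qmid a1 a2)) <= 2^-1 * dissip eps (qV a1) + 2^-1 * dissip eps (qV a2).
  rewrite /dissip -!(IntZ mQ)// -(IntD mQ); try exact: (itgZ mQ).
  apply: (Int_le mQ) => //; first by apply: (itgD mQ); exact: (itgZ mQ).
  move=> p _; have w0 := wt_gt0 p e0.
  have w1 : 0 <= (wt eps p)^-1 by rewrite invr_ge0 ltW.
  rewrite !mulrA -mulrDl; apply: ler_wpM2r => //.
  by rewrite /qmid/=; have := sqr_ge0 (qV a1 p.1 p.2 - qV a2 p.1 p.2); lra.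
by move: E IH1 IH2; rewrite /qmid/=; lra.
Qed.

Lemma good_Uitg a t : good a -> itg mu `[0, 1] (qU a t).
Proof. by move=> g; have [c _] := h2_cont (g_h2 g t); exact: itg_cont. Qed.

Lemma hull_mass n a : hull n a ->
  \int[mu]_(x in `[0, 1]) qU a T x + \int[mu]_(t in `[0, T]) energy2 (qP a t) (qQ a t) <=
  \int[mu]_(x in `[0, 1]) z0.1.1 x.
Proof.
have mT := mI 0 T; elim=> [j nj|a1 a2 h1 IH1 h2 IH2]; first exact: qseq_mass.
have g1 := hull_good h1; have g2 := hull_good h2.
have u1 := good_Uitg T g1; have u2 := good_Uitg T g2.
have [_ _ _ _ e1] := good_sqi g1; have [_ _ _ _ e2] := good_sqi g2.
have [_ _ _ _ e3] := good_sqi (good_mid g1 g2).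
have -> : \int[mu]_(x in `[0, 1]) qU (qmid a1 a2) T x =
    2^-1 * (\int[mu]_(x in `[0, 1]) qU a1 T x + \int[mu]_(x in `[0, 1]) qU a2 T x).
  by rewrite -(IntD m01 u1 u2) -(IntZ m01 _ (itgD m01 u1 u2)).
have : \int[mu]_(t in `[0, T]) energy2 (qP (qmid a1 a2) t) (qQ (qmid a1 a2) t) <=
    2^-1 * \int[mu]_(t in `[0, T]) energy2 (qP a1 t) (qQ a1 t) +
    2^-1 * \int[mu]_(t in `[0, T]) energy2 (qP a2 t) (qQ a2 t).
  rewrite -!(IntZ mT)// -(IntD mT); try exact: (itgZ mT).
  apply: (Int_le mT) => //; first by apply: (itgD mT); exact: (itgZ mT).
  move=> t _; exact: energy2_mid_le (g_h2 g1 t) (g_h2 g2 t).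
have mid_le (b1 b2 c1 c2 e c : R) : b1 + c1 <= c -> b2 + c2 <= c ->
  e <= 2^-1 * c1 + 2^-1 * c2 -> 2^-1 * (b1 + b2) + e <= c by lra.
exact: mid_le IH1 IH2.
Qed.

Lemma itg_QT_mul (f psi : R * R -> R) (C : R) : measurable_fun (QT T) psi ->
  (forall p, `|psi p| <= C) -> sqi mu2 (QT T) f -> itg mu2 (QT T) (fun p => f p * psi p).
Proof.
move=> mpsi HC sf; have fi := sqi_itg mQ (finQT T) sf.
apply: (itg_ext mQ _ (itg_mul_bdd mQ mpsi (fun p _ => HC p) fi)) => p _; exact: mulrC.
Qed.

(** A closed interval around c is convex and the pairing is linear; combinations of the tail are
    thus tested as well as the tail itself. *)
Lemma hull_lin n a (psi : R * R -> R) (C c e : R) : hull n a ->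
  measurable_fun (QT T) psi -> (forall p, `|psi p| <= C) ->
  (forall j, (n <= j)%N -> `|\int[mu2]_(p in QT T) (vdiff j p.1 p.2 * psi p) - c| <= e) ->
  `|\int[mu2]_(p in QT T) (qV a p.1 p.2 * psi p) - c| <= e.
Proof.
move=> ha mpsi HC H; elim: ha => [j nj|a1 a2 h1 IH1 h2 IH2]; first exact: H.
have g1 := hull_good h1; have g2 := hull_good h2.
have [s1 _ _ _ _] := good_sqi g1; have [s2 _ _ _ _] := good_sqi g2.
have i1 := itg_QT_mul mpsi HC s1; have i2 := itg_QT_mul mpsi HC s2.
have -> : \int[mu2]_(p in QT T) (qV (qmid a1 a2) p.1 p.2 * psi p) =
  2^-1 * \int[mu2]_(p in QT T) (qV a1 p.1 p.2 * psi p) + 2^-1 * \int[mu2]_(p in QT T) (qV a2 p.1 p.2 * psi p).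
  rewrite -!(IntZ mQ)// -(IntD mQ); try exact: (itgZ mQ).
  by apply: eq_Int => p _; rewrite /qmid/=; ring.
move: IH1 IH2; rewrite !ler_norml => /andP[? ?] /andP[? ?]; apply/andP; split; lra.
Qed.

Lemma nrmQT_mid (f g : R * R -> R) : sqi mu2 (QT T) f -> sqi mu2 (QT T) g ->
  \int[mu2]_(p in QT T) ((f p - g p) ^+ 2) = 2 * \int[mu2]_(p in QT T) (f p ^+ 2) +
   2 * \int[mu2]_(p in QT T) (g p ^+ 2) - 4 * \int[mu2]_(p in QT T) ((2^-1 * (f p + g p)) ^+ 2).
Proof. by move=> sf sg; rewrite (sq_mid mQ)//; lra. Qed.

(** The summand T comes from the energy bound at each time, the summand K + 1 from the weight u + 1
    <= K + 1 in the dissipation with eps = 1. *)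
Lemma qseq_bdd j :
  \int[mu2]_(p in QT T) (qQ (qseq j) p.1 p.2 ^+ 2) + \int[mu2]_(p in QT T) (qV (qseq j) p.1 p.2 ^+ 2) <=
  (T + (K + 1)) * enz z0.
Proof.
have g := qseq_good j; have [sV sQ IV -> _] := good_sqi g; have mT := mI 0 T.
have E0 : 0 <= enz z0 by exact: energy2_ge0.
rewrite mulrDl; apply: lerD.
  have -> : T * enz z0 = \int[mu]_(t in `[0, T]) enz z0.
    rewrite Rintegral_cst// mulrC; congr (_ * _); have := lebesgue_measure_itv (`[0, T]).
    by rewrite /= lte_fin T0 => ->; rewrite /= subr0.
  apply: (Int_le mT) => [||t _].
  - exact: (simple_itg 0 T (simple_comp (fun p => nrm2 p.1.2) (g_simple g))).
  - by apply: itg_cst => //; exact: itv_fin.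
  - by apply: le_trans (ap_en (ap j) t); rewrite lerDl nrm2_ge0.
have j1 : j.+1%:R^-1 <= 1 :> R by rewrite invf_le1// ler1n.
have := qseq_dissip j1; have := energy2_ge0 (Z_ j T).1.2 (Z_ j T).2.
rewrite -/(enz (Z_ j T)) => e0 h.
have : dissip 1 (qV (qseq j)) <= enz z0 by lra.
have di := dissip_itg ltr01 sV; have [_ Vi] := sV.
move=> {}h; apply: (@le_trans _ _ ((K + 1) * dissip 1 (qV (qseq j)))); last first.
  by rewrite ler_wpM2l// ltW// ltr_wpDl// ltW.
rewrite /dissip -(IntZ mQ)//; apply: (Int_le mQ) => //; first exact: (itgZ mQ).
move=> p _; have w0 := wt_gt0 p ltr01.
rewrite mulrA ler_pdivlMr//.
have wK : wt 1 p <= K + 1 by rewrite lerD2r; exact: (lim_le ap cu).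
set V2 := _ ^+ 2; have V0 : 0 <= V2 by exact: sqr_ge0.
have : V2 * wt 1 p <= V2 * (K + 1) by rewrite ler_wpM2l.
have : 0 <= V2 * (K + 1) by rewrite mulr_ge0// ltW// ltr_wpDl// ltW.
lra.
Qed.

(** Mazur's lemma for the sum of two squared norms, so that time derivatives and second space
    derivatives converge along the same combinations. For the latter the Cauchy estimate is kept as
    it stands: the limit is identified with derivatives of u only later, one time at a time. *)
Lemma hull_limit : exists (a : nat -> quad) (v : R -> R -> R),
  [/\ forall n, hull n (a n),
    measurable_fun setT (fun p : measurableTypeR R * measurableTypeR R => v p.1 p.2),
    sqi mu2 (QT T) (fun p => v p.1 p.2) & forall t x, v t (x + 1) = v t x] /\
  [/\ forall n, \int[mu2]_(p in QT T) ((v p.1 p.2 - qV (a n) p.1 p.2) ^+ 2) <= 8^-1 ^+ n &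
    forall n m, (n <= m)%N ->
      \int[mu2]_(p in QT T) ((qQ (a m) p.1 p.2 - qQ (a n) p.1 p.2) ^+ 2) <= 8^-1 ^+ n].
Proof.
pose NQ (f : R * R -> R) := \int[mu2]_(p in QT T) (f p ^+ 2).
have NQ0 f : 0 <= NQ f by apply: Rintegral_ge0 => p _; exact: sqr_ge0.
have [a [ha aC]] := @mazur R quad qmid qseq
  (fun a => NQ (fun p => qQ a p.1 p.2) + NQ (fun p => qV a p.1 p.2))
  (fun a b => NQ (fun p => qQ a p.1 p.2 - qQ b p.1 p.2) + NQ (fun p => qV a p.1 p.2 - qV b p.1 p.2))
  ((T + (K + 1)) * enz z0)
  (fun n x y hx hy => ltac:(
    have [sx sx' _ _ _] := good_sqi (hull_good hx); have [sy sy' _ _ _] := good_sqi (hull_good hy);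
    rewrite /NQ (nrmQT_mid sx sy) (nrmQT_mid sx' sy') /qmid/=; ring))
  (fun x => addr_ge0 (NQ0 _) (NQ0 _)) qseq_bdd.
have ga n := hull_good (ha n).
have dV n m : (n <= m)%N -> NQ (fun p => qV (a m) p.1 p.2 - qV (a n) p.1 p.2) <= 8^-1 ^+ n.
  by move=> nm; apply: le_trans (aC n m nm); rewrite lerDr.
have dQ n m : (n <= m)%N -> NQ (fun p => qQ (a m) p.1 p.2 - qQ (a n) p.1 p.2) <= 8^-1 ^+ n.
  by move=> nm; apply: le_trans (aC n m nm); rewrite lerDl.
have mV n : measurable_fun setT (fun p : measurableTypeR R * measurableTypeR R => qV (a n) p.1 p.2).
  apply: (simple_meas2 (simple_comp (fun p => p.2) (g_simple (ga n)))) => t.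
  by have [] := g_l2 (ga n) t.
have [v [mv sv pv _ Lv]] := @complete_sqi _ _ _ mu2 (QT T) mQ (fun n p => qV (a n) p.1 p.2)
  mV (fun n => let: And5 s _ _ _ _ := good_sqi (ga n) in s) dV.
exists a, (fun t x => v (t, x)); split; split => //.
- by move: mv; congr (measurable_fun _ _); apply/funext => -[].
- by move: sv; congr (sqi _ _ _); apply/funext => -[].
- by move=> t x; apply: pv => n /=; have [_ pp _] := g_l2 (ga n) t; exact: pp.
- move=> n; apply: le_trans (Lv n); rewrite le_eqVlt; apply/orP; left; apply/eqP.
  by apply: eq_Int => -[].
Qed.

End hull.

(** * Tools for the limit: interpolation, regular sections, convergence of energies *)

Section regular_limit.
Context (R : realType).
Local Notation mu := (@lebesgue_measure R).
Let m01 := mI (0 : R) 1.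

(** Over an interval of length eta the average of p is a difference quotient of f, at most 2 e /
    eta, and p deviates from it by at most its Hoelder oscillation. This yields continuity in time
    with values in H^1. *)
Lemma h2_p_small (f p q : R -> R) (e eta : R) x : h2 f p q -> (forall x, `|f x| <= e) ->
  0 < eta -> eta <= 1 / 2 -> `|p x| <= 2 * e / eta + Num.sqrt (nrm2 q * eta).
Proof.
move=> hf fe e0 e1; have [[_ pf _] [_ pp _] [_ _ sq] aff apq] := hf.
have [cf cp] := h2_cont hf.
have [y [n [m [/andP[y0 y1] ->]]]] := per_frac x; rewrite per_shift//.
pose a := if y <= 1 / 2 then y else y - eta.
have [a0 a1 aya] : [/\ 0 <= a, a + eta <= 1 & a <= y <= a + eta].
  by rewrite /a; case: ifPn => h; [|rewrite -ltNge in h]; split; try (apply/andP; split); lra.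
have ma := mI a (a + eta); set S := Num.sqrt _.
have IA (c : R) : \int[mu]_(t in `[a, a + eta]) c = c * eta.
  rewrite Rintegral_cst//; congr (_ * _); have := lebesgue_measure_itv (`[a, a + eta]).
  rewrite /= lte_fin ltrDl e0 => ->; rewrite /=; ring.
have ic (c : R) : itg mu `[a, a + eta] (fun=> c) by apply: itg_cst => //; exact: itv_fin.
have pint : itg mu `[a, a + eta] p by exact: itg_cont.
have fs : f (a + eta) - f a = \int[mu]_(t in `[a, a + eta]) p t.
  by apply: (@ac_sub R 1 f p a (a + eta) aff) => //; rewrite lerDl ltW.
have key : `|p y * eta - (f (a + eta) - f a)| <= S * eta.
  rewrite fs -!IA -(IntB ma)//; apply: (Int_abs_le ma) => //; first exact: (itgB ma).
  move=> t; rewrite /= in_itv/= => /andP[t0 t1]; move: aya => /andP[ya1 ya2].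
  rewrite -sqrtr_sqr; apply: ler_wsqrtr.
  have := @ac_holder _ 1 p q t y apq sq; rewrite !y0 (ltW y1) => h.
  have t01 : 0 <= t <= 1 by apply/andP; split; lra.
  apply: le_trans (h t01 isT) _; rewrite mulrC; apply: ler_wpM2l; first exact: nrm2_ge0.
  by rewrite ler_norml; apply/andP; split; lra.
rewrite -(ler_pM2r e0) mulrDl divfK ?gt_eqF// -{1}(gtr0_norm e0) -normrM.
have -> : p y * eta = (p y * eta - (f (a + eta) - f a)) + (f (a + eta) - f a) by ring.
apply: le_trans (ler_normD _ _) _; rewrite addrC; apply: lerD => //.
by apply: le_trans (ler_normB _ _) _; have := fe a; have := fe (a + eta); lra.
Qed.

Lemma ae_fst (P : R -> Prop) : {ae mu, forall t, P t} -> {ae mu2, forall p : R * R, P p.1}.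
Proof.
move=> [N [mN N0 PN]]; exists (N `*` setT); split.
- exact: measurableX.
- by rewrite product_measure1E// [X in (X * _)%E]N0 mul0e.
- by move=> p nP; split => //=; apply: PN.
Qed.

(** A square-integrable function on the rectangle may have bad sections for a null set of times;
    setting it to zero at those times makes every section an element of L^2. *)
Lemma l2p_section_fix (T : R) (v : R -> R -> R) :
  measurable_fun setT (fun p : measurableTypeR R * measurableTypeR R => v p.1 p.2) ->
  sqi mu2 (QT T) (fun p => v p.1 p.2) -> (forall t, per (v t)) ->
  exists v' : R -> R -> R,
    [/\ measurable_fun setT (fun p : measurableTypeR R * measurableTypeR R => v' p.1 p.2),
      forall t, l2p (v' t) & {ae mu2, forall p : R * R, QT T p -> v' p.1 p.2 = v p.1 p.2}].
Proof.
move=> mv [_ sv] pv.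
pose I (t : R) : \bar R := (\int[mu]_(x in `[0%R, 1%R]) ((v t x ^+ 2)%R)%:E)%E.
have mvs t : mfun1 setT (v t).
  have := @measurableT_comp _ _ _ _ _ _ _ _ _ mv (pair1_measurable t). done.
have mI' : measurable_fun (setT : set (measurableTypeR R)) I.
  pose D : set (measurableTypeR R * measurableTypeR R) := setT `*` `[0%R, 1%R]%classic.
  have mD : measurable D by exact: measurableX.
  pose f : measurableTypeR R * measurableTypeR R -> \bar R := (fun p => (v p.1 p.2 ^+ 2)%:E) \_ D.
  have mf : measurable_fun setT f.
    have mDf : measurable_fun D (fun p => (v p.1 p.2 ^+ 2)%:E).
      by apply: measurable_funTS; apply/measurable_EFinP; exact: measurable_funX.
    by have := (measurable_restrictT (fun p : measurableTypeR R * measurableTypeR R => (v p.1 p.2 ^+ 2)%:E) mD).1 mDf.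
  have f0 (p : measurableTypeR R * measurableTypeR R) : (0 <= f p)%E by rewrite /f patchE; case: ifP => // _; rewrite lee_fin sqr_ge0.
  have := @measurable_fun_fubini_tonelli_F _ _ _ _ _ mu f mf f0.
  apply: eq_measurable_fun => t _; rewrite /I/= integral_mkcond.
  apply: eq_integral => x _; rewrite /f !patchE.
  by rewrite in_setX/= in_setT.
pose G : set (measurableTypeR R) := I @^-1` (~` [set +oo%E]).
have mG : measurable G.
  rewrite -[G]setTI; apply: mI' => //; apply: measurableC; exact: emeasurable_set1.
exists (fun t x => \1_G t * v t x); split.
- apply: measurable_funM => //; apply: measurableT_comp; [exact: measurable_indic|exact: measurable_fst].
- move=> t; rewrite indicE; case: (boolP (t \in G)) => tG; last first.
    rewrite (_ : (fun x => _) = fun=> 0); last by apply/funext => x; rewrite mul0r.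
    by apply: cont_l2p => // x; exact: cvg_cst.
  rewrite (_ : (fun x => _) = v t); last by apply/funext => x; rewrite mul1r.
  have mt : mfun1 `[0, 1] (v t) by exact: measurable_funS (mvs t).
  split => //; split => //; apply/integrableP; split.
    by apply/measurable_EFinP; exact: measurable_funX.
  under eq_integral do rewrite /= ger0_norm ?sqr_ge0//.
  by move: tG; rewrite inE => /= /eqP; rewrite ltey.
have [aei _ _ _] := @Int_fubini R `[0, T] `[0, 1] (fun t x => v t x ^+ 2) (mI _ _) (mI _ _) sv.
have := ae_fst aei; apply: ae_imp => -[t x] /= h [tT _].
rewrite indicE mem_set ?mul1r// /G /I /= => E.
have := integrableP _ _ _ (h tT) => -[_].
under eq_integral do rewrite /= ger0_norm ?sqr_ge0//.
by rewrite E ltxx.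
Qed.

Lemma geo_cvg (b : nat -> R) (l C : R) : (forall n, `|b n - l| <= C * 2^-1 ^+ n) ->
  b n @[n --> \oo] --> l.
Proof.
move=> H; have c : (fun n => C * (2^-1 : R) ^+ n) @ \oo --> 0.
  rewrite -[X in _ --> X](mulr0 C); apply: cvgM; first exact: cvg_cst.
  by apply: cvg_expr; rewrite ger0_norm ?invr_ge0// invf_lt1// ltr1n.
apply/cvgrPdist_le => e e0; move: c => /cvgrPdist_le/(_ e e0); apply: filterS => n.
rewrite sub0r normrN distrC => h; apply: le_trans (H n) _; exact: le_trans (ler_norm _) h.
Qed.

(** Young's inequality with a free parameter: with s = 2^-n the main term loses only a factor
    tending to 1, while an error of size 4^-n times 1/s still vanishes. *)
Lemma energy2_young (f p q f' p' q' : R -> R) (s : R) : 0 < s -> h2 f p q -> h2 f' p' q' ->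
  energy2 (fun x => p x + p' x) (fun x => q x + q' x) <=
  (1 + s) * energy2 p q + (1 + s^-1) * energy2 p' q'.
Proof.
move=> s0 [_ [_ _ sp] [_ _ sq] _ _] [_ [_ _ sp'] [_ _ sq'] _ _].
have E (g g' : R -> R) : sqi mu `[0, 1] g -> sqi mu `[0, 1] g' ->
    nrm2 (fun x => g x + g' x) <= (1 + s) * nrm2 g + (1 + s^-1) * nrm2 g'.
  move=> sg sg'; have [_ i3] := sqiD m01 sg sg'; have [_ i1] := sg; have [_ i2] := sg'.
  rewrite /nrm2 -!(IntZ m01)// -(IntD m01); try exact: (itgZ m01).
  apply: (Int_le m01) => //; first by apply: (itgD m01); exact: (itgZ m01).
  move=> x _; have : 0 <= s^-1 * (s * g x - g' x) ^+ 2 by rewrite mulr_ge0 ?sqr_ge0// invr_ge0 ltW.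
  have -> : s^-1 * (s * g x - g' x) ^+ 2 = s * g x ^+ 2 - 2 * (g x * g' x) + s^-1 * g' x ^+ 2.
    by field; rewrite gt_eqF.
  lra.
by have := E _ _ sp sp'; have := E _ _ sq sq'; rewrite /energy2; lra.
Qed.

(** Both sides compute [energy f], so the energy does not depend on the derivatives carried
    along. *)
Lemma energy_triple (f p q p' q' : R -> R) : h2 f p q -> h2 f p' q' -> energy2 p q = energy2 p' q'.
Proof. by move=> h h'; have := energyE h; rewrite (energyE h') => -[] /esym. Qed.

End regular_limit.

Section limit_pair.
Context (R : realType).
Local Notation mu := (@lebesgue_measure R).
Context (T K : R) (T0 : 0 < T) (K0 : 0 < K) (z0 : triple R).
Context (u : R -> R -> R) (tau_ : nat -> R) (Z_ : nat -> R -> triple R).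
Context (ap : forall j, approx T (tau_ j) K z0 (Z_ j)).
Context (tau01 : forall j, 0 < tau_ j <= T / j.+1%:R).
Context (cu : forall j t x, `|(Z_ j t).1.1 x - u t x| <= j.+1%:R^-1).
Context (cus : forall j t x, `|(Z_ j (t - tau_ j)).1.1 x - u t x| <= j.+1%:R^-1).
Let mQ := @mQT R T.
Let hull n a := mhull (@qmid R) (qseq tau_ Z_) n a.

Lemma limit_exists : exists (a : nat -> quad R) (v : R -> R -> R),
  [/\ forall n, hull n (a n),
    measurable_fun setT (fun p : measurableTypeR R * measurableTypeR R => v p.1 p.2),
    forall t, l2p (v t) & sqi mu2 (QT T) (fun p => v p.1 p.2)] /\
  [/\ forall n, \int[mu2]_(p in QT T) ((v p.1 p.2 - qV (a n) p.1 p.2) ^+ 2) <= 8^-1 ^+ n &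
    forall n m, (n <= m)%N ->
      \int[mu2]_(p in QT T) ((qQ (a m) p.1 p.2 - qQ (a n) p.1 p.2) ^+ 2) <= 8^-1 ^+ n].
Proof.
have [a [v [[ha mv sv pv] [Lv LQ]]]] := hull_limit T0 K0 ap tau01 cu cus.
have [v' [mv' lv' e]] := l2p_section_fix mv sv pv.
have mD (f : R * R -> R) : measurable_fun setT (f : measurableTypeR R * measurableTypeR R -> R) ->
  measurable_fun (QT T) f by move=> mf; exact: measurable_funS mf.
exists a, v'; split; split => //.
- split; first exact: mD.
  have [||h _//] := @Int_ae _ _ _ mu2 (QT T) mQ (fun p => v p.1 p.2 ^+ 2) (fun p => v' p.1 p.2 ^+ 2) sv.2.
  + by apply: measurable_funX; exact: mD.
  + by apply: ae_imp e => p h Dp; rewrite h.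
- move=> n; apply: le_trans (Lv n).
  have [sV _ _ _ _] := good_sqi T (hull_good ap (ha n)).
  have [||_ ->//] := @Int_ae _ _ _ mu2 (QT T) mQ (fun p => (v p.1 p.2 - qV (a n) p.1 p.2) ^+ 2)
      (fun p => (v' p.1 p.2 - qV (a n) p.1 p.2) ^+ 2) (sqiB mQ sv sV).2.
  + by apply: measurable_funX; apply: measurable_funB; [exact: mD|case: sV].
  + by apply: ae_imp e => p h Dp; rewrite h.
Qed.

End limit_pair.


(** * Energy, mass and dissipation in the limit *)

Section limit_facts.
Context (R : realType).
Local Notation mu := (@lebesgue_measure R).
Let m01 := mI (0 : R) 1.
Context (T K : R) (T0 : 0 < T) (K0 : 0 < K) (z0 : triple R).
Context (u : R -> R -> R) (tau_ : nat -> R) (Z_ : nat -> R -> triple R).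
Context (ap : forall j, approx T (tau_ j) K z0 (Z_ j)).
Context (tau01 : forall j, 0 < tau_ j <= T / j.+1%:R).
Context (cu : forall j t x, `|(Z_ j t).1.1 x - u t x| <= j.+1%:R^-1).
Context (cus : forall j t x, `|(Z_ j (t - tau_ j)).1.1 x - u t x| <= j.+1%:R^-1).
Context (a : nat -> quad R) (v : R -> R -> R).
Context (ha : forall n, mhull (@qmid R) (qseq tau_ Z_) n (a n)).
Context (mv : measurable_fun setT (fun p : measurableTypeR R * measurableTypeR R => v p.1 p.2)).
Context (lv : forall t, l2p (v t)) (sv : sqi mu2 (QT T) (fun p => v p.1 p.2)).
Context (Lv : forall n, \int[mu2]_(p in QT T) ((v p.1 p.2 - qV (a n) p.1 p.2) ^+ 2) <= 8^-1 ^+ n).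
Context (LQ : forall n m, (n <= m)%N ->
      \int[mu2]_(p in QT T) ((qQ (a m) p.1 p.2 - qQ (a n) p.1 p.2) ^+ 2) <= 8^-1 ^+ n).
Let mQ := @mQT R T.
Let mT := mI 0 T.
Let ga n : good (a n) := hull_good ap (ha n).
Let ga_close n t x := hull_close cu (ha n) t x.

Lemma a_cvg t x : qU (a n) t x @[n --> \oo] --> u t x.
Proof. by apply: inv_cvg => n; exact: ga_close. Qed.

(** The constant 4 C is the fixed point of the induction: twice 4 C 4^-(n+1) plus twice C 4^-n
    equals 4 C 4^-n. *)
Lemma dQ_le (C : R) t : (forall n, nrm2 (fun x => qQ (a n.+1) t x - qQ (a n) t x) <= C * 4^-1 ^+ n) ->
  forall m n, nrm2 (fun x => qQ (a (n + m)%N) t x - qQ (a n) t x) <= 4 * C * 4^-1 ^+ n.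
Proof.
move=> H; have C0 : 0 <= C by have := le_trans (nrm2_ge0 _) (H 0%N); rewrite expr0 mulr1.
have sq n : sqi mu `[0, 1] (qQ (a n) t) by have [_ _ s] := h2q (g_h2 (ga n) t).
elim=> [|m IH] n.
  rewrite addn0 /nrm2 (@eq_IntI _ _ _ _ (fun=> 0)) ?IntC; last by move=> x _; rewrite subrr expr0n.
  by rewrite !mulr_ge0// exprn_ge0// invr_ge0.
have -> : (fun x => qQ (a (n + m.+1)%N) t x - qQ (a n) t x) =
  (fun x => (qQ (a (n.+1 + m)%N) t x - qQ (a n.+1) t x) - (qQ (a n) t x - qQ (a n.+1) t x)).
  by apply/funext => x; rewrite addSnnS; ring.
apply: le_trans (nrm2_sub_le (sqiB m01 (sq _) (sq _)) (sqiB m01 (sq _) (sq _))) _.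
have -> : nrm2 (fun x => qQ (a n) t x - qQ (a n.+1) t x) = nrm2 (fun x => qQ (a n.+1) t x - qQ (a n) t x).
  by apply: eq_IntI => x _; ring.
have := IH n.+1; have := H n; rewrite exprS; set e := 4^-1 ^+ n.
lra.
Qed.

(** At almost every time the second derivatives of the combinations converge geometrically, and
    lower semicontinuity transfers the rate to u itself. The factor 8 is the 4 of [dQ_le] doubled by
    bounding p through q. *)
Lemma ae_close : {ae mu, forall t, 0 <= t <= T -> exists2 C : R, 0 <= C & forall n,
  exists p q, h2 (fun x => u t x - qU (a n) t x) p q /\ energy2 p q <= C * 4^-1 ^+ n}.
Proof.
pose g n t := nrm2 (fun x => qQ (a n.+1) t x - qQ (a n) t x).
have sd n : simple (fun t x => qQ (a n.+1) t x - qQ (a n) t x).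
  pose F (p : ((R -> R) * (R -> R) * (R -> R) * (R -> R)) * ((R -> R) * (R -> R) * (R -> R) * (R -> R))) :=
    (fun x => p.1.1.2 x - p.2.1.2 x).
  exact: (simple_comp F (simple_pair (g_simple (ga n.+1)) (g_simple (ga n)))).
have ld n t : l2p (fun x => qQ (a n.+1) t x - qQ (a n) t x).
  exact: h2q (h2B (g_h2 (ga n.+1) t) (g_h2 (ga n) t)).
have gi n : itg mu `[0, T] (g n) := simple_itg 0 T (simple_comp (@nrm2 R) (sd n)).
have gC n : \int[mu]_(t in `[0, T]) g n t <= 8^-1 ^+ n.
  have [_ <-] := simple_sqi T (sd n) (ld n); exact: LQ.
have := @ae_summable _ _ _ mu `[0, T] mT g gi (fun n t _ => nrm2_ge0 _) gC.
apply: ae_imp => t h tT; have [|C C0 HC] := h; first by rewrite /= in_itv.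
exists (8 * C) => [|n]; first by rewrite mulr_ge0.
have hB m := h2B (g_h2 (ga (m + n)%N) t) (g_h2 (ga n) t).
apply: (energy_lsc hB).
  move=> x; apply: cvgB; last exact: cvg_cst.
  by rewrite (cvg_shiftn n (fun m => qU (a m) t x) _); exact: a_cvg.
move=> e e0; apply: nearW => m; have := dQ_le HC m n; rewrite addnC => h'.
by have := nrm2_p_le (hB m); rewrite /energy2; lra.
Qed.

(** The energy is finite at every time, so nothing is lost in taking its real value. *)
Definition eu (t : R) : R := fine (energy (u t)).

Lemma euE t p q : h2 (u t) p q -> eu t = energy2 p q /\ energy (u t) = (eu t)%:E.
Proof. by move=> h; rewrite /eu (energyE h). Qed.

Lemma eu_fin t : energy (u t) = (eu t)%:E.
Proof. by have [p [q [h _]]] := lim_h2 ap cu t; case: (euE h). Qed.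

Lemma eu_ge0 t : 0 <= eu t.
Proof. by have [p [q [h _]]] := lim_h2 ap cu t; have [-> _] := euE h; exact: energy2_ge0. Qed.

Lemma eu_lsc (t : R) (s : nat -> R) (c : R) : s n @[n --> \oo] --> t -> (forall n, eu (s n) <= c) ->
  eu t <= c.
Proof.
move=> st sc; have /choice[pq Hpq] : forall n, exists pq : (R -> R) * (R -> R), h2 (u (s n)) pq.1 pq.2.
  by move=> n; have [p [q [h _]]] := lim_h2 ap cu (s n); exists (p, q).
have [||p [q [h]]] := @energy_lsc _ (fun n => u (s n)) (fun n => (pq n).1) (fun n => (pq n).2) (u t) c Hpq.
- move=> x; apply/cvgrPdist_le => e e0; have [d d0 Hd] := lim_modulus K0 ap tau01 cu e0.
  move: st => /cvgrPdist_le/(_ d d0); apply: filterS => n h.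
  by apply: Hd; rewrite ?subrr ?normr0// ltW.
- move=> e e0; apply: nearW => n; have [<- _] := euE (Hpq n).
  by apply: le_trans (sc n) _; rewrite lerDl ltW.
by have [-> _] := euE h.
Qed.

(** The energy is lower semicontinuous in time, because u is uniformly continuous in time and the
    energy is lower semicontinuous on H^2. *)
Lemma eu_meas : mfun1 setT eu.
Proof.
have : measurable_fun (setT : set (measurableTypeR R)) (fun t : R => (eu t)%:E).
  apply: lower_semicontinuous_measurable; apply/lower_semicontinuousP => c.
  rewrite openE => t /= ct'; apply: contrapT => nb.
  have ct : c < eu t by exact: ct'.
  have /choice[s Hs] : forall n : nat, exists s, `|t - s| <= n.+1%:R^-1 /\ eu s <= c.
    move=> n; apply: contrapT => ns; apply: nb; exists n.+1%:R^-1 => /=; first by rewrite invr_gt0.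
    move=> s /= /ltW ts; rewrite lte_fin ltNge; apply/negP => sc; apply: ns; exists s; split => //.
  have : eu t <= c.
    apply: (@eu_lsc t s) => [|n]; last by case: (Hs n).
    by apply: inv_cvg => n; rewrite distrC; case: (Hs n).
  by rewrite leNgt ct.
by move=> /measurable_EFinP.
Qed.

(** Young's inequality with s = 2^-n in both directions, between u and the combination, bounds the
    difference of the energies by a multiple of 2^-n. *)
Lemma energy_cvg t (C : R) : 0 <= C -> (forall n,
  exists p q, h2 (fun x => u t x - qU (a n) t x) p q /\ energy2 p q <= C * 4^-1 ^+ n) ->
  energy2 (qP (a n) t) (qQ (a n) t) @[n --> \oo] --> eu t.
Proof.
move=> C0 H; have [p0 [q0 [h0 _]]] := lim_h2 ap cu t.
have e0 := eu_ge0 t.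
apply: (@geo_cvg _ _ _ (2 * eu t + 4 * C)) => n.
have [p [q [hd dC]]] := H n; have hn := g_h2 (ga n) t.
set En := energy2 _ _; pose s : R := 2^-1 ^+ n.
have s0 : 0 < s by rewrite exprn_gt0// invr_gt0.
have s1 : s <= 1 by rewrite exprn_ile1 ?invr_ge0// invf_le1// ler1n.
have s4 : 4^-1 ^+ n = s * s.
  by rewrite -exprMn; congr (_ ^+ _); field.
have dle : (1 + s^-1) * energy2 p q <= 2 * C * s.
  apply: (@le_trans _ _ ((1 + s^-1) * (C * (s * s)))).
    by rewrite -s4; apply: ler_wpM2l => //; rewrite addr_ge0// invr_ge0 ltW.
  have -> : (1 + s^-1) * (C * (s * s)) = C * s * (s + 1) by field; rewrite gt_eqF.
  have : C * s * (s + 1) <= C * s * 2 by apply: ler_wpM2l; [rewrite mulr_ge0// ltW|lra].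
  lra.
have H1 : eu t <= (1 + s) * En + 2 * C * s.
  have hs := h2_lin 1 hn hd.
  have hs' : h2 (u t) (fun x => qP (a n) t x + 1 * p x) (fun x => qQ (a n) t x + 1 * q x).
    by move: hs; congr h2; apply/funext => x; rewrite mul1r addrC subrK.
  have [-> _] := euE hs'.
  have := energy2_young s0 hn hd.
  rewrite (_ : (fun x => qP (a n) t x + 1 * p x) = (fun x => qP (a n) t x + p x)); last by apply/funext => x; rewrite mul1r.
  rewrite (_ : (fun x => qQ (a n) t x + 1 * q x) = (fun x => qQ (a n) t x + q x)); last by apply/funext => x; rewrite mul1r.
  by rewrite -/En; lra.
have H2 : En <= (1 + s) * eu t + 2 * C * s.
  have hN := h2Z (-1) hd.
  have hs := h2_lin (-1) h0 hd.
  have hs' : h2 (qU (a n) t) (fun x => p0 x + -1 * p x) (fun x => q0 x + -1 * q x).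
    by move: hs; congr h2; apply/funext => x; ring.
  have -> : En = energy2 (fun x => p0 x + -1 * p x) (fun x => q0 x + -1 * q x) by exact: energy_triple hn hs'.
  have := energy2_young s0 h0 hN; have [-> _] := euE h0.
  have -> : energy2 (fun x => -1 * p x) (fun x => -1 * q x) = energy2 p q.
    by rewrite /energy2; congr (_ + _); apply: eq_IntI => x _; ring.
  lra.
have En0 : 0 <= En by exact: energy2_ge0.
have EnB : En <= 2 * eu t + 2 * C.
  have : s * eu t <= 1 * eu t by rewrite ler_wpM2r.
  have : C * s <= C * 1 by rewrite ler_wpM2l.
  lra.
have sEn : s * En <= s * (2 * eu t + 2 * C) by rewrite ler_wpM2l// ltW.
have seu : 0 <= s * eu t by rewrite mulr_ge0// ltW.
have sC : 0 <= s * C by rewrite mulr_ge0// ltW.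
rewrite -/s ler_norml; apply/andP; split; lra.
Qed.

Lemma lim_mass : itg mu `[0, T] eu /\
  \int[mu]_(x in `[0, 1]) u T x + \int[mu]_(t in `[0, T]) eu t <= \int[mu]_(x in `[0, 1]) z0.1.1 x.
Proof.
have uTi : itg mu `[0, 1] (u T).
  by have [p [q [h _]]] := lim_h2 ap cu T; have [c _] := h2_cont h; exact: itg_cont.
have [] := @itg_fatou _ _ _ mu `[0, T] mT (fun n t => energy2 (qP (a n) t) (qQ (a n) t)) eu
  (\int[mu]_(x in `[0, 1]) z0.1.1 x - \int[mu]_(x in `[0, 1]) u T x).
- by move=> n; have [_ _ _ _ e] := good_sqi T (ga n).
- by move=> n t _; exact: energy2_ge0.
- exact: measurable_funS eu_meas.
- by apply: aeW => t _; exact: eu_ge0.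
- apply: ae_imp ae_close => t h; rewrite /= in_itv/= => tT; have [C C0 HC] := h tT.
  exact: energy_cvg HC.
- move=> e e0; apply: filterS (inv_near e0) => n ne.
  have := hull_mass ap tau01 (ha n).
  have uni := good_Uitg T (ga n).
  have : \int[mu]_(x in `[0, 1]) u T x <= \int[mu]_(x in `[0, 1]) (qU (a n) T x + e).
    apply: (Int_le m01) => //; first by apply: (itgD m01) => //; exact: itgC.
    move=> x _; have := ga_close n T x; rewrite ler_norml => /andP[h _].
    by move: h; rewrite lerNl opprB => h; rewrite addrC -lerBlDr; exact: le_trans h ne.
  rewrite (IntD m01)//; last exact: itgC.
  rewrite IntC; lra.
by move=> i I; split => //; lra.
Qed.

(** In the dissipation, v^2 <= (1 + s) V^2 + (1 + 1/s) (v - V)^2 with s = 2^-n and V the time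
    derivative of the n-th combination. The first term is bounded on the hull, the second is of
    order 8^-n / s. *)
Lemma lim_dissip (eps : R) : 0 < eps -> eu T + dissip T u eps v <= enz z0.
Proof.
move=> e0; have [pT [qT [hT _]]] := lim_h2 ap cu T.
pose E0 := enz z0; have E00 : 0 <= E0 by exact: energy2_ge0.
pose y := dissip T u eps v.
have E1 n : eps >= n.+1%:R^-1 -> energy2 (qP (a n) T) (qQ (a n) T) <= E0 - y + (E0 + 4 / eps) * 2^-1 ^+ n.
  move=> ne; have := hull_energy ap tau01 cu cus (ha n) ne; set yn := dissip _ _ _ _ => h.
  pose s : R := 2^-1 ^+ n.
  have s0 : 0 < s by rewrite exprn_gt0// invr_gt0.
  have s1 : s <= 1 by rewrite exprn_ile1 ?invr_ge0// invf_le1// ler1n.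
  have s8 : 8^-1 ^+ n = s * s * s.
    by rewrite -!exprMn; congr (_ ^+ _); field.
  have [sV _ _ _ _] := good_sqi T (ga n).
  have sB := sqiB mQ sv sV.
  have dv := dissip_itg ap cu e0 sv; have dV := dissip_itg ap cu e0 sV.
  have yyn : y <= (1 + s) * yn + (1 + s^-1) * (2 / eps) * \int[mu2]_(p in QT T) ((v p.1 p.2 - qV (a n) p.1 p.2) ^+ 2).
    rewrite /y /yn /dissip -!(IntZ mQ)//; last exact: sB.2.
    rewrite -(IntD mQ); [|exact: (itgZ mQ)|by apply: (itgZ mQ); exact: sB.2].
    apply: (Int_le mQ) => //.
      by apply: (itgD mQ); apply: (itgZ mQ) => //; exact: sB.2.
    move=> p _; have w0 := wt_gt0 ap cu p e0; set w := wt u eps p in w0 *.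
    have we : w^-1 <= eps^-1 by rewrite lef_pV2 ?posrE// /w /wt lerDr; exact: (lim_ge0 ap cu).
    set V := qV (a n) p.1 p.2; set vv := v p.1 p.2.
    have yg : vv ^+ 2 <= (1 + s) * V ^+ 2 + (1 + s^-1) * (vv - V) ^+ 2.
      have : 0 <= s^-1 * (s * V - (vv - V)) ^+ 2 by rewrite mulr_ge0 ?sqr_ge0// invr_ge0 ltW.
      have -> : s^-1 * (s * V - (vv - V)) ^+ 2 = s * V ^+ 2 - 2 * (V * (vv - V)) + s^-1 * (vv - V) ^+ 2.
        by field; rewrite gt_eqF.
      set D := (vv - V) ^+ 2; have -> : D = (vv - V) * (vv - V) by rewrite /D expr2.
      nra.
    apply: (@le_trans _ _ (2 * ((1 + s) * V ^+ 2 + (1 + s^-1) * (vv - V) ^+ 2) / w)).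
      by apply: ler_wpM2r; [rewrite invr_ge0 ltW|rewrite ler_wpM2l].
    have -> : 2 * ((1 + s) * V ^+ 2 + (1 + s^-1) * (vv - V) ^+ 2) / w =
      (1 + s) * (2 * V ^+ 2 / w) + (1 + s^-1) * 2 * (vv - V) ^+ 2 * w^-1 by ring.
    rewrite lerD2l.
    have -> : (1 + s^-1) * (2 / eps) * (vv - V) ^+ 2 = (1 + s^-1) * 2 * (vv - V) ^+ 2 * eps^-1 by ring.
    apply: ler_wpM2l => //; rewrite mulr_ge0 ?sqr_ge0// mulr_ge0// addr_ge0// invr_ge0 ltW//.
  have En0 := energy2_ge0 (qP (a n) T) (qQ (a n) T).
  have ynE : yn <= E0 by rewrite /E0; lra.
  have I8 : (1 + s^-1) * (2 / eps) * \int[mu2]_(p in QT T) ((v p.1 p.2 - qV (a n) p.1 p.2) ^+ 2) <= 4 / eps * s.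
    apply: (@le_trans _ _ ((1 + s^-1) * (2 / eps) * (s * s * s))).
      rewrite -s8; apply: ler_wpM2l; last exact: Lv.
      by rewrite mulr_ge0 ?divr_ge0 ?addr_ge0 ?invr_ge0// ltW.
    have -> : (1 + s^-1) * (2 / eps) * (s * s * s) = 2 / eps * s * (s * s + s) by field; rewrite !gt_eqF.
    have -> : 4 / eps * s = 2 / eps * s * 2 by ring.
    apply: ler_wpM2l; first by rewrite mulr_ge0 ?divr_ge0// ltW.
    have : s * s <= 1 * 1 by apply: ler_pM => //; exact: ltW.
    lra.
  have : s * yn <= s * E0 by rewrite ler_wpM2l// ltW.
  rewrite -/s -/E0 in h *; lra.
have [||p [q [hu]]] := @energy_lsc _ (fun n => qU (a n) T) (fun n => qP (a n) T) (fun n => qQ (a n) T) (u T) (E0 - y)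
   (fun n => g_h2 (ga n) T).
- by move=> x; exact: a_cvg.
- move=> e e1; near=> n.
  have n1 : n.+1%:R^-1 <= eps by near: n; exact: inv_near.
  apply: le_trans (E1 n n1) _; rewrite lerD2l.
  near: n; have : (fun n => (E0 + 4 / eps) * (2^-1 : R) ^+ n) @ \oo --> 0.
    rewrite -[X in _ --> X](mulr0 (E0 + 4 / eps)); apply: cvgM; first exact: cvg_cst.
    by apply: cvg_expr; rewrite ger0_norm ?invr_ge0// invf_lt1// ltr1n.
  move=> /cvgrPdist_le/(_ e e1); apply: filterS => n; rewrite sub0r normrN.
  exact: le_trans (ler_norm _).
by have [-> _] := euE hu; rewrite -/y -/E0; lra.
Unshelve. all: by end_near. Qed.

(** Identification of v: pairings of the difference quotients with psi converge to c, hence so do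
    those of the combinations, and these converge strongly to v. *)
Lemma v_lim (psi : R * R -> R) (C c : R) : measurable_fun (QT T) psi ->
  (forall p, `|psi p| <= C) ->
  \int[mu2]_(p in QT T) (vdiff tau_ Z_ j p.1 p.2 * psi p) @[j --> \oo] --> c ->
  \int[mu2]_(p in QT T) (v p.1 p.2 * psi p) = c.
Proof.
move=> mpsi HC cc.
have spsi : sqi mu2 (QT T) psi.
  split => //; apply: (@itg_bdd _ _ _ mu2 _ mQ _ (C ^+ 2) (finQT T)); first exact: measurable_funX.
  move=> p _; rewrite ger0_norm ?sqr_ge0// -(real_normK (num_real _)).
  by rewrite lerXn2r ?nnegrE// (le_trans (normr_ge0 _) (HC p)).
apply/eqP; rewrite -subr_eq0 -normr_le0; apply/ler_addgt0Pl => e e0; rewrite addr0.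
have e2 : 0 < e / 2 by lra.
pose N := \int[mu2]_(p in QT T) (psi p ^+ 2).
have N0 : 0 <= N by apply: Rintegral_ge0 => p _; exact: sqr_ge0.
have c1 : \forall n \near \oo, forall j, (n <= j)%N ->
    `|\int[mu2]_(p in QT T) (vdiff tau_ Z_ j p.1 p.2 * psi p) - c| <= e / 2.
  move: cc => /cvgrPdist_le/(_ _ e2)[M _ HM]; exists M => // n /= Mn j nj.
  by rewrite distrC; apply: HM; rewrite /= (leq_trans Mn).
have c2 : \forall n \near \oo, 8^-1 ^+ n * N <= (e / 2) ^+ 2.
  have : (fun n => (8^-1 : R) ^+ n * N) @ \oo --> 0.
    rewrite -[X in _ --> X](mul0r N); apply: cvgM; last exact: cvg_cst.
    by apply: cvg_expr; rewrite ger0_norm ?invr_ge0// invf_lt1// ltr1n.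
  move=> /cvgrPdist_le/(_ _ (exprn_gt0 2 e2)); apply: filterS => n; rewrite sub0r normrN.
  exact: le_trans (ler_norm _).
near \oo => n.
have h1 : `|\int[mu2]_(p in QT T) (qV (a n) p.1 p.2 * psi p) - c| <= e / 2.
  by apply: (hull_lin ap (ha n) mpsi HC); near: n.
have [sV _ _ _ _] := good_sqi T (ga n); have sB := sqiB mQ sv sV.
have h2' : `|\int[mu2]_(p in QT T) (v p.1 p.2 * psi p) - \int[mu2]_(p in QT T) (qV (a n) p.1 p.2 * psi p)| <= e / 2.
  have iv := itg_QT_mul mpsi HC sv; have iV := itg_QT_mul mpsi HC sV.
  rewrite -(IntB mQ)// -(@ler_pXn2r _ 2)// ?nnegrE//; last exact: ltW.
  rewrite real_normK ?num_real//.
  apply: (@le_trans _ _ (8^-1 ^+ n * N)); last by near: n.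
  have := cauchy_schwarz mQ sB spsi.
  rewrite (@eq_Int _ _ _ mu2 _ _ (fun p => v p.1 p.2 * psi p - qV (a n) p.1 p.2 * psi p)); last first.
    by move=> p _; rewrite mulrBl.
  by move=> /le_trans; apply; apply: ler_wpM2r.
have -> : e = e / 2 + e / 2 by field.
apply: le_trans (lerD h2' h1); apply: le_trans (ler_normD _ _).
by rewrite addrA subrK.
Unshelve. all: by end_near. Qed.

End limit_facts.

(** * The equation in the limit *)

Section weak_equation.
Context (R : realType).
Local Notation mu := (@lebesgue_measure R).
Let m01 := mI (0 : R) 1.

Lemma cont_per_bdd (f : R -> R -> R) (a b : R) : continuous (fun p : R * R => f p.1 p.2) ->
  (forall t, per (f t)) -> exists2 M, 0 <= M & forall t x, a <= t <= b -> `|f t x| <= M.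
Proof.
move=> cf pf.
have cK : compact (`[a, b]%classic `*` `[0, 1]%classic : set (R * R)).
  by apply: compact_setX; exact: segment_compact.
have := compact_bounded (continuous_compact (continuous_subspaceT cf) cK).
move=> [M [_ HM]]; exists (Num.max 0 (M + 1)); first by rewrite le_max lexx.
move=> t x tab; have [y [n [m [/andP[y0 y1] ->]]]] := per_frac x.
rewrite per_shift; last exact: pf.
rewrite le_max; apply/orP; right; apply: (HM (M + 1)); first by rewrite ltrDl.
by exists (t, y) => //=; rewrite !in_itv/= y0 (ltW y1).
Qed.

Lemma cont_sec1 (f : R -> R -> R) x : continuous (fun p : R * R => f p.1 p.2) ->
  continuous (f ^~ x).
Proof.
move=> cf t; apply: (@continuous_comp _ _ _ (fun t : R => (t, x)) (fun p : R * R => f p.1 p.2)); last exact: cf.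
move=> A [[B C] /= [hB hC] BC]; apply: filterS hB => y By.
by apply: BC; split => //=; exact: nbhs_singleton hC.
Qed.

Lemma cont_sec2 (f : R -> R -> R) t : continuous (fun p : R * R => f p.1 p.2) ->
  continuous (f t).
Proof.
move=> cf x; apply: (@continuous_comp _ _ _ (fun x : R => (t, x)) (fun p : R * R => f p.1 p.2)); last exact: cf.
move=> A [[B C] /= [hB hC] BC]; apply: filterS hC => y Cy.
by apply: BC; split => //=; exact: nbhs_singleton hB.
Qed.

Lemma cont_shift1 (f : R -> R -> R) c : continuous (fun p : R * R => f p.1 p.2) ->
  continuous (fun p : R * R => f (p.1 + c) p.2).
Proof.
move=> cf [t x]; apply: (@continuous_comp _ _ _ (fun p : R * R => (p.1 + c, p.2)) (fun p : R * R => f p.1 p.2)); last exact: cf.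
move=> A [[B C] /= [hB hC] BC].
have cp : continuous (fun t : R => t + c) by move=> y; apply: cvgD; [exact: cvg_id|exact: cvg_cst].
exists ((fun t : R => t + c) @^-1` B, C) => /=; first by split => //; exact: cp.
by move=> [s y] [/= h1 h2]; apply: BC.
Qed.

Section on_strip.
Context (T : R) (T0 : 0 < T).
Let mQ := @mQT R T.
Let mT := mI 0 T.

Lemma QT_bdd (f : R -> R -> R) (C : R) :
  measurable_fun (QT T) (fun p => f p.1 p.2) ->
  (forall t x, 0 <= t <= T -> `|f t x| <= C) ->
  [/\ itg mu2 (QT T) (fun p => f p.1 p.2),
    \int[mu2]_(p in QT T) f p.1 p.2 = \int[mu]_(t in `[0, T]) \int[mu]_(x in `[0, 1]) f t x &
    itg mu `[0, T] (fun t => \int[mu]_(x in `[0, 1]) f t x)].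
Proof.
move=> mf fC.
have fi : itg mu2 (QT T) (fun p => f p.1 p.2).
  apply: (@itg_bdd _ _ _ mu2 _ mQ _ C (finQT T) mf) => -[t x] [/= + _].
  by rewrite in_itv/=; exact: fC.
have [_ h _ h'] := @Int_fubini R `[0, T] `[0, 1] f (mI _ _) (mI _ _) fi.
by split.
Qed.

Lemma IntQT_cst (c : R) : \int[mu2]_(p in QT T) c = c * T.
Proof.
have [|_ -> _] := @QT_bdd (fun=> fun=> c) `|c| (measurable_cst c); first by [].
rewrite (@eq_IntI _ 0 T _ (fun=> c)); last by move=> t _; rewrite IntC.
rewrite Rintegral_cst//; congr (_ * _); have := lebesgue_measure_itv (`[0, T]).
by rewrite /= lte_fin T0 => ->; rewrite /= subr0.
Qed.

Lemma cont_measQT (f : R -> R -> R) : continuous (fun p : R * R => f p.1 p.2) ->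
  measurable_fun (QT T) (fun p => f p.1 p.2).
Proof.
move=> cf; apply: measurable_funS (cont_meas2 T0 cf).
  by apply: measurableX => //; exact: mI.
by move=> p [].
Qed.

End on_strip.

Context (T K : R) (T0 : 0 < T) (K0 : 0 < K) (z0 : triple R).
Context (u : R -> R -> R) (tau_ : nat -> R) (Z_ : nat -> R -> triple R).
Context (ap : forall j, approx T (tau_ j) K z0 (Z_ j)).
Context (tau01 : forall j, 0 < tau_ j <= T / j.+1%:R).
Context (cu : forall j t x, `|(Z_ j t).1.1 x - u t x| <= j.+1%:R^-1).
Context (cus : forall j t x, `|(Z_ j (t - tau_ j)).1.1 x - u t x| <= j.+1%:R^-1).
Context (a : nat -> quad R) (v : R -> R -> R).
Context (ha : forall n, mhull (@qmid R) (qseq tau_ Z_) n (a n)).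
Context (sv : sqi mu2 (QT T) (fun p => v p.1 p.2)).
Context (Lv : forall n, \int[mu2]_(p in QT T) ((v p.1 p.2 - qV (a n) p.1 p.2) ^+ 2) <= 8^-1 ^+ n).
Let mQ := @mQT R T.
Let mT := mI 0 T.
Let t0 j : 0 < tau_ j. Proof. by case/andP: (tau01 j). Qed.
Let tT j : tau_ j <= T.
Proof.
case/andP: (tau01 j) => _ /le_trans; apply; rewrite ler_pdivrMr// ler_peMr ?ler1n//.
exact: ltW.
Qed.

Lemma Z_meas j (c : R) : measurable_fun (QT T) (fun p => (Z_ j (p.1 + c)).1.1 p.2).
Proof.
apply: measurable_funTS.
have sZ : simple (Z_ j).
  by have [N [idx [g [h1 h2 _ h3]]]] := ap_steps (ap j); exists N, idx, g; split.
apply: (simple_meas2 (simple_comp (fun z : triple R => z.1.1) (simple_shift c sZ))) => t.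
by have [] := h2u (st_h2 (ap_state (ap j) (t + c))).
Qed.

Lemma Z_norm j t x : `|(Z_ j t).1.1 x| <= K.
Proof. by rewrite ger0_norm ?(ap_le (ap j))//; exact: st_ge0 (ap_state (ap j) t) x. Qed.

Section time_derivative.
Context (phi phit : R -> R -> R).
Context (cphi : continuous (fun p : R * R => phi p.1 p.2)).
Context (cphit : continuous (fun p : R * R => phit p.1 p.2)).
Context (dphi : forall x t : R, is_derive t 1 (phi ^~ x) (phit t x)).
Context (pphi : forall t, per (phi t)) (pphit : forall t, per (phit t)).
Context (phi0 : forall t x, ~~ (0 < t < T) -> phi t x = 0).

Lemma phi_sub (s t x : R) : s <= t -> phi t x - phi s x = \int[mu]_(r in `[s, t]) phit r x.
Proof. by move=> st; rewrite (FTC2_line st (dphi x))//; exact: cont_sec1. Qed.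

(** Summation by parts: the difference quotient is moved onto phi. As phi vanishes outside ]0, T[,
    the shifted term is zero near T, and the strip [0, tau] contributes O(tau) because phi grows at
    most linearly from t = 0. *)
Lemma vdiff_dt : \int[mu2]_(p in QT T) (vdiff tau_ Z_ j p.1 p.2 * phi p.1 p.2) @[j --> \oo] -->
  - \int[mu2]_(p in QT T) (u p.1 p.2 * phit p.1 p.2).
Proof.
(* The shifted times t + tau reach up to 2 T. *)
have [M M0 HM] := cont_per_bdd 0 (T + T) cphit pphit.
have lip (s t x : R) : 0 <= s -> s <= t -> t <= T + T -> `|phi t x - phi s x| <= M * (t - s).
  move=> s0 st tT2; rewrite phi_sub//.
  have -> : M * (t - s) = \int[mu]_(r in `[s, t]) M.
    rewrite Rintegral_cst//; congr (_ * _); have := lebesgue_measure_itv (`[s, t]).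
    move: st; rewrite /= le_eqVlt lte_fin => /predU1P[->|->] -> //=; by rewrite ?ltxx/= ?subrr.
  apply: (Int_abs_le (mI s t)).
  - by apply: itg_cont; exact: cont_sec1.
  - by apply: itg_cst; [exact: mI|exact: itv_fin].
  - move=> r; rewrite /= in_itv/= => /andP[sr rt]; apply: HM.
    by rewrite (le_trans s0 sr) (le_trans rt tT2).
have phiM t x : `|phi t x| <= M * (T + T).
  case: (boolP (0 < t < T)) => [/andP[h1 h2]|h]; last first.
    by rewrite (phi0 x h) normr0 mulr_ge0// addr_ge0// ltW.
  have := lip 0 t x (lexx _) (ltW h1); rewrite (@phi0 0 x) ?ltxx// subr0 subr0 => h.
  apply: (le_trans (h _)); first by rewrite (le_trans (ltW h2))// lerDr ltW.
  by apply: ler_wpM2l => //; rewrite (le_trans (ltW h2))// lerDr ltW.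
pose U j := fun t => (Z_ j t).1.1.
have mU j : measurable_fun (QT T) (fun p => U j p.1 p.2).
  by have := Z_meas j 0; congr measurable_fun; apply/funext => p; rewrite addr0.
have mphi := cont_measQT T0 cphi.
have mphis j := @cont_measQT T T0 (fun t => phi (t + tau_ j)) (cont_shift1 (c := tau_ j) cphi).
have KM x y : `|x| <= K -> `|y| <= M * (T + T) -> `|x * y| <= K * (M * (T + T)).
  by move=> xK yM; rewrite normrM; apply: ler_pM.
pose A j t := \int[mu]_(x in `[0, 1]) (U j (t - tau_ j) x * phi t x).
pose B j t := \int[mu]_(x in `[0, 1]) (U j t x * phi (t + tau_ j) x).
have HA j := @QT_bdd T (fun t x => U j (t - tau_ j) x * phi t x) _
  (measurable_funM (Z_meas j (- tau_ j)) mphi) (fun t x _ => KM _ _ (Z_norm j _ x) (phiM t x)).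
have HA' j := @QT_bdd T (fun t x => U j t x * phi t x) _
  (measurable_funM (mU j) mphi) (fun t x _ => KM _ _ (Z_norm j _ x) (phiM t x)).
have HB j := @QT_bdd T (fun t x => U j t x * phi (t + tau_ j) x) _
  (measurable_funM (mU j) (mphis j)) (fun t x _ => KM _ _ (Z_norm j _ x) (phiM _ x)).
pose F j (p : R * R) := (tau_ j)^-1 * (U j p.1 p.2 * phi p.1 p.2 - U j p.1 p.2 * phi (p.1 + tau_ j) p.2).
have E j : \int[mu2]_(p in QT T) (vdiff tau_ Z_ j p.1 p.2 * phi p.1 p.2) =
    \int[mu2]_(p in QT T) F j p - (tau_ j)^-1 * \int[mu]_(t in `[0, tau_ j]) A j t.
  have [i1 E1 g1] := HA j; have [i2 E2 g2] := HA' j; have [i3 E3 g3] := HB j.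
  have tj := t0 j; have tjT := tT j.
  have -> : \int[mu2]_(p in QT T) (vdiff tau_ Z_ j p.1 p.2 * phi p.1 p.2) =
    (tau_ j)^-1 * (\int[mu2]_(p in QT T) (U j p.1 p.2 * phi p.1 p.2) -
      \int[mu2]_(p in QT T) (U j (p.1 - tau_ j) p.2 * phi p.1 p.2)).
    rewrite -(IntB mQ)// -(IntZ mQ); last exact: (itgB mQ).
    by apply: eq_Int => p _; rewrite /vdiff /U; ring.
  rewrite /F (IntZ mQ); last exact: (itgB mQ).
  rewrite (IntB mQ)// -mulrBr; congr (_ * _); rewrite -addrA -opprD; congr (_ - _).
  rewrite E1 E3 -/(A j) (@Int_cat _ (A j) 0 (tau_ j) T (ltW tj) tjT g1) addrC.
  apply: f_equal2; last exact: erefl.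
  have l1 : 0 <= T - tau_ j by rewrite subr_ge0.
  have l2 : T - tau_ j <= T by rewrite gerBl ltW.
  rewrite -/(B j) (@Int_cat _ (B j) 0 (T - tau_ j) T l1 l2 g3).
  rewrite [X in _ = _ + X](@eq_IntI _ _ _ _ (fun=> 0)); last first.
    move=> t /andP[h1 _]; rewrite /B (@eq_IntI _ _ _ _ (fun=> 0)) ?IntC// => x _.
    by rewrite phi0 ?mulr0// negb_and -!leNgt; apply/orP; right; rewrite -lerBlDr.
  have -> : \int[mu]_(t in `[T - tau_ j, T]) (0 : R) = 0 by rewrite Rintegral_cst// mul0r.
  rewrite addr0; have g1' : itg mu `[tau_ j, T] (A j) by exact: itg_subitv (ltW tj) (lexx _) g1.
  have [_ ->] := itg_shift_itv (tau_ j) g1'; rewrite subrr.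
  by apply: eq_IntI => t _; rewrite /A /B addrK.
have err j : `|(tau_ j)^-1 * \int[mu]_(t in `[0, tau_ j]) A j t| <= K * M * tau_ j.
  have [_ _ g1] := HA j; have tj := t0 j; have tjT := tT j.
  have mt := mI 0 (tau_ j).
  rewrite normrM gtr0_norm ?invr_gt0// ler_pdivrMl//.
  have -> : tau_ j * (K * M * tau_ j) = \int[mu]_(t in `[0, tau_ j]) (K * M * tau_ j).
    rewrite Rintegral_cst// mulrC; congr (_ * _); have := lebesgue_measure_itv (`[0, tau_ j]).
    by rewrite /= lte_fin tj => ->; rewrite /= subr0.
  apply: (Int_abs_le mt); first exact: itg_subitv (lexx _) tjT g1.
    by apply: itg_cst => //; exact: itv_fin.
  move=> t; rewrite /= in_itv/= => /andP[ht0 ht1].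
  rewrite -[leRHS]IntC; apply: (Int_abs_le m01); last 1 first.
  - move=> x _; rewrite normrM -mulrA; apply: ler_pM => //; first exact: Z_norm.
    have := lip 0 t x (lexx _) ht0; rewrite (@phi0 0 x) ?ltxx// !subr0 => h.
    apply: (le_trans (h _)); first by rewrite (le_trans ht1)// (le_trans tjT)// lerDr ltW.
    exact: ler_wpM2l.
  - apply: itg_cont => x; apply: cvgM; last exact: cont_sec2.
    by have [c _] := h2_cont (st_h2 (ap_state (ap j) (t - tau_ j))); exact: c.
  - exact: itgC.
rewrite (funext E) -[X in _ --> X]subr0; apply: cvgB; last first.
  apply/cvgrPdist_le => e e0; have := tau_cvg tau01 => ct.
  have : (fun j => K * M * tau_ j) @ \oo --> 0.
    by rewrite -[X in _ --> X](mulr0 (K * M)); apply: cvgM; [exact: cvg_cst|exact: ct].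
  move=> /cvgrPdist_le/(_ e e0); apply: filterS => j; rewrite !sub0r !normrN.
  by move=> h; apply: le_trans (err j) _; exact: le_trans (ler_norm _) h.
have iuphi : itg mu2 (QT T) (fun p => u p.1 p.2 * phit p.1 p.2).
  have mu' := cont_measQT T0 (lim_cont K0 ap tau01 cu).
  have [//||i _ _] := @QT_bdd T (fun t x => u t x * phit t x) (K * M).
  - by apply: measurable_funM => //; exact: cont_measQT.
  - move=> t x /andP[ht0 htT]; rewrite normrM; apply: ler_pM => //.
      by rewrite ger0_norm ?(lim_ge0 ap cu)// (lim_le ap cu).
    by apply: HM; rewrite ht0 (le_trans htT)// lerDr ltW.
  done.
have quot (t x : R) : (fun j => (tau_ j)^-1 * (phi (t + tau_ j) x - phi t x)) @ \oo --> phit t x.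
  apply/cvgrPdist_le => e e0.
  have /cvgrPdist_le/(_ e e0)[d /= d0 Hd] := @cont_sec1 phit x cphit t.
  have := tau_cvg tau01 => /cvgrPdist_lt/(_ d d0); apply: filterS => j.
  have tj := t0 j; rewrite sub0r normrN (gtr0_norm tj) => jd.
  have ll : t <= t + tau_ j by rewrite lerDl ltW.
  have mtt := mI t (t + tau_ j).
  have IA (c : R) : \int[mu]_(r in `[t, t + tau_ j]) c = c * tau_ j.
    rewrite Rintegral_cst//; congr (_ * _); have := lebesgue_measure_itv (`[t, t + tau_ j]).
    rewrite /= lte_fin ltrDl tj => ->; rewrite /=; ring.
  have ic (c : R) : itg mu `[t, t + tau_ j] (fun=> c) by apply: itg_cst => //; exact: itv_fin.
  have ip : itg mu `[t, t + tau_ j] (phit ^~ x) by apply: itg_cont; exact: cont_sec1.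
  rewrite phi_sub// -(ler_pM2r tj) -[X in _ * X <= _](gtr0_norm tj) -normrM.
  have -> : (phit t x - (tau_ j)^-1 * \int[mu]_(r in `[t, t + tau_ j]) phit r x) * tau_ j =
    \int[mu]_(r in `[t, t + tau_ j]) (phit t x - phit r x).
    by rewrite (IntB mtt)// IA; field; rewrite gt_eqF.
  rewrite -IA; apply: (Int_abs_le mtt) => //; first exact: (itgB mtt).
  move=> r; rewrite /= in_itv/= => /andP[r1 r2]; apply: Hd.
  by rewrite /= distrC ger0_norm ?subr_ge0// (le_lt_trans _ jd)// lerBlDl.
rewrite -(IntN mQ)//.
have [||||| _ c] := @itg_dct _ _ _ mu2 (QT T) mQ F (fun p => - (u p.1 p.2 * phit p.1 p.2)) (fun=> K * M).
- by move=> j; apply: measurable_funM => //; apply: measurable_funB; apply: measurable_funM.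
- by apply: measurable_funN; exact: itg_meas iuphi.
- by apply: itg_cst => //; exact: finQT.
- apply: aeW => -[t x] [/= + _]; rewrite in_itv/= => /andP[ht0 htT].
  have c1 : (fun j => U j t x) @ \oo --> u t x by exact: lim_cvg.
  have c2 := quot t x.
  have := cvgN (cvgM c1 c2); rewrite (_ : - _ = (fun j => F j (t, x))); first by apply.
  by apply/funext => j; rewrite /F /= fctE/=; ring.
- move=> j [t x] [/= + _]; rewrite in_itv/= => /andP[ht0 htT].
  have tj := t0 j; rewrite /F/= -mulrBr mulrCA normrM; apply: ler_pM => //; first exact: Z_norm.
  rewrite normrM gtr0_norm ?invr_gt0// ler_pdivrMl// distrC mulrC.
  have ll : t <= t + tau_ j by rewrite lerDl ltW.
  by have := lip t (t + tau_ j) x ht0 ll; rewrite (addrC t) addrK; apply; apply: lerD.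
exact: c.
Qed.

Lemma lim_dt : \int[mu2]_(p in QT T) (v p.1 p.2 * phi p.1 p.2) =
  - \int[mu2]_(p in QT T) (u p.1 p.2 * phit p.1 p.2).
Proof.
have [M M0 HM] := cont_per_bdd 0 T cphi pphi.
apply: (v_lim ap ha sv Lv (cont_measQT T0 cphi) (C := M)) => [[t x] /=|]; last exact: vdiff_dt.
case: (boolP (0 < t < T)) => [/andP[h1 h2]|h]; first by apply: HM; rewrite !ltW.
by rewrite (phi0 x h) normr0.
Qed.

End time_derivative.

Section test_equation.
Context (phi phi1 phi2 phi3 phi4 : R -> R -> R) (del : R) (del0 : 0 < del).
Context (cphi : continuous (fun p : R * R => phi p.1 p.2)).
Context (c2 : continuous (fun p : R * R => phi2 p.1 p.2)).
Context (c4 : continuous (fun p : R * R => phi4 p.1 p.2)).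
Context (D0 : forall t x : R, is_derive x 1 (phi t) (phi1 t x)).
Context (D1 : forall t x : R, is_derive x 1 (phi1 t) (phi2 t x)).
Context (D2 : forall t x : R, is_derive x 1 (phi2 t) (phi3 t x)).
Context (D3 : forall t x : R, is_derive x 1 (phi3 t) (phi4 t x)).
Context (per0 : forall t, per (phi t)) (per1 : forall t, per (phi1 t)).
Context (per2 : forall t, per (phi2 t)) (per3 : forall t, per (phi3 t)) (per4 : forall t, per (phi4 t)).
Context (supp : forall t x, phi t x != 0 -> 0 < t < T /\ del <= u t x).

(** The scheme satisfies the equation tested with phi / u_j. Three errors vanish: the residual of
    the scheme ([B1]), the replacement of phi / u_j by phi / u ([B2]), and that of u_j by u in the
    linear term ([B3]). *)
Lemma lim_eq : \int[mu2]_(p in QT T) (v p.1 p.2 * (phi p.1 p.2 / u p.1 p.2)) =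
  - \int[mu2]_(p in QT T) (u p.1 p.2 * (phi4 p.1 p.2 - phi2 p.1 p.2)).
Proof.
have [M M0 HM] := cont_per_bdd 0 T cphi per0.
have phiM t x : `|phi t x| <= M.
  have [->|pn] := eqVneq (phi t x) 0; first by rewrite normr0.
  by have [/andP[h1 h2] _] := supp pn; apply: HM; rewrite !ltW.
have [M2 M20 HM2] := cont_per_bdd 0 T c2 per2.
have [M4 M40 HM4] := cont_per_bdd 0 T c4 per4.
have uc := lim_cont K0 ap tau01 cu.
have mu' := cont_measQT T0 uc.
have mphi := cont_measQT T0 cphi.
have m4 := cont_measQT T0 c4; have m2 := cont_measQT T0 c2.
have m42 : measurable_fun (QT T) (fun p => phi4 p.1 p.2 - phi2 p.1 p.2) by exact: measurable_funB.
pose psi (p : R * R) := phi p.1 p.2 / u p.1 p.2.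
have minv (f : R * R -> R) : measurable_fun (QT T) f -> measurable_fun (QT T) (fun p => (f p)^-1).
  by move=> mf; apply: measurableT_comp; [exact: measurable_invr|exact: mf].
have mpsi : measurable_fun (QT T) psi by apply: measurable_funM => //; exact: minv.
have psiC p : `|psi p| <= M / del.
  rewrite /psi; have [->|pn] := eqVneq (phi p.1 p.2) 0; first by rewrite mul0r normr0 divr_ge0// ltW.
  have [_ du] := supp pn; have u0 : 0 < u p.1 p.2 by exact: lt_le_trans du.
  by rewrite normrM ler_pM// normfV gtr0_norm// lef_pV2 ?posrE.
apply: (v_lim ap ha sv Lv mpsi psiC).
pose C0 := (T + (K + 1)) * enz z0.
have C00 : 0 <= C0 by rewrite mulr_ge0 ?energy2_ge0// addr_ge0 ?ltW// ltr_wpDl// ltW.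
have g j := qseq_good ap j.
have sV j : sqi mu2 (QT T) (fun p => vdiff tau_ Z_ j p.1 p.2) by have [h _ _ _ _] := good_sqi T (g j).
have VC j : \int[mu2]_(p in QT T) (vdiff tau_ Z_ j p.1 p.2 ^+ 2) <= C0.
  apply: le_trans (qseq_bdd T0 K0 ap tau01 cu cus j); rewrite /= lerDr.
  by apply: Rintegral_ge0 => p _; exact: sqr_ge0.
pose I2 := \int[mu2]_(p in QT T) (u p.1 p.2 * (phi4 p.1 p.2 - phi2 p.1 p.2)).
have bdd42 t x : 0 <= t <= T -> `|phi4 t x - phi2 t x| <= M4 + M2.
  by move=> tT'; apply: le_trans (ler_normB _ _) _; apply: lerD; [exact: HM4|exact: HM2].
pose e j : R := j.+1%:R^-1.
have e0 j : 0 < e j by rewrite invr_gt0.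
(* The sum of the constants of the three errors. The approximations are at least del/2 on the
   support, once e j <= del/2, hence the 4 and the 2. *)
pose Cst := 4 * M / del ^+ 2 * T * C0 + (2 * M / del ^+ 2 * (T + C0) + (M4 + M2) * T).
have key j : e j <= del / 2 ->
   `|\int[mu2]_(p in QT T) (vdiff tau_ Z_ j p.1 p.2 * psi p) - (- I2)| <= Cst * e j.
  move=> ed; have tj := t0 j.
  pose U t := (Z_ j t).1.1; pose V := vdiff tau_ Z_ j.
  have mU : measurable_fun (QT T) (fun p => U p.1 p.2).
    by have := Z_meas j 0; congr measurable_fun; apply/funext => p; rewrite addr0.
  have d2 : 0 < del / 2 by rewrite divr_gt0.
  have Ud t x : phi t x != 0 -> del / 2 <= U t x /\ del / 2 <= (Z_ j (t - tau_ j)).1.1 x.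
    move=> pn; have [_ du] := supp pn; have := cu j t x; have := cus j t x.
    rewrite -/(e j) -/(U t) !ler_norml => /andP[h1 _] /andP[h2 _]; split; lra.
  pose psij (p : R * R) := phi p.1 p.2 / U p.1 p.2.
  have mpsij : measurable_fun (QT T) psij by apply: measurable_funM => //; exact: minv.
  have psijC p : `|psij p| <= M / (del / 2).
    rewrite /psij; have [->|pn] := eqVneq (phi p.1 p.2) 0.
      by rewrite mul0r normr0 divr_ge0// ltW.
    have [du _] := Ud _ _ pn; have U0 : 0 < U p.1 p.2 by exact: lt_le_trans du.
    by rewrite normrM ler_pM// normfV gtr0_norm// lef_pV2 ?posrE.
  have iV1 := itg_QT_mul mpsi psiC (sV j); have iV2 := itg_QT_mul mpsij psijC (sV j).
  have [||iU _ _] := @QT_bdd T (fun t x => U t x * (phi4 t x - phi2 t x)) (K * (M4 + M2)).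
  - exact: measurable_funM.
  - by move=> t x tT'; rewrite normrM; apply: ler_pM => //; [exact: Z_norm|exact: bdd42].
  have [||iu _ _] := @QT_bdd T (fun t x => u t x * (phi4 t x - phi2 t x)) (K * (M4 + M2)).
  - exact: measurable_funM.
  - move=> t x tT'; rewrite normrM; apply: ler_pM => //; last exact: bdd42.
    by rewrite ger0_norm ?(lim_ge0 ap cu)// (lim_le ap cu).
  have iS := itgD mQ iV2 iU; have iD := itgB mQ iV1 iV2; have iD2 := itgB mQ iu iU.
  have -> : \int[mu2]_(p in QT T) (V p.1 p.2 * psi p) - (- I2) =
    \int[mu2]_(p in QT T) (V p.1 p.2 * psij p + U p.1 p.2 * (phi4 p.1 p.2 - phi2 p.1 p.2)) +
    (\int[mu2]_(p in QT T) (V p.1 p.2 * psi p - V p.1 p.2 * psij p) +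
     \int[mu2]_(p in QT T) (u p.1 p.2 * (phi4 p.1 p.2 - phi2 p.1 p.2) - U p.1 p.2 * (phi4 p.1 p.2 - phi2 p.1 p.2))).
    rewrite (IntD mQ iV2 iU) (IntB mQ iV1 iV2) (IntB mQ iu iU) /I2; ring.
  have B1 : `|\int[mu2]_(p in QT T) (V p.1 p.2 * psij p + U p.1 p.2 * (phi4 p.1 p.2 - phi2 p.1 p.2))| <=
      4 * M / del ^+ 2 * T * C0 * e j.
    have [_ -> _ gi] := @Int_fubini R `[0, T] `[0, 1] (fun t x => V t x * psij (t, x) + U t x * (phi4 t x - phi2 t x)) (mI _ _) (mI _ _) iS.
    have [_ _ IV _ _] := good_sqi T (g j).
    have ni : itg mu `[0, T] (fun t => nrm2 (V t)).
      exact: (simple_itg 0 T (simple_comp (fun p => nrm2 p.2) (g_simple (g j)))).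
    apply: (@le_trans _ _ (M / (del / 2) ^+ 2 * tau_ j * C0)); last first.
      have /andP[_ tjT] := tau01 j.
      have -> : 4 * M / del ^+ 2 * T * C0 * e j = M / (del / 2) ^+ 2 * (T * e j) * C0 by field; rewrite gt_eqF.
      apply: ler_wpM2r => //; apply: ler_wpM2l => //.
      by rewrite divr_ge0// exprn_ge0// ltW.
    apply: (@le_trans _ _ (M / (del / 2) ^+ 2 * tau_ j * \int[mu]_(t in `[0, T]) nrm2 (V t))); last first.
      apply: ler_wpM2l; first by rewrite mulr_ge0 ?divr_ge0 ?exprn_ge0// ltW.
      by rewrite -IV; exact: VC.
    rewrite -(IntZ mT)//.
    have ni' : itg mu `[0, T] (fun t => M / (del / 2) ^+ 2 * tau_ j * nrm2 (V t)) by exact: (itgZ mT).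
    have aeb : {ae mu, forall t, `[0, T]%classic t ->
        `|\int[mu]_(x in `[0, 1]) (V t x * psij (t, x) + U t x * (phi4 t x - phi2 t x))| <=
         M / (del / 2) ^+ 2 * tau_ j * nrm2 (V t)}.
      have : {ae mu, forall t, t != 0}.
        exists [set 0]; split => //; first exact: lebesgue_measure_set1.
        by move=> x /= /negP; rewrite negbK => /eqP.
      apply: ae_imp => t tn0; rewrite /= in_itv/= => /andP[ht0 htT].
      have {}ht0 : 0 < t by rewrite lt_def tn0.
      have Hs x : phi t x != 0 -> del / 2 <= (Z_ j (t - tau_ j)).1.1 x /\ del / 2 <= (Z_ j t).1.1 x.
        by move=> pn; have [h1 h2] := Ud _ _ pn.
      have c4t : continuous (phi4 t) by exact: cont_sec2.
      have := eu_eq (ap_euler (ap j) ht0 htT) (D0 t) (D1 t) (D2 t) (D3 t) c4t (per0 t) (per1 t) (per2 t) (per3 t) d2 Hs (phiM t).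
      rewrite (@eq_IntI _ _ _ _ (fun x => V t x * psij (t, x) + U t x * (phi4 t x - phi2 t x)))//.
      by move=> x _; rewrite /V /vdiff /psij /U/=; ring.
    rewrite ler_norml; apply/andP; split.
      rewrite -(IntN mT)//; apply: (Int_le_ae mT) => //; first exact: itgN.
      by apply: ae_imp aeb => t h Dt; have := h Dt; rewrite ler_norml => /andP[].
    apply: (Int_le_ae mT) => //.
    by apply: ae_imp aeb => t h Dt; have := h Dt; rewrite ler_norml => /andP[].
  have B2 : `|\int[mu2]_(p in QT T) (V p.1 p.2 * psi p - V p.1 p.2 * psij p)| <= 2 * M / del ^+ 2 * (T + C0) * e j.
    have i1 : itg mu2 (QT T) (fun=> 1 : R) by apply: itg_cst => //; exact: finQT.
    have iV3 : itg mu2 (QT T) (fun p => 1 + V p.1 p.2 ^+ 2) by apply: (itgD mQ) => //; have [_ h] := sV j.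
    apply: (@le_trans _ _ (\int[mu2]_(p in QT T) (2 * M / del ^+ 2 * e j * (1 + V p.1 p.2 ^+ 2)))).
      apply: (Int_abs_le mQ) => //; first exact: (itgZ mQ).
      move=> p _; rewrite -mulrBr normrM mulrC.
      (* The uniform bound on V is only in L^2; this gives the L^1 bound T + C0. *)
      have V1 : `|V p.1 p.2| <= 1 + V p.1 p.2 ^+ 2.
        rewrite -(real_normK (num_real (V p.1 p.2))); have := sqr_ge0 (`|V p.1 p.2| - 1).
        by have := normr_ge0 (V p.1 p.2); nra.
      apply: ler_pM => //; rewrite /psi /psij.
      have [->|pn] := eqVneq (phi p.1 p.2) 0.
        by rewrite !mul0r subrr normr0 !mulr_ge0// ?invr_ge0 ?exprn_ge0// ltW.
      have [_ du] := supp pn; have u0 : 0 < u p.1 p.2 by exact: lt_le_trans du.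
      have [dU _] := Ud _ _ pn; have U0 : 0 < U p.1 p.2 by exact: lt_le_trans dU.
      have -> : phi p.1 p.2 / u p.1 p.2 - phi p.1 p.2 / U p.1 p.2 =
        phi p.1 p.2 * (U p.1 p.2 - u p.1 p.2) / (u p.1 p.2 * U p.1 p.2) by field; rewrite !gt_eqF.
      have -> : 2 * M / del ^+ 2 * e j = M * e j / (del * (del / 2)) by field; rewrite gt_eqF.
      have uU0 : 0 < u p.1 p.2 * U p.1 p.2 by rewrite mulr_gt0.
      rewrite normrM normfV (gtr0_norm uU0) normrM; apply: ler_pM => //.
      - by rewrite invr_ge0 ltW.
      - by apply: ler_pM => //; exact: cu.
      by rewrite lef_pV2 ?posrE ?mulr_gt0//; apply: ler_pM => //; exact: ltW.
    rewrite (IntZ mQ)// (IntD mQ)//; last by have [_ h] := sV j.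
    rewrite (IntQT_cst T0) mul1r.
    have -> : 2 * M / del ^+ 2 * (T + C0) * e j = 2 * M / del ^+ 2 * e j * (T + C0) by ring.
    apply: ler_wpM2l; last by rewrite lerD2l; exact: VC.
    by rewrite !mulr_ge0// ?invr_ge0 ?exprn_ge0// ltW.
  have B3 : `|\int[mu2]_(p in QT T) (u p.1 p.2 * (phi4 p.1 p.2 - phi2 p.1 p.2) - U p.1 p.2 * (phi4 p.1 p.2 - phi2 p.1 p.2))| <= (M4 + M2) * T * e j.
    have -> : (M4 + M2) * T * e j = \int[mu2]_(p in QT T) (e j * (M4 + M2)) by rewrite (IntQT_cst T0); ring.
    apply: (Int_abs_le mQ) => //; first by apply: itg_cst => //; exact: finQT.
    move=> [t x] [/= + _]; rewrite in_itv/= => tT'; rewrite -mulrBl normrM; apply: ler_pM => //.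
      by rewrite distrC; exact: cu.
    exact: bdd42.
  apply: le_trans (ler_normD _ _) _; have := ler_normD (\int[mu2]_(p in QT T) (V p.1 p.2 * psi p - V p.1 p.2 * psij p))
   (\int[mu2]_(p in QT T) (u p.1 p.2 * (phi4 p.1 p.2 - phi2 p.1 p.2) - U p.1 p.2 * (phi4 p.1 p.2 - phi2 p.1 p.2))).
  have -> : Cst * e j = 4 * M / del ^+ 2 * T * C0 * e j +
    (2 * M / del ^+ 2 * (T + C0) * e j + (M4 + M2) * T * e j) by rewrite /Cst; ring.
  by move=> h; apply: lerD => //; apply: le_trans h _; exact: lerD.
apply/cvgrPdist_le => r r0.
have cC : (fun j => Cst * e j) @ \oo --> 0.
  by rewrite -[X in _ --> X](mulr0 Cst); apply: cvgM; [exact: cvg_cst|exact: cvg_harmonic].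
have d2 : 0 < del / 2 by rewrite divr_gt0.
near=> j; have ej : e j <= del / 2 by near: j; exact: inv_near.
rewrite distrC; apply: le_trans (key j ej) _; near: j.
by move: cC => /cvgrPdist_le/(_ r r0); apply: filterS => j; rewrite sub0r normrN; exact: le_trans (ler_norm _).
Unshelve. all: by end_near. Qed.

End test_equation.

End weak_equation.

(** * Measurability and null sets in the plane *)

Section plane.
Context (R : realType).
Local Notation mu := (@lebesgue_measure R).

(** An open set is the countable union of the boxes with rational centres and radii 1/(n+1) that it
    contains; each box is a measurable rectangle. *)
Lemma open_meas2 (U : set (R * R)) : open U ->
  measurable (U : set (measurableTypeR R * measurableTypeR R)).
Proof.
move=> oU.
pose box (k : rat * rat * nat) : set (R * R) :=
  ball (ratr k.1.1 : R) k.2.+1%:R^-1 `*` ball (ratr k.1.2 : R) k.2.+1%:R^-1.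
pose B (i : nat) : set (measurableTypeR R * measurableTypeR R) :=
  if unpickle i is Some k then (if `[< box k `<=` U >] then box k else set0) else set0.
have mB i : measurable (B i).
  rewrite /B; case: unpickle => [k|]; last exact: measurable0.
  case: asboolP => _; last exact: measurable0.
  by apply: measurableX; rewrite ball_itv; exact: measurable_itv.
suff -> : U = \bigcup_i B i by exact: bigcup_measurable.
apply/seteqP; split => [[t x] Utx|p [i _]]; last first.
  by rewrite /B; case: unpickle => [k|//]; case: asboolP => // h; exact: h.
have [[C1 C2] /= [/nbhs_ballP[d1 /= d10 h1] /nbhs_ballP[d2 /= d20 h2]] sub] : nbhs (t, x) U.
  by move: oU; rewrite openE; apply.
have d0 : 0 < Num.min d1 d2 / 2 by rewrite divr_gt0// lt_min d10.
near \oo => n.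
have nd : n.+1%:R^-1 <= Num.min d1 d2 / 2 by near: n; exact: inv_near.
have nn : n.+1%:R^-1 + n.+1%:R^-1 <= Num.min d1 d2 by rewrite [leRHS]splitr; exact: lerD.
have n0 : 0 < n.+1%:R^-1 :> R by rewrite invr_gt0.
have rat_close (y : R) : exists q : rat, `|ratr q - y| < n.+1%:R^-1.
  have [|q] := @rat_in_itvoo _ y (y + n.+1%:R^-1); first by rewrite ltrDl.
  rewrite in_itv/= => /andP[q1 q2]; exists q.
  by rewrite gtr0_norm ?subr_gt0// ltrBlDl.
have [q1 hq1] := rat_close t; have [q2 hq2] := rat_close x.
have BE k : box k `<=` U -> box k `<=` \bigcup_i B i.
  by move=> h p bp; exists (pickle k); [exact: I|rewrite /B pickleK; case: asboolP].
apply: (BE (q1, q2, n)); last by split.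
move=> [s y] [/= b1 b2]; apply: sub; split => /=.
  apply: h1; rewrite -ball_normE/=; have -> : t - s = (ratr q1 - s) - (ratr q1 - t) by ring.
  apply: (le_lt_trans (ler_normB _ _)); apply: (@lt_le_trans _ _ (n.+1%:R^-1 + n.+1%:R^-1)).
    exact: ltrD.
  by apply: (@le_trans _ _ (Num.min d1 d2)); [exact: nn|rewrite ge_min lexx].
apply: h2; rewrite -ball_normE/=; have -> : x - y = (ratr q2 - y) - (ratr q2 - x) by ring.
apply: (le_lt_trans (ler_normB _ _)); apply: (@lt_le_trans _ _ (n.+1%:R^-1 + n.+1%:R^-1)).
  exact: ltrD.
by apply: (@le_trans _ _ (Num.min d1 d2)); [exact: nn|rewrite ge_min lexx orbT].
Unshelve. all: by end_near. Qed.

Lemma compact_meas2 (K : set (R * R)) : compact K ->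
  measurable (K : set (measurableTypeR R * measurableTypeR R)).
Proof.
move=> cK; rewrite -[K]setCK; apply: measurableC; apply: open_meas2; apply: closed_openC.
by apply: compact_closed => //; exact: norm_hausdorff.
Qed.

Lemma ae_snd (P : R -> Prop) : {ae mu, forall t, P t} -> {ae mu2, forall p : R * R, P p.2}.
Proof.
move=> [N [mN N0 PN]]; exists (setT `*` N); split.
- exact: measurableX.
- by rewrite product_measure1E// [X in (_ * X)%E]N0 mule0.
- by move=> p nP; split => //=; apply: PN.
Qed.

Lemma ae_neq (c : R) : {ae mu, forall x, x != c}.
Proof.
exists [set c]; split => //; first exact: lebesgue_measure_set1.
by move=> x /= /negP; rewrite negbK => /eqP.
Qed.

(** The set {u <= 0} is jointly measurable and all its time sections are null, so its product
    measure vanishes. *)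
Lemma ae_sections (u : R -> R -> R) :
  measurable_fun setT (fun p : measurableTypeR R * measurableTypeR R => u p.1 p.2) ->
  (forall t, {ae mu, forall x, 0 < u t x}) -> {ae mu2, forall p : R * R, 0 < u p.1 p.2}.
Proof.
move=> mu' H; pose Z : set (measurableTypeR R * measurableTypeR R) := [set p | u p.1 p.2 <= 0].
have mZ : measurable Z.
  rewrite -[Z]setTI; rewrite (_ : Z = (fun p : measurableTypeR R * measurableTypeR R => u p.1 p.2) @^-1` `]-oo, 0]%classic).
    by apply: mu' => //; exact: measurable_itv.
  by apply/seteqP; split => p /=; rewrite /Z/= in_itv.
exists Z; split => //; last by move=> p /= /negP; rewrite -leNgt.
apply: integral0_eq => t _; have [N [mN N0 HN]] := H t.
apply/eqP; rewrite eq_le measure_ge0 andbT -N0.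
apply: le_measure; rewrite ?inE//; first exact: measurable_xsection.
move=> x; rewrite /xsection/= inE /Z/= => h; apply: HN => /=.
by apply/negP; rewrite -leNgt.
Qed.

Lemma sqrt_cvg0 {X : Type} (F : set_system X) {FF : Filter F} (b : X -> R) :
  b x @[x --> F] --> 0 -> (Num.sqrt (b x))%:E @[x --> F] --> 0%E.
Proof.
move=> b0; apply: cvg_EFin; first exact: nearW.
rewrite -(@sqrtr0 R); apply: continuous_cvg => //; exact: sqrt_continuous.
Qed.

Section restriction.
Context (T : R) (A : set (measurableTypeR R * measurableTypeR R)).
Context (mA : measurable A) (AQ : A `<=` QT T).
Context (aeA : {ae mu2, forall p : R * R, QT T p -> A p}).

Lemma Int_restrict (g : R * R -> R) : itg mu2 (QT T) g ->
  itg mu2 A g /\ \int[mu2]_(p in A) g p = \int[mu2]_(p in QT T) g p.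
Proof.
move=> gi; split; first exact: (integrableS (mQT T) mA AQ gi).
have mg := itg_meas gi.
have [||_ ->] := @Int_ae _ _ _ mu2 (QT T) (mQT T) g (g \_ A) gi.
- by apply: ((measurable_restrict g mA (mQT T)).1); apply: (measurable_funS (mQT T)) mg => p [].
- by apply: ae_imp aeA => p h Dp; rewrite patchE mem_set//; exact: h.
rewrite Rintegral_mkcond [RHS]Rintegral_mkcond; congr Rintegral; apply/funext => p.
by rewrite !patchE; case: ifPn => pA; case: ifPn => // /negP[]; rewrite inE; apply: AQ; rewrite inE in pA.
Qed.

End restriction.
End plane.

(** * The weak solution *)

Section space_time_sets.
Context (R : realType).
Local Notation mu := (@lebesgue_measure R).
Let m01 := mI (0 : R) 1.

Lemma cont_meas_plane (f : R -> R -> R) : continuous (fun p : R * R => f p.1 p.2) ->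
  measurable_fun setT (fun p : measurableTypeR R * measurableTypeR R => f p.1 p.2).
Proof.
move=> cf; apply: (measurability _ (RGenOInfty.measurableE R)) => //.
move=> _ [_ [a ->] <-]; rewrite setTI; apply: open_meas2.
have := @open_comp _ _ (fun p : R * R => f p.1 p.2) `]a, +oo[%classic (fun p _ => cf p).
by rewrite set_itvoy; apply; exact: open_gt.
Qed.

(** The image of K is closed and misses 0, hence misses a ball around 0. *)
Lemma compact_pos_lb (K : set (R * R)) (f : R -> R -> R) : compact K ->
  continuous (fun p : R * R => f p.1 p.2) -> (forall p, K p -> 0 < f p.1 p.2) ->
  exists2 del : R, 0 < del & forall p, K p -> del <= f p.1 p.2.
Proof.
move=> cK cf f0; pose I := (fun p : R * R => f p.1 p.2) @` K.
have cI : closed I.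
  apply: compact_closed; first exact: norm_hausdorff.
  by apply: continuous_compact => //; exact: continuous_subspaceT.
have : nbhs (0 : R) (~` I).
  apply: open_nbhs_nbhs; split; first exact: closed_openC.
  by move=> [p Kp fp]; have := f0 _ Kp; rewrite fp ltxx.
move=> /nbhs_ballP[e /= e0 he]; exists e => // p Kp; rewrite leNgt; apply/negP => fe.
apply: (he (f p.1 p.2)); last by exists p.
by rewrite -ball_normE/= sub0r normrN gtr0_norm//; exact: f0.
Qed.

Lemma compact_box (K : set (R * R)) : compact K ->
  exists N : nat, forall p, K p -> - N%:R <= p.2 <= N%:R.
Proof.
move=> cK.
have : compact (snd @` K) by apply: continuous_compact => //; apply: continuous_subspaceT => p; exact: cvg_snd.
move=> /compact_bounded[M [_ hM]].
exists (Num.bound `|M + 1|) => p Kp; rewrite -ler_norml.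
apply: (@le_trans _ _ (M + 1)); first by apply: (hM (M + 1)); [rewrite ltrDl|exists p].
apply: le_trans (ler_norm _) _; exact/ltW/archi_boundP/normr_ge0.
Qed.

Context (T : R) (T0 : 0 < T).
Context (u : R -> R -> R) (cu : continuous (fun p : R * R => u p.1 p.2)).
Context (ug : forall t x, 0 <= u t x) (upos : forall t, {ae mu, forall x, 0 < u t x}).

Definition strip1 : set (measurableTypeR R * measurableTypeR R) := strip T `&` one_period.
Definition PT1 : set (measurableTypeR R * measurableTypeR R) := PT T u `&` one_period.

Lemma mstrip : measurable (strip T : set (measurableTypeR R * measurableTypeR R)).
Proof.
rewrite (_ : strip T = `]0, T[%classic `*` setT); first by apply: measurableX => //; exact: measurable_itv.
by apply/seteqP; split => p /=; rewrite /strip/= in_itv//= => -[].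
Qed.

Lemma mstrip1 : measurable strip1.
Proof.
apply: measurableI; first exact: mstrip.
rewrite (_ : one_period = setT `*` `[0, 1[%classic); first by apply: measurableX => //; exact: measurable_itv.
by apply/seteqP; split => p /=; rewrite /one_period/= in_itv//= => -[].
Qed.

Lemma mupos : measurable ([set p | u p.1 p.2 != 0] : set (measurableTypeR R * measurableTypeR R)).
Proof.
rewrite (_ : [set _ | _] = (fun p : measurableTypeR R * measurableTypeR R => u p.1 p.2) @^-1` (~` [set 0])).
  by rewrite -[X in measurable X]setTI; apply: (cont_meas_plane cu) => //; exact: measurableC.
by apply/seteqP; split => p /=; move/eqP.
Qed.

Lemma PT1E : PT1 = strip1 `&` [set p | u p.1 p.2 != 0].
Proof. by rewrite /PT1 /strip1 /PT -!setIA; congr setI; exact: setIC. Qed.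

Lemma mPT1 : measurable PT1.
Proof. by rewrite PT1E; apply: measurableI; [exact: mstrip1|exact: mupos]. Qed.

Lemma strip1_QT : strip1 `<=` QT T.
Proof.
move=> [t x] [/= /andP[t0 tT] /andP[x0 x1]]; split; rewrite /= in_itv/=; first by rewrite !ltW.
by rewrite x0 ltW.
Qed.

Lemma PT1_QT : PT1 `<=` QT T.
Proof. by rewrite PT1E => p [/strip1_QT]. Qed.

Lemma PT1_pos p : PT1 p -> 0 < u p.1 p.2.
Proof. by rewrite PT1E => -[_ /= n0]; rewrite lt_neqAle eq_sym n0 ug. Qed.

Lemma ae_upos : {ae mu2, forall p : R * R, 0 < u p.1 p.2}.
Proof. by apply: ae_sections => //; exact: cont_meas_plane. Qed.

Lemma ae_strip1 : {ae mu2, forall p : R * R, QT T p -> strip1 p}.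
Proof.
have h1 := ae_fst (ae_neq (0 : R)); have h2 := ae_fst (ae_neq T).
have h3 := ae_snd (ae_neq (1 : R)).
have h12 : {ae mu2, forall p : R * R, p.1 != 0 /\ p.1 != T} by apply: ae_imp2 h1 h2.
apply: ae_imp2 h12 h3 => -[t x] [/= t0 tT] x1 [/= + +].
rewrite !in_itv/= => /andP[a b] /andP[c d]; split; rewrite /=.
  by apply/andP; rewrite !lt_neqAle a b eq_sym t0 tT.
by apply/andP; rewrite lt_neqAle d x1.
Qed.

(** The closed rectangle exceeds the set of positivity by the lines t = 0, t = T, x = 1 and by {u =
    0}, all null. Integrals over both sets can therefore be exchanged. *)
Lemma ae_PT1 : {ae mu2, forall p : R * R, QT T p -> PT1 p}.
Proof.
apply: ae_imp2 ae_strip1 ae_upos => p h1 h2 Dp; rewrite PT1E; split; first exact: h1.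
by rewrite /= gt_eqF.
Qed.

Lemma Int_strip1 (g : R * R -> R) : itg mu2 (QT T) g ->
  itg mu2 strip1 g /\ \int[mu2]_(p in strip1) g p = \int[mu2]_(p in QT T) g p.
Proof. exact: (Int_restrict mstrip1 strip1_QT ae_strip1). Qed.

Lemma Int_PT1 (g : R * R -> R) : itg mu2 (QT T) g ->
  itg mu2 PT1 g /\ \int[mu2]_(p in PT1) g p = \int[mu2]_(p in QT T) g p.
Proof. exact: (Int_restrict mPT1 PT1_QT ae_PT1). Qed.

(** By periodicity the integral over 2 N periods is 2 N times that over one; any compact subset of
    the strip lies in such a box. *)
Lemma itg_box (v : R -> R -> R) (N : nat) :
  measurable_fun setT (fun p : measurableTypeR R * measurableTypeR R => v p.1 p.2) ->
  (forall t, l2p (v t)) -> sqi mu2 (QT T) (fun p => v p.1 p.2) ->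
  itg mu2 (`[0, T] `*` `[- N%:R, (N + N)%:R - N%:R]) (fun p => `|v p.1 p.2|).
Proof.
move=> mv lv sv; have mT := mI 0 T.
have vp t : per (fun x => `|v t x|) by move=> x; have [_ + _] := lv t => ->.
have vi t : itg mu `[0, 1] (fun x => `|v t x|) by apply: itg_norm; exact: l2p_itg.
have vB t := @itg_per _ _ (N + N) N (vp t) (vi t).
have h := itg_norm (sqi_itg (@mQT R T) (finQT T) sv).
have [_ _ _ it] := @Int_fubini _ _ _ (fun t x => `|v t x|) mT m01 h.
apply: (@itg_prod _ _ _ (fun t x => `|v t x|)) => //.
  apply: (@measurable_funTS _ _ _ _ _ (fun p : measurableTypeR R * measurableTypeR R => `|v p.1 p.2|)).
  by apply: measurableT_comp => //; exact: measurable_normr.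
apply: (@itg_ext _ _ _ mu _ mT (fun t => (N + N)%:R * \int[mu]_(x in `[0, 1]) `|v t x|)); last exact: itgZ.
move=> t _; rewrite Int_split// (eq_bigr (fun=> \int[mu]_(x in `[0, 1]) `|v t x|)).
  by rewrite sumr_const card_ord mulr_natl.
by move=> i _; apply: eq_Int => x _; exact: (per_shift _ _ _ (vp t)).
Qed.

Lemma loc_itg (v : R -> R -> R) (K : set (R * R)) :
  measurable_fun setT (fun p : measurableTypeR R * measurableTypeR R => v p.1 p.2) ->
  (forall t, l2p (v t)) -> sqi mu2 (QT T) (fun p => v p.1 p.2) ->
  compact K -> K `<=` strip T -> itg mu2 K (fun p => `|v p.1 p.2|).
Proof.
move=> mv lv sv cK KT; have [N hN] := compact_box cK.
apply: (integrableS _ _ _ (itg_box N mv lv sv)).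
- by apply: measurableX; exact: mI.
- exact: compact_meas2.
move=> p Kp; have := KT _ Kp; rewrite /strip/= => /andP[a b]; split; rewrite /= in_itv/=.
  by rewrite !ltW.
by rewrite natrD addrK; exact: hN.
Qed.

End space_time_sets.

(** * Smooth functions on the torus *)

Section smooth_functions.
Context (R : realType).

Lemma derive1_per (f : R -> R) : per f -> per (derive1 f).
Proof.
move=> pf x; rewrite /derive1.
rewrite (_ : (fun h => h^-1 *: (f (h + (x + 1)) - f (x + 1))) = (fun h => h^-1 *: (f (h + x) - f x)))//.
by apply/funext => h; rewrite addrA !pf.
Qed.

Lemma smooth_torus_dt (phi : R -> R -> R) : smooth_torus phi -> smooth_torus (dt phi).
Proof.
move=> [C P]; split; first by move=> n; have [_ []] := C n.+1.
by move=> t x; rewrite /dt; congr (derive1 _ t); apply/funext => s; exact: P.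
Qed.

Lemma smooth_torus_dx (phi : R -> R -> R) : smooth_torus phi -> smooth_torus (dx phi).
Proof.
move=> [C P]; split; first by move=> n; have [_ []] := C n.+1.
by move=> t x; rewrite /dx; apply: derive1_per => y; exact: P.
Qed.

Lemma smooth_torus_cont (phi : R -> R -> R) : smooth_torus phi -> continuous (fun p : R * R => phi p.1 p.2).
Proof. by move=> [C _]; case: (C 0%N). Qed.

Lemma smooth_torus_per (phi : R -> R -> R) : smooth_torus phi -> forall t, per (phi t).
Proof. by move=> [_ P] t x; exact: P. Qed.

Lemma smooth_torus_is_dt (phi : R -> R -> R) : smooth_torus phi ->
  forall x t : R, is_derive t 1 (phi ^~ x) (dt phi t x).
Proof.
move=> [C _] x t; have [_ [h _ _ _]] := C 1%N.
by rewrite /dt derive1E; apply: DeriveDef.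
Qed.

Lemma smooth_torus_is_dx (phi : R -> R -> R) : smooth_torus phi ->
  forall t x : R, is_derive x 1 (phi t) (dx phi t x).
Proof.
move=> [C _] t x; have [_ [_ h _ _]] := C 1%N.
by rewrite /dx derive1E; apply: DeriveDef.
Qed.

Lemma test_torus_supp (Om : set (R * R)) (phi : R -> R -> R) : test_torus Om phi ->
  forall t x, phi t x != 0 -> Om (t, x).
Proof. by move=> [_ S] t x h; apply: S; apply: subset_closure. Qed.

(* By periodicity the infimum of u over the support is taken over one period. *)
Lemma test_torus_lb (T : R) (u phi : R -> R -> R) :
  continuous (fun p : R * R => u p.1 p.2) -> (forall t, per (u t)) -> (forall t x, 0 <= u t x) ->
  test_torus (PT T u) phi ->
  exists2 del : R, 0 < del & forall t x, phi t x != 0 -> 0 < t < T /\ del <= u t x.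
Proof.
move=> cu pu ug [sphi S].
pose C := closure [set p : R * R | phi p.1 p.2 != 0].
pose B : set (R * R) := `[0, T]%classic `*` `[0, 1]%classic.
have cB : compact B by apply: compact_setX; exact: segment_compact.
have cK : compact (C `&` B) by rewrite setIC; apply: compact_closedI => //; exact: closed_closure.
have [p [Cp Bp]|del d0 hd] := compact_pos_lb cK cu.
  by have [_ /= n0] := S _ Cp; rewrite lt_neqAle eq_sym n0 ug.
exists del => // t x pn; have [/= tT _] := S (t, x) (subset_closure (pn : [set p : R * R | phi p.1 p.2 != 0] (t, x))).
split => //; have [y [n [m [/andP[y0 y1] xE]]]] := per_frac x.
rewrite xE per_shift//; apply: (hd (t, y)); split.
  by apply: subset_closure => /=; rewrite xE (per_shift _ _ _ (smooth_torus_per sphi t)) in pn.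
by split; rewrite /= in_itv/=; [case/andP: tT => a b; rewrite !ltW|rewrite y0 ltW].
Qed.

End smooth_functions.

Lemma distr_dx_even {R : realType} (k : nat) (Om : set (R * R)) (f phi : R -> R -> R) :
  ~~ odd k -> distr_dx k Om f phi = pairing Om f (iter k dx phi).
Proof. by move=> ok; rewrite /distr_dx -signr_odd (negPf ok) expr0 mul1r. Qed.

Section solution.
Context (R : realType).
Local Notation mu := (@lebesgue_measure R).
Let m01 := mI (0 : R) 1.

Lemma nrm2_le_sq (f : R -> R) (c : R) : sqi mu `[0, 1] f -> (forall x, `|f x| <= c) ->
  nrm2 f <= c ^+ 2.
Proof.
move=> [_ fi] fc; rewrite -(IntC (c ^+ 2)); apply: Int01_le => //; first exact: itgC.
move=> x _; rewrite -(real_normK (num_real (f x))); apply: lerXn2r => //; rewrite nnegrE.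
exact: le_trans (fc x).
Qed.

Context (T K : R) (T0 : 0 < T) (K0 : 0 < K) (z0 : triple R).
Context (u : R -> R -> R) (tau_ : nat -> R) (Z_ : nat -> R -> triple R).
Context (ap : forall j, approx T (tau_ j) K z0 (Z_ j)).
Context (tau01 : forall j, 0 < tau_ j <= T / j.+1%:R).
Context (cu : forall j t x, `|(Z_ j t).1.1 x - u t x| <= j.+1%:R^-1).
Context (cus : forall j t x, `|(Z_ j (t - tau_ j)).1.1 x - u t x| <= j.+1%:R^-1).
Context (a : nat -> quad R) (v : R -> R -> R).
Context (ha : forall n, mhull (@qmid R) (qseq tau_ Z_) n (a n)).
Context (mv : measurable_fun setT (fun p : measurableTypeR R * measurableTypeR R => v p.1 p.2)).
Context (lv : forall t, l2p (v t)) (sv : sqi mu2 (QT T) (fun p => v p.1 p.2)).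
Context (Lv : forall n, \int[mu2]_(p in QT T) ((v p.1 p.2 - qV (a n) p.1 p.2) ^+ 2) <= 8^-1 ^+ n).
Context (LQ : forall n m, (n <= m)%N ->
      \int[mu2]_(p in QT T) ((qQ (a m) p.1 p.2 - qQ (a n) p.1 p.2) ^+ 2) <= 8^-1 ^+ n).
Let mQ := @mQT R T.
Let mT := mI 0 T.
Let ga n : good (a n) := hull_good ap (ha n).
Let ucont := lim_cont K0 ap tau01 cu.
Let uper t : per (u t). Proof. by move=> x; rewrite (lim_per ap cu). Qed.
Let uge0 t x : 0 <= u t x := lim_ge0 ap cu t x.
Let upos t : {ae mu, forall x, 0 < u t x}. Proof. exact: lim_pos ap cu t. Qed.
Let sgood n := good_sqi T (ga n).

Lemma exp4_cvg0 (C : R) : C * 4^-1 ^+ n @[n --> \oo] --> 0.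
Proof.
rewrite -[X in _ --> X](mulr0 C); apply: cvgM; first exact: cvg_cst.
by apply: cvg_expr; rewrite ger0_norm ?invr_ge0// invf_lt1// ltr1n.
Qed.

(** The convex combinations are themselves the simple functions required for strong measurability:
    at almost every time they converge to u in H^2. *)
Lemma solution_Linfty_H2 : Linfty_Hper 2 T u.
Proof.
split.
  exists (fun n => qU (a n)); split => [n|].
    apply: simple_Hper_intro; first exact: (simple_comp (fun q => q.1.1.1) (g_simple (ga n))).
    by move=> t; exact: (Hper_h2 (leqnn 2) (g_h2 (ga n) t)).
  apply: ae_imp (ae_close ap cu ha LQ) => t H tT; have [C C0 hC] := H tT.
  split; first by have [p [q [h _]]] := lim_h2 ap cu t; exact: Hper_h2 h.
  have /choice[pq hpq] : forall n, exists pq : (R -> R) * (R -> R),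
    h2 (fun x => u t x - qU (a n) t x) pq.1 pq.2 /\ energy2 pq.1 pq.2 <= C * 4^-1 ^+ n.
    by move=> n; have [p [q h]] := hC n; exists (p, q).
  pose f n := fun x => u t x - qU (a n) t x.
  rewrite (_ : (fun n => Hnorm 2 _) = fun n =>
    (Num.sqrt (nrm2 (f n) + nrm2 (pq n).1 + nrm2 (pq n).2))%:E); last first.
    by apply/funext => n; exact: (Hnorm2E (hpq n).1).
  apply: sqrt_cvg0.
  have lim0 : n.+1%:R^-1 + C * 4^-1 ^+ n @[n --> \oo] --> (0 : R).
    by rewrite -[X in _ --> X](addr0 0); apply: cvgD; [exact: cvg_harmonic|exact: exp4_cvg0].
  apply: (squeeze_cvgr _ (cvg_cst 0) lim0); apply: nearW => n.
  have [hh he] := hpq n; apply/andP; split; first by rewrite !addr_ge0// nrm2_ge0.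
  have fn : nrm2 (f n) <= n.+1%:R^-1 ^+ 2.
    apply: nrm2_le_sq; first by have [] := h2u hh.
    by move=> x; rewrite distrC; exact: (hull_close cu (ha n)).
  have i1 : n.+1%:R^-1 ^+ 2 <= n.+1%:R^-1 :> R.
    by rewrite expr2 ler_piMr// ?invr_ge0// invf_le1// ler1n.
  rewrite -addrA (addrC (nrm2 (pq n).1)); apply: lerD => //; exact: le_trans i1.
exists (Num.sqrt (K ^+ 2 + enz z0)); apply: nearW => t _.
have [p [q [h he]]] := lim_h2 ap cu t.
rewrite (Hnorm2E h) lee_fin; apply: ler_wsqrtr; rewrite -addrA (addrC (nrm2 p)).
apply: lerD => //; apply: nrm2_le_sq; first by have [] := h2u h.
by move=> x; rewrite ger0_norm//; exact: (lim_le ap cu).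
Qed.

Lemma solution_C_H1 : C_Hper 1 T u.
Proof.
split; first by move=> t _; have [p [q [h _]]] := lim_h2 ap cu t; exact: Hper_h2 h.
move=> t _.
have /choice[pq hpq] : forall s, exists pq : (R -> R) * (R -> R),
  h2 (u s) pq.1 pq.2 /\ energy2 pq.1 pq.2 <= enz z0.
  by move=> s; have [p [q h]] := lim_h2 ap cu s; exists (p, q).
pose f s := fun x => u s x - u t x.
pose p s := fun x => (pq s).1 x - (pq t).1 x.
pose q s := fun x => (pq s).2 x - (pq t).2 x.
have hB s : h2 (f s) (p s) (q s) by apply: h2B; have [] := hpq s; have [] := hpq t.
rewrite (_ : (fun s => Hnorm 1 _) = fun s => (Num.sqrt (nrm2 (f s) + nrm2 (p s)))%:E); last first.
  by apply/funext => s; exact: (Hnorm1E (hB s)).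
apply: sqrt_cvg0; apply: cvg_within_filter.
pose E0 := enz z0.
have E00 : 0 <= E0 by exact: energy2_ge0.
have nq s : nrm2 (q s) <= 4 * E0.
  have qE r : nrm2 (pq r).2 <= E0.
    by have [_ h] := hpq r; apply: le_trans h; rewrite /energy2 lerDl nrm2_ge0.
  have s1 r : sqi mu `[0, 1] (pq r).2 by have [h _] := hpq r; have [] := h2q h.
  apply: le_trans (nrm2_sub_le (s1 s) (s1 t)) _.
  by have := qE s; have := qE t; lra.
apply/cvgrPdist_le => e e0.
(* Both u(s) - u(t) and its derivative will be at most g, so that the two squared norms add up to at
   most e. For the derivative, [eta] gives g/2 to the Hoelder term and r <= g eta / 4 gives g/2 to
   the difference quotient. *)
pose g := Num.min 1 (e / 2).
have g0 : 0 < g by rewrite lt_min ltr01 divr_gt0.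
have g1 : g <= 1 by rewrite ge_min lexx.
have ge : g <= e / 2 by rewrite ge_min lexx orbT.
have gg : g ^+ 2 <= e / 2 by apply: le_trans ge; rewrite expr2 ler_piMr// ltW.
have E1 : 0 < 16 * (E0 + 1) by rewrite mulr_gt0// ltr_wpDl.
pose eta := Num.min (1 / 2) (g ^+ 2 / (16 * (E0 + 1))).
have eta0 : 0 < eta by rewrite lt_min !divr_gt0// exprn_gt0.
have eta1 : eta <= 1 / 2 by rewrite ge_min lexx.
have eta2 : eta <= g ^+ 2 / (16 * (E0 + 1)) by rewrite ge_min lexx orbT.
pose r := Num.min g (g * eta / 4).
have r0 : 0 < r by rewrite lt_min g0 divr_gt0// mulr_gt0.
have rg : r <= g by rewrite ge_min lexx.
have rg2 : r <= g * eta / 4 by rewrite ge_min lexx orbT.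
have [del del0 hdel] := lim_modulus K0 ap tau01 cu r0.
have main s : `|t - s| <= del -> nrm2 (f s) + nrm2 (p s) <= e.
  move=> ts; have fr x : `|f s x| <= r by apply: hdel; rewrite ?subrr ?normr0 ?(ltW del0)// distrC.
  have h1 : nrm2 (f s) <= g ^+ 2.
    by apply: nrm2_le_sq; [have [] := h2u (hB s)|move=> x; exact: le_trans rg].
  have h2 : nrm2 (p s) <= g ^+ 2.
    apply: nrm2_le_sq; first by have [] := h2p (hB s).
    move=> x; apply: le_trans (h2_p_small x (hB s) fr eta0 eta1) _.
    have a1 : 2 * r / eta <= g / 2 by rewrite ler_pdivrMr//; lra.
    have a2 : Num.sqrt (nrm2 (q s) * eta) <= g / 2.
      have b1 : nrm2 (q s) * eta <= (g / 2) ^+ 2.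
        apply: (@le_trans _ _ (4 * E0 * (g ^+ 2 / (16 * (E0 + 1))))).
          by apply: ler_pM => //; [exact: nrm2_ge0|exact: ltW].
        by rewrite mulrA ler_pdivrMr//; have := sqr_ge0 g; lra.
      by apply: le_trans (ler_wsqrtr b1) _; rewrite sqrtr_sqr ger0_norm// divr_ge0// ltW.
    lra.
  lra.
apply/nbhs_ballP; exists del => // s ts; rewrite /= sub0r normrN ger0_norm ?addr_ge0 ?nrm2_ge0//.
by apply: main; exact: ltW ts.
Qed.

Lemma itg_contQT (f : R -> R -> R) : continuous (fun p : R * R => f p.1 p.2) ->
  (forall t, per (f t)) -> itg mu2 (QT T) (fun p => f p.1 p.2).
Proof.
move=> cf pf; have [M M0 hM] := cont_per_bdd 0 T cf pf.
by have [] := QT_bdd (cont_measQT T0 cf) hM.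
Qed.

Lemma itg_contQT_mul (phi : R -> R -> R) : continuous (fun p : R * R => phi p.1 p.2) ->
  (forall t, per (phi t)) -> itg mu2 (QT T) (fun p => phi p.1 p.2 * v p.1 p.2).
Proof.
move=> cphi pphi; have [M M0 hM] := cont_per_bdd 0 T cphi pphi.
apply: (@itg_mul_bdd _ _ _ mu2 _ mQ _ _ M); first exact: cont_measQT.
  by move=> [t x] [/= + _]; rewrite in_itv; exact: hM.
exact: (sqi_itg mQ (finQT T) sv).
Qed.

Lemma cont_umul (phi : R -> R -> R) : continuous (fun p : R * R => phi p.1 p.2) ->
  continuous (fun p : R * R => u p.1 p.2 * phi p.1 p.2).
Proof. by move=> cphi p; apply: cvgM; [exact: ucont|exact: cphi]. Qed.

Lemma itg_umul (phi : R -> R -> R) : smooth_torus phi ->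
  itg mu2 (QT T) (fun p => u p.1 p.2 * phi p.1 p.2).
Proof.
move=> sp; apply: (@itg_contQT (fun t x => u t x * phi t x)).
  exact/cont_umul/smooth_torus_cont.
by move=> t x; rewrite uper (smooth_torus_per sp).
Qed.

Lemma solution_dt : represented_by (strip T) (distr_dt (strip T) u) v.
Proof.
split.
  split.
  - by move=> t x; have [_ + _] := lv t => ->.
  - exact: measurable_funTS.
  - move=> C cC CT; have /integrableP[_] := loc_itg mv lv sv cC CT.
    by under eq_integral do rewrite /= normr_id.
move=> phi tphi; have [sp _] := tphi; have sd := smooth_torus_dt sp.
have [cp pp] := (smooth_torus_cont sp, smooth_torus_per sp).
rewrite /distr_dt /pairing.
have -> : \int[mu2]_(p in strip T `&` one_period) (u p.1 p.2 * dt phi p.1 p.2) =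
  \int[mu2]_(p in QT T) (u p.1 p.2 * dt phi p.1 p.2).
  exact: (Int_strip1 (itg_umul sd)).2.
have iv : itg mu2 (QT T) (fun p => v p.1 p.2 * phi p.1 p.2).
  by apply: itg_ext (itg_contQT_mul cp pp) => // p _; exact: mulrC.
have -> : \int[mu2]_(p in strip T `&` one_period) (v p.1 p.2 * phi p.1 p.2) =
  \int[mu2]_(p in QT T) (v p.1 p.2 * phi p.1 p.2).
  exact: (Int_strip1 iv).2.
symmetry; apply: (lim_dt T0 K0 ap tau01 cu ha sv Lv) => //.
- exact: smooth_torus_cont.
- exact: smooth_torus_is_dt.
- exact: smooth_torus_per.
move=> t x; apply: contraNeq => h; exact: (test_torus_supp tphi h).
Qed.

(** The time derivatives of the combinations are simple in time; the rate 8^-n on the rectangle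
    gives their convergence in L^2 of the circle at almost every time. *)
Lemma solution_dt_L2 : L2_Hper 0 T v.
Proof.
have iB n : itg mu2 (QT T) (fun p => (v p.1 p.2 - qV (a n) p.1 p.2) ^+ 2).
  by have [s1 _ _ _ _] := sgood n; have [] := sqiB mQ sv s1.
split; last first.
  have [_ _ _ iv] := @Int_fubini _ _ _ (fun t x => v t x ^+ 2) mT m01 sv.2.
  have -> : (\int[mu]_(t in `[0%R, T]) Hnorm 0 (v t) ^+ 2 = \int[mu]_(t in `[0%R, T]) (nrm2 (v t))%:E)%E.
    by apply: eq_integral => t _; rewrite (Hnorm0E (lv t)) -EFin_expe sqr_sqrtr// nrm2_ge0.
  by rewrite (itgE mT iv) ltry.
exists (fun n => qV (a n)); split => [n|].
  apply: simple_Hper_intro; first exact: (simple_comp (fun q => q.2) (g_simple (ga n))).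
  by move=> t; exact: (Hper_l2p (g_l2 (ga n) t)).
have hf n := @Int_fubini _ _ _ (fun t x => (v t x - qV (a n) t x) ^+ 2) mT m01 (iB n).
have : {ae mu, forall t, `[0, T]%classic t -> exists2 C : R, 0 <= C &
    forall n, nrm2 (fun x => v t x - qV (a n) t x) <= C * 4^-1 ^+ n}.
  apply: (ae_summable mT).
  - by move=> n; have [_ _ _ +] := hf n.
  - by move=> n t _; exact: nrm2_ge0.
  - by move=> n; have [_ <- _ _] := hf n; exact: Lv.
apply: ae_imp => t H tT; split; first exact: Hper_l2p.
have [|C C0 hC] := H; first by rewrite /= in_itv.
rewrite (_ : (fun n => Hnorm 0 _) = fun n => (Num.sqrt (nrm2 (fun x => v t x - qV (a n) t x)))%:E).
  apply: sqrt_cvg0; apply: (squeeze_cvgr _ (cvg_cst 0) (exp4_cvg0 C)).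
  by apply: nearW => n; rewrite nrm2_ge0 hC.
apply/funext => n; apply: Hnorm0E.
have := l2p_lin (- 1) (lv t) (g_l2 (ga n) t).
by congr l2p; apply/funext => x; rewrite mulN1r.
Qed.

(** The equation dictates this candidate for the distribution d_x^4 u - d_x^2 u on the set where u >
    0; where u = 0 it takes the default value 0. *)
Definition opw (t x : R) : R := - (v t x / u t x).

Lemma opw_meas : measurable_fun setT (fun p : measurableTypeR R * measurableTypeR R => opw p.1 p.2).
Proof.
apply: measurableT_comp => //; apply: measurable_funM => //.
apply: measurableT_comp; [exact: measurable_invr|exact: cont_meas_plane].
Qed.

(** Test functions on the positivity set have supports on which u is bounded below, which is the
    situation of [lim_eq]; on a compact subset the same lower bound makes v / u integrable. *)
Lemma solution_dxx : represented_by (PT T u)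
  (fun phi => distr_dx 4 (PT T u) u phi - distr_dx 2 (PT T u) u phi) opw.
Proof.
split.
  split.
  - by move=> t x; rewrite /opw uper; have [_ + _] := lv t => ->.
  - exact: measurable_funTS opw_meas.
  - move=> C cC CP.
    have CT : C `<=` strip T by move=> p /CP[].
    have [p /CP[_ /= n0]|del d0 hd] := compact_pos_lb cC ucont.
      by rewrite lt_neqAle eq_sym n0 uge0.
    have mC := compact_meas2 cC.
    have : itg mu2 C (fun p => opw p.1 p.2).
      have il := itgZ mC del^-1 (loc_itg mv lv sv cC CT).
      apply: (itg_dom mC _ il).
        exact: measurable_funTS opw_meas.
      move=> p Cp; rewrite /opw normrN normrM normfV mulrC; apply: ler_wpM2r => //.
      have up := hd _ Cp; have u0 : 0 < u p.1 p.2 by exact: lt_le_trans up.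
      by rewrite gtr0_norm// lef_pV2.
    by move=> /integrableP[_].
move=> phi tphi; have [sp _] := tphi.
have s1 := smooth_torus_dx sp; have s2 := smooth_torus_dx s1.
have s3 := smooth_torus_dx s2; have s4 := smooth_torus_dx s3.
have [del d0 hd] := test_torus_lb ucont uper uge0 tphi.
have [M M0 hM] := cont_per_bdd 0 T (smooth_torus_cont sp) (smooth_torus_per sp).
rewrite (distr_dx_even _ _ _ (isT : ~~ odd 4)) (distr_dx_even _ _ _ (isT : ~~ odd 2)).
rewrite /pairing -[iter 4 dx phi]/(dx (dx (dx (dx phi)))) -[iter 2 dx phi]/(dx (dx phi)).
have i4 := itg_umul s4; have i2 := itg_umul s2.
transitivity (\int[mu2]_(p in QT T) (u p.1 p.2 * dx (dx (dx (dx phi))) p.1 p.2) -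
    \int[mu2]_(p in QT T) (u p.1 p.2 * dx (dx phi) p.1 p.2)).
  by congr (_ - _); [exact: (Int_PT1 ucont upos i4).2|exact: (Int_PT1 ucont upos i2).2].
have iv : itg mu2 (QT T) (fun p => v p.1 p.2 * (phi p.1 p.2 / u p.1 p.2)).
  apply: (@itg_ext _ _ _ mu2 _ mQ (fun p => (phi p.1 p.2 / u p.1 p.2) * v p.1 p.2)).
    by move=> p _; exact: mulrC.
  apply: (@itg_mul_bdd _ _ _ mu2 _ mQ _ _ (M / del)).
  - apply: measurable_funTS; apply: measurable_funM; first exact: cont_meas_plane (smooth_torus_cont sp).
    apply: measurableT_comp; [exact: measurable_invr|exact: cont_meas_plane].
  - move=> [t x] [/= + _]; rewrite in_itv/= => tT.
    have [->|pn] := eqVneq (phi t x) 0; first by rewrite mul0r normr0 divr_ge0// ltW.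
    have [_ du] := hd _ _ pn; have u0 : 0 < u t x by exact: lt_le_trans du.
    rewrite normrM normfV (gtr0_norm u0); apply: ler_pM => //; first by rewrite invr_ge0 ltW.
      exact: hM.
    by rewrite lef_pV2.
  exact: (sqi_itg mQ (finQT T) sv).
have iN := itgN iv.
have -> : \int[mu2]_(p in PT T u `&` one_period) (opw p.1 p.2 * phi p.1 p.2) =
  \int[mu2]_(p in QT T) (- (v p.1 p.2 * (phi p.1 p.2 / u p.1 p.2))).
  rewrite -(Int_PT1 ucont upos iN).2; apply: eq_Int => p _.
  by rewrite /opw mulNr -!mulrA (mulrC _^-1).
rewrite -(IntB mQ i4 i2) (IntN mQ iv).
rewrite (lim_eq T0 K0 ap tau01 cu cus ha sv Lv d0 (smooth_torus_cont sp) (smooth_torus_cont s2)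
  (smooth_torus_cont s4) (smooth_torus_is_dx sp) (smooth_torus_is_dx s1) (smooth_torus_is_dx s2)
  (smooth_torus_is_dx s3) (smooth_torus_per sp) (smooth_torus_per s1) (smooth_torus_per s2)
  (smooth_torus_per s3) (smooth_torus_per s4) hd) opprK.
by apply: eq_Int => p _; rewrite mulrBr.
Qed.

Lemma u_opw p : PT1 T u p -> u p.1 p.2 * opw p.1 p.2 = - v p.1 p.2.
Proof.
move=> /(PT1_pos uge0) u0.
by rewrite /opw mulrN mulrCA mulfV ?mulr1// gt_eqF.
Qed.

Lemma solution_dxx_L2 : (\int[mu2]_(p in PT T u `&` one_period)
  ((u p.1 p.2 * opw p.1 p.2) ^+ 2)%:E < +oo)%E.
Proof.
have i1 := (Int_PT1 ucont upos sv.2).1.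
have mP := mPT1 T ucont.
have i2 : itg mu2 (PT1 T u) (fun p => (u p.1 p.2 * opw p.1 p.2) ^+ 2).
  by apply: (itg_ext mP _ i1) => p Pp; rewrite u_opw// sqrrN.
by have := itgE mP i2; rewrite /PT1 => ->; rewrite ltry.
Qed.

Lemma solution_equation phi : smooth_torus phi ->
  \int[mu]_(t in `[0, T]) (\int[mu]_(x in `[0, 1]) (phi t x * v t x)) +
  \int[mu2]_(p in PT T u `&` one_period) (phi p.1 p.2 * (u p.1 p.2 * opw p.1 p.2)) = 0.
Proof.
move=> sp; have ip := itg_contQT_mul (smooth_torus_cont sp) (smooth_torus_per sp).
have [_ <- _ _] := @Int_fubini _ _ _ (fun t x => phi t x * v t x) mT m01 ip.
have iN := itgN ip.
have -> : \int[mu2]_(p in PT T u `&` one_period) (phi p.1 p.2 * (u p.1 p.2 * opw p.1 p.2)) =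
  \int[mu2]_(p in QT T) (- (phi p.1 p.2 * v p.1 p.2)).
  rewrite -(Int_PT1 ucont upos iN).2; apply: eq_Int => p Pp.
  by rewrite u_opw// mulrN.
by rewrite (IntN mQ)// subrr.
Qed.

Let z0_state : state z0.
Proof. by rewrite -(ap_init (ap 0) (lexx 0)); exact: ap_state (ap 0) 0. Qed.

Let u0E : u 0 = z0.1.1.
Proof. by apply/funext => x; exact: lim_init ap cu x. Qed.

(** On the positivity set 2 u w^2 = 2 v^2 / u. The dissipation inequality holds with weight u +
    1/(n+1) for every n, and Fatou's lemma removes the shift. *)
Lemma solution_energy : (energy (u T) + \int[mu2]_(p in PT T u `&` one_period)
  (2 * u p.1 p.2 * opw p.1 p.2 ^+ 2)%:E <= energy (u 0%R))%E.
Proof.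
have mP := mPT1 T ucont.
pose f_ n (p : R * R) := 2 * v p.1 p.2 ^+ 2 / wt u n.+1%:R^-1 p.
have e0 n : 0 < n.+1%:R^-1 :> R by rewrite invr_gt0.
have fi n : itg mu2 (QT T) (f_ n) by exact: (dissip_itg ap cu (e0 n) sv).
have fP n := Int_PT1 ucont upos (fi n).
have [||||||gi gI] := @itg_fatou _ _ _ mu2 (PT1 T u) mP f_
  (fun p => 2 * u p.1 p.2 * opw p.1 p.2 ^+ 2) (enz z0 - eu u T).
- by move=> n; exact: (fP n).1.
- move=> n p _; rewrite /f_ divr_ge0//; first by rewrite mulr_ge0// sqr_ge0.
  by rewrite ltW// (wt_gt0 ap cu p (e0 n)).
- apply: measurable_funTS; apply: measurable_funM.
    by apply: measurable_funM => //; exact: cont_meas_plane.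
  by apply: measurable_funX; exact: opw_meas.
- by apply: nearW => p _; rewrite mulr_ge0// ?sqr_ge0// mulr_ge0.
- apply: nearW => p Pp; have u0 := PT1_pos uge0 Pp.
  have -> : 2 * u p.1 p.2 * opw p.1 p.2 ^+ 2 = 2 * v p.1 p.2 ^+ 2 / u p.1 p.2.
    by rewrite /opw; field; rewrite gt_eqF.
  apply: cvgM; first exact: cvg_cst.
  apply: cvgV; first by rewrite gt_eqF.
  by rewrite -[X in _ --> X](addr0 (u p.1 p.2)); apply: cvgD; [exact: cvg_cst|exact: cvg_harmonic].
- move=> e e00; apply: nearW => n; rewrite (fP n).2.
  have := lim_dissip ap tau01 cu cus ha sv Lv (e0 n).
  rewrite /dissip -/(f_ n) => h.
  by rewrite -lerBrDl in h; apply: (le_trans h); rewrite lerDl ltW.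
have := itgE mP gi; rewrite /PT1 => ->.
rewrite (eu_fin ap cu) u0E (energyE (st_h2 z0_state)) -EFinD lee_fin.
by rewrite -lerBrDl; exact: gI.
Qed.

Lemma solution_mass :
  (mass (u T) + \int[mu]_(t in `[0%R, T]) energy (u t) <= mass (u 0%R))%E.
Proof.
have [ie le] := lim_mass K0 ap tau01 cu ha LQ.
have iu t : itg mu `[0, 1] (u t) by apply: itg_cont; exact: cont_sec2.
have -> : (\int[mu]_(t in `[0%R, T]) energy (u t) = \int[mu]_(t in `[0%R, T]) (eu u t)%:E)%E.
  by apply: eq_integral => t _; exact: eu_fin ap cu t.
by rewrite /mass (itgE mT ie) (itgE m01 (iu T)) (itgE m01 (iu 0)) -EFinD lee_fin u0E.
Qed.

Lemma solution_weak (u0 : R -> R) : {ae mu, forall x, u0 x = z0.1.1 x} ->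
  weak_solution T u0 u /\ {ae mu2, forall p : R * R, 0 <= p.1 <= T -> 0 < u p.1 p.2}.
Proof.
move=> hu0; split; last first.
  by have := ae_upos ucont upos; apply: ae_imp => p h _.
exists v, opw; split.
- by move=> t x _; exact: uper.
- by move=> t x _; exact: uge0.
- by apply: continuous_subspaceT => p; exact: ucont.
- exact: solution_Linfty_H2.
- exact: solution_C_H1.
- exact: solution_dt.
- exact: measurable_funTS.
- exact: solution_dt_L2.
- exact: solution_dxx.
- exact: solution_dxx_L2.
- by rewrite u0E; apply: ae_imp hu0 => x ->.
- exact: solution_equation.
- exact: solution_energy.
- exact: solution_mass.
Qed.

End solution.

Theorem theorem1 (R : realType) (T : R) (u0 : R -> R) (m0 : R)
  (T_gt0 : 0 < T)
  (u0_H2 : Hper 2 u0)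
  (u0_ge0 : {ae mu1, forall x : R, 0 <= u0 x})
  (u0_ln : (\int[mu1]_(x in `[0%R, 1%R]) lne (u0 x)%:E = m0%:E)%E) :
  exists u : R -> R -> R,
    weak_solution T u0 u /\
    {ae mu2, forall p : R * R, 0 <= p.1 <= T -> 0 < u p.1 p.2}.
Proof.
have [U [P [Q [h U0 uU Upos Uln]]]] := initial_rep u0_H2 u0_ge0 u0_ln.
have sz : state (U, P, Q) by split => //; apply: ae_imp Upos => x H; rewrite /= in_itv; exact: H.
have [K K0 apex] := approx_exists T_gt0 sz.
have [u [tau_ [Z_ [ap tau01 cu cus]]]] := extract_approx T_gt0 K0 apex.
have [a [v [[ha mv lv sv] [Lv LQ]]]] := limit_exists T_gt0 K0 ap tau01 cu cus.
by exists u; exact: (solution_weak T_gt0 K0 ap tau01 cu cus ha mv lv sv Lv LQ uU).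
Qed.
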